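(* Let $3\le n\le 7$. Let $\hat\gamma$ be a Riemannian metric on $\Sigma=S^1\times T^{n-2}$. There exists a constant $C=C(\hat\gamma,n)$ with the following property. Suppose $\hat g$ is a Riemannian metric on $\Omega=B^2\times T^{n-2}$ (with $\partial\Omega=\Sigma$) such that $\hat g|_{\partial\Omega}=\hat\gamma$ and $R_{\hat g}\ge -n(n-1)$ in $\Omega$. Let $H_{\hat g}$ be the mean curvature of $\partial\Omega$ with respect to the metric $\hat g$ and the outward unit normal. If $H_{\hat g}>0$ on $\partial\Omega$, then $$\int_{\partial\Omega}H_{\hat g}\,d\mathrm{vol}_{\hat\gamma}\le C.$$
   Context: $B^2$ is the closed 2-dimensional disk with $\partial B^2=S^1$, and $T^{n-2}$ is the $(n-2)$-dimensional torus. All metrics are smooth. $R_{\hat g}$ is the scalar curvature and $\hat g|_{\partial\Omega}$ is the induced metric on the boundary. Mean curvature is the trace of the second fundamental form, with the sign convention that the boundary of a round ball in Euclidean space has positive mean curvature with respect to the outward normal. *)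

(* Defs.v *)
From HB Require Import structures.
From mathcomp Require Import all_boot all_order all_algebra.
From mathcomp Require Import all_classical all_reals all_analysis.

Set Implicit Arguments.
Unset Strict Implicit.
Unset Printing Implicit Defensive.

Import Order.TTheory GRing.Theory Num.Theory.
Import numFieldNormedType.Exports.

Local Open Scope classical_set_scope.
Local Open Scope ring_scope.

(* The tangent bundles of B^2 x T^k and S^1 x T^k are trivial, so a metric is
   written globally as a matrix-valued function of the coordinates
     (x, y, t_1, ..., t_k)    with x^2 + y^2 <= 1   on B^2 x T^k,
     (theta, t_1, ..., t_k)                         on S^1 x T^k,
   where T^k = R^k / Z^k (periodicity in each t_j) and
   theta |-> (cos theta, sin theta) is the 2 pi-periodic parametrization of
   S^1 = bd B^2. *)

Section Smooth.
Variables (R : realType) (m : nat).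
Implicit Types (U : set 'rV[R]_m) (f : 'rV[R]_m -> R) (x : 'rV[R]_m).

Definition partial (i : 'I_m) f x : R := 'D_('e_i) f x.

Definition iter_partial (s : seq 'I_m) f : 'rV[R]_m -> R := foldr partial f s.

(* C^oo: all iterated partial derivatives exist and are continuous. *)
Definition smooth_on U f : Prop :=
  forall (s : seq 'I_m) x, U x ->
    {for x, continuous (iter_partial s f)} /\
    forall i : 'I_m, derivable (iter_partial s f) x 'e_i.

(* Smooth up to the boundary: U need not be open. *)
Definition smooth_near U f : Prop :=
  exists V : set 'rV[R]_m, [/\ open V, U `<=` V & smooth_on V f].

End Smooth.

Section LocalGeometry.
Variables (R : realType) (m : nat).
Implicit Types (g : 'rV[R]_m -> 'M[R]_m) (x u v : 'rV[R]_m).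

Definition posdefmx (A : 'M[R]_m) : Prop :=
  A^T = A /\ forall v : 'rV[R]_m, v != 0 -> 0 < (v *m A *m v^T) 0 0.

Definition metric_near (U : set 'rV[R]_m) g : Prop :=
  (forall i j, smooth_near U (fun x => g x i j)) /\
  (forall x, U x -> posdefmx (g x)).

Definition inner g x u v : R := (u *m g x *m v^T) 0 0.

(* christoffel g l i j = Gamma^l_{ij} *)
Definition christoffel g (l i j : 'I_m) x : R :=
  2^-1 * \sum_p invmx (g x) l p *
    (partial i (fun y => g y j p) x + partial j (fun y => g y i p) x
     - partial p (fun y => g y i j) x).

(* riemann g l k i j = R^l_{kij}, where
   R(d_i, d_j) d_k = R^l_{kij} d_l and
   R(X, Y) = [nabla_X, nabla_Y] - nabla_[X, Y] *)
Definition riemann g (l k i j : 'I_m) x : R :=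
  partial i (christoffel g l j k) x - partial j (christoffel g l i k) x
  + \sum_p (christoffel g l i p x * christoffel g p j k x
            - christoffel g l j p x * christoffel g p i k x).

Definition ricci g (k j : 'I_m) x : R := \sum_i riemann g i k i j x.

Definition scalar_curvature g x : R :=
  \sum_k \sum_j invmx (g x) k j * ricci g k j x.

End LocalGeometry.

Section SolidTorus.
Variables (R : realType) (k : nat).
Implicit Types (g : 'rV[R]_k.+2 -> 'M[R]_k.+2) (gam : 'rV[R]_k.+1 -> 'M[R]_k.+1).
Implicit Types (nu : 'rV[R]_k.+1 -> 'rV[R]_k.+2) (p : 'rV[R]_k.+1).

Definition solid_torus : set 'rV[R]_k.+2 :=
  [set x | x 0 0 ^+ 2 + x 0 1 ^+ 2 <= 1].

Definition metric_on_solid_torus g : Prop :=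
  metric_near solid_torus g /\
  forall x, solid_torus x ->
    forall j : 'I_k.+2, (1 < j)%N -> g (x + 'e_j) = g x.

Definition metric_on_boundary gam : Prop :=
  [/\ metric_near setT gam,
      forall p, gam (p + (2 * pi) *: 'e_0) = gam p
    & forall p (j : 'I_k.+1), (0 < j)%N -> gam (p + 'e_j) = gam p].

(* The inclusion of the boundary: (theta, t) |-> (cos theta, sin theta, t). *)
Definition bd_incl p : 'rV[R]_k.+2 :=
  \row_(i < k.+2) match val i with
                  | 0 => cos (p 0 0)
                  | 1 => sin (p 0 0)
                  | j.+2 => p 0 (inord j.+1)
                  end.

(* Row a of the Jacobian is the coordinate tangent vector d_a of the boundary. *)
Definition bd_tangent (a : 'I_k.+1) p : 'rV[R]_k.+2 := row a ('J bd_incl p).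

Definition induced_metric g p : 'M[R]_k.+1 :=
  \matrix_(a, b) inner g (bd_incl p) (bd_tangent a p) (bd_tangent b p).

(* The last condition says that nu points out of the disk: its first two
   components have positive Euclidean product with (cos theta, sin theta). *)
Definition outward_unit_normal g nu : Prop :=
  forall p,
    [/\ forall a, inner g (bd_incl p) (nu p) (bd_tangent a p) = 0,
        inner g (bd_incl p) (nu p) (nu p) = 1
      & 0 < nu p 0 0 * cos (p 0 0) + nu p 0 1 * sin (p 0 0)].

(* nabla_{d_a} nu along the boundary *)
Definition covariant_derivative g nu (a : 'I_k.+1) p : 'rV[R]_k.+2 :=
  \row_l ('J nu p a l +
    \sum_i \sum_j christoffel g l i j (bd_incl p)
                  * bd_tangent a p 0 i * nu p 0 j).

(* A(X, Y) = g(nabla_X nu, Y) *)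
Definition second_fundamental_form g nu p : 'M[R]_k.+1 :=
  \matrix_(a, b)
    inner g (bd_incl p) (covariant_derivative g nu a p) (bd_tangent b p).

Definition mean_curvature g nu p : R :=
  \tr (invmx (induced_metric g p) *m second_fundamental_form g nu p).

End SolidTorus.

(* Lebesgue integral over [0, 1]^k, as an iterated integral. *)
Fixpoint torus_integral (R : realType) (k : nat) : ('rV[R]_k -> R) -> R :=
  match k with
  | 0 => fun f => f 0
  | k'.+1 => fun f =>
      \int[lebesgue_measure]_(t in `[0, 1])
         torus_integral (fun v : 'rV[R]_k' => f (row_mx t%:M v))
  end.

(* Integral over S^1 x T^k for the Riemannian volume sqrt(det gam) dtheta dt. *)
Definition boundary_integral (R : realType) (k : nat)
    (gam : 'rV[R]_k.+1 -> 'M[R]_k.+1) (f : 'rV[R]_k.+1 -> R) : R :=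
  \int[lebesgue_measure]_(theta in `[0, 2 * pi])
     torus_integral (fun t : 'rV[R]_k =>
       let p : 'rV[R]_k.+1 := row_mx theta%:M t in
       f p * Num.sqrt (\det (gam p))).

(* Main.v *)
Require Import Defs.
From HB Require Import structures.
From mathcomp Require Import all_boot all_order all_algebra.
From mathcomp Require Import all_classical all_reals all_analysis.
From mathcomp Require Import ring lra zify.
Set Implicit Arguments.
Unset Strict Implicit.
Unset Printing Implicit Defensive.
Import Order.TTheory GRing.Theory Num.Theory.
Import numFieldNormedType.Exports.
Local Open Scope classical_set_scope.
Local Open Scope ring_scope.

(* Witten's argument with a cosmological term. A Clifford module for R^(n+1)
   (skew c_1, .., c_n and a symmetric J with J^2 = 1 anticommuting with them)
   gives a Dirac operator D of g in a global orthonormal frame. With n = dim and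
   lam = L (1 - 1/n), the Lichnerowicz formula for D - L J reads
     int |nab psi + (L/n) c J psi|^2 + (R/4 + L lam) |psi|^2 - |(D - L J) psi|^2
       = boundary term,
   and for L = n the zeroth order term is nonnegative since R >= -n(n-1).
   On the boundary let beta = c(nu) J. The boundary form is -H/2 |psi|^2 on both
   eigenspaces of beta, and the off-diagonal part between them is an operator
   determined by the boundary metric. As H > 0, the condition beta chi = chi is
   coercive, and D - L J maps such chi onto a dense subspace of L^2; hence a fixed
   boundary spinor psi0 with beta psi0 = - psi0 is corrected to
   psi = psi0 + chi with (D - L J) psi as small as desired. The formula for psi
   then bounds int H |psi0|^2, since the terms in chi are absorbed by
   - lam int |chi|^2.
   Density is proved without functional analysis: the set of parameters for which
   it holds is open and closed along a segment of operators with a uniform a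
   priori estimate. The segment starts at the flat product, where the equation is
   solved explicitly on polynomials in (x, y) times Fourier modes in t, and the
   boundary condition makes the estimates hold for all large L; a second
   segment lowers L to n. Integrals are used only as positive linear functionals
   on continuous functions together with the divergence theorem. *)

(** * Functions of class C^k *)

(** For L = n/2 the zeroth order term would vanish exactly at scalar curvature -n(n-1). L = n leaves
    a margin of at least |psi|^2, and this margin is the a priori estimate behind the density. On
    the +1 eigenspace of beta both boundary terms, the one with H and the one with J, are
    nonpositive; on the -1 eigenspace, where psi0 lives, the J term is positive but known. Two
    obstacles shape the rest. The space of admissible spinors must not move along a path of
    operators although the normal depends on the metric: the frame is chosen so that the unit normal
    has components (x, y, 0), which makes the boundary condition independent of the metric. And the
    bound must not see the interior: symmetry of the flux moves the derivative in the cross term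
    from chi to psi0, the normal part of the connection drops out by parity under beta, and the
    tangential part is the connection of the boundary in a frame that the uniqueness of the
    Gram-Schmidt factorisation makes intrinsic. As [g] is a metric on the closed solid torus only,
    pointwise identities are proved in the interior and extended by continuity. *)

(* [pd] and [mpd] are locked because unification otherwise unfolds derivatives. *)
HB.lock Definition pd (R : realType) (m : nat) (i : 'I_m) (f : 'rV[R]_m -> R)
  (x : 'rV[R]_m) : R := partial i f x.

Lemma pdE (R : realType) (m : nat) (i : 'I_m) (f : 'rV[R]_m -> R) : pd i f = partial i f.
Proof. by apply/funext => x; rewrite pd.unlock. Qed.

Lemma pd_val (R : realType) (m : nat) (i : 'I_m) (f : 'rV[R]_m -> R) x d :
  is_derive x 'e_i f d -> pd i f x = d.
Proof. by rewrite pdE => -[]. Qed.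

Section Ck.
Variables (R : realType) (m : nat).
Implicit Types (V : set 'rV[R]_m) (f g : 'rV[R]_m -> R) (x : 'rV[R]_m).

Lemma is_derive_line (W : normedModType R) (f : W -> R) (y v : W) (h : R) d :
  is_derive (h *: v + y) v f d -> is_derive h (1:R) (fun s : R => f (s *: v + y)) d.
Proof.
move=> [dfv <-].
have E : (fun s : R => s^-1 *: ((f \o shift (h *: v + y)) (s *: v) - f (h *: v + y)))
  = (fun s : R => s^-1 *: (((fun s : R => f (s *: v + y)) \o shift h) (s *: (1 : R))
        - f (h *: v + y))).
  apply/funext => s /=; congr (_ *: (f _ - _)).
  by rewrite addrA -scalerDl /GRing.scale /= mulr1.
by split; move: dfv; rewrite /derivable /derive E.
Qed.

(** The intermediate point is only located by |c| <= |h|, so that the sign of h never matters to the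
    users, who work in balls around the base point. *)
Lemma mvt_line (W : normedModType R) (f : W -> R) (y v : W) (h : R) (df : W -> R) :
  (forall s, `|s| <= `|h| -> is_derive (s *: v + y) v f (df (s *: v + y))) ->
  exists2 c, `|c| <= `|h| & f (h *: v + y) - f y = h * df (c *: v + y).
Proof.
move=> H; set F := fun s : R => f (s *: v + y).
have dF s : `|s| <= `|h| -> is_derive s (1:R) F (df (s *: v + y)).
  by move=> /H; exact: is_derive_line.
have cF s : `|s| <= `|h| -> {for s, continuous F}.
  move=> /dF[/derivable1_diffP/differentiable_continuous //].
have F0 : F 0 = f y by rewrite /F scale0r add0r.
have [h0|h0] := leP 0 h.
  have [s||c + E] := @MVT_segment R F (fun s => df (s *: v + y)) 0 h h0.
  - rewrite in_itv /= => /andP[s0 sh]; apply: dF.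
    by rewrite (gtr0_norm s0) (ger0_norm h0) ltW.
  - apply: continuous_in_subspaceT => s; rewrite inE /= in_itv /= => /andP[s0 sh].
    by apply: cF; rewrite (ger0_norm s0) (ger0_norm h0).
  rewrite in_itv /= => /andP[c0 ch]; exists c; first by rewrite (ger0_norm c0) (ger0_norm h0).
  by rewrite -F0 -/(F h) E subr0 mulrC.
have [s||c + E] := @MVT_segment R F (fun s => df (s *: v + y)) h 0 (ltW h0).
- rewrite in_itv /= => /andP[s0 sh]; apply: dF.
  by rewrite (ltr0_norm sh) (ltr0_norm h0) lerN2 ltW.
- apply: continuous_in_subspaceT => s; rewrite inE /= in_itv /= => /andP[s0 sh].
  by apply: cF; rewrite (ler0_norm sh) (ltr0_norm h0) lerN2.
rewrite in_itv /= => /andP[c0 ch]; exists c.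
  by rewrite (ler0_norm ch) (ltr0_norm h0) lerN2.
rewrite -F0 -/(F h) -opprB E; ring.
Qed.

(** Finite order suits induction: products, quotients and compositions lose one order at a time, and
    two derivatives are all that the geometry needs. Continuity and derivability refer to the
    ambient space, not to the subspace [V]. *)
Fixpoint Ck (k : nat) V f : Prop :=
  match k with
  | 0 => forall x, V x -> {for x, continuous f}
  | k'.+1 => (forall x, V x ->
       {for x, continuous f} /\ forall i : 'I_m, derivable f x 'e_i) /\
      forall i : 'I_m, Ck k' V (pd i f)
  end.

Lemma iter_partial_rcons (s : seq 'I_m) i f :
  iter_partial (rcons s i) f = iter_partial s (partial i f).
Proof. by rewrite /iter_partial foldr_rcons. Qed.

Lemma smooth_on_partial V f i : smooth_on V f -> smooth_on V (partial i f).
Proof. by move=> H s x Vx; rewrite -iter_partial_rcons; exact: H. Qed.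

Lemma smooth_on_Ck k V f : smooth_on V f -> Ck k V f.
Proof.
elim: k f => [|k IH] f sf /=; first by move=> x /(sf [::]) [].
split; first by move=> x /(sf [::]).
by move=> i; rewrite pdE; apply: IH; exact: smooth_on_partial.
Qed.

Lemma Ck_sub k V V' f : V' `<=` V -> Ck k V f -> Ck k V' f.
Proof.
move=> VV'; elim: k f => [|k IH] f /=; first by move=> H x /VV' /H.
by move=> [H1 H2]; split => [x /VV' /H1 //|i]; apply: IH.
Qed.

Lemma Ck_cont k V f : Ck k V f -> forall x, V x -> {for x, continuous f}.
Proof. by case: k => [//|k [H _]] x /H []. Qed.

Lemma CkS k V f : Ck k.+1 V f -> Ck k V f.
Proof.
elim: k f => [|k IH] f; first by move=> H x Vx; exact: (Ck_cont H).
by move=> [H1 H2]; split => // i; apply: IH.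
Qed.

Lemma Ck_le k l V f : (l <= k)%N -> Ck k V f -> Ck l V f.
Proof. by move=> /subnK <-; elim: (k - l)%N => // d IH /CkS. Qed.

Lemma Ck_derivable k V f x i : Ck k.+1 V f -> V x -> derivable f x 'e_i.
Proof. by move=> [H _] /H[]. Qed.

Lemma Ck_partial k V f i : Ck k.+1 V f -> Ck k V (pd i f).
Proof. by case=> _ H; exact: H. Qed.

Section OpenV.
Variables (V : set 'rV[R]_m) (oV : open V).

Lemma near_open (P : 'rV[R]_m -> Prop) x : V x -> (forall y, V y -> P y) ->
  \forall y \near x, P y.
Proof. by move=> Vx VP; apply: filterS (open_nbhs_nbhs (conj oV Vx)). Qed.

Lemma partial_congr f g x i : (forall y, V y -> f y = g y) -> V x ->
  pd i f x = pd i g x.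
Proof. by move=> fg Vx; rewrite !pdE; apply: near_eq_derive; exact: near_open. Qed.

Lemma Ck_congr k f g : (forall y, V y -> f y = g y) -> Ck k V f -> Ck k V g.
Proof.
have C (h1 h2 : 'rV[R]_m -> R) x : (forall y, V y -> h1 y = h2 y) -> V x ->
    {for x, continuous h1} -> {for x, continuous h2}.
  move=> fg Vx; rewrite /prop_for /continuous_at -(fg _ Vx) => fc.
  have E : \forall y \near x, h1 y = h2 y by exact: near_open.
  apply: cvg_trans fc; exact: (@near_eq_cvg _ _ (nbhs x) _ h1 h2 E).
elim: k f g => [|k IH] f g fg /=; first by move=> fc x Vx; apply: C (fc _ Vx).
move=> [H1 H2]; split=> [x Vx|i].
  have [c d] := H1 _ Vx; split => [|i]; first exact: C c.
  by apply: near_eq_derivable (d i); exact: near_open.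
by apply: IH (H2 i) => y Vy; apply: partial_congr.
Qed.

Lemma Ck_cst k c : Ck k V (fun=> c).
Proof.
elim: k c => [|k IH] c /=; first by move=> *; exact: cst_continuous.
split=> [x Vx|i]; first by split=> [|i]; [exact: cst_continuous|exact: derivable_cst].
by rewrite (_ : pd i _ = fun=> 0)//; apply/funext => y; rewrite pdE; exact: derive_cst.
Qed.

Lemma is_derive_coord x (v : 'rV[R]_m) (j : 'I_m) :
  is_derive x v (fun y : 'rV[R]_m => y 0 j) (v 0 j).
Proof.
have H : derivable (fun y : 'rV[R]_m => y) x v by exact: derivable_id.
have H2 := (derivable_mxP (fun y : 'rV[R]_m => y) x v).1 H.
split; first exact: H2.
have := derive_mx H; rewrite (derive_id x v) => /matrixP /(_ 0 j).
by rewrite mxE.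
Qed.

Lemma partial_coord i j : pd i (fun y : 'rV[R]_m => y 0 j) = fun=> (i == j)%:R.
Proof.
apply/funext => x; rewrite pdE /partial.
by have [_ ->] := is_derive_coord x 'e_i j; rewrite mxE eqxx eq_sym.
Qed.

Lemma Ck_coord k j : Ck k V (fun y : 'rV[R]_m => y 0 j).
Proof.
case: k => [|k] /=; first by move=> x _; exact: coord_continuous.
split=> [x _|i].
  by split=> [|i]; [exact: coord_continuous|case: (is_derive_coord x 'e_i j)].
by rewrite partial_coord; exact: Ck_cst.
Qed.

Lemma partialD f g x i : derivable f x 'e_i -> derivable g x 'e_i ->
  pd i (fun y => f y + g y) x = pd i f x + pd i g x.
Proof. by move=> df dg; rewrite !pdE; exact: (deriveD df dg). Qed.

Lemma partialN f x i : derivable f x 'e_i ->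
  pd i (fun y => - f y) x = - pd i f x.
Proof. by move=> df; rewrite !pdE; exact: (deriveN df). Qed.

Lemma partialM f g x i : derivable f x 'e_i -> derivable g x 'e_i ->
  pd i (fun y => f y * g y) x = pd i f x * g x + f x * pd i g x.
Proof.
move=> df dg; rewrite !pdE /partial; transitivity (f x *: 'D_'e_i g x + g x *: 'D_'e_i f x).
  exact: (deriveM df dg).
by rewrite /GRing.scale /= addrC [g x * _]mulrC.
Qed.

Lemma partial_sum (I : Type) (r : seq I) (F : I -> 'rV[R]_m -> R) x i :
  (forall j, derivable (F j) x 'e_i) ->
  derivable (fun y => \sum_(j <- r) F j y) x 'e_i /\
  pd i (fun y => \sum_(j <- r) F j y) x = \sum_(j <- r) pd i (F j) x.
Proof.
move=> H; elim: r => [|j r [IH1 IH2]].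
  rewrite (_ : (fun y => \sum_(j <- [::]) F j y) = cst 0); last first.
    by apply/funext => y; rewrite big_nil.
  by rewrite big_nil; split; [exact: derivable_cst|rewrite pdE; exact: derive_cst].
have -> : (fun y => \sum_(j <- j :: r) F j y) = (fun y => F j y + \sum_(j <- r) F j y).
  by apply/funext => y; rewrite big_cons.
rewrite big_cons -IH2; split; last exact: (partialD (H j) IH1).
exact: (derivableD (H j) IH1).
Qed.

Lemma CkD k f g : Ck k V f -> Ck k V g -> Ck k V (fun y => f y + g y).
Proof.
elim: k f g => [|k IH] f g /=.
  by move=> cf cg x Vx; apply: continuousD; [exact: cf|exact: cg].
move=> [f1 f2] [g1 g2]; split=> [x Vx|i].
  have [cf df] := f1 _ Vx; have [cg dg] := g1 _ Vx.
  by split=> [|i]; [exact: continuousD|exact: derivableD].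
apply: Ck_congr (IH _ _ (f2 i) (g2 i)) => y Vy.
by rewrite partialD //; [exact: (f1 _ Vy).2|exact: (g1 _ Vy).2].
Qed.

Lemma CkM k f g : Ck k V f -> Ck k V g -> Ck k V (fun y => f y * g y).
Proof.
elim: k f g => [|k IH] f g.
  by move=> cf cg x Vx; apply: continuousM; [exact: cf|exact: cg].
move=> Hf Hg; have [f1 f2] := Hf; have [g1 g2] := Hg; split=> [x Vx|i].
  have [cf df] := f1 _ Vx; have [cg dg] := g1 _ Vx.
  by split=> [|i]; [exact: continuousM|exact: derivableM].
apply: (@Ck_congr k (fun y => pd i f y * g y + f y * pd i g y)).
  by move=> y Vy; rewrite partialM //; [exact: (f1 _ Vy).2|exact: (g1 _ Vy).2].
exact: (CkD (IH _ _ (f2 i) (CkS Hg)) (IH _ _ (CkS Hf) (g2 i))).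
Qed.

Lemma CkN k f : Ck k V f -> Ck k V (fun y => - f y).
Proof.
move=> cf; apply: (@Ck_congr k (fun y => -1 * f y)) => [y _|]; first by rewrite mulN1r.
by apply: CkM => //; exact: Ck_cst.
Qed.

Lemma CkB k f g : Ck k V f -> Ck k V g -> Ck k V (fun y => f y - g y).
Proof. by move=> cf cg; apply: CkD => //; exact: CkN. Qed.

Lemma Ck_sum k (I : Type) (r : seq I) (F : I -> 'rV[R]_m -> R) :
  (forall j, Ck k V (F j)) -> Ck k V (fun y => \sum_(j <- r) F j y).
Proof.
move=> H; elim: r => [|j r IH].
  by apply: Ck_congr (Ck_cst k 0) => y _; rewrite big_nil.
by apply: Ck_congr (CkD (H j) IH) => y _; rewrite big_cons.
Qed.

Lemma Ck_inv k f : (forall y, V y -> f y != 0) -> Ck k V f ->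
  Ck k V (fun y => (f y)^-1).
Proof.
move=> f0; elim: k f f0 => [|k IH] f f0.
  by move=> cf x Vx; apply: continuousV; [exact: f0|exact: cf].
move=> Hf; have [f1 f2] := Hf; split=> [x Vx|i].
  have [cf df] := f1 _ Vx.
  by split=> [|i]; [apply: continuousV => //; exact: f0|apply: derivableV => //; exact: f0].
apply: (@Ck_congr k (fun y => - (((f y)^-1 * (f y)^-1) * pd i f y))).
  move=> y Vy; rewrite !pdE /partial deriveV; [|exact: f0|exact: (f1 _ Vy).2].
  by rewrite [RHS]/GRing.scale /= -invfM -expr2 mulNr.
apply: CkN; apply: CkM; last exact: f2.
by apply: CkM; apply: IH => //; exact: CkS Hf.
Qed.

Lemma is_derive_compR (W : normedModType R) (phi : R -> R) (f : W -> R) (x v : W) (d d' : R) :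
  is_derive x v f d -> is_derive (f x) 1 phi d' ->
  is_derive x v (fun y => phi (f y)) (d' * d).
Proof.
move=> fd phid.
have [c1 c2] : is_derive (0 : R) (1:R) (phi \o (fun s : R => f (s *: v + x))) (d' * d).
  apply: is_derive1_comp; rewrite ?scale0r ?add0r //.
  by apply: is_derive_line; rewrite scale0r add0r.
split; first exact/derivable1P.
rewrite -c2 /derive.
set F1 := fun h => _; set F2 := fun h => _; suff -> : F1 = F2 by [].
by apply/funext => h; rewrite /F1 /F2 /= addr0 scale0r add0r /GRing.scale /= mulr1.
Qed.

Lemma Ck_sqrt k f : (forall y, V y -> 0 < f y) -> Ck k V f ->
  Ck k V (fun y => Num.sqrt (f y)).
Proof.
move=> f0; elim: k f f0 => [|k IH] f f0.
  move=> cf x Vx; apply: continuous_comp; first exact: cf.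
  exact: sqrt_continuous.
move=> Hf; have [f1 f2] := Hf.
have D y i : V y -> is_derive y 'e_i (fun y => Num.sqrt (f y))
    ((2 * Num.sqrt (f y))^-1 * pd i f y).
  move=> Vy; apply: is_derive_compR.
    by rewrite pdE; apply: derivableP; exact: (f1 _ Vy).2.
  exact: is_derive1_sqrt (f0 _ Vy).
split=> [x Vx|i].
  split=> [|i]; last by case: (D x i Vx).
  have [cf df] := f1 _ Vx.
  by apply: continuous_comp => //; exact: sqrt_continuous.
apply: (@Ck_congr k (fun y => (2 * Num.sqrt (f y))^-1 * pd i f y)).
  by move=> y Vy; rewrite (pd_val (D y i Vy)).
apply: CkM; last exact: f2.
apply: Ck_inv => [y Vy|]; first by rewrite mulf_neq0 ?pnatr_eq0 // sqrtr_eq0 -ltNge f0.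
by apply: CkM; [exact: Ck_cst|apply: IH => //; exact: CkS Hf].
Qed.

Lemma Ck_cos_sin k f : Ck k V f ->
  Ck k V (fun y => cos (f y)) /\ Ck k V (fun y => sin (f y)).
Proof.
elim: k f => [|k IH] f.
  by move=> cf; split=> x Vx; apply: continuous_comp;
    [exact: cf|exact: continuous_cos|exact: cf|exact: continuous_sin].
move=> Hf; have [f1 f2] := Hf.
have Dc y i : V y -> is_derive y 'e_i (fun y => cos (f y)) (- sin (f y) * pd i f y).
  by move=> Vy; rewrite pdE; apply: is_derive_compR; apply: derivableP; exact: (f1 _ Vy).2.
have Ds y i : V y -> is_derive y 'e_i (fun y => sin (f y)) (cos (f y) * pd i f y).
  by move=> Vy; rewrite pdE; apply: is_derive_compR; apply: derivableP; exact: (f1 _ Vy).2.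
have [IHc IHs] := IH _ (CkS Hf).
split; split=> [x Vx|i].
- split=> [|i]; last by case: (Dc x i Vx).
  by have [cf df] := f1 _ Vx; apply: continuous_comp => //; exact: continuous_cos.
- apply: (@Ck_congr k (fun y => - sin (f y) * pd i f y)).
    by move=> y Vy; rewrite (pd_val (Dc y i Vy)).
  by apply: CkM; [exact: CkN|exact: f2].
- split=> [|i]; last by case: (Ds x i Vx).
  by have [cf df] := f1 _ Vx; apply: continuous_comp => //; exact: continuous_sin.
- apply: (@Ck_congr k (fun y => cos (f y) * pd i f y)).
    by move=> y Vy; rewrite (pd_val (Ds y i Vy)).
  by apply: CkM; [|exact: f2].
Qed.

End OpenV.
End Ck.

Lemma cont_near (R : realType) (T : topologicalType) (f : T -> R) (x : T) (e : R) :
  {for x, continuous f} -> 0 < e -> \forall y \near x, `|f y - f x| <= e.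
Proof.
move=> cf e0; have /cvgrPdist_le /(_ e e0) := cf.
by apply: filterS => y; rewrite distrC.
Qed.

Lemma derivableP' (R : realType) m (f : 'rV[R]_m -> R) x (i : 'I_m) :
  derivable f x 'e_i -> is_derive x 'e_i f (pd i f x).
Proof. by rewrite pdE; exact: derivableP. Qed.

(** * Differentiability, chain rule and symmetry of second derivatives *)

Section Frechet.
Variables (R : realType) (m : nat).
Implicit Types (V : set 'rV[R]_m) (f g : 'rV[R]_m -> R) (x : 'rV[R]_m).

Lemma rV_norm_le (v : 'rV[R]_m) (r : R) :
  0 <= r -> (forall i, `|v 0 i| <= r) -> `|v| <= r.
Proof.
move=> r0 H; rewrite [leLHS]/Num.Def.normr /= mx_normrE.
by apply: bigmax_le => // -[i j] _ /=; rewrite ord1.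
Qed.

Lemma rV_norm_ge (v : 'rV[R]_m) i : `|v 0 i| <= `|v|.
Proof.
rewrite [leRHS]/Num.Def.normr /= mx_normrE.
exact: (le_bigmax _ (fun j : 'I_1 * 'I_m => `|v j.1 j.2|) (0, i)).
Qed.

Let trunc (j : nat) (h : 'rV[R]_m) : 'rV[R]_m := \row_i (if (i < j)%N then h 0 i else 0).

Lemma truncS (j : 'I_m) h : trunc j.+1 h = h 0 j *: 'e_j + trunc j h.
Proof.
apply/rowP => i; rewrite !mxE eqxx /= ltnS leq_eqVlt.
by have [/val_inj ->|ij] := eqVneq (i : nat) j;
  rewrite ?eqxx ?ltnn ?mulr1 ?addr0 //= -[i == j]/((i : nat) == j) (negPf ij) mulr0 add0r.
Qed.

(** The increment from x to x + h is telescoped along the coordinate axes through the truncations of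
    h. The mean value theorem on each edge produces a partial derivative at a nearby point, which
    continuity compares with its value at x. *)
Lemma C1_differentiable V f x : open V -> Ck 1 V f -> V x ->
  differentiable f x /\ forall v, 'D_v f x = \sum_i v 0 i * pd i f x.
Proof.
move=> oV [f1 f2] Vx.
pose L (v : 'rV[R]_m) : R := \sum_i v 0 i * pd i f x.
have linL : linear L.
  move=> a u v; rewrite /L /GRing.scale /= mulr_sumr -big_split /=.
  by apply: eq_bigr => i _; rewrite !mxE; ring.
pose LL : {linear 'rV[R]_m -> R} := HB.pack L (GRing.isLinear.Build _ _ _ _ L linL).
have cL : continuous LL.
  have : Ck 0 setT L.
    apply: Ck_sum => [|i]; first exact: openT.
    by apply: CkM; [exact: openT|exact: Ck_coord|exact: Ck_cst].
  by move=> cL v; exact: cL.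
have oL : f \o shift x = cst (f x) + LL +o_ (0 : 'rV[R]_m) id.
  apply/eqaddoP => _ /posnumP[e].
  (* There are m edges, each of length at most |h|, so each may contribute an error |h| e / (m + 1);
     the successor keeps the quotient meaningful for m = 0. *)
  have n0 : 0 < e%:num / m.+1%:R by rewrite divr_gt0.
  have nb : \forall y \near x, V y /\ forall i, `|pd i f y - pd i f x| <= e%:num / m.+1%:R.
    apply: filterI; first exact: open_nbhs_nbhs.
    apply: (@filter_forall _ _ _ (nbhs x)) => i.
    exact: cont_near (f2 i x Vx) n0.
  have [d d0 Hd] := (nbhs_ballP _ _).1 nb.
  near=> h.
  have hd : `|h| < d.
    have : ball (0 : 'rV[R]_m) d h by near: h; exact: nbhsx_ballx.
    by rewrite -ball_normE /ball_ /= sub0r normrN.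
  rewrite /= -[X in `|X|]/(f (h + x) - (f x + L h)).
  have E : f (h + x) - f x = \sum_(j < m) (f (trunc j.+1 h + x) - f (trunc j h + x)).
    rewrite -(big_mkord xpredT (fun j => f (trunc j.+1 h + x) - f (trunc j h + x))).
    rewrite telescope_sumr //; congr (f _ - f _); apply/rowP => i; rewrite !mxE ?ltn_ord //.
    by rewrite add0r.
  rewrite opprD addrA E -sumrB.
  apply: le_trans (ler_norm_sum _ _ _) _.
  apply: (@le_trans _ _ (\sum_(j < m) `|h| * (e%:num / m.+1%:R))); last first.
    rewrite sumr_const card_ord -[X in X <= _]mulr_natr.
    have -> : `|h| * (e%:num / m.+1%:R) * m%:R = (e%:num * `|h|) * (m%:R / m.+1%:R) by ring.
    apply: ler_piMr; first by rewrite mulr_ge0.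
    by rewrite ler_pdivrMr // mul1r ler_nat.
  apply: ler_sum => j _; rewrite truncS -(addrA (h 0 j *: 'e_j)).
  have inb c : `|c| <= `|h 0 j| -> ball x d (c *: 'e_j + (trunc j h + x)).
    move=> cj; rewrite -ball_normE /= distrC addrA addrK.
    apply: le_lt_trans hd; apply: rV_norm_le => // i; rewrite !mxE eqxx /=.
    case: (eqVneq i j) => [->|_]; last by rewrite mulr0 add0r; case: ifP => _;
      rewrite ?normr0 // rV_norm_ge.
    by rewrite ltnn mulr1 addr0 (le_trans cj) ?rV_norm_ge.
  have [c cj ->] := @mvt_line R _ f (trunc j h + x) 'e_j (h 0 j) (pd j f)
    (fun s sj => derivableP' ((f1 _ (Hd _ (inb s sj)).1).2 j)).
  rewrite -mulrBr normrM ler_pM ?rV_norm_ge //.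
  exact: (Hd _ (inb c cj)).2.
have dE : 'd f x = LL :> (_ -> _) by exact: diff_unique.
have df : differentiable f x by apply/diff_locallyP; rewrite dE; split.
by split=> // v; rewrite deriveE // dE.
Unshelve. all: by end_near. Qed.

(** [b] is only assumed to have a derivative in the direction v, which does not make it
    differentiable. Restricting to the line through u turns this into differentiability in one
    variable, where composition with the differentiable [f] is available. *)
Lemma is_derive_chain (U : normedModType R) (b : U -> 'rV[R]_m) V f (u v : U) :
  open V -> Ck 1 V f -> V (b u) ->
  (forall i, derivable (fun y => b y 0 i) u v) ->
  is_derive u v (fun y => f (b y))
    (\sum_i 'D_v (fun y => b y 0 i) u * pd i f (b u)).
Proof.
move=> oV fC Vbu db; have [df Df] := C1_differentiable oV fC Vbu.
have dbu : derivable b u v by apply/derivable_mxP => i j; rewrite (ord1 i).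
pose c (s : R) := b (s *: v + u).
have c0 : c 0 = b u by rewrite /c scale0r add0r.
have dc1 : derivable c 0 (1 : R) by exact: ((derivable1P b u v).1 dbu).
have dc : differentiable c 0 by exact: ((derivable1_diffP c 0).1 dc1).
have dfc : differentiable (f \o c) 0.
  by apply: differentiable_comp; [exact: dc|rewrite c0].
have -> : (fun y => f (b y)) = f \o b by [].
split.
  apply: ((derivable1P (f \o b) u v).2).
  exact: ((derivable1_diffP (f \o c) 0).2 dfc).
transitivity ('D_(1 : R) (f \o c) 0).
  rewrite /derive; set F1 := fun h => _; set F2 := fun h => _; suff -> : F1 = F2 by [].
  by apply/funext => h; rewrite /F1 /F2 /c /= addr0 scale0r add0r [h%:A]mulr1.
rewrite (deriveE _ dfc) diff_comp; [|exact: dc|by rewrite c0].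
rewrite /= c0 -[RHS]/(\sum_i _ * _) -(deriveE _ df) Df; apply: eq_bigr => i _; congr (_ * _).
rewrite -(deriveE _ dc).
have -> : 'D_(1 : R) c 0 = 'D_v b u.
  rewrite /derive; set F1 := fun h => _; set F2 := fun h => _; suff -> : F1 = F2 by [].
  by apply/funext => h; rewrite /F1 /F2 /c /= addr0 scale0r add0r [h%:A]mulr1.
by rewrite (derive_mx dbu) mxE.
Qed.

(** Schwarz' theorem: applying the mean value theorem twice to the second difference of f over a
    small square, in either order, gives h^2 times one mixed derivative or the other at points near
    x, and both are continuous at x. *)
Lemma partial_sym V f i j x : open V -> Ck 2 V f -> V x ->
  pd i (pd j f) x = pd j (pd i f) x.
Proof.
move=> oV [f1 f2] Vx.
suff H a b : forall e : R, 0 < e -> pd a (pd b f) x <= pd b (pd a f) x + e.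
  by apply/eqP; rewrite eq_le; apply/andP; split; apply/ler_addgt0Pr => e /H.
move=> e e0.
have e40 : 0 < e / 2 by lra.
have nb : \forall y \near x, V y /\ (`|pd a (pd b f) y - pd a (pd b f) x| <= e / 2
    /\ `|pd b (pd a f) y - pd b (pd a f) x| <= e / 2).
  apply: filterI; first exact: open_nbhs_nbhs.
  apply: filterI.
    exact: cont_near ((f2 b).2 a x Vx) e40.
  exact: cont_near ((f2 a).2 b x Vx) e40.
have [d d0 Hd] := (nbhs_ballP _ _).1 nb.
(* With both displacements at most d/4 the whole square has sup distance at most d/2 from x, hence
   stays inside the ball of radius d. *)
pose h := d / 4; have h0 : 0 < h by rewrite /h; move: d0 => /=; lra.
have hh : `|h| = h by rewrite ger0_norm // ltW.
have inb (k l : 'I_m) s t : `|s| <= `|h| -> `|t| <= `|h| -> ball x d (s *: 'e_k + (t *: 'e_l + x)).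
  rewrite hh => sh th; rewrite -ball_normE /= distrC addrA addrK.
  apply: (@le_lt_trans _ _ (2 * h)); last by rewrite /h; move: d0 => /=; lra.
  have nE (q : 'I_m) : `|'e_q : 'rV[R]_m| <= 1.
    by apply: rV_norm_le => // i'; rewrite mxE; case: (_ && _); rewrite ?normr1 ?normr0.
  rewrite (le_trans (ler_normD _ _)) // !normrZ.
  have := ler_pM (normr_ge0 s) (normr_ge0 _) sh (nE k).
  have := ler_pM (normr_ge0 t) (normr_ge0 _) th (nE l).
  lra.
pose Del := f (h *: 'e_a + (h *: 'e_b + x)) - f (h *: 'e_b + x) - (f (h *: 'e_a + x) - f x).
have key (k l : 'I_m) : exists2 y, ball x d y &
   f (h *: 'e_k + (h *: 'e_l + x)) - f (h *: 'e_l + x) - (f (h *: 'e_k + x) - f x)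
    = h * (h * pd l (pd k f) y).
  pose F y := f (h *: 'e_l + y) - f y.
  have zl : `|(0 : R)| <= `|h| by rewrite normr0.
  have in1 s : `|s| <= `|h| -> ball x d (s *: 'e_k + x).
    by move=> sh; have := inb k l s 0 sh zl; rewrite scale0r add0r.
  have in2 s : `|s| <= `|h| -> ball x d (h *: 'e_l + (s *: 'e_k + x)).
    by move=> sh; exact: inb.
  have dF s : `|s| <= `|h| -> is_derive (s *: 'e_k + x) 'e_k F
       (pd k f (h *: 'e_l + (s *: 'e_k + x)) - pd k f (s *: 'e_k + x)).
    move=> sh; apply: is_deriveB; last first.
      by apply: derivableP'; exact: (f1 _ (Hd _ (in1 _ sh)).1).2.
    have [Ha Hb] : is_derive (h *: 'e_l + (s *: 'e_k + x)) 'e_k f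
         (pd k f (h *: 'e_l + (s *: 'e_k + x))).
      by apply: derivableP'; exact: (f1 _ (Hd _ (in2 _ sh)).1).2.
    have EE : (fun t : R => t^-1 *: ((f \o shift (h *: 'e_l + (s *: 'e_k + x))) (t *: 'e_k)
         - f (h *: 'e_l + (s *: 'e_k + x)))) =
       (fun t : R => t^-1 *: (((fun y => f (h *: 'e_l + y)) \o shift (s *: 'e_k + x)) (t *: 'e_k)
         - f (h *: 'e_l + (s *: 'e_k + x)))).
      by apply/funext => t /=; congr (_ *: (f _ - _)); rewrite addrCA.
    by split; move: Ha Hb; rewrite /derivable /derive EE.
  have [c cj E1] := @mvt_line R _ F x 'e_k h
    (fun z => pd k f (h *: 'e_l + z) - pd k f z) dF.
  have [c' cj' E2] := @mvt_line R _ (pd k f) (c *: 'e_k + x) 'e_l h (pd l (pd k f))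
    (fun s sj => derivableP' (((f2 k).1 _ (Hd _ (inb _ _ _ _ sj cj)).1).2 l)).
  exists (c' *: 'e_l + (c *: 'e_k + x)); first exact: inb.
  rewrite -E2 -E1 /F; rewrite [h *: 'e_l + (h *: 'e_k + x)]addrCA; ring.
have [y1 By1 E1] := key b a; have [y2 By2 E2] := key a b.
have EE : pd a (pd b f) y1 = pd b (pd a f) y2.
  have hn : h * h != 0 by rewrite mulf_neq0 ?gt_eqF.
  apply: (mulfI hn); rewrite -[LHS]mulrA -[RHS]mulrA -E1 -E2.
  have -> : h *: 'e_b + (h *: 'e_a + x) = h *: 'e_a + (h *: 'e_b + x) by rewrite addrCA.
  move: (f (h *: 'e_a + (h *: 'e_b + x))) (f (h *: 'e_a + x)) (f (h *: 'e_b + x)) (f x).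
  move=> A B C D; lra.
have [_ [A1 _]] := Hd _ By1; have [_ [_ A2]] := Hd _ By2.
move: A1 A2; rewrite -EE !ler_norml => /andP[? ?] /andP[? ?]; lra.
Qed.

End Frechet.

(** * Calculus of matrix-valued functions *)

HB.lock Definition mpd (R : realType) (m p q : nat) (i : 'I_m)
    (A : 'rV[R]_m -> 'M[R]_(p, q)) (x : 'rV[R]_m) : 'M[R]_(p, q) :=
  \matrix_(a, b) pd i (fun y => A y a b) x.

Section MatrixCalculus.
Variables (R : realType) (m : nat) (V : set 'rV[R]_m) (oV : open V).
Implicit Types (x : 'rV[R]_m).

Definition mCk k p q (A : 'rV[R]_m -> 'M[R]_(p, q)) :=
  forall a b, Ck k V (fun x => A x a b).

Lemma mpdE p q i (A : 'rV[R]_m -> 'M[R]_(p, q)) x a b :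
  mpd i A x a b = pd i (fun y => A y a b) x.
Proof. by rewrite unlock mxE. Qed.

Lemma mCk_le k l p q (A : 'rV[R]_m -> 'M[R]_(p, q)) : (l <= k)%N -> mCk k A -> mCk l A.
Proof. by move=> lk H a b; apply: Ck_le lk _. Qed.

Lemma mCk_congr k p q (A B : 'rV[R]_m -> 'M[R]_(p, q)) :
  (forall x, V x -> A x = B x) -> mCk k A -> mCk k B.
Proof. by move=> E H a b; apply: Ck_congr (H a b) => // y Vy; rewrite E. Qed.

Lemma mpd_congr p q (A B : 'rV[R]_m -> 'M[R]_(p, q)) i x :
  (forall x, V x -> A x = B x) -> V x -> mpd i A x = mpd i B x.
Proof.
move=> E Vx; apply/matrixP => a b; rewrite ?mpdE ?mxE.
by apply: (partial_congr oV) => // y Vy; rewrite E.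
Qed.

Lemma mCk_mpd k p q (A : 'rV[R]_m -> 'M[R]_(p, q)) i : mCk k.+1 A -> mCk k (mpd i A).
Proof.
move=> H a b; have := Ck_partial i (H a b); apply: Ck_congr => // y Vy.
by rewrite mpdE.
Qed.

Lemma mCk_cst k p q (A : 'M[R]_(p, q)) : mCk k (fun=> A).
Proof. by move=> a b; exact: Ck_cst. Qed.

Lemma mpd_cst p q (A : 'M[R]_(p, q)) i x : mpd i (fun=> A) x = 0.
Proof. by apply/matrixP => a b; rewrite mpdE mxE pdE; exact: derive_cst. Qed.

Lemma mCkD k p q (A B : 'rV[R]_m -> 'M[R]_(p, q)) :
  mCk k A -> mCk k B -> mCk k (fun x => A x + B x).
Proof.
move=> HA HB a b; apply: Ck_congr (CkD oV (HA a b) (HB a b)) => // y _.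
by rewrite mxE.
Qed.

Lemma mCkN k p q (A : 'rV[R]_m -> 'M[R]_(p, q)) : mCk k A -> mCk k (fun x => - A x).
Proof.
by move=> HA a b; apply: Ck_congr (CkN oV (HA a b)) => // y _; rewrite mxE.
Qed.

Lemma mCkB k p q (A B : 'rV[R]_m -> 'M[R]_(p, q)) :
  mCk k A -> mCk k B -> mCk k (fun x => A x - B x).
Proof. by move=> HA HB; apply: mCkD => //; exact: mCkN. Qed.

Lemma mCkM k p q r (A : 'rV[R]_m -> 'M[R]_(p, q)) (B : 'rV[R]_m -> 'M[R]_(q, r)) :
  mCk k A -> mCk k B -> mCk k (fun x => A x *m B x).
Proof.
move=> HA HB a b; apply: (@Ck_congr _ _ _ oV _ (fun y => \sum_j A y a j * B y j b)).
  by move=> y _; rewrite mxE.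
by apply: Ck_sum => // j; apply: CkM.
Qed.

Lemma mCkZ k p q (f : 'rV[R]_m -> R) (A : 'rV[R]_m -> 'M[R]_(p, q)) :
  Ck k V f -> mCk k A -> mCk k (fun x => f x *: A x).
Proof.
move=> Hf HA a b; apply: Ck_congr (CkM oV Hf (HA a b)) => // y _.
by rewrite mxE.
Qed.

Lemma mCkT k p q (A : 'rV[R]_m -> 'M[R]_(p, q)) : mCk k A -> mCk k (fun x => (A x)^T).
Proof. by move=> HA a b; apply: Ck_congr (HA b a) => // y _; rewrite mxE. Qed.

Lemma mCk_sum k p q (I : Type) (r : seq I) (A : I -> 'rV[R]_m -> 'M[R]_(p, q)) :
  (forall j, mCk k (A j)) -> mCk k (fun x => \sum_(j <- r) A j x).
Proof.
move=> HA a b; apply: (@Ck_congr _ _ _ oV _ (fun y => \sum_(j <- r) A j y a b)).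
  by move=> y _; rewrite summxE.
by apply: Ck_sum => // j; exact: HA.
Qed.

Lemma Ck_tr k p (A : 'rV[R]_m -> 'M[R]_p) : mCk k A -> Ck k V (fun x => \tr (A x)).
Proof. by move=> HA; apply: Ck_sum => // j; exact: HA. Qed.

Section Point.
Variables (x : 'rV[R]_m) (Vx : V x).

Lemma mpdD p q i (A B : 'rV[R]_m -> 'M[R]_(p, q)) : mCk 1 A -> mCk 1 B ->
  mpd i (fun y => A y + B y) x = mpd i A x + mpd i B x.
Proof.
move=> HA HB; apply/matrixP => a b; rewrite ?(mpdE, mxE).
transitivity (pd i (fun y => A y a b + B y a b) x).
  by apply: (partial_congr oV) => // y _; rewrite ?(mpdE, mxE).
by rewrite partialD //; [exact: Ck_derivable (HA a b) Vx|exact: Ck_derivable (HB a b) Vx].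
Qed.

Lemma mpdN p q i (A : 'rV[R]_m -> 'M[R]_(p, q)) : mCk 1 A ->
  mpd i (fun y => - A y) x = - mpd i A x.
Proof.
move=> HA; apply/matrixP => a b; rewrite ?(mpdE, mxE).
transitivity (pd i (fun y => - A y a b) x).
  by apply: (partial_congr oV) => // y _; rewrite ?(mpdE, mxE).
by rewrite partialN //; exact: Ck_derivable (HA a b) Vx.
Qed.

Lemma mpdB p q i (A B : 'rV[R]_m -> 'M[R]_(p, q)) : mCk 1 A -> mCk 1 B ->
  mpd i (fun y => A y - B y) x = mpd i A x - mpd i B x.
Proof. by move=> HA HB; rewrite (mpdD i HA (mCkN HB)) (mpdN i HB). Qed.

Lemma mpdT p q i (A : 'rV[R]_m -> 'M[R]_(p, q)) :
  mpd i (fun y => (A y)^T) x = (mpd i A x)^T.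
Proof.
apply/matrixP => a b; rewrite ?(mpdE, mxE).
by apply: (partial_congr oV) => // y _; rewrite ?(mpdE, mxE).
Qed.

Lemma mpdM p q r i (A : 'rV[R]_m -> 'M[R]_(p, q)) (B : 'rV[R]_m -> 'M[R]_(q, r)) :
  mCk 1 A -> mCk 1 B ->
  mpd i (fun y => A y *m B y) x = mpd i A x *m B x + A x *m mpd i B x.
Proof.
move=> HA HB; apply/matrixP => a b; rewrite ?(mpdE, mxE).
have D j : derivable (fun y => A y a j * B y j b) x 'e_i.
  by apply: derivableM; [exact: Ck_derivable (HA a j) Vx|exact: Ck_derivable (HB j b) Vx].
transitivity (pd i (fun y => \sum_j A y a j * B y j b) x).
  by apply: (partial_congr oV) => // y _; rewrite ?(mpdE, mxE).
rewrite (partial_sum _ D).2 -big_split /=; apply: eq_bigr => j _.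
rewrite ?(mpdE, mxE) partialM //; [exact: Ck_derivable (HA a j) Vx|exact: Ck_derivable (HB j b) Vx].
Qed.

Lemma mpdZ p q i (f : 'rV[R]_m -> R) (A : 'rV[R]_m -> 'M[R]_(p, q)) :
  Ck 1 V f -> mCk 1 A ->
  mpd i (fun y => f y *: A y) x = pd i f x *: A x + f x *: mpd i A x.
Proof.
move=> Hf HA; apply/matrixP => a b; rewrite ?(mpdE, mxE).
transitivity (pd i (fun y => f y * A y a b) x).
  by apply: (partial_congr oV) => // y _; rewrite ?(mpdE, mxE).
by rewrite partialM //; [exact: Ck_derivable Hf Vx|exact: Ck_derivable (HA a b) Vx].
Qed.

Lemma mpd_sum p q i (I : Type) (r : seq I) (A : I -> 'rV[R]_m -> 'M[R]_(p, q)) :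
  (forall j, mCk 1 (A j)) ->
  mpd i (fun y => \sum_(j <- r) A j y) x = \sum_(j <- r) mpd i (A j) x.
Proof.
move=> HA; apply/matrixP => a b; rewrite summxE ?(mpdE, mxE).
have D j : derivable (fun y => A j y a b) x 'e_i by exact: Ck_derivable (HA j a b) Vx.
transitivity (pd i (fun y => \sum_(j <- r) A j y a b) x).
  by apply: (partial_congr oV) => // y _; rewrite summxE.
by rewrite (partial_sum _ D).2; apply: eq_bigr => j _; rewrite ?(mpdE, mxE).
Qed.

Lemma partial_tr p i (A : 'rV[R]_m -> 'M[R]_p) : mCk 1 A ->
  pd i (fun y => \tr (A y)) x = \tr (mpd i A x).
Proof.
move=> HA; have D j : derivable (fun y => A y j j) x 'e_i by exact: Ck_derivable (HA j j) Vx.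
rewrite /mxtrace (partial_sum _ D).2.
by apply: eq_bigr => j _; rewrite ?(mpdE, mxE).
Qed.

Lemma mpd_sym p q i j (A : 'rV[R]_m -> 'M[R]_(p, q)) : mCk 2 A ->
  mpd i (mpd j A) x = mpd j (mpd i A) x.
Proof.
move=> HA; apply/matrixP => a b. 
rewrite 2!mpdE.
transitivity (pd i (pd j (fun y => A y a b)) x).
  by apply: (partial_congr oV) => // y _; rewrite mpdE.
rewrite (partial_sym i j oV (HA a b) Vx).
by apply: (partial_congr oV) => // y _; rewrite mpdE.
Qed.

End Point.
End MatrixCalculus.

(** * Positive functionals and the divergence theorem *)

Section PosFun.
Variable R : realType.

Definition cont_on (X : topologicalType) (K : set X) (f : X -> R) :=
  forall x, K x -> {for x, continuous f}.

(** [I] takes arbitrary functions but is constrained only on those continuous at the points of [K].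
    Iterated integrals acquire this structure by induction on the number of variables, so that no
    Fubini theorem and no measurability question arises later. *)
Record posfun (X : topologicalType) (K : set X) (I : (X -> R) -> R) : Prop := Posfun {
  pf_lin : forall a f g, cont_on K f -> cont_on K g ->
    I (fun x => a * f x + g x) = a * I f + I g;
  pf_le : forall f g, cont_on K f -> cont_on K g ->
    (forall x, K x -> f x <= g x) -> I f <= I g }.

Section Theory.
Variables (X : topologicalType) (K : set X) (I : (X -> R) -> R).
Hypothesis pI : posfun K I.

Lemma cont_cst c : cont_on K (fun=> c).
Proof. by move=> x _; exact: cst_continuous. Qed.

Lemma contD f g : cont_on K f -> cont_on K g -> cont_on K (fun x => f x + g x).
Proof. by move=> cf cg x Kx; apply: continuousD; [exact: cf|exact: cg]. Qed.

Lemma contM f g : cont_on K f -> cont_on K g -> cont_on K (fun x => f x * g x).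
Proof. by move=> cf cg x Kx; apply: continuousM; [exact: cf|exact: cg]. Qed.

Lemma contN f : cont_on K f -> cont_on K (fun x => - f x).
Proof. by move=> cf x Kx; apply: continuousN; exact: cf. Qed.

Lemma contB f g : cont_on K f -> cont_on K g -> cont_on K (fun x => f x - g x).
Proof. by move=> cf cg; apply: contD => //; exact: contN. Qed.

Lemma cont_sum (J : Type) (r : seq J) (F : J -> X -> R) :
  (forall j, cont_on K (F j)) -> cont_on K (fun x => \sum_(j <- r) F j x).
Proof.
move=> H; elim: r => [|j r IH].
  by rewrite (_ : (fun x => _) = fun=> 0); [exact: cont_cst|apply/funext => x; rewrite big_nil].
rewrite (_ : (fun x => _) = fun x => F j x + \sum_(j <- r) F j x); first exact: contD.
by apply/funext => x; rewrite big_cons.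
Qed.

Lemma pf_eq f g : cont_on K f -> cont_on K g -> (forall x, K x -> f x = g x) -> I f = I g.
Proof.
move=> cf cg E; apply/eqP; rewrite eq_le; apply/andP.
by split; apply: (pf_le pI) => // x /E ->.
Qed.

Lemma pfD f g : cont_on K f -> cont_on K g -> I (fun x => f x + g x) = I f + I g.
Proof.
move=> cf cg; rewrite -[I f]mul1r -(pf_lin pI) //.
by congr (I _); apply/funext => x; rewrite mul1r.
Qed.

Lemma pf0 : I (fun=> 0) = 0.
Proof.
have := pfD (@cont_cst 0) (@cont_cst 0).
rewrite (_ : (fun x : X => 0 + 0) = (fun=> 0 : R)); last by apply/funext => x; rewrite addr0.
by move/eqP; rewrite eq_sym -subr_eq0 addrK => /eqP.
Qed.

Lemma pfZ a f : cont_on K f -> I (fun x => a * f x) = a * I f.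
Proof.
move=> cf; rewrite -[a * I f]addr0 -pf0 -(pf_lin pI) //; last exact: cont_cst.
by congr (I _); apply/funext => x; rewrite addr0.
Qed.

Lemma pfN f : cont_on K f -> I (fun x => - f x) = - I f.
Proof.
move=> cf; rewrite -mulN1r -pfZ //.
by congr (I _); apply/funext => x; rewrite mulN1r.
Qed.

Lemma pfB f g : cont_on K f -> cont_on K g -> I (fun x => f x - g x) = I f - I g.
Proof. by move=> cf cg; rewrite (pfD cf (contN cg)) (pfN cg). Qed.

Lemma pf_sum (J : Type) (r : seq J) (F : J -> X -> R) :
  (forall j, cont_on K (F j)) -> I (fun x => \sum_(j <- r) F j x) = \sum_(j <- r) I (F j).
Proof.
move=> H; elim: r => [|j r IH].
  rewrite big_nil -[RHS]pf0; congr (I _); apply/funext => x.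
  by rewrite big_nil.
rewrite big_cons -IH -pfD //; last exact: cont_sum.
by congr (I _); apply/funext => x; rewrite big_cons.
Qed.

Lemma pf_ge0 f : cont_on K f -> (forall x, K x -> 0 <= f x) -> 0 <= I f.
Proof. by move=> cf f0; rewrite -pf0; apply: (pf_le pI) => //; exact: cont_cst. Qed.

Lemma pf_abs f e : cont_on K f -> (forall x, K x -> `|f x| <= e) -> `|I f| <= e * I (fun=> 1).
Proof.
move=> cf fe; rewrite -pfZ; last exact: cont_cst.
rewrite ler_norml -pfN; last by move=> x Kx; exact: cst_continuous.
by apply/andP; split; apply: (pf_le pI) => //; try exact: cont_cst; move=> x /fe;
  rewrite mulr1 ler_norml => /andP[].
Qed.

Hypothesis cK : compact K.

(** The tube lemma: over a compact [K], closeness that holds locally in x for parameters near the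
    limit holds for all x at once. Joint continuity thereby becomes uniform continuity in the
    parameter. *)
Lemma tube_near (Y : Type) (F : set_system Y) (h : Y -> X -> R) (h0 : X -> R) (e : R) :
  Filter F -> (forall x, K x -> \forall x' \near x & y \near F, `|h y x' - h0 x'| <= e) ->
  \forall y \near F, forall x, K x -> `|h y x - h0 x| <= e.
Proof.
move=> FF H.
exact: ((compact_near_coveringP K).1 cK _ F (fun y x => `|h y x - h0 x| <= e) FF H).
Qed.

Lemma tube_cont (Y : topologicalType) (h : Y -> X -> R) (y0 : Y) (e : R) : 0 < e ->
  (forall x, K x -> {for (y0, x), continuous (fun p : Y * X => h p.1 p.2)}) ->
  \forall y \near y0, forall x, K x -> `|h y x - h y0 x| <= e.
Proof.
move=> e0 ch; apply: tube_near => x Kx.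
have e20 : 0 < e / 2 by lra.
have := cont_near (ch x Kx) e20 => -[[A B] /= [nA nB] AB].
exists (B, A) => //= -[x' y] /= [Bx' Ay].
have H1 := AB (y, x') (conj Ay Bx').
have H2 := AB (y0, x') (conj (nbhs_singleton nA) Bx').
move: H1 H2; rewrite /= !ler_norml => /andP[? ?] /andP[? ?]; apply/andP; split; lra.
Qed.

Lemma pf_param (Y : topologicalType) (A : set Y) (h : Y -> X -> R) (y0 : Y) :
  A y0 -> (forall y, A y -> cont_on K (h y)) ->
  (forall x, K x -> {for (y0, x), continuous (fun p : Y * X => h p.1 p.2)}) ->
  I (h y) @[y --> within A (nbhs y0)] --> I (h y0).
Proof.
move=> Ay0 cA ch; apply/cvgrPdist_le => e e0.
have I1 : 0 <= I (fun=> 1) by apply: pf_ge0 => [|x _]; [exact: cont_cst|exact: ler01].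
have d0 : 0 < e / (I (fun=> 1) + 1) by rewrite divr_gt0 // ltr_wpDl.
have := tube_cont d0 ch; rewrite /within /=; apply: filterS => y H Ay.
rewrite distrC -pfB; [|exact: cA|exact: cA].
apply: le_trans (pf_abs (contB (cA _ Ay) (cA _ Ay0)) H) _.
rewrite mulrAC ler_pdivrMr ?ltr_wpDl //.
by apply: ler_wpM2l; [exact: ltW|lra].
Qed.

Lemma cont_slice (Y : topologicalType) (h : Y -> X -> R) (y : Y) :
  (forall x, K x -> {for (y, x), continuous (fun p : Y * X => h p.1 p.2)}) ->
  cont_on K (h y).
Proof.
move=> ch x Kx.
have : {for x, continuous ((fun p : Y * X => h p.1 p.2) \o (fun x => (y, x)))}.
  apply: continuous_comp; last exact: ch.
  by apply: cvg_pair => //=; exact: cvg_cst.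
by [].
Qed.

Lemma pf_param_within (Y : topologicalType) (A : set Y) (h : Y -> X -> R) :
  (forall y x, A y -> K x -> {for (y, x), continuous (fun p : Y * X => h p.1 p.2)}) ->
  {within A, continuous (fun y => I (h y))}.
Proof.
move=> ch; apply/subspace_continuousP => y Ay; apply: pf_param => //.
  by move=> y' Ay'; apply: cont_slice => x; exact: ch.
by move=> x; exact: ch.
Qed.

(** Differentiation under the integral sign. By the mean value theorem the difference quotient
    equals [h'] at a parameter between, and the tube lemma makes this uniformly close to [h' t0] on
    [K]. *)
Lemma pf_deriv (O : set R) (h h' : R -> X -> R) (t0 : R) : open O -> O t0 ->
  (forall t x, O t -> K x -> is_derive t (1 : R) (fun s => h s x) (h' t x)) ->
  (forall t x, O t -> K x -> {for (t, x), continuous (fun p : R * X => h p.1 p.2)}) ->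
  (forall t x, O t -> K x -> {for (t, x), continuous (fun p : R * X => h' p.1 p.2)}) ->
  is_derive t0 (1 : R) (fun t => I (h t)) (I (h' t0)).
Proof.
move=> oO Ot0 dh ch ch'.
have cs t : O t -> cont_on K (h t) by move=> Ot; apply: cont_slice => x; exact: ch.
have cs' t : O t -> cont_on K (h' t) by move=> Ot; apply: cont_slice => x; exact: ch'.
have I1 : 0 <= I (fun=> 1) by apply: pf_ge0 => [|x _]; [exact: cont_cst|exact: ler01].
suff L : (fun s : R => s^-1 *: (((fun t => I (h t)) \o shift t0) (s *: (1:R)) - I (h t0))) @ 0^' --> I (h' t0).
  split; last exact: cvg_lim L.
  by apply/cvg_ex; exists (I (h' t0)).
apply/cvgrPdist_le => e e0.
have d0 : 0 < e / (I (fun=> 1) + 1) by rewrite divr_gt0 // ltr_wpDl.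
have T := tube_cont d0 (fun x Kx => ch' t0 x Ot0 Kx).
have nO : nbhs t0 O by exact: open_nbhs_nbhs.
have [r /= r0 Hr] := (nbhs_ballP _ _).1 (filterI T nO).
near=> s.
have s0 : s != 0 by near: s; exact: nbhs_dnbhs_neq.
have sr : `|s| < r by near: s; exact: dnbhs0_lt.
have inb c : `|c| <= `|s| -> ball t0 r (c + t0).
  by move=> cs0; rewrite /ball /= opprD addrCA subrr addr0 normrN (le_lt_trans cs0).
have Os : O (s + t0) by have [] := Hr _ (inb s (lexx _)).
have -> : s^-1 *: (((fun t => I (h t)) \o shift t0) (s *: (1:R)) - I (h t0)) =
   I (fun x => s^-1 * (h (s + t0) x - h t0 x)).
  rewrite pfZ; last by apply: contB; exact: cs.
  by rewrite pfB /= ?[s%:A]mulr1 //; exact: cs.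
rewrite distrC -pfB; last exact: cs'; last first.
  by apply: contM; [exact: cont_cst|apply: contB; exact: cs].
have B x : K x -> `|s^-1 * (h (s + t0) x - h t0 x) - h' t0 x| <= e / (I (fun=> 1) + 1).
  move=> Kx.
  have D c : `|c| <= `|s| -> is_derive (c *: (1:R) + t0) (1:R) (fun t => h t x) (h' (c *: (1:R) + t0) x).
    move=> cs0; apply: dh => //; rewrite [c *: _]mulr1.
    by have [] := Hr _ (inb c cs0).
  have [c cs0] := @mvt_line R _ (fun t => h t x) t0 (1:R) s (fun t => h' t x) D.
  rewrite ![_ *: (1:R)]mulr1 => ->; rewrite mulrA mulVf // mul1r.
  by have [H _] := Hr _ (inb c cs0); exact: H.
apply: le_trans (pf_abs _ B) _.
  by apply: contB (cs' _ Ot0); apply: contM; [exact: cont_cst|apply: contB; exact: cs].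
rewrite mulrAC ler_pdivrMr ?ltr_wpDl //.
by apply: ler_wpM2l; [exact: ltW|lra].
Unshelve. all: by end_near. Qed.

End Theory.

Lemma pf_pull (X X' : topologicalType) (K : set X) (K' : set X') (phi : X' -> X) J :
  posfun K' J -> (forall y, K' y -> {for y, continuous phi}) -> (forall y, K' y -> K (phi y)) ->
  posfun K (fun f => J (fun y => f (phi y))).
Proof.
move=> pJ cphi Kphi.
have C f : cont_on K f -> cont_on K' (fun y => f (phi y)).
  move=> cf y K'y; apply: continuous_comp; first exact: cphi.
  by apply: cf; exact: Kphi.
split=> [a f g cf cg|f g cf cg fg]; first by rewrite -(pf_lin pJ) //; exact: C.
by apply: (pf_le pJ); [exact: C|exact: C|move=> y /Kphi /fg].
Qed.

Lemma pf_weight (X : topologicalType) (K : set X) (w : X -> R) J :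
  posfun K J -> cont_on K w -> (forall x, K x -> 0 <= w x) ->
  posfun K (fun f => J (fun x => w x * f x)).
Proof.
move=> pJ cw w0; split=> [a f g cf cg|f g cf cg fg].
  rewrite -(pf_lin pJ) //; [|exact: contM..].
  by congr (J _); apply/funext => x; ring.
apply: (pf_le pJ); [exact: contM..|move=> x Kx].
by apply: ler_wpM2l; [exact: w0|exact: fg].
Qed.

Lemma Rint_within (a b : R) (f : R -> R) : {within `[a, b], continuous f} ->
  (@lebesgue_measure R).-integrable `[a, b] (EFin \o f).
Proof. by move=> cf; apply: continuous_compact_integrable => //; exact: segment_compact. Qed.

Lemma ftc_seg (a b : R) (f F : R -> R) : a < b ->
  {within `[a, b], continuous f} -> {within `[a, b], continuous F} ->
  (forall x, a < x < b -> is_derive x (1 : R) F (f x)) ->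
  \int[lebesgue_measure]_(x in `[a, b]) f x = F b - F a.
Proof.
move=> ab cf cF dF; rewrite /Rintegral (@continuous_FTC2 _ f F a b ab cf) //.
  have /continuous_within_itvP -/(_ ab) [_ Fa Fb] := cF.
  by split=> // x; rewrite in_itv /= => /dF[].
by move=> x; rewrite in_itv /= => /dF[_ <-]; rewrite derive1E.
Qed.

(** The inductive step for iterated integrals: by compactness the inner functional depends
    continuously on t, hence is integrable over the segment. *)
Lemma pf_seg (X : topologicalType) (K : set X) (I : (X -> R) -> R) (a b : R) :
  posfun K I -> compact K ->
  posfun [set p : R * X | p.1 \in `[a, b] /\ K p.2]
    (fun f => \int[lebesgue_measure]_(t in `[a, b]) I (fun x => f (t, x))).
Proof.
move=> pI cK.
have U (f : R * X -> R) t x : {for (t, x), continuous f} ->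
    {for (t, x), continuous (fun q : R * X => f (q.1, q.2))}.
  by rewrite /prop_for; congr (continuous_at _ _); apply/funext => -[].
have S (f : R * X -> R) t : cont_on [set p : R * X | p.1 \in `[a, b] /\ K p.2] f -> t \in `[a, b] ->
    cont_on K (fun x => f (t, x)).
  by move=> cf ab; apply: (@cont_slice _ K _ (fun t x => f (t, x))) => x Kx; apply: U; exact: cf.
have Wc f : cont_on [set p : R * X | p.1 \in `[a, b] /\ K p.2] f ->
    {within `[a, b], continuous (fun t => I (fun x => f (t, x)))}.
  move=> cf; apply: (pf_param_within pI cK) => t x tab Kx.
  by apply: U; exact: cf.
have W f : cont_on [set p : R * X | p.1 \in `[a, b] /\ K p.2] f ->
    (@lebesgue_measure R).-integrable `[a, b] (EFin \o (fun t => I (fun x => f (t, x)))).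
  by move=> cf; apply: Rint_within; exact: Wc.
split=> [c f g cf cg|f g cf cg fg].
  rewrite -RintegralZl //; [|exact: W].
  rewrite -RintegralD //; [|apply: Rint_within|exact: W]; last first.
    by move=> t; apply: cvgM; [exact: cvg_cst|exact: (Wc f cf t)].
  apply: eq_Rintegral => t; rewrite inE /= => tab.
  by rewrite -(pf_lin pI) //; exact: S.
apply: le_Rintegral => //; [exact: W|exact: W|move=> t tab].
by apply: (pf_le pI); [exact: S|exact: S|move=> x Kx; exact: fg].
Qed.

End PosFun.

(** * Rows split into first coordinate and rest *)

HB.lock Definition rcons_mx (R : realType) k (a : R) (v : 'rV[R]_k) : 'rV[R]_k.+1 :=
  row_mx a%:M v.

Section RowCons.
Variable R : realType.

Lemma rcons_mxE k (a : R) (v : 'rV[R]_k) : (row_mx a%:M v : 'rV[R]_k.+1) = rcons_mx a v.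
Proof. by rewrite rcons_mx.unlock. Qed.

Lemma torus_integralS k (f : 'rV[R]_k.+1 -> R) : torus_integral f =
  \int[lebesgue_measure]_(t in `[0, 1]) torus_integral (fun v => f (rcons_mx t v)).
Proof.
congr (Rintegral _ _ _); apply/funext => t; congr torus_integral; apply/funext => v.
by rewrite -rcons_mxE.
Qed.

Lemma rcons0 k a (v : 'rV[R]_k) : rcons_mx a v 0 0 = a.
Proof.
have -> : (0 : 'I_k.+1) = lshift k (0 : 'I_1) by apply/val_inj.
by rewrite rcons_mx.unlock; apply: etrans (@row_mxEl R 1 1 k a%:M v 0 0) _; rewrite mxE.
Qed.

Lemma rconsS k a (v : 'rV[R]_k) j : rcons_mx a v 0 (lift ord0 j) = v 0 j.
Proof.
have -> : lift ord0 j = rshift 1 j by apply/val_inj.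
rewrite rcons_mx.unlock; exact: (@row_mxEr R 1 1 k a%:M v 0 j).
Qed.

Lemma rV_continuous (Y : topologicalType) m (phi : Y -> 'rV[R]_m) y :
  (forall i, {for y, continuous (fun z => phi z 0 i)}) -> {for y, continuous phi}.
Proof.
move=> H; apply/cvgrPdist_le => e e0.
have : \forall z \near y, forall i, `|phi z 0 i - phi y 0 i| <= e.
  apply: (@filter_forall _ _ _ (nbhs y)) => i.
  exact: cont_near (H i) e0.
apply: filterS => z Hz; apply: rV_norm_le; first exact: ltW.
by move=> i; rewrite !mxE distrC.
Qed.

Lemma rcons_continuous (Y : topologicalType) k (a : Y -> R) (v : Y -> 'rV[R]_k) y :
  {for y, continuous a} -> {for y, continuous v} ->
  {for y, continuous (fun z => rcons_mx (a z) (v z))}.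
Proof.
move=> ca cv; apply: rV_continuous => i; have [j ->|->] := unliftP 0 i.
  rewrite (_ : (fun z => _) = (fun z => v z 0 j)); last first.
    by apply/funext => z; rewrite -[0]/(ord0) rconsS.
  apply: (@continuous_comp _ _ _ v (fun w : 'rV[R]_k => w 0 j)) => //.
  exact: coord_continuous.
by rewrite (_ : (fun z => _) = a) //; apply/funext => z; rewrite rcons0.
Qed.

Lemma cont_fst (X Y : topologicalType) (p : X * Y) : {for p, continuous (fun q : X * Y => q.1)}.
Proof. exact: cvg_fst. Qed.
Lemma cont_snd (X Y : topologicalType) (p : X * Y) : {for p, continuous (fun q : X * Y => q.2)}.
Proof. exact: cvg_snd. Qed.

Lemma is_derive_chainE (U : normedModType R) m (b : U -> 'rV[R]_m) V (f : 'rV[R]_m -> R)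
    (u v : U) (db : 'I_m -> R) :
  open V -> Ck 1 V f -> V (b u) -> (forall i, is_derive u v (fun y => b y 0 i) (db i)) ->
  is_derive u v (fun y => f (b y)) (\sum_i db i * pd i f (b u)).
Proof.
move=> oV fC Vb D.
have De i : derivable (fun y => b y 0 i) u v by case: (D i).
have Dv i : 'D_v (fun y => b y 0 i) u = db i by case: (D i).
have := is_derive_chain oV fC Vb De.
by rewrite (eq_bigr (fun i => db i * pd i f (b u))) // => i _; rewrite Dv.
Qed.

Lemma is_derive_rcons k (f : 'rV[R]_k.+1 -> R) V (v : 'rV[R]_k) (s : R) :
  open V -> Ck 1 V f -> V (rcons_mx s v) ->
  is_derive s (1 : R) (fun s => f (rcons_mx s v)) (pd ord0 f (rcons_mx s v)).
Proof.
move=> oV fC Vs.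
have D i : is_derive s (1 : R) (fun s : R => rcons_mx s v 0 i) (i == 0)%:R.
  have [j ->|->] := unliftP 0 i.
    rewrite (_ : (fun s : R => _) = cst (v 0 j)); last by apply/funext => z; rewrite rconsS.
    exact: is_derive_cst.
  rewrite (_ : (fun s : R => _) = id); last by apply/funext => z; rewrite rcons0.
  exact: is_derive_id.
have := is_derive_chainE (b := fun s => rcons_mx s v) (u := s) (v := 1 : R) oV fC Vs D.
rewrite big_ord_recl big1 ?addr0; last by move=> i _; rewrite mul0r.
by rewrite mul1r.
Qed.

Lemma pd_slice k (f : 'rV[R]_k.+1 -> R) V (s : R) (v : 'rV[R]_k) j :
  open V -> Ck 1 V f -> V (rcons_mx s v) ->
  is_derive v 'e_j (fun v => f (rcons_mx s v)) (pd (lift ord0 j) f (rcons_mx s v)).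
Proof.
move=> oV fC Vs.
have D i : is_derive v 'e_j (fun v : 'rV[R]_k => rcons_mx s v 0 i) (i == lift ord0 j)%:R.
  have [l ->|->] := unliftP 0 i.
    rewrite (_ : (fun v : 'rV[R]_k => _) = (fun v => v 0 l)); last by apply/funext => z; rewrite rconsS.
    apply: is_derive_eq (is_derive_coord v 'e_j l) _.
    by rewrite mxE eqxx (inj_eq lift_inj).
  rewrite (_ : (fun v : 'rV[R]_k => _) = cst s); last by apply/funext => z; rewrite rcons0.
  exact: is_derive_cst.
have := is_derive_chainE oV fC Vs D.
rewrite (bigD1 (lift ord0 j)) //= big1 ?addr0; last by move=> i /negPf ->; rewrite mul0r.
by rewrite eqxx mul1r.
Qed.

Lemma open_slice k (V : set 'rV[R]_k.+1) (s : R) : open V ->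
  open [set v : 'rV[R]_k | V (rcons_mx s v)].
Proof.
move=> oV; apply: (open_comp (f := rcons_mx s)) oV => v _.
by apply: rcons_continuous => //; exact: cst_continuous.
Qed.

Lemma Ck_slice c k (f : 'rV[R]_k.+1 -> R) V (s : R) : open V -> Ck c V f ->
  Ck c [set v : 'rV[R]_k | V (rcons_mx s v)] (fun v => f (rcons_mx s v)).
Proof.
move=> oV; have cc v : {for v, continuous (fun v : 'rV[R]_k => rcons_mx s v)}.
  by apply: rcons_continuous => //; exact: cst_continuous.
elim: c f => [|c IH] f fC.
  by move=> v Vv; apply: continuous_comp; [exact: cc|exact: fC].
have f1 : Ck 1 V f by apply: Ck_le fC.
split=> [v Vv|i].
  split=> [|i]; first by apply: continuous_comp; [exact: cc|exact: (Ck_cont fC)].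
  by case: (pd_slice i oV f1 Vv).
apply: Ck_congr (IH _ (fC.2 (lift ord0 i))); first exact: open_slice.
by move=> v Vv; rewrite (pd_val (pd_slice i oV f1 Vv)).
Qed.

End RowCons.

(** * Integration over the torus *)

Section Torus.
Variable R : realType.

Definition cube k : set 'rV[R]_k := [set v | forall j, v 0 j \in `[0, 1]].

Lemma cube_compact k : compact (@cube k).
Proof.
have := @rV_compact R k (fun=> `[0, 1]%classic) (fun=> @segment_compact R 0 1).
by apply: eq_subset_compact || (congr compact).
Qed.

Lemma cube_cons k (s : R) (v : 'rV[R]_k) : s \in `[0, 1] -> cube v -> cube (rcons_mx s v).
Proof.
move=> s01 cv j; have [l ->|->] := unliftP 0 j; first by rewrite rconsS.
by rewrite rcons0.
Qed.

Lemma pf_torus k : posfun (@cube k) (@torus_integral R k).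
Proof.
elim: k => [|k IH].
  split=> [a f g _ _ //|f g _ _ fg /=]; apply: fg => j; by case: j.
have -> : @torus_integral R k.+1 = fun f =>
    \int[lebesgue_measure]_(t in `[0, 1]) torus_integral (fun v => f (rcons_mx t v)).
  by apply/funext => f; rewrite torus_integralS.
apply: (pf_pull (phi := fun p : R * 'rV[R]_k => rcons_mx p.1 p.2) (pf_seg 0 1 IH (@cube_compact k))).
  by move=> p _; apply: rcons_continuous; [exact: cont_fst|exact: cont_snd].
by move=> p /= [p1 p2]; exact: cube_cons.
Qed.

Lemma torus_ext k f g : cont_on (@cube k) f -> cont_on (@cube k) g ->
  (forall v, cube v -> f v = g v) -> torus_integral f = torus_integral g.
Proof. exact: pf_eq (@pf_torus k) _ _. Qed.

(** Only opposite faces of the cube have to match, which is why periodicity is asked at v j = 0. In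
    the first direction the derivative is taken under the inner integral and the fundamental theorem
    of calculus applies; the other directions are handled slice by slice by induction. *)
Lemma torus_div k (U : set 'rV[R]_k) (f : 'rV[R]_k -> R) j :
  open U -> (forall v, cube v -> U v) -> Ck 1 U f ->
  (forall v, cube v -> v 0 j = 0 -> f (v + 'e_j) = f v) ->
  torus_integral (pd j f) = 0.
Proof.
elim: k U f j => [|k IH] U f j oU cU fC per; first by case: j {per}.
have cpd i : cont_on (@cube k.+1) (pd i f) by move=> v cv; apply: (fC.2 i); exact: cU.
have cs (h : 'rV[R]_k.+1 -> R) s v : {for rcons_mx s v, continuous h} ->
    {for (s, v), continuous (fun p : R * 'rV[R]_k => h (rcons_mx p.1 p.2))}.
  move=> ch; apply: (@continuous_comp _ _ _ (fun p : R * 'rV[R]_k => rcons_mx p.1 p.2) h) => //.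
  by apply: rcons_continuous; [exact: cont_fst|exact: cont_snd].
have csl (h : 'rV[R]_k.+1 -> R) s : s \in `[0, 1] -> cont_on (@cube k.+1) h ->
    cont_on (@cube k) (fun v => h (rcons_mx s v)).
  move=> s01 ch; apply: (@cont_slice R _ (@cube k) _ (fun s v => h (rcons_mx s v))) => v cv.
  by apply: cs; apply: ch; exact: cube_cons.
rewrite torus_integralS; have [j' Ej|Ej] := unliftP 0 j; rewrite {}Ej in per *.
  transitivity (\int[lebesgue_measure]_(t in `[0, 1]) (0 : R)); last first.
    by rewrite Rintegral_cst // mul0r.
  apply: eq_Rintegral => s; rewrite inE /= => s01.
  rewrite -(IH _ (fun v => f (rcons_mx s v)) j' (open_slice (s := s) oU) _ (Ck_slice s oU fC)).
  - apply: torus_ext => [||v cv].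
    + exact: (csl _ _ s01 (cpd _)).
    + move=> v cv; apply: ((Ck_slice s oU fC).2 j').
      by apply: cU; exact: cube_cons.
    + by rewrite (pd_val (pd_slice j' oU fC (cU _ (cube_cons s01 cv)))).
  - by move=> v cv; apply: cU; exact: cube_cons.
  - move=> v cv vj; rewrite -(per (rcons_mx s v)) ?rconsS //; last exact: cube_cons.
    congr f; apply/rowP => i; rewrite mxE; have [l ->|->] := unliftP 0 i.
      by rewrite !rconsS !mxE (inj_eq lift_inj).
    by rewrite !rcons0 mxE /= addr0.
pose F s := torus_integral (fun v : 'rV[R]_k => f (rcons_mx s v)).
have fc : cont_on (@cube k.+1) f by move=> v cv; apply: (Ck_cont fC); exact: cU.
transitivity (F 1 - F 0); last first.
  apply/eqP; rewrite subr_eq0; apply/eqP.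
  have s0 : (0 : R) \in `[0, 1] by rewrite in_itv /= lexx ler01.
  have s1 : (1 : R) \in `[0, 1] by rewrite in_itv /= lexx ler01.
  apply: torus_ext => [||v cv]; [exact: (csl _ _ s1 fc)|exact: (csl _ _ s0 fc)|].
  rewrite -(per (rcons_mx 0 v)) ?rcons0 //; last exact: cube_cons.
  congr f; apply/rowP => i; rewrite mxE; have [l ->|->] := unliftP 0 i.
    by rewrite !rconsS !mxE addr0.
  by rewrite !rcons0 mxE /= add0r.
apply: ftc_seg => //.
- apply: (pf_param_within (pf_torus k) (@cube_compact k) (h := fun s v => pd ord0 f (rcons_mx s v))).
  by move=> s v s01 cv; apply: cs; apply: cpd; exact: cube_cons.
- apply: (pf_param_within (pf_torus k) (@cube_compact k) (h := fun s v => f (rcons_mx s v))).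
  by move=> s v s01 cv; apply: cs; apply: fc; exact: cube_cons.
move=> s s01; apply: (pf_deriv (pf_torus k) (@cube_compact k) (O := `]0, 1[%classic)
   (h := fun s v => f (rcons_mx s v)) (h' := fun s v => pd ord0 f (rcons_mx s v))).
- exact: itv_open.
- by rewrite /= in_itv.
- move=> t v; rewrite /= in_itv /= => t01 cv; apply: (is_derive_rcons oU fC).
  by apply: cU; apply: cube_cons => //; rewrite in_itv /=; lra.
- move=> t v; rewrite /= in_itv /= => t01 cv; apply: cs; apply: fc.
  by apply: cube_cons => //; rewrite in_itv /=; lra.
- move=> t v; rewrite /= in_itv /= => t01 cv; apply: cs; apply: cpd.
  by apply: cube_cons => //; rewrite in_itv /=; lra.
Qed.

End Torus.

Lemma pair_continuous (X Y : topologicalType) (a : X) (y : Y) :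
  {for y, continuous (fun y : Y => (a, y))}.
Proof. by apply: cvg_pair => //=; exact: cvg_cst. Qed.

Lemma is_derive_mulcomb (R : realType) (f g : R -> R) (a b x df dg : R) :
  is_derive x (1 : R) f df -> is_derive x (1 : R) g dg ->
  is_derive x (1 : R) (fun r => r * (a * f r + b * g r))
    ((a * f x + b * g x) + x * (a * df + b * dg)).
Proof.
move=> hf hg.
have e := is_deriveM (is_derive_id x (1 : R)) (is_deriveD (is_deriveZ a hf) (is_deriveZ b hg)).
apply: (is_derive_eq e); change (x * (a * df + b * dg) + (a * f x + b * g x) * 1 =
  (a * f x + b * g x) + x * (a * df + b * dg)); ring.
Qed.

Lemma is_derive_sincos (R : realType) (f g : R -> R) (x df dg : R) :
  is_derive x (1 : R) f df -> is_derive x (1 : R) g dg ->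
  is_derive x (1 : R) (fun r => - sin r * f r + cos r * g r)
    (- cos x * f x - sin x * df + (- sin x * g x + cos x * dg)).
Proof.
move=> hf hg.
have e := is_deriveD (is_deriveM (is_deriveN (is_derive_sin x)) hf) (is_deriveM (is_derive_cos x) hg).
apply: (is_derive_eq e); change ((- sin x * df + f x * - cos x) + (cos x * dg + g x * - sin x) =
  - cos x * f x - sin x * df + (- sin x * g x + cos x * dg)); ring.
Qed.

(** * The divergence theorem on the solid torus in polar coordinates *)

Section Polar.
Variables (R : realType) (k : nat).
Implicit Types (q : R * (R * 'rV[R]_k)).
Local Notation n := k.+2.

Definition polar q : 'rV[R]_n :=
  rcons_mx (q.2.1 * cos q.1) (rcons_mx (q.2.1 * sin q.1) q.2.2).

Definition box : set (R * (R * 'rV[R]_k)) :=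
  [set q | q.1 \in `[0, 2 * pi] /\ (q.2.1 \in `[0, 1] /\ cube q.2.2)].

(** A compact fundamental domain: [solid_torus] itself is unbounded in the coordinates t, so
    compactness arguments and bounds on functions are made here. *)
Definition K0 : set 'rV[R]_n := polar @` box.
Definition K1 : set 'rV[R]_k.+1 := [set p | exists th t, [/\ th \in `[0, 2 * pi], cube t & p = rcons_mx th t]].

Definition IJ (H : R * (R * 'rV[R]_k) -> R) : R :=
  \int[lebesgue_measure]_(th in `[0, 2 * pi]) \int[lebesgue_measure]_(r in `[0, 1])
    torus_integral (fun t => H (th, (r, t))).
(** Integration for the flat measure dx dy dt; the factor [q.2.1] is the Jacobian of polar
    coordinates. *)
Definition IO : ('rV[R]_n -> R) -> R := locked (fun f => IJ (fun q => q.2.1 * f (polar q))).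
Definition IB : ('rV[R]_k.+1 -> R) -> R := locked (fun f =>
  \int[lebesgue_measure]_(th in `[0, 2 * pi]) torus_integral (fun t => f (rcons_mx th t))).

Lemma IOE f : IO f = IJ (fun q => q.2.1 * f (polar q)). Proof. by rewrite /IO -lock. Qed.
Lemma IBE f : IB f = \int[lebesgue_measure]_(th in `[0, 2 * pi]) torus_integral (fun t => f (rcons_mx th t)).
Proof. by rewrite /IB -lock. Qed.

Lemma polar_continuous q : {for q, continuous polar}.
Proof.
have c2 : {for q, continuous (fun q : R * (R * 'rV[R]_k) => q.2)} by exact: cont_snd.
have c21 : {for q, continuous (fun q : R * (R * 'rV[R]_k) => q.2.1)}.
  by apply: (@continuous_comp _ _ _ snd (fun p : R * 'rV[R]_k => p.1)); [exact: c2|exact: cont_fst].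
have c22 : {for q, continuous (fun q : R * (R * 'rV[R]_k) => q.2.2)}.
  by apply: (@continuous_comp _ _ _ snd (fun p : R * 'rV[R]_k => p.2)); [exact: c2|exact: cont_snd].
have cc : {for q, continuous (fun q : R * (R * 'rV[R]_k) => cos q.1)}.
  by apply: (@continuous_comp _ _ _ fst (@cos R)); [exact: cont_fst|exact: continuous_cos].
have cs : {for q, continuous (fun q : R * (R * 'rV[R]_k) => sin q.1)}.
  by apply: (@continuous_comp _ _ _ fst (@sin R)); [exact: cont_fst|exact: continuous_sin].
apply: rcons_continuous; first by apply: continuousM; [exact: c21|exact: cc].
apply: rcons_continuous; last exact: c22.
by apply: continuousM; [exact: c21|exact: cs].
Qed.

Lemma pi2_gt0 : (0 : R) < 2 * pi.
Proof. by rewrite mulr_gt0 // pi_gt0. Qed.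

Let c01 : compact [set p : R * 'rV[R]_k | p.1 \in `[0, 1] /\ cube p.2].
Proof.
have := @compact_setX R 'rV[R]_k `[0, 1]%classic (@cube R k) (@segment_compact R 0 1) (@cube_compact R k).
by apply: (fun A B (H : A = B) => (fun c : compact A => let: erefl := H in c)).
Qed.

Lemma box_compact : compact box.
Proof.
have := @compact_setX R _ `[0, 2 * pi]%classic _ (@segment_compact R 0 (2 * pi)) c01.
by apply: (fun A B (H : A = B) => (fun c : compact A => let: erefl := H in c)).
Qed.

Lemma pf_I2 : posfun [set p : R * 'rV[R]_k | p.1 \in `[0, 1] /\ cube p.2]
  (fun H => \int[lebesgue_measure]_(r in `[0, 1]) torus_integral (fun t => H (r, t))).
Proof. exact: (pf_seg 0 1 (@pf_torus R k) (@cube_compact R k)). Qed.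

Lemma pf_IJ : posfun box IJ.
Proof. exact: (pf_seg 0 (2 * pi) pf_I2 c01). Qed.

Lemma pf_IO : posfun K0 IO.
Proof.
rewrite /IO -lock; apply: (@pf_pull _ _ _ K0 box polar (fun H => IJ (fun q => q.2.1 * H q))).
- apply: pf_weight; first exact: pf_IJ.
    move=> q _; apply: (@continuous_comp _ _ _ snd (fun p : R * 'rV[R]_k => p.1)).
      exact: cont_snd.
    exact: cont_fst.
  by move=> q [_ [+ _]]; rewrite in_itv /= => /andP[].
- by move=> q _; exact: polar_continuous.
- by move=> q bq; exists q.
Qed.

Lemma K0_compact : compact K0.
Proof.
apply: continuous_compact; last exact: box_compact.
by apply: continuous_subspaceT => q; exact: polar_continuous.
Qed.

Lemma rcons_pair_continuous (q : R * 'rV[R]_k) :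
  {for q, continuous (fun q : R * 'rV[R]_k => rcons_mx q.1 q.2)}.
Proof. by apply: rcons_continuous; [exact: cont_fst|exact: cont_snd]. Qed.

Lemma pf_IB : posfun K1 IB.
Proof.
rewrite /IB -lock; apply: (@pf_pull _ _ _ K1 [set p : R * 'rV[R]_k | p.1 \in `[0, 2 * pi] /\ cube p.2]
   (fun p => rcons_mx p.1 p.2)
   (fun H => \int[lebesgue_measure]_(r in `[0, 2 * pi]) torus_integral (fun t => H (r, t)))).
- exact: (pf_seg 0 (2 * pi) (@pf_torus R k) (@cube_compact R k)).
- by move=> q _; exact: rcons_pair_continuous.
- by move=> [th t] [/= H1 H2]; exists th, t.
Qed.

Lemma K1_compact : compact K1.
Proof.
have -> : K1 = (fun p : R * 'rV[R]_k => rcons_mx p.1 p.2) @`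
    (`[0, 2 * pi]%classic `*` @cube R k).
  apply/seteqP; split => p.
    by move=> [th [t [H1 H2 ->]]]; exists (th, t).
  by move=> [[th t] [/= H1 H2] <-]; exists th, t.
apply: continuous_compact; first by apply: continuous_subspaceT => q; exact: rcons_pair_continuous.
by apply: compact_setX; [exact: segment_compact|exact: cube_compact].
Qed.

Lemma lift2E (i : 'I_n) : [\/ i = ord0, i = lift ord0 ord0 | exists j : 'I_k, i = lift ord0 (lift ord0 j)].
Proof.
have [j ->|->] := unliftP ord0 i; last by constructor 1.
have [l ->|->] := unliftP ord0 j; last by constructor 2.
by constructor 3; exists l.
Qed.

Lemma ord1E : (1 : 'I_n) = lift ord0 ord0. Proof. exact: val_inj. Qed.

Lemma polar0 q : polar q 0 ord0 = q.2.1 * cos q.1.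
Proof. exact: rcons0. Qed.
Lemma polar1 q : polar q 0 (lift ord0 ord0) = q.2.1 * sin q.1.
Proof. by rewrite /polar rconsS; exact: rcons0. Qed.
Lemma polarS q j : polar q 0 (lift ord0 (lift ord0 j)) = q.2.2 0 j.
Proof. by rewrite /polar !rconsS. Qed.

Lemma bd_inclE th (t : 'rV[R]_k) : bd_incl (rcons_mx th t) = polar (th, (1, t)).
Proof.
apply/rowP => i; rewrite [LHS]mxE.
case: (lift2E i) => [->|->|[j ->]] /=.
- by rewrite polar0 /= mul1r rcons0.
- by rewrite polar1 /= mul1r rcons0.
- rewrite polarS /= -[RHS](rconsS th); congr (rcons_mx _ _ _ _); apply/val_inj.
  by rewrite /= inordK ?add0n // ltnS.
Qed.

Lemma solid_torus_polar q : box q -> solid_torus (polar q).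
Proof.
move=> [_ [+ _]]; rewrite /solid_torus /= ord1E polar1 (polar0 q : polar q 0 (0 : 'I_n) = _).
rewrite in_itv /= => /andP[r0 r1].
rewrite !exprMn -mulrDr cos2Dsin2 mulr1 expr2.
by rewrite -[1]mulr1 ler_pM.
Qed.

Section Divergence.
Variables (V : set 'rV[R]_n) (oV : open V) (VK : forall x, K0 x -> V x).

Lemma Ck_K0 c f : Ck c V f -> cont_on K0 f.
Proof. by move=> H x /VK Vx; exact: (Ck_cont H). Qed.

Lemma is_derive_polar_r (f : 'rV[R]_n -> R) (th r : R) (t : 'rV[R]_k) :
  Ck 1 V f -> V (polar (th, (r, t))) ->
  is_derive r (1 : R) (fun r => f (polar (th, (r, t))))
    (cos th * pd ord0 f (polar (th, (r, t))) + sin th * pd (lift ord0 ord0) f (polar (th, (r, t)))).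
Proof.
move=> fC Vq.
pose db (i : 'I_n) : R := if i == ord0 then cos th else if i == lift ord0 ord0 then sin th else 0.
have D i : is_derive r (1 : R) (fun r : R => polar (th, (r, t)) 0 i) (db i).
  case: (lift2E i) => [->|->|[j ->]]; rewrite /db /=.
  - rewrite (_ : (fun r => _) = cos th \*o id).
      by apply: is_derive_eq; rewrite [_ *: _]mulr1.
    by apply/funext => s; rewrite polar0 /= mulrC.
  - rewrite (_ : (fun r => _) = sin th \*o id).
      by apply: is_derive_eq; rewrite [_ *: _]mulr1.
    by apply/funext => s; rewrite polar1 /= mulrC.
  - rewrite (_ : (fun r => _) = cst (t 0 j)); first exact: is_derive_cst.
    by apply/funext => s; rewrite polarS.
have := is_derive_chainE (b := fun r => polar (th, (r, t))) (u := r) (v := 1 : R) oV fC Vq D.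
rewrite !big_ord_recl big1 ?addr0; last by move=> i _; rewrite /db /= mul0r.
by rewrite /db /=.
Qed.

Lemma is_derive_polar_th (f : 'rV[R]_n -> R) (th r : R) (t : 'rV[R]_k) :
  Ck 1 V f -> V (polar (th, (r, t))) ->
  is_derive th (1 : R) (fun th => f (polar (th, (r, t))))
    (r * (- sin th * pd ord0 f (polar (th, (r, t))) + cos th * pd (lift ord0 ord0) f (polar (th, (r, t))))).
Proof.
move=> fC Vq.
pose db (i : 'I_n) : R := if i == ord0 then r * - sin th else
  if i == lift ord0 ord0 then r * cos th else 0.
have D i : is_derive th (1 : R) (fun th : R => polar (th, (r, t)) 0 i) (db i).
  case: (lift2E i) => [->|->|[j ->]]; rewrite /db /=.
  - rewrite (_ : (fun r => _) = r \*: (@cos R)).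
      exact: (@is_deriveZ _ _ _ (@cos R) r th 1 _ (is_derive_cos th)).
    by apply/funext => s; rewrite polar0 /=.
  - rewrite (_ : (fun r => _) = r \*: (@sin R)).
      exact: (@is_deriveZ _ _ _ (@sin R) r th 1 _ (is_derive_sin th)).
    by apply/funext => s; rewrite polar1 /=.
  - rewrite (_ : (fun r => _) = cst (t 0 j)); first exact: is_derive_cst.
    by apply/funext => s; rewrite polarS.
have := is_derive_chainE (b := fun th => polar (th, (r, t))) (u := th) (v := 1 : R) oV fC Vq D.
rewrite !big_ord_recl big1 ?addr0; last by move=> i _; rewrite /db /= mul0r.
by rewrite /db /= mulrDr !mulrA.
Qed.

Lemma div_torus (f : 'rV[R]_n -> R) th r j : Ck 1 V f ->
  th \in `[0, 2 * pi] -> r \in `[0, 1] ->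
  (forall q, box q -> q.2.2 0 j = 0 ->
     f (polar q + 'e_(lift ord0 (lift ord0 j))) = f (polar q)) ->
  torus_integral (fun t => pd (lift ord0 (lift ord0 j)) f (polar (th, (r, t)))) = 0.
Proof.
move=> fC th2 r01 per.
pose V1 := [set v : 'rV[R]_k.+1 | V (rcons_mx (r * cos th) v)].
pose V2 := [set v : 'rV[R]_k | V1 (rcons_mx (r * sin th) v)].
have oV1 : open V1 by exact: open_slice.
have oV2 : open V2 by exact: open_slice.
have C1 : Ck 1 V1 (fun v => f (rcons_mx (r * cos th) v)) by exact: Ck_slice.
have C2 : Ck 1 V2 (fun v => f (polar (th, (r, v)))).
  exact: (Ck_slice (r * sin th) oV1 C1).
have cV2 v : cube v -> V2 v.
  by move=> cv; apply: VK; exists (th, (r, v)).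
rewrite -(@torus_div R k V2 (fun v => f (polar (th, (r, v)))) j oV2 cV2 C2).
  apply: torus_ext.
  - move=> v cv.
    have fj : Ck 0 V (pd (lift ord0 (lift ord0 j)) f) by exact: Ck_partial fC.
    exact: (Ck_cont (Ck_slice (r * sin th) oV1 (Ck_slice (r * cos th) oV fj)) (cV2 v cv)).
  - by move=> v cv; apply: (C2.2 j); exact: cV2.
  - move=> v cv; rewrite (pd_val (pd_slice j oV1 C1 (cV2 _ cv))).
    by rewrite (pd_val (pd_slice (lift ord0 j) oV fC (cV2 _ cv))).
move=> v cv vj; rewrite -(per (th, (r, v)))//.
congr f; apply/rowP => i; rewrite [RHS]mxE; case: (lift2E i) => [->|->|[l ->]].
- by rewrite !polar0 mxE /= addr0.
- by rewrite !polar1 mxE /= addr0.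
- by rewrite !polarS !mxE !(inj_eq lift_inj).
Qed.

Lemma IJ_r (G G' : R * (R * 'rV[R]_k) -> R) : cont_on box G -> cont_on box G' ->
  (forall (th r : R) (t : 'rV[R]_k), th \in `[0, 2 * pi] -> 0 < r < 1 -> cube t ->
     is_derive r (1 : R) (fun r => G (th, (r, t))) (G' (th, (r, t)))) ->
  IJ G' = \int[lebesgue_measure]_(th in `[0, 2 * pi])
    (torus_integral (fun t => G (th, (1, t))) - torus_integral (fun t => G (th, (0, t)))).
Proof.
move=> cG cG' dG.
suff key (th : R) : th \in `[0, 2 * pi] -> \int[lebesgue_measure]_(r in `[0, 1])
    torus_integral (fun t => G' (th, (r, t))) =
    torus_integral (fun t => G (th, (1, t))) - torus_integral (fun t => G (th, (0, t))).
  by apply: eq_Rintegral => th; rewrite inE /= => /key.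
move=> th2.
have cs (H : R * (R * 'rV[R]_k) -> R) r t : cont_on box H -> r \in `[0, 1] -> cube t ->
    {for (r, t), continuous (fun p : R * 'rV[R]_k => H (th, (p.1, p.2)))}.
  move=> cH r01 ct.
  have : {for (r, t), continuous (H \o (fun p => (th, p)))}.
    apply: continuous_comp; last apply: cH.
      exact: pair_continuous.
    by split=> //; split.
  by rewrite /prop_for; congr (continuous_at _ _); apply/funext => -[].
have W (H : R * (R * 'rV[R]_k) -> R) : cont_on box H ->
    {within `[0, 1], continuous (fun r : R => torus_integral (fun t => H (th, (r, t))))}.
  move=> cH.
  have := @pf_param_within R _ _ _ (@pf_torus R k) (@cube_compact R k) R `[0, 1]%classic
    (fun (r : R) (t : 'rV[R]_k) => H (th, (r, t))).
  by apply=> r t r01 ct; apply: cs.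
apply: (@ftc_seg R 0 1 (fun r => torus_integral (fun t => G' (th, (r, t))))
   (fun r => torus_integral (fun t => G (th, (r, t))))); [exact: ltr01|exact: W|exact: W|].
have sub (r : R) : 0 < r < 1 -> r \in `[0, 1] by rewrite in_itv /=; lra.
move=> s s01; apply: (pf_deriv (@pf_torus R k) (@cube_compact R k) (O := `]0, 1[%classic)
   (h := fun (r : R) (t : 'rV[R]_k) => G (th, (r, t))) (h' := fun r t => G' (th, (r, t)))).
- exact: itv_open.
- by rewrite /= in_itv.
- by move=> r t; rewrite /= in_itv /= => r01 ct; exact: dG.
- by move=> r t; rewrite /= in_itv /= => r01 ct; apply: cs => //; exact: sub.
- by move=> r t; rewrite /= in_itv /= => r01 ct; apply: cs => //; exact: sub.
Qed.

Lemma IJ_th (G G' : R * (R * 'rV[R]_k) -> R) :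
  (forall q, q.2.1 \in `[0, 1] -> cube q.2.2 -> {for q, continuous G}) ->
  (forall q, q.2.1 \in `[0, 1] -> cube q.2.2 -> {for q, continuous G'}) ->
  (forall (th r : R) (t : 'rV[R]_k), r \in `[0, 1] -> cube t ->
     is_derive th (1 : R) (fun th => G (th, (r, t))) (G' (th, (r, t)))) ->
  (forall r t, G (2 * pi, (r, t)) = G (0, (r, t))) ->
  IJ G' = 0.
Proof.
move=> cG cG' dG per.
have cs (H : R * (R * 'rV[R]_k) -> R) th p :
    {for (th, p), continuous H} ->
    {for (th, p), continuous (fun p : R * (R * 'rV[R]_k) => H (p.1, (p.2.1, p.2.2)))}.
  by rewrite /prop_for; congr (continuous_at _ _); apply/funext => -[? []].
pose F th := \int[lebesgue_measure]_(r in `[0, 1]) torus_integral (fun t => G (th, (r, t))).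
transitivity (F (2 * pi) - F 0); last first.
  rewrite /F (_ : (fun r => torus_integral (fun t => G (2 * pi, (r, t)))) =
     (fun r => torus_integral (fun t => G (0, (r, t))))) ?subrr //.
  by apply/funext => r; congr torus_integral; apply/funext => t.
apply: (@ftc_seg R 0 (2 * pi) (fun th => \int[lebesgue_measure]_(r in `[0, 1])
      torus_integral (fun t => G' (th, (r, t)))) F pi2_gt0).
- apply: (pf_param_within pf_I2 c01 (h := fun th p => G' (th, (p.1, p.2)))).
  by move=> th p _ [p1 p2]; apply: cs; exact: cG'.
- apply: (pf_param_within pf_I2 c01 (h := fun th p => G (th, (p.1, p.2)))).
  by move=> th p _ [p1 p2]; apply: cs; exact: cG.
move=> s _; apply: (pf_deriv pf_I2 c01 (O := setT)
   (h := fun th p => G (th, (p.1, p.2))) (h' := fun th p => G' (th, (p.1, p.2)))).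
- exact: openT.
- by [].
- by move=> th [r t] _ [p1 p2]; exact: dG.
- by move=> th p _ [p1 p2]; apply: cs; exact: cG.
- by move=> th p _ [p1 p2]; apply: cs; exact: cG'.
Qed.

Lemma cos_sin_periodz (x : R) (z : int) :
  cos (x + z%:~R * (2 * pi)) = cos x /\ sin (x + z%:~R * (2 * pi)) = sin x.
Proof.
have N (y : R) (m : nat) : cos (y + m%:R * (2 * pi)) = cos y /\ sin (y + m%:R * (2 * pi)) = sin y.
  have cP u : cos (u + 2 * pi) = cos u :> R by rewrite mulr_natl cosD2pi.
  have sP u : sin (u + 2 * pi) = sin u :> R by rewrite mulr_natl sinD2pi.
  elim: m => [|m [IH1 IH2]]; first by rewrite mul0r addr0.
  have -> : m.+1%:R = m%:R + 1 :> R by rewrite -addn1 natrD.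
  by rewrite mulrDl mul1r addrA cP sP.
case: z => m; first by rewrite -pmulrn.
rewrite NegzE mulrNz mulNr -pmulrn.
have [<- <-] := N (x - m.+1%:R * (2 * pi)) m.+1.
by rewrite subrK.
Qed.

(** The angle is arbitrary here. Derivatives in theta are taken on neighbourhoods of the end points
    0 and 2 pi as well, so continuity of the integrand has to be known for all angles. *)
Lemma polar_K0 q : q.2.1 \in `[0, 1] -> cube q.2.2 -> K0 (polar q).
Proof.
move=> q1 q2; pose th := q.1; pose N := Num.floor (th / (2 * pi)).
exists (th - N%:~R * (2 * pi), q.2); last first.
  have [c s] := cos_sin_periodz th (- N); rewrite mulrNz mulNr in c s.
  by rewrite /polar /= c s.
split=> //=; rewrite in_itv /=.
have /andP[h1 h2] := floor_itv (th / (2 * pi)).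
rewrite subr_ge0 -ler_pdivlMr ?pi2_gt0 // h1 /=.
rewrite lerBlDr -[X in X + _]mul1r -mulrDl -ler_pdivrMr ?pi2_gt0 //.
by apply: ltW; rewrite addrC -[1]/(1%:~R) -intrD.
Qed.

Lemma cont_polar_r (f : 'rV[R]_n -> R) q : cont_on K0 f ->
  q.2.1 \in `[0, 1] -> cube q.2.2 -> {for q, continuous (fun q => f (polar q))}.
Proof.
move=> cf q1 q2; apply: continuous_comp; first exact: polar_continuous.
by apply: cf; exact: polar_K0.
Qed.

(** In polar coordinates r div F = d_r (r F_r) + d_theta F_theta + r sum_j d_j F_j. The first term
    gives the boundary integral at r = 1, the factor r removing the contribution of r = 0; the
    second integrates to 0 because the angle is 2 pi-periodic, the third because of periodicity in
    t. *)
Theorem div_thm (F : 'I_n -> 'rV[R]_n -> R) : (forall i, Ck 1 V (F i)) ->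
  (forall j q, box q -> q.2.2 0 j = 0 ->
     F (lift ord0 (lift ord0 j)) (polar q + 'e_(lift ord0 (lift ord0 j)))
       = F (lift ord0 (lift ord0 j)) (polar q)) ->
  IO (fun x => \sum_i pd i (F i) x) =
  IB (fun p => cos (p 0 0) * F ord0 (bd_incl p) + sin (p 0 0) * F (lift ord0 ord0) (bd_incl p)).
Proof.
move=> fC per.
pose F0 := F ord0; pose F1 := F (lift ord0 ord0).
pose G q := q.2.1 * (cos q.1 * F0 (polar q) + sin q.1 * F1 (polar q)).
pose Dr f q := cos q.1 * pd ord0 f (polar q) + sin q.1 * pd (lift ord0 ord0) f (polar q).
pose Dt f q := q.2.1 * (- sin q.1 * pd ord0 f (polar q) + cos q.1 * pd (lift ord0 ord0) f (polar q)).
pose G' q := (cos q.1 * F0 (polar q) + sin q.1 * F1 (polar q)) +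
  q.2.1 * (cos q.1 * Dr F0 q + sin q.1 * Dr F1 q).
pose H q := - sin q.1 * F0 (polar q) + cos q.1 * F1 (polar q).
pose H' q := - cos q.1 * F0 (polar q) - sin q.1 * Dt F0 q +
   (- sin q.1 * F1 (polar q) + cos q.1 * Dt F1 q).
pose L j q := q.2.1 * pd (lift ord0 (lift ord0 j)) (F (lift ord0 (lift ord0 j))) (polar q).
pose B := [set q : R * (R * 'rV[R]_k) | q.2.1 \in `[0, 1] /\ cube q.2.2].
have bB q : box q -> B q by move=> [_].
have cB (f : 'rV[R]_n -> R) : cont_on K0 f -> cont_on B (fun q => f (polar q)).
  by move=> cf q [q1 q2]; exact: cont_polar_r.
have cF i : cont_on B (fun q => F i (polar q)) by apply: cB; exact: Ck_K0 (fC i).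
have cdF i j : cont_on B (fun q => pd j (F i) (polar q)).
  by apply: cB; apply: (Ck_K0 (c := 0)); exact: Ck_partial (fC i).
have cc : cont_on B (fun q => cos q.1).
  by move=> q _; apply: (@continuous_comp _ _ _ fst (@cos R)); [exact: cont_fst|exact: continuous_cos].
have cs : cont_on B (fun q => sin q.1).
  by move=> q _; apply: (@continuous_comp _ _ _ fst (@sin R)); [exact: cont_fst|exact: continuous_sin].
have cr : cont_on B (fun q => q.2.1).
  move=> q _; apply: (@continuous_comp _ _ _ snd (fun p : R * 'rV[R]_k => p.1)).
    exact: cont_snd.
  exact: cont_fst.
pose l1 : 'I_n := lift ord0 ord0.
have cDr i : cont_on B (Dr (F i)).
  exact: (contD (contM cc (cdF i ord0)) (contM cs (cdF i l1))).
have cDt i : cont_on B (Dt (F i)).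
  exact: (contM cr (contD (contM (contN cs) (cdF i ord0)) (contM cc (cdF i l1)))).
have cG : cont_on B G by exact: (contM cr (contD (contM cc (cF ord0)) (contM cs (cF l1)))).
have cG' : cont_on B G'.
  exact: (contD (contD (contM cc (cF ord0)) (contM cs (cF l1)))
    (contM cr (contD (contM cc (cDr ord0)) (contM cs (cDr l1))))).
have cH : cont_on B H by exact: (contD (contM (contN cs) (cF ord0)) (contM cc (cF l1))).
have cH' : cont_on B H'.
  exact: (contD (contB (contM (contN cc) (cF ord0)) (contM cs (cDt ord0)))
    (contD (contM (contN cs) (cF l1)) (contM cc (cDt l1)))).
have cL j : cont_on B (L j) by exact: (contM cr (cdF _ _)).
have cSL : cont_on B (fun q => \sum_j L j q) by apply: cont_sum.
have sub (f : R * (R * 'rV[R]_k) -> R) : cont_on B f -> cont_on box f by move=> cf q /bB; exact: cf.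
have E : IO (fun x => \sum_i pd i (F i) x) = IJ (fun q => G' q + H' q + \sum_j L j q).
  rewrite IOE; apply: (pf_eq pf_IJ).
  - have cS : cont_on B (fun q => \sum_i pd i (F i) (polar q)).
      by apply: cont_sum => i; exact: cdF.
    exact: (sub _ (contM cr cS)).
  - exact: (sub _ (contD (contD cG' cH') cSL)).
  move=> q _; rewrite !big_ord_recl !mulrDr addrA mulr_sumr; congr (_ + _).
  rewrite /G' /H' /Dr /Dt -/F0 -/F1; have := cos2Dsin2 q.1.
  move: (cos q.1) (sin q.1) => c s cs1.
  (* The Cartesian and the polar expression agree only modulo cos^2 + sin^2 = 1, which is multiplied
     into the left side. *)
  rewrite -[LHS]mulr1 -cs1; ring.
rewrite E (pfD pf_IJ); [|exact: (sub _ (contD cG' cH'))|exact: (sub _ cSL)].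
rewrite (pfD pf_IJ); [|exact: (sub _ cG')|exact: (sub _ cH')].
have -> : IJ H' = 0.
  apply: (@IJ_th H H').
  - by move=> q q1 q2; apply: cH; split.
  - by move=> q q1 q2; apply: cH'; split.
  - move=> th r t r01 ct.
    have Vq : V (polar (th, (r, t))) by apply: VK; exact: polar_K0.
    exact: (is_derive_sincos (is_derive_polar_th (fC ord0) Vq)
      (is_derive_polar_th (fC (lift ord0 ord0)) Vq)).
  - move=> r t; rewrite /H /polar /=.
    by rewrite -[2 * pi]add0r mulr_natl cosD2pi sinD2pi.
rewrite (pf_sum pf_IJ) ?big1 ?addr0; last by move=> j; exact: (sub _ (cL j)).
  have dG (th r : R) (t : 'rV[R]_k) : th \in `[0, 2 * pi] -> 0 < r < 1 -> cube t ->
     is_derive r (1 : R) (fun r => G (th, (r, t))) (G' (th, (r, t))).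
    move=> th2 r01 ct.
    have Vq : V (polar (th, (r, t))).
      apply: VK; apply: polar_K0; last exact: ct.
      by move: (r01); rewrite /= in_itv /= => /andP[/ltW -> /ltW ->].
    exact: (is_derive_mulcomb (cos th) (sin th) (is_derive_polar_r (fC ord0) Vq)
      (is_derive_polar_r (fC (lift ord0 ord0)) Vq)).
  apply: etrans (IJ_r (sub _ cG) (sub _ cG') dG) _.
  rewrite IBE; apply: eq_Rintegral => th; rewrite inE /= => th2.
  rewrite (_ : (fun t => G (th, (0, t))) = fun=> 0); last first.
    by apply/funext => t; rewrite /G /= mul0r.
  rewrite (pf0 (@pf_torus R k)) subr0; congr torus_integral; apply/funext => t.
  by rewrite /G /= mul1r bd_inclE !rcons0.
move=> j _.
have key (th r : R) : th \in `[0, 2 * pi] -> r \in `[0, 1] ->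
    torus_integral (fun t => L j (th, (r, t))) = 0.
  move=> th2 r01; rewrite /L /=.
  have ct : cont_on (@cube R k) (fun t => pd (lift ord0 (lift ord0 j))
      (F (lift ord0 (lift ord0 j))) (polar (th, (r, t)))).
    move=> t ct.
    have c1 : {for t, continuous (fun t : 'rV[R]_k => (r, t))} by exact: pair_continuous.
    have c2 : {for (r, t), continuous (fun p : R * 'rV[R]_k => (th, p))} by exact: pair_continuous.
    have c3 := cdF (lift ord0 (lift ord0 j)) (lift ord0 (lift ord0 j)) (th, (r, t)) (conj r01 ct).
    exact: (continuous_comp (continuous_comp c1 c2) c3).
  rewrite (pfZ (@pf_torus R k) _ ct) (div_torus (fC _) th2 r01) ?mulr0 //.
  exact: per.
transitivity (\int[lebesgue_measure]_(th in `[0, 2 * pi]) (0 : R)); last first.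
  by rewrite Rintegral_cst // mul0r.
apply: eq_Rintegral => th; rewrite inE /= => th2.
transitivity (\int[lebesgue_measure]_(r in `[0, 1]) (0 : R)); last first.
  by rewrite Rintegral_cst // mul0r.
by apply: eq_Rintegral => r; rewrite inE /= => r01; exact: key.
Qed.

End Divergence.
End Polar.

(** * The Frobenius inner product of matrices *)

Section InnerProduct.
Variables (R : realType).

Definition ip p q (X Y : 'M[R]_(p, q)) : R := \tr (X^T *m Y).
Notation nsq X := (ip X X).

Section Fixed.
Variables (p q : nat).
Implicit Types (X Y Z : 'M[R]_(p, q)).

Lemma ipC X Y : ip X Y = ip Y X.
Proof. by rewrite /ip -mxtrace_tr trmx_mul trmxK. Qed.
Lemma ipDl X Y Z : ip (X + Y) Z = ip X Z + ip Y Z.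
Proof. by rewrite /ip raddfD /= mulmxDl raddfD. Qed.
Lemma ipDr X Y Z : ip Z (X + Y) = ip Z X + ip Z Y.
Proof. by rewrite ipC ipDl !(ipC Z). Qed.
Lemma ipNl X Y : ip (- X) Y = - ip X Y.
Proof. by rewrite /ip raddfN /= mulNmx raddfN. Qed.
Lemma ipNr X Y : ip X (- Y) = - ip X Y.
Proof. by rewrite ipC ipNl ipC. Qed.
Lemma ipBl X Y Z : ip (X - Y) Z = ip X Z - ip Y Z.
Proof. by rewrite ipDl ipNl. Qed.
Lemma ipBr X Y Z : ip Z (X - Y) = ip Z X - ip Z Y.
Proof. by rewrite ipDr ipNr. Qed.
Lemma ipZl a X Y : ip (a *: X) Y = a * ip X Y.
Proof. by rewrite /ip linearZ /= -scalemxAl linearZ. Qed.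
Lemma ipZr a X Y : ip X (a *: Y) = a * ip X Y.
Proof. by rewrite ipC ipZl ipC. Qed.
Lemma ip0l X : ip 0 X = 0.
Proof. by rewrite /ip trmx0 mul0mx raddf0. Qed.
Lemma ip0r X : ip X 0 = 0.
Proof. by rewrite ipC ip0l. Qed.
Lemma ip_suml (I : Type) (r : seq I) (F : I -> 'M[R]_(p, q)) Y :
  ip (\sum_(i <- r) F i) Y = \sum_(i <- r) ip (F i) Y.
Proof. by elim/big_rec2: _ => [|i y x _ <-]; [exact: ip0l|rewrite ipDl]. Qed.
Lemma ip_sumr (I : Type) (r : seq I) (F : I -> 'M[R]_(p, q)) Y :
  ip Y (\sum_(i <- r) F i) = \sum_(i <- r) ip Y (F i).
Proof. by rewrite ipC ip_suml; apply: eq_bigr => i _; rewrite ipC. Qed.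

Lemma ipE X Y : ip X Y = \sum_j \sum_i X i j * Y i j.
Proof.
by rewrite /ip /mxtrace; apply: eq_bigr => j _; rewrite mxE; apply: eq_bigr => i _; rewrite mxE.
Qed.

Lemma ip_ge0 X : 0 <= nsq X.
Proof. by rewrite ipE; do 2!apply: sumr_ge0 => ? _; rewrite -expr2 sqr_ge0. Qed.

Lemma ip_eq0 X : nsq X = 0 -> X = 0.
Proof.
rewrite ipE => H; apply/matrixP => i j; rewrite mxE.
have P a b : 0 <= X a b * X a b by rewrite -expr2 sqr_ge0.
have H1 : \sum_a X a j * X a j = 0.
  by apply: (psumr_eq0P _ H) => // b _; apply: sumr_ge0.
have H2 : X i j * X i j = 0 by apply: (psumr_eq0P _ H1).
by apply/eqP; rewrite -sqrf_eq0 expr2 H2.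
Qed.

Lemma ip_agm t X Y : 0 < t -> 2 * ip X Y <= t * nsq X + t^-1 * nsq Y.
Proof.
move=> t0; have := ip_ge0 (t *: X - Y); rewrite ipBl !ipBr !ipZl !ipZr (ipC Y X) => H.
have t1 : 0 < t^-1 by rewrite invr_gt0.
have := mulr_ge0 (ltW t1) H.
have -> : t^-1 * (t * (t * nsq X) - t * ip X Y - (t * ip X Y - nsq Y)) =
   (t^-1 * t) * (t * nsq X) - 2 * ((t^-1 * t) * ip X Y) + t^-1 * nsq Y by ring.
rewrite mulVf ?gt_eqF // !mul1r; lra.
Qed.

Lemma ip_norm2D X Y : nsq (X + Y) <= 2 * nsq X + 2 * nsq Y.
Proof.
have := ip_ge0 (X - Y); rewrite ipBl !ipBr ipDl !ipDr (ipC Y X); lra.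
Qed.

Lemma ip_CS X Y : ip X Y ^+ 2 <= nsq X * nsq Y.
Proof.
have [Y0|Y0] := eqVneq (nsq Y) 0.
  by rewrite (ip_eq0 Y0) !ip0r mulr0 expr0n.
have YP : 0 < nsq Y by rewrite lt_neqAle eq_sym Y0 ip_ge0.
have := ip_ge0 (nsq Y *: X - ip X Y *: Y); rewrite ipBl !ipBr !ipZl !ipZr (ipC Y X).
have -> : nsq Y * (nsq Y * nsq X) - nsq Y * (ip X Y * ip X Y) -
  (ip X Y * (nsq Y * ip X Y) - ip X Y * (ip X Y * nsq Y)) = nsq Y * (nsq X * nsq Y - ip X Y ^+ 2).
  by ring.
by rewrite pmulr_rge0 // subr_ge0.
Qed.
End Fixed.

Lemma ip_adjl p q r (A : 'M[R]_(p, q)) (X : 'M[R]_(q, r)) (Y : 'M[R]_(p, r)) :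
  ip (A *m X) Y = ip X (A^T *m Y).
Proof. by rewrite /ip trmx_mul mulmxA. Qed.

Lemma ip_adjr p q r (A : 'M[R]_(p, q)) (X : 'M[R]_(q, r)) (Y : 'M[R]_(p, r)) :
  ip Y (A *m X) = ip (A^T *m Y) X.
Proof. by rewrite ipC ip_adjl ipC. Qed.

(** Every entry of the product is an inner product of a row of A with a column of X, so
    Cauchy-Schwarz entrywise and summation give the bound. *)
Lemma ip_mul_le p q r (A : 'M[R]_(p, q)) (X : 'M[R]_(q, r)) : nsq (A *m X) <= nsq A * nsq X.
Proof.
have E p' q' (Z : 'M[R]_(p', q')) : nsq Z = \sum_i nsq (row i Z).
  rewrite ipE exchange_big; apply: eq_bigr => i _; rewrite ipE; apply: eq_bigr => j _.
  by rewrite big_ord1 !mxE.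
have E' p' q' (Z : 'M[R]_(p', q')) : nsq Z = \sum_j nsq ((col j Z)^T).
  rewrite ipE; apply: eq_bigr => j _; rewrite ipE; apply: eq_bigr => i _.
  by rewrite big_ord1 !mxE.
rewrite (E _ _ A) (E' _ _ X) mulr_suml ipE exchange_big /=.
apply: ler_sum => i _; rewrite mulr_sumr; apply: ler_sum => j _.
apply: le_trans (ip_CS (row i A) (col j X)^T); rewrite le_eqVlt expr2.
suff -> : (A *m X) i j = ip (row i A) (col j X)^T by rewrite eqxx.
rewrite mxE ipE; apply: eq_bigr => l _.
by rewrite big_ord1 !mxE.
Qed.

Lemma ip_mulr p q (X : 'M[R]_(p, q)) (I : 'M[R]_q) : I *m I^T = 1%:M -> nsq (X *m I) = nsq X.
Proof. by move=> II; rewrite /ip trmx_mul mxtrace_mulC mulmxA -[X *m I *m _]mulmxA II mulmx1 mxtrace_mulC. Qed.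

End InnerProduct.

Notation nsq X := (ip X X).

(** * Clifford algebra *)

Section Clifford.
Variable R : realType.

(* Spinors are N x N matrices, i.e. N-tuples of column spinors: Clifford elements
   act from the left, which leaves right multiplication for the Fourier modes. *)
Record clifford N n (c : 'I_n -> 'M[R]_N) (J : 'M[R]_N) : Prop := {
  cl_skew : forall a, (c a)^T = - c a;
  cl_anti : forall a b, c a *m c b = - (c b *m c a) - (2 * (a == b)%:R)%:M;
  J_sym : J^T = J;
  J_sq : J *m J = 1%:M;
  cl_J : forall a, c a *m J = - (J *m c a) }.

(** Each new generator doubles the dimension: the old ones become diag(c, -c), J becomes diag(J,
    -J), and the block rotation by a right angle anticommutes with all of these and squares to
    -1. *)
Lemma clifford_exists n : exists N (c : 'I_n -> 'M[R]_N) (J : 'M[R]_N),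
  (0 < N)%N /\ clifford c J.
Proof.
elim: n => [|n [N [c [J [N0 H]]]]].
  exists 1, (fun=> 0), 1%:M; split=> //; split=> [[]//|[]//||| []//].
    by rewrite trmx1.
  by rewrite mulmx1.
pose c' (a : 'I_n.+1) : 'M[R]_(N + N) :=
  if unlift ord0 a is Some b then block_mx (c b) 0 0 (- c b) else block_mx 0 (- 1%:M) 1%:M 0.
exists (N + N)%N, c', (block_mx J 0 0 (- J)).
split; first by rewrite addn_gt0 N0.
have z : (0 : 'M[R]_N) = - 0 by rewrite oppr0.
split=> [a|a b|||a].
- rewrite /c'; case: unliftP => [b _|_]; rewrite tr_block_mx ?trmx0 ?opp_block_mx ?raddfN /= ?(cl_skew H) ?trmx1 ?opprK ?oppr0 //.
- rewrite /c'; case: (unliftP ord0 a) => [a' ->|->]; case: (unliftP ord0 b) => [b' ->|->];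
   rewrite !mulmx_block !opp_block_mx ?mulmx0 ?mul0mx ?mulmx1 ?mul1mx ?mulmxN ?mulNmx ?addr0 ?add0r ?opprK ?oppr0.
  + rewrite (inj_eq lift_inj) scalar_mx_block opp_block_mx add_block_mx !oppr0 !addr0.
    by rewrite -(cl_anti H).
  + by rewrite ?mulmx1 ?mul1mx ?opprK ?oppr0 [lift _ _ == _]eq_sym (negPf (neq_lift _ _)) mulr0 raddf0 subr0.
  + by rewrite ?mulmx1 ?mul1mx ?opprK ?oppr0 (negPf (neq_lift _ _)) mulr0 raddf0 subr0.
  + rewrite eqxx mulr1 scalar_mx_block opp_block_mx add_block_mx !oppr0 !addr0.
    have -> : 1%:M - 2%:M = - 1%:M :> 'M[R]_N by rewrite -raddfB -raddfN /=; congr (_%:M); ring.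
    by [].
- by rewrite tr_block_mx !trmx0 raddfN /= (J_sym H).
- by rewrite mulmx_block !mulmx0 !mul0mx !addr0 !add0r mulmxN mulNmx opprK (J_sq H) -scalar_mx_block.
- rewrite /c'; case: unliftP => [b _|_]; rewrite !mulmx_block ?mulmx0 ?mul0mx ?mulmx1 ?mul1mx ?mulmxN ?mulNmx ?addr0 ?add0r ?opprK ?opp_block_mx ?oppr0 ?(cl_J H) ?opprK ?mulmx1 ?mul1mx //.
Qed.

Section Algebra.
Variables (N n : nat) (c : 'I_n -> 'M[R]_N) (J : 'M[R]_N).
Hypothesis H : clifford c J.

Definition cl (v : 'rV[R]_n) : 'M[R]_N := \sum_a v 0 a *: c a.
(** On skew A this is the spin representation of so(n). The factor 1/4 is the one for which
    commutators with vectors and among such elements carry coefficient 1. *)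
Definition cl2 (A : 'M[R]_n) : 'M[R]_N := 4^-1 *: \sum_a \sum_b A a b *: (c a *m c b).

Lemma clD u v : cl (u + v) = cl u + cl v.
Proof. by rewrite /cl -big_split; apply: eq_bigr => a _; rewrite mxE scalerDl. Qed.
Lemma clZ k u : cl (k *: u) = k *: cl u.
Proof. by rewrite /cl scaler_sumr; apply: eq_bigr => a _; rewrite mxE scalerA. Qed.
Lemma clN u : cl (- u) = - cl u.
Proof. by rewrite -scaleN1r clZ scaleN1r. Qed.
Lemma clB u v : cl (u - v) = cl u - cl v.
Proof. by rewrite clD clN. Qed.
Lemma cl0 : cl 0 = 0.
Proof. by rewrite -(scale0r 0) clZ scale0r. Qed.
Lemma cl_sum (I : Type) (r : seq I) (F : I -> 'rV[R]_n) :
  cl (\sum_(i <- r) F i) = \sum_(i <- r) cl (F i).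
Proof. by elim/big_rec2: _ => [|i y x _ <-]; [exact: cl0|rewrite clD]. Qed.
Lemma cl_e a : cl 'e_a = c a.
Proof.
rewrite /cl (bigD1 a) //= mxE !eqxx scale1r big1 ?addr0 // => b ba.
by rewrite mxE eqxx (negPf ba) scale0r.
Qed.
Lemma clT u : (cl u)^T = - cl u.
Proof.
rewrite /cl raddf_sum /= -sumrN; apply: eq_bigr => a _.
by rewrite linearZ /= (cl_skew H) scalerN.
Qed.
Lemma clJ u : cl u *m J = - (J *m cl u).
Proof.
rewrite /cl mulmx_suml mulmx_sumr -sumrN; apply: eq_bigr => a _.
by rewrite -scalemxAl -scalemxAr (cl_J H) scalerN.
Qed.
Lemma cl_mul u v : cl u *m cl v = - (cl v *m cl u) - (2 * (u *m v^T) 0 0)%:M.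
Proof.
have E (x y : 'rV[R]_n) : cl x *m cl y = \sum_a \sum_b (x 0 a * y 0 b) *: (c a *m c b).
  rewrite mulmx_suml; apply: eq_bigr => a _; rewrite mulmx_sumr; apply: eq_bigr => b _.
  by rewrite -scalemxAl -scalemxAr scalerA.
rewrite (E u v) (E v u) exchange_big /= -sumrN.
have -> : (2 * (u *m v^T) 0 0)%:M = \sum_a \sum_b (u 0 b * v 0 a) *: (2 * (b == a)%:R)%:M :> 'M[R]_N.
  rewrite mxE mulr_sumr raddf_sum /=; apply: eq_bigr => a _; rewrite (bigD1 a) //= eqxx mulr1.
  rewrite big1 => [|b ba]; last by rewrite (negPf ba) mulr0 raddf0 scaler0.
  by rewrite addr0 !mxE -mul_scalar_mx -scalar_mxM mulrC.
rewrite -sumrB; apply: eq_bigr => a _; rewrite -sumrN -sumrB; apply: eq_bigr => b _.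
by rewrite (cl_anti H b a) scalerBr scalerN [v 0 a * _]mulrC.
Qed.
Lemma cl_sq u : cl u *m cl u = (- (u *m u^T) 0 0)%:M.
Proof.
have E := cl_mul u u.
have : 2 *: (cl u *m cl u) = 2 *: (- (u *m u^T) 0 0)%:M.
  rewrite scaler_nat mulr2n {2}E addrA subrr sub0r.
  by rewrite -raddfN /= -mul_scalar_mx -scalar_mxM mulrN.
by move/(congr1 (fun X => 2^-1 *: X)); rewrite !scalerA mulVf ?pnatr_eq0 // !scale1r.
Qed.

Lemma cl2D A B : cl2 (A + B) = cl2 A + cl2 B.
Proof.
rewrite /cl2 -scalerDr -big_split; congr (_ *: _); apply: eq_bigr => a _ /=.
by rewrite -big_split; apply: eq_bigr => b _; rewrite mxE scalerDl.
Qed.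
Lemma cl2Z k A : cl2 (k *: A) = k *: cl2 A.
Proof.
rewrite /cl2 [RHS]scalerA [k * _]mulrC -[RHS]scalerA; congr (_ *: _).
rewrite scaler_sumr; apply: eq_bigr => a _ /=.
by rewrite scaler_sumr; apply: eq_bigr => b _; rewrite mxE scalerA.
Qed.
Lemma cl2N A : cl2 (- A) = - cl2 A.
Proof. by rewrite -scaleN1r cl2Z scaleN1r. Qed.
Lemma cl2B A B : cl2 (A - B) = cl2 A - cl2 B.
Proof. by rewrite cl2D cl2N. Qed.

Lemma cl2T A : A^T = - A -> (cl2 A)^T = - cl2 A.
Proof.
move=> sA; rewrite /cl2 linearZ /= -scalerN; congr (_ *: _).
rewrite [in LHS]exchange_big /= raddf_sum -sumrN; apply: eq_bigr => a _ /=.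
rewrite raddf_sum -sumrN; apply: eq_bigr => b _ /=.
rewrite linearZ /= trmx_mul !(cl_skew H) mulmxN mulNmx opprK -scaleNr; congr (_ *: _).
by have /matrixP /(_ a b) := sA; rewrite !mxE.
Qed.
Lemma cl2J A : cl2 A *m J = J *m cl2 A.
Proof.
rewrite /cl2 -scalemxAl -scalemxAr; congr (_ *: _).
rewrite mulmx_suml mulmx_sumr; apply: eq_bigr => a _; rewrite mulmx_suml mulmx_sumr.
apply: eq_bigr => b _; rewrite -scalemxAl -scalemxAr; congr (_ *: _).
by rewrite -mulmxA (cl_J H) mulmxN mulmxA (cl_J H) mulNmx opprK mulmxA.
Qed.

Lemma comm_cc a b d : c a *m c b *m c d - c d *m (c a *m c b) =
  (2 * (a == d)%:R) *: c b - (2 * (b == d)%:R) *: c a.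
Proof.
have -> : c a *m c b *m c d = c a *m (- (c d *m c b) - (2 * (b == d)%:R)%:M).
  by rewrite -mulmxA (cl_anti H b d).
have -> : c d *m (c a *m c b) = (- (c a *m c d) - (2 * (a == d)%:R)%:M) *m c b.
  by rewrite mulmxA (cl_anti H d a) [d == a]eq_sym.
rewrite mulmxBr mulmxBl mulmxN mulNmx -mulmxA mul_scalar_mx mul_mx_scalar.
by rewrite opprD !opprK addrACA addNr add0r addrC.
Qed.

Lemma cl2_comm A v : A^T = - A -> cl2 A *m cl v - cl v *m cl2 A = cl (v *m A).
Proof.
move=> sA.
have K d : cl2 A *m c d - c d *m cl2 A = cl (row d A).
  rewrite /cl2 -scalemxAl -scalemxAr -scalerBr mulmx_suml mulmx_sumr -sumrB.
  have -> : \sum_a ((\sum_b A a b *: (c a *m c b)) *m c d - c d *m (\sum_b A a b *: (c a *m c b)))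
     = \sum_a \sum_b (A a b * (2 * (a == d)%:R)) *: c b - \sum_a \sum_b (A a b * (2 * (b == d)%:R)) *: c a.
    rewrite -sumrB; apply: eq_bigr => a _; rewrite mulmx_suml mulmx_sumr -!sumrB.
    apply: eq_bigr => b _; rewrite -scalemxAl -scalemxAr -scalerBr comm_cc.
    by rewrite scalerBr !scalerA.
  have -> : \sum_a \sum_b (A a b * (2 * (a == d)%:R)) *: c b = \sum_b (2 * A d b) *: c b.
    rewrite (bigD1 d) //= [X in _ + X]big1 ?addr0 => [|a ad].
      by apply: eq_bigr => b _; rewrite eqxx mulr1 mulrC.
    by apply: big1 => b _; rewrite (negPf ad) !mulr0 scale0r.
  have -> : \sum_a \sum_b (A a b * (2 * (b == d)%:R)) *: c a = \sum_a (- (2 * A d a)) *: c a.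
    apply: eq_bigr => a _; rewrite (bigD1 d) //= [X in _ + X]big1 ?addr0 => [|b bd]; last first.
      by rewrite (negPf bd) !mulr0 scale0r.
    rewrite eqxx mulr1 mulrC -mulrN; congr ((_ * _) *: _).
    by have /matrixP /(_ d a) := sA; rewrite !mxE.
  rewrite -sumrB scaler_sumr; apply: eq_bigr => b _.
  rewrite -scalerBl scalerA mxE; congr (_ *: _).
  by field.
have -> : v *m A = \sum_d v 0 d *: row d A by rewrite [LHS]mulmx_sum_row.
rewrite cl_sum {1 2}/cl mulmx_suml mulmx_sumr -sumrB; apply: eq_bigr => d _.
by rewrite clZ -K scalerBr -scalemxAl -scalemxAr.
Qed.

Lemma cl2_commc A a : A^T = - A -> cl2 A *m c a - c a *m cl2 A = cl (row a A).
Proof. by move=> sA; rewrite -cl_e (cl2_comm _ sA) -rowE. Qed.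

(** The bracket on the right is reversed because skew matrices act on row vectors from the right,
    which is an antihomomorphism. The commutator with [cl2 A] is a derivation, so it can be
    distributed over the factors of c a c b. *)
Lemma cl2_lie A B : A^T = - A -> B^T = - B ->
  cl2 A *m cl2 B - cl2 B *m cl2 A = cl2 (B *m A - A *m B).
Proof.
move=> sA sB.
have L a b : cl2 A *m (c a *m c b) - (c a *m c b) *m cl2 A = cl (row a A) *m c b + c a *m cl (row b A).
  have := cl2_commc a sA; have := cl2_commc b sA => <- <-.
  by rewrite mulmxBl mulmxBr !mulmxA addrA subrK.
move: (cl2 A) L => X L; rewrite /cl2 -scalemxAr -scalemxAl -scalerBr.
rewrite mulmx_suml mulmx_sumr -sumrB.
rewrite (eq_bigr (fun a => \sum_b B a b *: (cl (row a A) *m c b + c a *m cl (row b A)))); last first.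
  move=> a _; rewrite mulmx_suml mulmx_sumr -sumrB; apply: eq_bigr => b _.
  by rewrite -scalemxAl -scalemxAr -scalerBr L.
congr (_ *: _).
have -> : \sum_a \sum_b (B *m A - A *m B) a b *: (c a *m c b) =
  \sum_a \sum_b (B *m A) a b *: (c a *m c b) + - \sum_a \sum_b (A *m B) a b *: (c a *m c b).
  rewrite -sumrB; apply: eq_bigr => a _; rewrite -sumrB; apply: eq_bigr => b _.
  by rewrite -scalerBl; congr (_ *: _); rewrite mxE [X in _ + X]mxE.
have -> : \sum_a \sum_b B a b *: (cl (row a A) *m c b + c a *m cl (row b A)) =
  \sum_a \sum_b B a b *: (c a *m cl (row b A)) + \sum_a \sum_b B a b *: (cl (row a A) *m c b).
  rewrite -big_split; apply: eq_bigr => a _; rewrite -big_split; apply: eq_bigr => b _.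
  by rewrite /= -scalerDr addrC.
congr (_ + _).
  apply: eq_bigr => a _.
  rewrite (eq_bigr (fun b => \sum_d (B a b * A b d) *: (c a *m c d))); last first.
    move=> b _; rewrite /cl mulmx_sumr scaler_sumr; apply: eq_bigr => d _.
    by rewrite -scalemxAr scalerA mxE.
  rewrite exchange_big /=; apply: eq_bigr => d _.
  by rewrite -scaler_suml mxE.
rewrite -sumrN (eq_bigr (fun a => \sum_d \sum_b (B a b * A a d) *: (c d *m c b))); last first.
  move=> a _; rewrite exchange_big /=; apply: eq_bigr => b _.
  rewrite /cl mulmx_suml scaler_sumr; apply: eq_bigr => d _.
  by rewrite -scalemxAl scalerA mxE.
rewrite exchange_big /=; apply: eq_bigr => d _; rewrite exchange_big /= -sumrN.
apply: eq_bigr => b _; rewrite -scaler_suml -scaleNr; congr (_ *: _).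
rewrite mxE -sumrN; apply: eq_bigr => a _.
have /matrixP /(_ d a) := sA; rewrite !mxE => ->; ring.
Qed.

(* The algebraic identity behind Lichnerowicz' formula: the first Bianchi
   identity kills the degree-4 and degree-2 parts of the Clifford product. *)
Lemma clifford_bianchi (W : 'I_n -> 'I_n -> 'I_n -> 'I_n -> R) :
  (forall a b x d, W b a x d = - W a b x d) -> (forall a b x d, W a b d x = - W a b x d) ->
  (forall a b x d, W a b x d + W x b d a + W d b a x = 0) ->
  \sum_a \sum_b \sum_x \sum_d W a b x d *: (c x *m c d *m (c a *m c b)) =
  (2 * \sum_a \sum_b W a b b a)%:M.
Proof.
move=> s1 s2 bi.
pose T b := \sum_a \sum_x \sum_d W a b x d *: (c x *m c d *m c a).
pose S b d := \sum_a W a b a d.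
(* Symmetry of the Ricci contraction: it is an instance of the pair symmetry of curvature tensors, a
   linear consequence of both skew symmetries and the Bianchi identity. *)
have Ssym b d : S b d = S d b.
  rewrite /S; apply: eq_bigr => a _; have E1 := bi a b a d; have E2 := bi a d a b.
  have p1 := s2 d b a a; have p2 := s2 b d a a; have p3 := s2 a b a d; have p4 := s2 a d a b.
  have p5 := s1 a b a d; have p6 := s1 a d a b.
  have E3 := bi b a d a; have E4 := bi d a b a; have p7 := s1 d b a a; have p8 := s2 d b a a.
  have p9 := s1 b a d a; have p10 := s1 d a b a; have p11 := s2 b a a d; have p12 := s2 d a a b.
  have p13 := s1 a b d a; have p14 := s1 a d b a; have p15 := s1 a b b a.
  have q1 := s1 b a a d; have q2 := s1 d a a b; have q3 := s1 a a d b; have q4 := s1 a a b d.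
  have q5 := s2 a a b d.
  lra.
have TE b : T b = \sum_d (2 * S b d) *: c d.
  have r1 a x d : c d *m c a *m c x = c x *m c d *m c a - (2 * (a == x)%:R) *: c d + (2 * (x == d)%:R) *: c a.
    have := comm_cc d a x; rewrite [d == x]eq_sym => /eqP; rewrite subr_eq => /eqP ->.
    by rewrite mulmxA addrC addrA addrAC.
  have r2 a x d : c a *m c x *m c d = c x *m c d *m c a - (2 * (a == x)%:R) *: c d + (2 * (a == d)%:R) *: c x.
    have /eqP := comm_cc x d a; rewrite subr_eq => /eqP ->; rewrite -!mulmxA.
    rewrite [x == a]eq_sym [d == a]eq_sym.
    move: (c a *m _) (_ *: c d) (_ *: c x) => P Q U.
    by apply/matrixP => i j; rewrite !mxE; ring.
  have rot (f : 'I_n -> 'I_n -> 'I_n -> 'M[R]_N) :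
      \sum_a \sum_x \sum_d f a x d = \sum_a \sum_x \sum_d f x d a.
    by rewrite [RHS]exchange_big /=; apply: eq_bigr => a _; rewrite [RHS]exchange_big.
  pose G d := c d; pose X := \sum_d S b d *: c d.
  have tri (f g h : 'I_n -> 'I_n -> 'I_n -> 'M[R]_N) :
      \sum_a \sum_x \sum_d (f a x d + g a x d + h a x d) =
      \sum_a \sum_x \sum_d f a x d + \sum_a \sum_x \sum_d g a x d + \sum_a \sum_x \sum_d h a x d.
    rewrite -!big_split; apply: eq_bigr => a _; rewrite -!big_split; apply: eq_bigr => x _.
    by rewrite -!big_split.
  have e1 : T b = \sum_a \sum_x \sum_d W x b d a *: (c d *m c a *m c x) by rewrite /T rot.
  have e2 : T b = \sum_a \sum_x \sum_d W d b a x *: (c a *m c x *m c d) by rewrite e1 rot.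
  have dl (f : 'I_n -> 'M[R]_N) a : \sum_x (2 * (a == x)%:R) *: f x = 2 *: f a.
    rewrite (bigD1 a) //= eqxx mulr1 [X in _ + X]big1 ?addr0 // => x xa.
    by rewrite eq_sym (negPf xa) mulr0 scale0r.
  (* The three cyclic rotations of [T b] are added. After normal ordering, the Bianchi identity
     cancels the cubic terms and only the contractions created by the anticommutators remain. *)
  have e3 : \sum_a \sum_x \sum_d (W a b x d *: (c x *m c d *m c a) +
      W x b d a *: (c d *m c a *m c x) + W d b a x *: (c a *m c x *m c d)) = 6 *: X.
    pose f1 a x d : 'M[R]_N := (2 * (a == x)%:R) *: (- (W x b d a) *: c d).
    pose f2 a x d : 'M[R]_N := (2 * (x == d)%:R) *: (W x b d a *: c a).
    pose f3 a x d : 'M[R]_N := (2 * (a == x)%:R) *: (- (W d b a x) *: c d).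
    pose f4 a x d : 'M[R]_N := (2 * (a == d)%:R) *: (W d b a x *: c x).
    have -> : \sum_a \sum_x \sum_d (W a b x d *: (c x *m c d *m c a) +
      W x b d a *: (c d *m c a *m c x) + W d b a x *: (c a *m c x *m c d)) =
      \sum_a \sum_x \sum_d (f1 a x d + f2 a x d + (f3 a x d + f4 a x d)).
      apply: eq_bigr => a _; apply: eq_bigr => x _; apply: eq_bigr => d _.
      rewrite (r1 a x d) (r2 a x d) /f1 /f2 /f3 /f4; have := bi a b x d.
      move: (c x *m c d *m c a) => P; move: (W a b x d) (W x b d a) (W d b a x) => w1 w2 w3 w0.
      have -> : w1 = - w2 - w3 by lra.
      clear.
      by apply/matrixP => i j; rewrite !mxE; ring.
    rewrite tri.
    have -> : \sum_a \sum_x \sum_d f1 a x d = 2 *: X.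
      rewrite /f1; under eq_bigr do rewrite exchange_big /=.
      under eq_bigr do under eq_bigr do rewrite dl.
      rewrite exchange_big /= /X scaler_sumr; apply: eq_bigr => d _.
      rewrite -scaler_sumr; congr (_ *: _); rewrite /S scaler_suml; apply: eq_bigr => a _.
      by rewrite s2 opprK.
    have -> : \sum_a \sum_x \sum_d f2 a x d = 2 *: X.
      rewrite /f2; under eq_bigr do under eq_bigr do rewrite dl.
      rewrite /X scaler_sumr; apply: eq_bigr => d _.
      by rewrite -scaler_sumr -scaler_suml.
    have -> : \sum_a \sum_x \sum_d (f3 a x d + f4 a x d) = 2 *: X.
      have -> : \sum_a \sum_x \sum_d (f3 a x d + f4 a x d) =
         \sum_a \sum_x \sum_d (f3 a x d + f4 a x d + 0).
        by apply: eq_bigr => a _; apply: eq_bigr => x _; apply: eq_bigr => d _; rewrite addr0.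
      rewrite tri.
      have -> : \sum_(a < n) \sum_(x < n) \sum_(d < n) (0 : 'M[R]_N) = 0.
        by apply: big1 => a _; apply: big1 => x _; apply: big1.
      have -> : \sum_a \sum_x \sum_d f3 a x d = 0.
        rewrite /f3; apply: big1 => a _; rewrite exchange_big /=; apply: big1 => d _; rewrite dl.
        have H0 : W d b a a = 0 by have := s2 d b a a; lra.
        by rewrite H0 oppr0 scale0r scaler0.
      rewrite add0r addr0 /f4; under eq_bigr do under eq_bigr do rewrite dl.
      rewrite exchange_big /= /X scaler_sumr; apply: eq_bigr => d _.
      by rewrite -scaler_sumr -scaler_suml.
    by rewrite -!scalerDl; congr (_ *: _); ring.
  have e4 : 3 *: T b = 6 *: X.
    rewrite -e3 tri -/(T b) -e1 -e2 -[X in X + _ + _]scale1r -[X in _ + X + _]scale1r -[X in _ + X]scale1r.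
    by rewrite -!scalerDl; congr (_ *: _); ring.
  have : 3^-1 *: (3 *: T b) = 3^-1 *: (6 *: X) by rewrite e4.
  rewrite !scalerA mulVf ?pnatr_eq0 // scale1r => ->; rewrite /X scaler_sumr.
  by apply: eq_bigr => d _; rewrite scalerA; congr (_ *: _); field.
have -> : \sum_a \sum_b \sum_x \sum_d W a b x d *: (c x *m c d *m (c a *m c b)) =
    \sum_b T b *m c b.
  rewrite exchange_big /=; apply: eq_bigr => b _; rewrite /T mulmx_suml; apply: eq_bigr => a _.
  rewrite mulmx_suml; apply: eq_bigr => x _; rewrite mulmx_suml; apply: eq_bigr => d _.
  by rewrite -scalemxAl !mulmxA.
pose Z := \sum_b T b *m c b.
have Z1 : Z = \sum_b \sum_d (2 * S b d) *: (c d *m c b).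
  by apply: eq_bigr => b _; rewrite TE mulmx_suml; apply: eq_bigr => d _; rewrite -scalemxAl.
have Z2 : Z = \sum_b \sum_d (2 * S b d) *: (c b *m c d).
  rewrite Z1 exchange_big /=; apply: eq_bigr => b _; apply: eq_bigr => d _; by rewrite Ssym.
have Z3 : Z + Z = (4 * \sum_a \sum_b W a b b a)%:M.
  rewrite {1}Z1 Z2 -big_split /=.
  have -> : (4 * \sum_a \sum_b W a b b a)%:M = \sum_b (4 * \sum_a W a b b a)%:M :> 'M[R]_N.
    by rewrite exchange_big /= mulr_sumr raddf_sum.
  apply: eq_bigr => b _; rewrite -big_split /= (bigD1 b) //= [X in _ + X]big1 ?addr0 => [|d db].
    have q : c b *m c b + c b *m c b = (- 2)%:M.
      by rewrite {1}(cl_anti H b b) eqxx mulr1 addrC addrA addrN sub0r raddfN.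
    rewrite -scalerDr q scale_scalar_mx; congr (_%:M);
    rewrite (eq_bigr (fun a => - W a b a b)) => [|a _]; last by rewrite s2.
    by rewrite sumrN /S; ring.
  by rewrite -scalerDr (cl_anti H d b) (negPf db) mulr0 raddf0 subr0 addNr scaler0.
rewrite -/Z; have : 2^-1 *: (Z + Z) = 2^-1 *: (4 * \sum_a \sum_b W a b b a)%:M by rewrite Z3.
have -> : 2^-1 *: (Z + Z) = Z by move: (Z) => z; apply/matrixP => i j; rewrite !mxE; field.
rewrite scale_scalar_mx => ->.
by congr (_%:M); field.
Qed.

End Algebra.
End Clifford.

From mathcomp Require Import perm.

(** * Derivatives of determinants and inverse matrices *)

Section DetCalculus.
Variables (R : realType) (m : nat) (V : set 'rV[R]_m) (oV : open V).

Lemma Ck_prod k (I : Type) (r : seq I) (F : I -> 'rV[R]_m -> R) :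
  (forall j, Ck k V (F j)) -> Ck k V (fun y => \prod_(j <- r) F j y).
Proof.
move=> FC; elim: r => [|j r IH].
  by apply: (Ck_congr oV _ (Ck_cst V k 1)) => y _; rewrite big_nil.
by apply: (Ck_congr oV _ (CkM oV (FC j) IH)) => y _; rewrite big_cons.
Qed.

Lemma partial_prod (I : eqType) (r : seq I) (F : I -> 'rV[R]_m -> R) x i :
  uniq r -> V x -> (forall j, Ck 1 V (F j)) ->
  pd i (fun y => \prod_(j <- r) F j y) x =
  \sum_(j <- r) pd i (F j) x * \prod_(l <- r | l != j) F l x.
Proof.
move=> ur Vx FC; elim: r ur => [_|j r IH /= /andP[jr ur]].
  rewrite big_nil (partial_congr (g := fun=> 1) oV) //; last by move=> y _; rewrite big_nil.
  by apply: pd_val; apply: is_derive_cst.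
rewrite (partial_congr (g := fun y => F j y * \prod_(l <- r) F l y) oV) //; last first.
  by move=> y _; rewrite big_cons.
rewrite partialM; last 2 first.
- exact: Ck_derivable (FC j) Vx.
- by apply: (Ck_derivable (k := 0)) Vx; apply: Ck_prod.
rewrite IH // !big_cons eqxx /=; congr (_ * _ + _).
  rewrite [RHS]big_mkcond /= big_seq [RHS]big_seq; apply: eq_bigr => l lr.
  by case: eqVneq => // e; rewrite e (negPf jr) in lr.
rewrite mulr_sumr [LHS]big_seq [RHS]big_seq; apply: eq_bigr => l lr.
rewrite big_cons; case: eqVneq => [e|_]; first by rewrite -e (negPf jr) in lr.
by rewrite mulrCA.
Qed.

Lemma Ck_det k p (A : 'rV[R]_m -> 'M[R]_p) : mCk V k A -> Ck k V (fun x => \det (A x)).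
Proof.
move=> AC; rewrite /determinant; apply: Ck_sum => // s; apply: CkM => //; first exact: Ck_cst.
by apply: Ck_prod => j; apply: AC.
Qed.

Lemma mCk_adj k p (A : 'rV[R]_m -> 'M[R]_p) : mCk V k A -> mCk V k (fun x => \adj (A x)).
Proof.
move=> AC a b.
apply: (Ck_congr (f := fun x => (-1) ^+ (b + a) * \det (row' b (col' a (A x)))) oV).
  by move=> y _; rewrite mxE.
apply: CkM => //; first exact: Ck_cst.
apply: Ck_det => c d; apply: (Ck_congr _ _ (AC (lift b c) (lift a d))) => // y _.
by rewrite !mxE.
Qed.

Lemma mCk_invmx k p (A : 'rV[R]_m -> 'M[R]_p) : (forall x, V x -> \det (A x) != 0) ->
  mCk V k A -> mCk V k (fun x => invmx (A x)).
Proof.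
move=> dA AC.
apply: (mCk_congr (A := fun x => (\det (A x))^-1 *: \adj (A x)) oV).
  by move=> x Vx; rewrite /invmx unitmxE unitfE dA.
by apply: mCkZ => //; [apply: Ck_inv => //; exact: Ck_det|exact: mCk_adj].
Qed.

(** Jacobi's formula. The product rule differentiates one row at a time, and the determinant with
    row a replaced by its derivative, expanded along that row, is the a-th diagonal entry of A' adj
    A. *)
Lemma partial_det p i (A : 'rV[R]_m -> 'M[R]_p) x : V x -> mCk V 1 A ->
  pd i (fun y => \det (A y)) x = \tr (\adj (A x) *m mpd i A x).
Proof.
move=> Vx AC.
have dd (f : 'rV[R]_m -> R) : Ck 1 V f -> derivable f x 'e_i.
  by move=> fC; apply: Ck_derivable fC Vx.
have prodC (s : {perm 'I_p}) : Ck 1 V (fun y => \prod_j A y j (s j)) by apply: Ck_prod => j; apply: AC.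
have -> : pd i (fun y => \det (A y)) x =
   \sum_(s : {perm 'I_p}) (-1) ^+ s * pd i (fun y => \prod_j A y j (s j)) x.
  rewrite /determinant (proj2 (partial_sum _ _)); last first.
    by move=> s; apply: dd; apply: CkM => //; exact: Ck_cst.
  apply: eq_bigr => s _; rewrite partialM ?(pd_val (d := 0)) ?mul0r ?add0r //.
  exact: dd.
rewrite mxtrace_mulC.
pose B a : 'M[R]_p := \matrix_(b, c) if b == a then mpd i A x a c else A x b c.
have -> : \tr (mpd i A x *m \adj (A x)) = \sum_a \det (B a).
  apply: eq_bigr => a _; rewrite mxE (expand_det_row (B a) a); apply: eq_bigr => c _.
  rewrite !mxE eqxx mpdE; congr (_ * _); rewrite /cofactor; congr (_ * \det _).
  by apply/matrixP => u v; rewrite !mxE eq_sym (negPf (neq_lift _ _)).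
rewrite exchange_big /=; apply: eq_bigr => s _; rewrite -mulr_sumr; congr (_ * _).
rewrite partial_prod ?index_enum_uniq //.
apply: eq_bigr => a _; rewrite [RHS](bigD1 a) //= mxE eqxx mpdE; congr (_ * _).
by apply: eq_bigr => b ba; rewrite mxE (negPf ba).
Qed.

End DetCalculus.

(** * Passage from the interior to the boundary, and periodicity *)

Section SolidTorusCalculus.
Variables (R : realType) (k : nat).
Local Notation n := k.+2.
Local Notation Om := (@solid_torus R k).

Definition inner_torus : set 'rV[R]_n := [set x | x 0 0 ^+ 2 + x 0 1 ^+ 2 < 1].
Local Notation U := inner_torus.

Lemma inner_sub : U `<=` Om.
Proof. by move=> x /ltW. Qed.

Let rad (x : 'rV[R]_n) : R := x 0 0 ^+ 2 + x 0 1 ^+ 2.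
Let rad_cont : continuous rad.
Proof.
have C : Ck 0 setT rad.
  by apply: (CkD openT (k := 0)); apply: (CkM openT (k := 0)); exact: Ck_coord.
by move=> x; exact: (C x Logic.I).
Qed.

Lemma inner_open : open U.
Proof. by apply: (@open_comp _ _ rad [set y | y < 1]) => [x _|]; [exact: rad_cont|exact: open_lt]. Qed.

(** Differentiating a hypothesis requires it on an open set, whereas the geometric hypotheses hold
    on the closed solid torus. Their consequences are therefore derived in the interior and carried
    to the boundary by this lemma and its corollaries. *)
Lemma Om_closure (f : 'rV[R]_n -> R) : (forall x, Om x -> {for x, continuous f}) ->
  (forall x, U x -> 0 <= f x) -> forall x, Om x -> 0 <= f x.
Proof.
move=> cf H x Ox; rewrite leNgt; apply/negP => fx.
(* The direction v points to the core of the solid torus: moving by h v multiplies the disk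
   coordinates by 1 - h, which enters the interior for 0 < h < 1. *)
pose v : 'rV[R]_n := - (x 0 0 *: 'e_0 + x 0 1 *: 'e_1).
have e0 : 0 < - f x / 2 by lra.
pose g (h : R) := f (h *: v + x).
have cg : {for 0, continuous g}.
  have c1 : {for (0 : R), continuous (fun h : R => h *: v + x)}.
    by apply: continuousD; [exact: scalel_continuous|exact: cst_continuous].
  by apply: (continuous_comp c1); rewrite scale0r add0r; apply: cf.
have := cont_near cg e0; rewrite /g scale0r add0r => near0.
have [h /andP[h0 h1] gh] : exists2 h : R, 0 < h < 1 & `|f (h *: v + x) - f x| <= - f x / 2.
  have /nbhs_ballP[d /= d0 dP] := near0.
  have m0 : 0 < Order.min (d / 2) 2^-1 by rewrite lt_min !divr_gt0 //= invr_gt0.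
  have m1 : Order.min (d / 2) 2^-1 <= d / 2 by rewrite ge_min lexx.
  have m2 : Order.min (d / 2) 2^-1 <= (2^-1 : R) by rewrite ge_min lexx orbT.
  exists (Order.min (d / 2) 2^-1); first by rewrite m0; lra.
  by apply: dP; rewrite /ball /= sub0r normrN gtr0_norm //; lra.
have vE (a : 'I_n) : v 0 a = - (x 0 0 * (a == 0)%:R + x 0 1 * (a == 1)%:R).
  by rewrite /v !mxE.
have : U (h *: v + x).
  rewrite /U /= [(h *: v + x) 0 0]mxE [(h *: v) 0 0]mxE [(h *: v + x) 0 1]mxE [(h *: v) 0 1]mxE !vE /=.
  have := Ox; rewrite /solid_torus /=.
  have -> : h * - (x 0 0 * 1 + x 0 1 * 0) + x 0 0 = (1 - h) * x 0 0 by ring.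
  have -> : h * - (x 0 0 * 0 + x 0 1 * 1) + x 0 1 = (1 - h) * x 0 1 by ring.
  move=> r1; have -> : ((1 - h) * x 0 0) ^+ 2 + ((1 - h) * x 0 1) ^+ 2 =
     (1 - h) ^+ 2 * (x 0 0 ^+ 2 + x 0 1 ^+ 2) by ring.
  apply: (@le_lt_trans _ _ ((1 - h) ^+ 2)); last by nra.
  by rewrite ler_piMr // sqr_ge0.
move/H; move: gh; rewrite ler_norml => /andP[_]; lra.
Qed.

Lemma Om_eq (f g : 'rV[R]_n -> R) : (forall x, Om x -> {for x, continuous f}) ->
  (forall x, Om x -> {for x, continuous g}) ->
  (forall x, U x -> f x = g x) -> forall x, Om x -> f x = g x.
Proof.
move=> cf cg H x Ox; apply/eqP; rewrite eq_le -subr_ge0 -[X in _ && X]subr_ge0; apply/andP; split.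
  apply: (Om_closure (f := fun x => g x - f x)) (Ox) => [y Oy|y /H ->]; last by rewrite subrr.
  exact: continuousB (cg y Oy) (cf y Oy).
apply: (Om_closure (f := fun x => f x - g x)) (Ox) => [y Oy|y /H ->]; last by rewrite subrr.
exact: continuousB (cf y Oy) (cg y Oy).
Qed.

Lemma Om_meq (V : set 'rV[R]_n) p q (A B : 'rV[R]_n -> 'M[R]_(p, q)) : Om `<=` V ->
  mCk V 0 A -> mCk V 0 B -> (forall x, U x -> A x = B x) -> forall x, Om x -> A x = B x.
Proof.
move=> OV AC BC H x Ox; apply/matrixP => a b.
apply: (Om_eq (f := fun x => A x a b) (g := fun x => B x a b)) (Ox).
- by move=> y /OV Vy; apply: (AC a b).
- by move=> y /OV Vy; apply: (BC a b).
- by move=> y /H ->.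
Qed.

Definition per (T : Type) (f : 'rV[R]_n -> T) : Prop :=
  forall x (j : 'I_n), Om x -> (1 < j)%N -> f (x + 'e_j) = f x.

Lemma Om_shift x (j : 'I_n) : (1 < j)%N -> Om x -> Om (x + 'e_j).
Proof.
move=> j1; rewrite /solid_torus /= !mxE.
have -> : (0 == j) = false by apply/eqP => e; rewrite -e in j1.
have -> : (1 == j) = false by apply/eqP => e; rewrite -e in j1.
by rewrite andbF !addr0.
Qed.

(** Periodicity is known on the solid torus only, so the derivative is compared in the interior,
    where a neighbourhood is available, and the equality extends by continuity. *)
Lemma per_pd (V : set 'rV[R]_n) (f : 'rV[R]_n -> R) i : open V -> Om `<=` V -> Ck 1 V f ->
  per f -> per (pd i f).
Proof.
move=> oV OV fC pf x j Ox j1.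
have sh y : {for y, continuous (fun y : 'rV[R]_n => y + 'e_j)}.
  by apply: continuousD; [apply: cvg_id|exact: cst_continuous].
have c1 y : Om y -> {for y, continuous (pd i f)}.
  by move=> /OV Vy; apply: (Ck_cont (Ck_partial i fC)) Vy.
apply: (Om_eq (f := fun x => pd i f (x + 'e_j))) (Ox) => [y Oy|y Oy|y Uy].
- by apply: (continuous_comp (sh y)); apply: c1; exact: Om_shift.
- exact: c1.
have Vy : V (y + 'e_j) by apply: OV; apply: Om_shift => //; exact: inner_sub.
transitivity (pd i (fun y => f (y + 'e_j)) y); last first.
  by apply: (partial_congr inner_open) Uy => z Uz; apply: pf => //; exact: inner_sub.
symmetry; apply: pd_val.
have -> : pd i f (y + 'e_j) = \sum_l (i == l)%:R * pd l f (y + 'e_j).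
  rewrite (bigD1 i) //= eqxx mul1r big1 ?addr0 // => l li.
  by rewrite eq_sym (negPf li) mul0r.
apply: (is_derive_chainE (b := fun y => y + 'e_j) oV fC Vy) => l.
have -> : (fun z : 'rV[R]_n => (z + 'e_j) 0 l) = (fun z => z 0 l + ('e_j : 'rV[R]_n) 0 l).
  by apply/funext => z; rewrite mxE.
have <- : ('e_i : 'rV[R]_n) 0 l + 0 = (i == l)%:R by rewrite addr0 mxE eqxx eq_sym.
exact: (is_deriveD (is_derive_coord y ('e_i : 'rV[R]_n) l) (is_derive_cst (('e_j : 'rV[R]_n) 0 l) y 'e_i)).
Qed.

Lemma per_mpd (V : set 'rV[R]_n) p q (A : 'rV[R]_n -> 'M[R]_(p, q)) i : open V -> Om `<=` V ->
  mCk V 1 A -> per A -> per (mpd i A).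
Proof.
move=> oV OV AC pA x j Ox j1; apply/matrixP => a b; rewrite !mpdE.
by apply: (per_pd i oV OV (AC a b)) => // y l Oy l1; rewrite pA.
Qed.

End SolidTorusCalculus.

(** * Smooth Gram-Schmidt frames *)

Section GramSchmidt.
Variable R : realType.

Lemma posdef_dr k (M : 'M[R]_(1 + k)) : posdefmx M -> posdefmx (drsubmx M).
Proof.
move=> [sM pM]; split; first by rewrite trmx_drsub sM.
move=> v v0; have := pM (row_mx 0 v); rewrite -{1}(submxK M) mul_row_block !mul0mx !add0r.
rewrite tr_row_mx mul_row_col trmx0 mulmx0 add0r; apply.
by apply: contra v0 => /eqP e; rewrite -(row_mxKr (0 : 'rV_1) v) e linear0.
Qed.

(* The Gram-Schmidt frame of the bilinear form M: the rows e_a of [Fr M] satisfy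
   M(e_a, e_b) = delta_ab, and e_a lies in the span of the last k - a basis vectors. *)
Fixpoint Fr k : 'M[R]_k -> 'M[R]_k :=
  match k with
  | 0 => fun M => M
  | k'.+1 => fun M =>
    let M' : 'M[R]_(1 + k') := M in
    let F := Fr (drsubmx M') in let b := ursubmx M' in
    let q := (Num.sqrt ((ulsubmx M' - b *m (F^T *m F) *m b^T) 0 0))^-1 in
    block_mx q%:M (- q *: (b *m (F^T *m F))) 0 F
  end.

Definition upper_tri k (F : 'M[R]_k) : Prop :=
  (forall i j : 'I_k, (j < i)%N -> F i j = 0) /\ forall i, 0 < F i i.

Lemma upper_block k (q : R) (b : 'rV[R]_k) (F : 'M[R]_k) : 0 < q -> upper_tri F ->
  upper_tri (block_mx q%:M b 0 F : 'M[R]_(1 + k)).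
Proof.
move=> q0 [u1 u2]; split=> [i j|i].
  rewrite mxE; case: (splitP i) => i' ei; rewrite mxE; case: (splitP j) => j' ej; rewrite ?mxE.
  + by rewrite ei ej !ord1.
  + by rewrite ei ej ord1.
  + by [].
  + by rewrite ei ej ltn_add2l; apply: u1.
rewrite mxE; case: (splitP i) => i' ei; rewrite mxE; case: (splitP i) => i2 ei2; rewrite ?mxE.
+ by rewrite !ord1 eqxx mulr1n.
+ by have := ltn_ord i'; rewrite -[X in (X < _)%N]ei ei2.
+ by have := ltn_ord i2; rewrite -[X in (X < _)%N]ei2 ei.
+ suff -> : i' = i2 by [].
  by apply: val_inj; apply/eqP; rewrite /= -(eqn_add2l 1) -ei ei2.
Qed.

(** Since F^T F is the inverse of the lower right block D, the quantity is the Schur complement of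
    D, i.e. the value of the form M on the vector (1, - b D^-1). *)
Lemma schur_pos k (M : 'M[R]_(1 + k)) (F : 'M[R]_k) : posdefmx M ->
  F *m drsubmx M *m F^T = 1%:M ->
  0 < (ulsubmx M - ursubmx M *m (F^T *m F) *m (ursubmx M)^T) 0 0.
Proof.
move=> [sM pM] HF; set b := ursubmx M; set D := drsubmx M in HF *.
have HD : D *m (F^T *m F) = 1%:M.
  have e1 : F *m (D *m F^T) = 1%:M by rewrite mulmxA.
  by have := mulmx1C e1; rewrite !mulmxA.
pose v : 'rV[R]_(1 + k) := row_mx 1%:M (- (b *m (F^T *m F))).
have v0 : v != 0.
  apply/eqP => /(congr1 lsubmx); rewrite row_mxKl linear0 => /matrixP /(_ 0 0).
  by rewrite !mxE => /eqP; rewrite oner_eq0.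
have := pM v v0; rewrite -{1}(submxK M) mul_row_block.
have -> : dlsubmx M = b^T by rewrite /b trmx_ursub sM.
rewrite -/b -/D !mul1mx !mulNmx -!mulmxA.
have -> : b *m (F^T *m (F *m D)) = b.
  have := HD; rewrite -[1%:M]trmx1 => /(congr1 trmx); rewrite !trmx_mul !trmxK trmx_drsub sM -/D.
  by move=> e; rewrite [F^T *m _]mulmxA e mulmx1.
by rewrite subrr tr_row_mx mul_row_col mul0mx addr0 trmx1 mulmx1.
Qed.

Lemma Fr_spec k (M : 'M[R]_k) : posdefmx M -> Fr M *m M *m (Fr M)^T = 1%:M /\ upper_tri (Fr M).
Proof.
elim: k M => [|k IH] M pM; first by split; [apply/matrixP => -[]|split=> -[]].
have [HF [u1 u2]] := IH _ (posdef_dr pM).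
have q0 := schur_pos pM HF; have sM := proj1 pM.
rewrite /=; set F := Fr _ in HF u1 u2 q0 *; set b := ursubmx (M : 'M[R]_(1 + k)) in q0 *.
set a := (ulsubmx _ - _) 0 0 in q0 *.
set q := (Num.sqrt a)^-1.
have qq : q * q * a = 1.
  rewrite /q -invfM -expr2 sqr_sqrtr ?ltW // mulVf // gt_eqF //.
split; last by apply: upper_block => //; rewrite invr_gt0 sqrtr_gt0.
have HD : drsubmx (M : 'M[R]_(1 + k)) *m (F^T *m F) = 1%:M.
  have e1 : F *m (drsubmx (M : 'M[R]_(1 + k)) *m F^T) = 1%:M by rewrite mulmxA.
  by have := mulmx1C e1; rewrite !mulmxA.
have HD' : (F^T *m F) *m drsubmx (M : 'M[R]_(1 + k)) = 1%:M by apply: mulmx1C.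
have db : dlsubmx (M : 'M[R]_(1 + k)) = b^T by rewrite /b trmx_ursub sM.
rewrite -{1}[M](submxK (M : 'M[R]_(1 + k))) db -/b.
rewrite [LHS](_ : _ = @mulmx R (1 + k) (1 + k) (1 + k) (@mulmx R (1 + k) (1 + k) (1 + k)
   (block_mx q%:M (- q *: (b *m (F^T *m F))) 0 F)
   (block_mx (ulsubmx (M : 'M[R]_(1 + k))) b b^T (drsubmx (M : 'M[R]_(1 + k)))))
   (block_mx q%:M (- q *: (b *m (F^T *m F))) 0 F)^T) //.
rewrite tr_block_mx !mulmx_block !trmx0 !mul0mx !add0r !mulmx0 !add0r tr_scalar_mx.
have -> : q%:M *m b + - q *: (b *m (F^T *m F)) *m drsubmx (M : 'M[R]_(1 + k)) = 0.
  rewrite -!scalemxAl -!mulmxA [F^T *m _]mulmxA HD' mulmx1 mul_scalar_mx scaleNr addrN //.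
have -> : F *m b^T *m q%:M + F *m drsubmx (M : 'M[R]_(1 + k)) *m (- q *: (b *m (F^T *m F)))^T = 0.
  by rewrite linearZ /= !trmx_mul trmxK -scalemxAr !mulmxA HF mul1mx mul_mx_scalar scaleNr addrN.
rewrite !mul0mx !addr0 HF.
transitivity (block_mx 1%:M 0 0 1%:M : 'M[R]_(1 + k)); last by rewrite -scalar_mx_block.
rewrite [X in block_mx X _ _ _](_ : _ = 1%:M) //.
by rewrite mul_mx_scalar mul_scalar_mx -scalemxAl scaleNr -scalerBr scalerA [X in _ *: X]mx11_scalar -/a
  scale_scalar_mx qq.
Qed.

(** Uniqueness of the triangular factorisation with positive diagonal. It identifies a frame
    obtained from the interior metric along the boundary with the frame constructed from the induced
    metric alone. *)
Lemma Fr_uniq k (M F : 'M[R]_k) : posdefmx M -> upper_tri F -> F *m M *m F^T = 1%:M -> F = Fr M.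
Proof.
elim: k M F => [|k IH] M F pM uF HF; first by apply/matrixP => -[].
have [u1 u2] := uF; have sM := proj1 pM.
pose F0 : 'M[R]_(1 + k) := F.
have F0E : F0 = block_mx (F ord0 ord0)%:M (ursubmx F0) 0 (drsubmx F0).
  rewrite -{1}[F0]submxK; congr (block_mx _ _ _ _).
    by rewrite [LHS]mx11_scalar !mxE; congr (F _ _)%:M; apply: val_inj.
  by apply/matrixP => i j; rewrite !mxE; apply: u1; rewrite /= ord1.
pose M0 : 'M[R]_(1 + k) := M.
have db : dlsubmx M0 = (ursubmx M0)^T by rewrite trmx_ursub sM.
have : F0 *m M0 *m F0^T = block_mx 1%:M 0 0 1%:M by rewrite -scalar_mx_block.
set q := F ord0 ord0 in F0E; set v := ursubmx F0 in F0E; set F' := drsubmx F0 in F0E.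
rewrite F0E -{1}[M0]submxK db; set b := ursubmx M0; set a := ulsubmx M0; set D := drsubmx M0.
rewrite tr_block_mx !mulmx_block !trmx0 !mul0mx !add0r !mulmx0 !add0r => /eq_block_mx[e1 e2 _ e4].
have uF' : upper_tri F'.
  split=> [i j ij|i]; rewrite !mxE; first by apply: u1; rewrite /= ltn_add2l.
  exact: u2.
have F'E : F' = Fr D by apply: IH => //; exact: posdef_dr.
have D1 : D *m (F'^T *m F') = 1%:M.
  have e : F' *m (D *m F'^T) = 1%:M by rewrite mulmxA.
  by have := mulmx1C e; rewrite !mulmxA.
have F1 : F'^T *m F' *m D = 1%:M by apply: mulmx1C.
have vE : v = - q *: (b *m (F'^T *m F')).
  have := congr1 (mulmx^~ F') e2; rewrite mul0mx -mulmxA mulmxDl -[v *m D *m _]mulmxA D1 mulmx1.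
  by rewrite mul_scalar_mx -scalemxAl => /eqP; rewrite addrC addr_eq0 scaleNr => /eqP.
have q0 : 0 < q by apply: u2.
have qa : q * q * (a - b *m (F'^T *m F') *m b^T) 0 0 = 1.
  have e3 : q%:M *m b + v *m D = 0 by rewrite -[LHS]mulmx1 -F1 !mulmxA e2 !mul0mx.
  move: e1; rewrite e3 mul0mx addr0 vE tr_scalar_mx mul_mx_scalar mul_scalar_mx -scalemxAl scaleNr -scalerBr scalerA.
  move/matrixP/(_ 0 0); set A := a - _ => e.
  by transitivity (((q * q) *: A) 0 0); [rewrite [RHS]mxE|rewrite e mxE].
have qE : q = (Num.sqrt ((a - b *m (F'^T *m F') *m b^T) 0 0))^-1.
  have -> : (a - b *m (F'^T *m F') *m b^T) 0 0 = (q^-1) ^+ 2.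
    by rewrite exprVn expr2 -[RHS]mulr1 -qa mulrA mulVf ?mul1r // mulf_neq0 // gt_eqF.
  by rewrite sqrtr_sqr gtr0_norm ?invr_gt0 // invrK.
transitivity (block_mx q%:M v 0 F' : 'M[R]_(1 + k)); first exact: F0E.
by rewrite vE qE F'E.
Qed.

Lemma upper_det k (F : 'M[R]_k) : upper_tri F -> 0 < \det F.
Proof.
move=> [u1 u2]; rewrite -det_tr det_trig; last by apply/is_trig_mxP => i j ij; rewrite mxE u1.
by apply: prodr_gt0 => i _; rewrite mxE.
Qed.

Lemma upper_interp k (F : 'M[R]_k) s : 0 <= s <= 1 -> upper_tri F ->
  upper_tri ((1 - s)%:M + s *: F).
Proof.
move=> /andP[s0 s1] [u1 u2]; split=> [i j ij|i]; rewrite !mxE.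
  by rewrite u1 // mulr0 addr0 gt_eqF.
rewrite eqxx mulr1n; have := u2 i; have [->|s_neq0] := eqVneq s 0; first by rewrite mul0r addr0 subr0.
have sp : 0 < s by rewrite lt_neqAle eq_sym s_neq0.
by move=> f0; have := mulr_gt0 sp f0; lra.
Qed.

Section SmoothFr.
Variable m : nat.
Implicit Types V K : set 'rV[R]_m.

Lemma open_pos V (f : 'rV[R]_m -> R) : open V -> Ck 0 V f -> open (V `&` [set x | 0 < f x]).
Proof.
move=> oV fC; rewrite openE => x [Vx fx]; apply: filterI; first exact: open_nbhs_nbhs.
have := fC x Vx [set y | 0 < y]; apply.
by apply: open_nbhs_nbhs; split=> //; exact: open_gt.
Qed.

Lemma mCk_sub c V V' p q (A : 'rV[R]_m -> 'M[R]_(p, q)) : V' `<=` V -> mCk V c A -> mCk V' c A.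
Proof. by move=> VV AC a b; apply: Ck_sub VV (AC a b). Qed.

Lemma mCk_block c V p1 p2 q1 q2 (A : 'rV[R]_m -> 'M[R]_(p1, q1)) (B : 'rV[R]_m -> 'M[R]_(p1, q2))
  (C : 'rV[R]_m -> 'M[R]_(p2, q1)) (D : 'rV[R]_m -> 'M[R]_(p2, q2)) : open V ->
  mCk V c A -> mCk V c B -> mCk V c C -> mCk V c D ->
  mCk V c (fun x => block_mx (A x) (B x) (C x) (D x)).
Proof.
move=> oV AC BC CC DC a b; case: (split_ordP a) => a' ->; case: (split_ordP b) => b' ->.
- by apply: (Ck_congr oV _ (AC a' b')) => y _; rewrite block_mxEul.
- by apply: (Ck_congr oV _ (BC a' b')) => y _; rewrite block_mxEur.
- by apply: (Ck_congr oV _ (CC a' b')) => y _; rewrite block_mxEdl.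
- by apply: (Ck_congr oV _ (DC a' b')) => y _; rewrite block_mxEdr.
Qed.

Lemma mCk_scalar c V p (f : 'rV[R]_m -> R) : open V -> Ck c V f -> mCk V c (fun x => (f x)%:M : 'M[R]_p).
Proof.
move=> oV fC a b; apply: (Ck_congr (f := fun x => f x * (a == b)%:R) oV).
  by move=> y _; rewrite !mxE mulr_natr.
by apply: CkM => //; exact: Ck_cst.
Qed.

(** Positivity of the form is known on [K] only; the neighbourhood shrinks at each induction step to
    the open set where the next Schur complement, the argument of the square root, is positive. *)
Lemma Fr_smooth c k V K (M : 'rV[R]_m -> 'M[R]_k) : open V -> K `<=` V -> mCk V c M ->
  (forall x, K x -> posdefmx (M x)) ->
  exists V', [/\ open V', K `<=` V', V' `<=` V & mCk V' c (fun x => Fr (M x))].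
Proof.
elim: k M => [|k IH] M oV KV MC pM; first by exists V; split=> // -[].
pose M0 (x : 'rV[R]_m) : 'M[R]_(1 + k) := M x.
have [||V1 [oV1 KV1 VV1 FC]] := IH (fun x => drsubmx (M0 x)) oV KV.
- by move=> a b; apply: (Ck_congr oV _ (MC (rshift 1 a) (rshift 1 b))) => y _; rewrite !mxE.
- by move=> x Kx; apply: posdef_dr; apply: pM.
have MC1 := mCk_sub VV1 MC.
have bC : mCk V1 c (fun x => ursubmx (M0 x)).
  by move=> a b; apply: (Ck_congr oV1 _ (MC1 (lshift k a) (rshift 1 b))) => y _; rewrite !mxE.
have aC : mCk V1 c (fun x => ulsubmx (M0 x)).
  by move=> a b; apply: (Ck_congr oV1 _ (MC1 (lshift k a) (lshift k b))) => y _; rewrite !mxE.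
have FFC : mCk V1 c (fun x => ursubmx (M0 x) *m ((Fr (drsubmx (M0 x)))^T *m Fr (drsubmx (M0 x)))).
  by apply: mCkM => //; apply: mCkM => //; apply: mCkT.
pose h x := (ulsubmx (M0 x) - ursubmx (M0 x) *m ((Fr (drsubmx (M0 x)))^T *m Fr (drsubmx (M0 x))) *m
   (ursubmx (M0 x))^T) 0 0.
have hC : Ck c V1 h.
  by apply: (mCkB oV1 aC); apply: mCkM => //; apply: mCkT.
pose V' := V1 `&` [set x | 0 < h x].
have oV' : open V' by apply: open_pos => //; apply: Ck_le hC.
have V'V1 : V' `<=` V1 by move=> x [].
exists V'; split=> //.
- move=> x Kx; split; first exact: KV1.
  by apply: schur_pos; [exact: pM|apply: (proj1 (Fr_spec _)); apply: posdef_dr; apply: pM].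
- by move=> x /V'V1 /VV1.
have qC : Ck c V' (fun x => (Num.sqrt (h x))^-1).
  apply: Ck_inv => // [y [_ hy]|]; first by rewrite gt_eqF // sqrtr_gt0.
  by apply: Ck_sqrt => // [y [] //|]; apply: Ck_sub hC.
apply: (@mCk_block c V' 1 k 1 k (fun x => ((Num.sqrt (h x))^-1)%:M)
  (fun x => - (Num.sqrt (h x))^-1 *: (ursubmx (M0 x) *m ((Fr (drsubmx (M0 x)))^T *m Fr (drsubmx (M0 x)))))
  (fun=> 0) (fun x => Fr (drsubmx (M0 x)))) => //.
- exact: mCk_scalar.
- apply: mCkZ => //; first exact: CkN.
  exact: mCk_sub FFC.
- exact: mCk_cst.
- exact: mCk_sub FC.
Qed.

End SmoothFr.

Lemma ord2 (i : 'I_2) : i = 0 \/ i = 1.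
Proof. by case: i => -[|[|//]] h; [left|right]; apply: val_inj. Qed.

Definition mk2 (a b c d : R) : 'M[R]_2 :=
  \matrix_(i, j) if i == 0 then (if j == 0 then a else b) else (if j == 0 then c else d).

Lemma mk2P (A : 'M[R]_2) a b c d : A 0 0 = a -> A 0 1 = b -> A 1 0 = c -> A 1 1 = d -> A = mk2 a b c d.
Proof.
move=> e1 e2 e3 e4; apply/matrixP => i j; rewrite mxE.
by case: (ord2 i) => ->; case: (ord2 j) => ->.
Qed.

Lemma mk2_mul a b c d a' b' c' d' : mk2 a b c d *m mk2 a' b' c' d' =
  mk2 (a * a' + b * c') (a * b' + b * d') (c * a' + d * c') (c * b' + d * d').
Proof. by apply: mk2P; rewrite mxE !big_ord_recl big_ord0 addr0 !mxE. Qed.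

Lemma mk2T a b c d : (mk2 a b c d)^T = mk2 a c b d.
Proof. by apply: mk2P; rewrite !mxE. Qed.

Lemma mk2_scalar a : a%:M = mk2 a 0 0 a.
Proof. by apply: mk2P; rewrite !mxE. Qed.

Lemma mk2D a b c d a' b' c' d' : mk2 a b c d + mk2 a' b' c' d' = mk2 (a + a') (b + b') (c + c') (d + d').
Proof. by apply: mk2P; rewrite !mxE. Qed.

Lemma mk2Z s a b c d : s *: mk2 a b c d = mk2 (s * a) (s * b) (s * c) (s * d).
Proof. by apply: mk2P; rewrite !mxE. Qed.

Lemma mk2_det a b c d : \det (mk2 a b c d) = a * d - b * c.
Proof.
rewrite (expand_det_row _ 0) 2!big_ord_recl big_ord0 addr0 /cofactor /= !det_mx11 !mxE /=.
by rewrite /= /bump /= expr0 expr1; ring.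
Qed.

(** * A frame adapted to the boundary normal *)

Section Frame.
Variable k : nat.
Local Notation n := (2 + k)%N.

Definition nn2 (x y : R) : 'rV[R]_2 := \row_j if j == 0 then x else y.
Definition nnv (x y : R) : 'rV[R]_n := row_mx (nn2 x y) (0 : 'rV[R]_k).

Lemma mk2_nn a b c d x y : mk2 a b c d *m (nn2 x y)^T = (nn2 (a * x + b * y) (c * x + d * y))^T.
Proof.
by apply/matrixP => i j; rewrite !mxE !big_ord_recl big_ord0 !mxE addr0 /=; case: (ord2 i) => ->.
Qed.

(* R^2 = C, U2 z = p z + q conj(z) with |q| < |p|: the rotation by
   conj(p + q conj(z)^2), which has no zero on the disk, makes z an eigenvector
   of the rotated U2 when |z| = 1. *)
Definition rot_u (al be de x y : R) := (al + de + (al - de) * (x ^+ 2 - y ^+ 2) + 2 * be * x * y) / 2.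
Definition rot_v (al be de x y : R) := (be - be * (x ^+ 2 - y ^+ 2) + 2 * (al - de) * x * y) / 2.
Definition rot_w al be de x y := rot_u al be de x y ^+ 2 + rot_v al be de x y ^+ 2.
Definition rot al be de x y : 'M[R]_2 :=
  let: u := rot_u al be de x y in let: v := rot_v al be de x y in
  (Num.sqrt (rot_w al be de x y))^-1 *: mk2 u (- v) v u.

(** In the complex notation a zero would mean |p| = |q| |z|^2 <= |q|, while |p|^2 - |q|^2 = al de >
    0. *)
Lemma rot_w_gt0 al be de x y : 0 < al -> 0 < de -> x ^+ 2 + y ^+ 2 <= 1 -> 0 < rot_w al be de x y.
Proof.
move=> al0 de0 r1; rewrite lt_neqAle eq_sym addr_ge0 ?sqr_ge0 // andbT.
apply/negP; rewrite paddr_eq0 ?sqr_ge0 // !sqrf_eq0 => /andP[/eqP u0 /eqP v0].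
have E1 : al + de = - ((al - de) * (x ^+ 2 - y ^+ 2) + 2 * be * x * y).
  by move: u0; rewrite /rot_u; lra.
have E2 : be = be * (x ^+ 2 - y ^+ 2) - 2 * (al - de) * x * y by move: v0; rewrite /rot_v; lra.
have E3 : (al + de) ^+ 2 + be ^+ 2 = ((al - de) ^+ 2 + be ^+ 2) * (x ^+ 2 + y ^+ 2) ^+ 2.
  by rewrite E1 [X in _ + X ^+ 2 = _]E2; ring.
have r0 : 0 <= x ^+ 2 + y ^+ 2 by rewrite addr_ge0 ?sqr_ge0.
have r2 : (x ^+ 2 + y ^+ 2) ^+ 2 <= 1 by rewrite expr_le1.
have : ((al - de) ^+ 2 + be ^+ 2) * (x ^+ 2 + y ^+ 2) ^+ 2 <= (al - de) ^+ 2 + be ^+ 2.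
  by rewrite ler_piMr // addr_ge0 ?sqr_ge0.
have := mulr_gt0 al0 de0; rewrite -E3; nra.
Qed.

(** Up to the positive normalisation this is the trace of the rotated 2 x 2 block. Its determinant
    is positive as well, so the block has no eigenvalue <= 0 and the segment from the identity to it
    consists of invertible matrices. *)
Lemma rot_tr_gt0 al be de x y : 0 < al -> 0 < de -> x ^+ 2 + y ^+ 2 <= 1 ->
  0 < rot_u al be de x y * (al + de) + rot_v al be de x y * be.
Proof.
move=> al0 de0 r1.
pose X := (al + de) ^+ 2 + be ^+ 2.
pose Y := (x ^+ 2 - y ^+ 2) * ((al - de) * (al + de) - be ^+ 2) + 2 * x * y * (be * (al + de) + (al - de) * be).
have -> : rot_u al be de x y * (al + de) + rot_v al be de x y * be = (X + Y) / 2.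
  by rewrite /rot_u /rot_v /X /Y; field.
have X0 : 0 < X by rewrite /X ltr_wpDr ?sqr_ge0 // exprn_gt0 // addr_gt0.
have r0 : 0 <= x ^+ 2 + y ^+ 2 by rewrite addr_ge0 ?sqr_ge0.
have r2 : (x ^+ 2 + y ^+ 2) ^+ 2 <= 1 by rewrite expr_le1.
have q2 : (al - de) ^+ 2 + be ^+ 2 < X by rewrite /X; have := mulr_gt0 al0 de0; nra.
have q0 : 0 <= (al - de) ^+ 2 + be ^+ 2 by rewrite addr_ge0 ?sqr_ge0.
have YX : Y ^+ 2 < X ^+ 2.
  have Y2 : Y ^+ 2 <= X * ((al - de) ^+ 2 + be ^+ 2) * (x ^+ 2 + y ^+ 2) ^+ 2.
    set P := (al - de) * (al + de) - be ^+ 2; set Q := be * (al + de) + (al - de) * be.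
    have -> : X * ((al - de) ^+ 2 + be ^+ 2) = P ^+ 2 + Q ^+ 2 by rewrite /X /P /Q; ring.
    have -> : Y ^+ 2 = (P ^+ 2 + Q ^+ 2) * (x ^+ 2 + y ^+ 2) ^+ 2 -
       ((x ^+ 2 - y ^+ 2) * Q - 2 * x * y * P) ^+ 2 by rewrite /Y -/P -/Q; ring.
    by rewrite gerBl sqr_ge0.
  apply: (le_lt_trans Y2); apply: (@le_lt_trans _ _ (X * ((al - de) ^+ 2 + be ^+ 2))).
    by rewrite ler_piMr // mulr_ge0 // ltW.
  by rewrite expr2 ltr_pM2l.
rewrite divr_gt0 // -[X in X < _](subrr X) ltrD2l ltNge; apply/negP => YX'.
move: X0 YX YX'; clear; move: X Y => X Y X0 YX YX'.
have h1 : 0 <= - Y - X by lra.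
have h2 : 0 <= X - Y by lra.
by have := mulr_ge0 h1 h2; move: YX; nra.
Qed.

(** Only the first two frame vectors are rotated. By triangularity the remaining ones lie in the
    span of the torus directions, so they are already tangent to the boundary. *)
Definition frame_of (M : 'M[R]_n) (x y : R) : 'M[R]_n :=
  let U := Fr M in
  (block_mx (rot (U 0 0) (U 0 1) (U 1 1) x y) 0 0 1%:M : 'M[R]_(2 + k)) *m U.

Lemma upper_blocks (U : 'M[R]_n) : upper_tri U ->
  U = block_mx (mk2 (U 0 0) (U 0 1) 0 (U 1 1)) (ursubmx U) 0 (drsubmx U) :> 'M[R]_(2 + k)
  /\ upper_tri (drsubmx U).
Proof.
move=> [u1 u2]; split; last first.
  by split=> [i j ij|i]; rewrite !mxE; [apply: u1; rewrite /= ltn_add2l|apply: u2].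
rewrite -[LHS](submxK U); congr block_mx.
  apply: mk2P; rewrite !mxE; try by congr (U _ _); apply: val_inj.
  exact: u1.
apply/matrixP => i j; rewrite !mxE; apply: u1; rewrite /=; have := ltn_ord j; lia.
Qed.

Lemma frame_blocks (M : 'M[R]_n) x y : posdefmx M -> x ^+ 2 + y ^+ 2 <= 1 ->
  let U := Fr M in let al := U 0 0 in let be := U 0 1 in let de := U 1 1 in
  let u := rot_u al be de x y in let v := rot_v al be de x y in
  let w := (Num.sqrt (rot_w al be de x y))^-1 in
  exists (B : 'M[R]_(2, k)) (F : 'M[R]_k), [/\ 0 < al, 0 < de, 0 < w, w ^+ 2 * (u ^+ 2 + v ^+ 2) = 1
   & upper_tri F /\
   frame_of M x y = block_mx (w *: mk2 (u * al) (u * be - v * de) (v * al) (v * be + u * de)) B 0 F :> 'M[R]_(2 + k)].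
Proof.
move=> pM r1 U al be de u v w; have [_ uU] := Fr_spec pM; have [UE uF] := upper_blocks uU.
have al0 : 0 < al by apply: (proj2 uU).
have de0 : 0 < de by apply: (proj2 uU).
have w0 := rot_w_gt0 be al0 de0 r1.
exists (rot al be de x y *m ursubmx U), (drsubmx U); split=> //.
- by rewrite invr_gt0 sqrtr_gt0.
- by rewrite /w exprVn sqr_sqrtr ?ltW // mulVf // gt_eqF.
split; first exact: uF.
rewrite -/U in UE; rewrite /frame_of -/U -/al -/be -/de [X in _ *m X = _]UE mulmx_block !mul0mx !mulmx0 !addr0 !add0r !mul1mx /rot -/u -/v -/w.
by rewrite -scalemxAl mk2_mul -/al -/be -/de !mulr0 !addr0 mulNr.
Qed.

Lemma frame_orth (M : 'M[R]_n) x y : posdefmx M -> x ^+ 2 + y ^+ 2 <= 1 ->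
  frame_of M x y *m M *m (frame_of M x y)^T = 1%:M.
Proof.
move=> pM r1; have [FM uU] := Fr_spec pM.
rewrite /frame_of trmx_mul !mulmxA -[_ *m Fr M *m M]mulmxA -[_ *m (Fr M *m M) *m _]mulmxA FM mulmx1.
set al := Fr M 0 0; set be := Fr M 0 1; set de := Fr M 1 1.
rewrite tr_block_mx mulmx_block !trmx0 !mul0mx !mulmx0 !addr0 !add0r trmx1 mulmx1 /rot.
set u := rot_u _ _ _ _ _; set v := rot_v _ _ _ _ _.
rewrite [(_ *: mk2 _ _ _ _)^T]linearZ /= -scalemxAl -scalemxAr scalerA mk2T mk2_mul.
have w0 : 0 < rot_w al be de x y by apply: rot_w_gt0 => //; apply: (proj2 uU).
have ww : (Num.sqrt (rot_w al be de x y))^-1 * (Num.sqrt (rot_w al be de x y))^-1 * (u ^+ 2 + v ^+ 2) = 1.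
  by rewrite -expr2 exprVn sqr_sqrtr ?ltW // mulVf // gt_eqF.
have -> : mk2 (u * u + - v * - v) (u * v + - v * u) (v * u + u * - v) (v * v + u * u) =
    (u ^+ 2 + v ^+ 2) *: mk2 1 0 0 1.
  by rewrite mk2Z; congr mk2; ring.
by rewrite scalerA ww scale1r -mk2_scalar -scalar_mx_block.
Qed.

(** The left side lists the values of the frame vectors on the flat conormal. That they are
    proportional to (x, y, 0) says that the unit normal of the metric has the components (x, y, 0)
    in this frame. *)
Lemma frame_normal (M : 'M[R]_n) x y : posdefmx M -> x ^+ 2 + y ^+ 2 = 1 ->
  exists2 l, 0 < l & frame_of M x y *m (nnv x y)^T = l *: (nnv x y)^T.
Proof.
move=> pM r1; have r1' : x ^+ 2 + y ^+ 2 <= 1 by rewrite r1.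
have [B [F [al0 de0 w0 ww [uF ->]]]] := frame_blocks pM r1'.
move: al0 de0 w0 ww; set al := Fr M 0 0; set be := Fr M 0 1; set de := Fr M 1 1.
set u := rot_u _ _ _ _ _; set v := rot_v _ _ _ _ _; set w := (Num.sqrt _)^-1 => al0 de0 w0 ww.
(* On the unit circle u + i v = z conj(U2 z), so that multiplication by u + i v sends U2 z to |U2
   z|^2 z. The two formulas below are the real and imaginary part. *)
have uE : u = al * x ^+ 2 + be * x * y + de * y ^+ 2.
  have X2 : x ^+ 2 = 1 - y ^+ 2 by rewrite -r1 addrK.
  by rewrite /u /rot_u X2; field.
have vE : v = be * y ^+ 2 + (al - de) * x * y.
  have X2 : x ^+ 2 = 1 - y ^+ 2 by rewrite -r1 addrK.
  by rewrite /v /rot_v X2; field.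
exists (w * (u ^+ 2 + v ^+ 2)).
  rewrite mulr_gt0 // -(pmulr_rgt0 _ (exprn_gt0 2 w0)) ww //.
rewrite /nnv tr_row_mx mul_block_col trmx0 !mulmx0 mul0mx !addr0 scale_col_mx scaler0; congr col_mx.
rewrite -scalemxAl mk2_nn -scalerA; congr (_ *: _); rewrite -linearZ /=.
have -> : (u ^+ 2 + v ^+ 2) *: nn2 x y = nn2 ((u ^+ 2 + v ^+ 2) * x) ((u ^+ 2 + v ^+ 2) * y).
  by apply/matrixP => i j; rewrite !mxE; case: ifP.
congr (nn2 _ _)^T.
  transitivity ((u ^+ 2 + v ^+ 2) * x); last by [].
  have -> : u * al * x + (u * be - v * de) * y = u * (al * x + be * y) - v * (de * y) by ring.
  have -> : al * x + be * y = u * x + v * y.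
    transitivity ((al * x + be * y) * (x ^+ 2 + y ^+ 2)); first by rewrite r1 mulr1.
    by rewrite uE vE; ring.
  have -> : de * y = u * y - v * x.
    transitivity (de * y * (x ^+ 2 + y ^+ 2)); first by rewrite r1 mulr1.
    by rewrite uE vE; ring.
  by ring.
transitivity ((u ^+ 2 + v ^+ 2) * y); last by [].
have -> : v * al * x + (v * be + u * de) * y = v * (al * x + be * y) + u * (de * y) by ring.
have -> : al * x + be * y = u * x + v * y.
  transitivity ((al * x + be * y) * (x ^+ 2 + y ^+ 2)); first by rewrite r1 mulr1.
  by rewrite uE vE; ring.
have -> : de * y = u * y - v * x.
  transitivity (de * y * (x ^+ 2 + y ^+ 2)); first by rewrite r1 mulr1.
  by rewrite uE vE; ring.
by ring.
Qed.

(** The frame is joined to the coordinate frame by a straight segment of positively oriented frames.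
    This is the homotopy along which the Dirac operator is deformed to the flat one. *)
Lemma frame_det (M : 'M[R]_n) x y s : posdefmx M -> x ^+ 2 + y ^+ 2 <= 1 -> 0 <= s <= 1 ->
  0 < \det ((1 - s)%:M + s *: frame_of M x y).
Proof.
move=> pM r1 s01.
have [B [F [al0 de0 w0 ww [uF ->]]]] := frame_blocks pM r1.
have tr0 := rot_tr_gt0 (Fr M 0 1) al0 de0 r1.
move: al0 de0 w0 ww tr0; set al := Fr M 0 0; set be := Fr M 0 1; set de := Fr M 1 1.
set u := rot_u _ _ _ _ _; set v := rot_v _ _ _ _ _; set w := (Num.sqrt _)^-1 => al0 de0 w0 ww tr0.
have -> : (1 - s)%:M = block_mx (1 - s)%:M 0 0 (1 - s)%:M :> 'M[R]_(2 + k) by rewrite -scalar_mx_block.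
rewrite scale_block_mx add_block_mx scaler0 !add0r det_ublock.
apply: mulr_gt0; last by apply: upper_det; apply: upper_interp.
rewrite mk2_scalar !mk2Z mk2D mk2_det.
have /andP[s0 s1] := s01.
have [->|sn] := eqVneq s 0; first by rewrite !mul0r !addr0 subr0; lra.
have sp : 0 < s by rewrite lt_neqAle eq_sym sn.
(* For a 2 x 2 matrix M, det((1 - s) + s M) = (1 - s)^2 + s (1 - s) tr M + s^2 det M. *)
have -> : (1 - s + s * (w * (u * al))) * (1 - s + s * (w * (v * be + u * de))) -
   (0 + s * (w * (u * be - v * de))) * (0 + s * (w * (v * al))) =
   (1 - s) ^+ 2 + (s * (1 - s)) * (w * (u * (al + de) + v * be)) +
   s ^+ 2 * (al * de) * (w ^+ 2 * (u ^+ 2 + v ^+ 2)) by ring.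
rewrite ww mulr1 ltr_wpDl //; last by rewrite mulr_gt0 ?exprn_gt0 // mulr_gt0.
rewrite addr_ge0 ?sqr_ge0 // mulr_ge0 ?mulr_ge0 ?subr_ge0 //; exact: ltW.
Qed.

Lemma mCk_mk2 m c V (f1 f2 f3 f4 : 'rV[R]_m -> R) : open V -> Ck c V f1 -> Ck c V f2 -> Ck c V f3 ->
  Ck c V f4 -> mCk V c (fun x => mk2 (f1 x) (f2 x) (f3 x) (f4 x)).
Proof.
move=> oV c1 c2 c3 c4 a b; case: (ord2 a) => ->; case: (ord2 b) => ->.
- by apply: (Ck_congr oV _ c1) => y _; rewrite mxE.
- by apply: (Ck_congr oV _ c2) => y _; rewrite mxE.
- by apply: (Ck_congr oV _ c3) => y _; rewrite mxE.
- by apply: (Ck_congr oV _ c4) => y _; rewrite mxE.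
Qed.

Lemma frame_smooth m c V K (g : 'rV[R]_m -> 'M[R]_n) (X Y : 'rV[R]_m -> R) : open V -> K `<=` V ->
  mCk V c g -> Ck c V X -> Ck c V Y -> (forall x, K x -> posdefmx (g x)) ->
  (forall x, K x -> X x ^+ 2 + Y x ^+ 2 <= 1) ->
  exists V', [/\ open V', K `<=` V', V' `<=` V & mCk V' c (fun x => frame_of (g x) (X x) (Y x))].
Proof.
move=> oV KV gC XC YC pg r1.
have [V1 [oV1 KV1 VV1 FC]] := Fr_smooth oV KV gC pg.
have XC1 := Ck_sub VV1 XC; have YC1 := Ck_sub VV1 YC.
pose al x := Fr (g x) 0 0; pose be x := Fr (g x) 0 1; pose de x := Fr (g x) 1 1.
have alC : Ck c V1 al by apply: FC.
have beC : Ck c V1 be by apply: FC.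
have deC : Ck c V1 de by apply: FC.
pose u x := rot_u (al x) (be x) (de x) (X x) (Y x).
pose v x := rot_v (al x) (be x) (de x) (X x) (Y x).
have sq h : Ck c V1 h -> Ck c V1 (fun x => h x ^+ 2).
  by move=> hC; apply: (CkM oV1 hC).
have c2 : Ck c V1 (fun=> 2) by apply: Ck_cst.
have XYC : Ck c V1 (fun x => X x ^+ 2 - Y x ^+ 2) by apply: (CkB oV1); apply: sq.
have aC : Ck c V1 (fun x => al x - de x) by apply: CkB.
have uC : Ck c V1 u.
  apply: (CkM oV1 _ (Ck_cst V1 c 2^-1)); apply: (CkD oV1).
    by apply: (CkD oV1); [apply: CkD|apply: CkM].
  by apply: (CkM oV1) => //; apply: (CkM oV1) => //; apply: CkM.
have vC : Ck c V1 v.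
  apply: (CkM oV1 _ (Ck_cst V1 c 2^-1)); apply: (CkD oV1).
    by apply: (CkB oV1) => //; apply: CkM.
  by apply: (CkM oV1) => //; apply: (CkM oV1) => //; apply: CkM.
have wC : Ck c V1 (fun x => u x ^+ 2 + v x ^+ 2) by apply: (CkD oV1); apply: sq.
pose V' := V1 `&` [set x | 0 < u x ^+ 2 + v x ^+ 2].
have oV' : open V' by apply: open_pos => //; apply: Ck_le wC.
have V'V1 : V' `<=` V1 by move=> x [].
exists V'; split=> //.
- move=> x Kx; split; first exact: KV1.
  have [_ [_ u2]] := Fr_spec (pg x Kx).
  by apply: rot_w_gt0; rewrite ?u2 ?r1.
- by move=> x /V'V1 /VV1.
apply: mCkM => //; last exact: mCk_sub FC.
apply: mCk_block => //; [|exact: mCk_cst|exact: mCk_cst|exact: mCk_cst].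
apply: mCkZ => //.
  apply: Ck_inv => // [y [_ hy]|]; first by rewrite gt_eqF // sqrtr_gt0.
  by apply: Ck_sqrt => // [y [] //|]; apply: Ck_sub wC.
have uC' := Ck_sub V'V1 uC; have vC' := Ck_sub V'V1 vC.
by apply: mCk_mk2 => //; exact: CkN.
Qed.

End Frame.
End GramSchmidt.

Lemma cont_bounded (R : realType) (X : topologicalType) (K : set X) (f : X -> R) :
  compact K -> cont_on K f -> exists2 C, 0 <= C & forall x, K x -> `|f x| <= C.
Proof.
move=> cK cf.
have cw : {within K, continuous f} by apply: continuous_in_subspaceT => x /set_mem /cf.
have := continuous_compact cw cK => /compact_bounded[M [_ HM]].
exists (`|M| + 1); first by rewrite addr_ge0.
by move=> x Kx; apply: (HM (`|M| + 1)); [rewrite ltr_pwDr // ler_norm|exists x].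
Qed.

Section IPCalculus.
Variables (R : realType) (m : nat) (V : set 'rV[R]_m) (oV : open V).

Lemma Ck_ip c p q (f g : 'rV[R]_m -> 'M[R]_(p, q)) : mCk V c f -> mCk V c g ->
  Ck c V (fun x => ip (f x) (g x)).
Proof. by move=> fC gC; apply: Ck_tr => //; apply: mCkM => //; apply: mCkT. Qed.

Lemma pd_ip p q (f g : 'rV[R]_m -> 'M[R]_(p, q)) i x : V x -> mCk V 1 f -> mCk V 1 g ->
  pd i (fun x => ip (f x) (g x)) x = ip (mpd i f x) (g x) + ip (f x) (mpd i g x).
Proof.
move=> Vx fC gC; rewrite /ip (partial_tr Vx); last by apply: mCkM => //; apply: mCkT.
by rewrite (mpdM oV Vx i (mCkT oV fC) gC) raddfD (mpdT oV Vx).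
Qed.
End IPCalculus.

(** * Integrals over the solid torus and over its boundary *)

Section Functionals.
Variables (R : realType) (k : nat).
Local Notation n := k.+2.
Local Notation Om := (@solid_torus R k).
Definition bdK : set 'rV[R]_n := @bd_incl R k @` (@K1 R k).
Definition IBd : ('rV[R]_n -> R) -> R := locked (fun f => IB (fun p => f (bd_incl p))).

Lemma IBdE f : IBd f = IB (fun p => f (bd_incl p)). Proof. by rewrite /IBd -lock. Qed.

Lemma bd_circle (p : 'rV[R]_k.+1) :
  bd_incl p 0 ord0 ^+ 2 + bd_incl p 0 (lift ord0 ord0) ^+ 2 = 1.
Proof. by rewrite !mxE /= cos2Dsin2. Qed.

Lemma bdK_circle x : bdK x -> x 0 ord0 ^+ 2 + x 0 (lift ord0 ord0) ^+ 2 = 1.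
Proof. by move=> [p _ <-]; exact: bd_circle. Qed.

Lemma one_lift : (1 : 'I_n) = lift ord0 ord0. Proof. exact: val_inj. Qed.

Lemma bd_Om (p : 'rV[R]_k.+1) : Om (bd_incl p).
Proof. by rewrite /solid_torus /= one_lift bd_circle. Qed.

Lemma bdK_Om : bdK `<=` Om.
Proof. by move=> x [p _ <-]; exact: bd_Om. Qed.

Lemma K0_Om : @K0 R k `<=` Om.
Proof. by move=> x [q bq <-]; exact: solid_torus_polar. Qed.

Lemma bd_incl_cont (p : 'rV[R]_k.+1) : {for p, continuous (@bd_incl R k)}.
Proof.
have ct : {for p, continuous (fun p : 'rV[R]_k.+1 => p 0 0)}.
  by apply: (Ck_cont (Ck_coord setT 0 0)).
apply: rV_continuous => i; case: (lift2E i) => [->|->|[j ->]].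
- have -> : (fun z : 'rV[R]_k.+1 => bd_incl z 0 ord0) = (fun z => cos (z 0 0)).
    by apply/funext => z; rewrite mxE.
  by apply: (continuous_comp ct); exact: continuous_cos.
- have -> : (fun z : 'rV[R]_k.+1 => bd_incl z 0 (lift ord0 ord0)) = (fun z => sin (z 0 0)).
    by apply/funext => z; rewrite mxE.
  by apply: (continuous_comp ct); exact: continuous_sin.
have -> : (fun z : 'rV[R]_k.+1 => bd_incl z 0 (lift ord0 (lift ord0 j))) = (fun z => z 0 (inord j.+1)).
  by apply/funext => z; rewrite mxE.
by apply: (Ck_cont (Ck_coord setT 0 (inord j.+1))).
Qed.

Lemma pf_IBd : posfun bdK IBd.
Proof.
rewrite /IBd -lock; apply: (pf_pull (@pf_IB R k)) => y K1y; first exact: bd_incl_cont.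
by exists y.
Qed.

Section OnV.
Variables (V : set 'rV[R]_n) (oV : open V) (OV : Om `<=` V).

Lemma VK0 : @K0 R k `<=` V. Proof. by move=> x /K0_Om /OV. Qed.
Lemma Ck0_K0 f : Ck 0 V f -> cont_on (@K0 R k) f.
Proof. by move=> fC x /VK0; exact: fC. Qed.
Lemma Ck0_bdK f : Ck 0 V f -> cont_on bdK f.
Proof. by move=> fC x /bdK_Om/OV; exact: fC. Qed.

Lemma IOeq f g : Ck 0 V f -> Ck 0 V g -> (forall x, Om x -> f x = g x) -> IO f = IO g.
Proof.
move=> fC gC e; apply: (pf_eq (@pf_IO R k)); [exact: Ck0_K0|exact: Ck0_K0|].
by move=> x /K0_Om; exact: e.
Qed.
Lemma IOD f g : Ck 0 V f -> Ck 0 V g -> IO (fun x => f x + g x) = IO f + IO g.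
Proof. by move=> fC gC; apply: (pfD (@pf_IO R k)); exact: Ck0_K0. Qed.
Lemma IOB f g : Ck 0 V f -> Ck 0 V g -> IO (fun x => f x - g x) = IO f - IO g.
Proof. by move=> fC gC; apply: (pfB (@pf_IO R k)); exact: Ck0_K0. Qed.
Lemma IOZ a f : Ck 0 V f -> IO (fun x => a * f x) = a * IO f.
Proof. by move=> fC; apply: (pfZ (@pf_IO R k)); exact: Ck0_K0. Qed.
Lemma IOle f g : Ck 0 V f -> Ck 0 V g -> (forall x, Om x -> f x <= g x) -> IO f <= IO g.
Proof.
move=> fC gC e; apply: (pf_le (@pf_IO R k)); [exact: Ck0_K0|exact: Ck0_K0|].
by move=> x /K0_Om; exact: e.
Qed.
Lemma IOge0 f : Ck 0 V f -> (forall x, Om x -> 0 <= f x) -> 0 <= IO f.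
Proof.
move=> fC e; apply: (pf_ge0 (@pf_IO R k)); first exact: Ck0_K0.
by move=> x /K0_Om; exact: e.
Qed.

Lemma IBeq f g : Ck 0 V f -> Ck 0 V g -> (forall x, bdK x -> f x = g x) -> IBd f = IBd g.
Proof. by move=> fC gC e; apply: (pf_eq pf_IBd) => //; exact: Ck0_bdK. Qed.
Lemma IBD f g : Ck 0 V f -> Ck 0 V g -> IBd (fun x => f x + g x) = IBd f + IBd g.
Proof. by move=> fC gC; apply: (pfD pf_IBd); exact: Ck0_bdK. Qed.
Lemma IBZ a f : Ck 0 V f -> IBd (fun x => a * f x) = a * IBd f.
Proof. by move=> fC; apply: (pfZ pf_IBd); exact: Ck0_bdK. Qed.
Lemma IBle f g : Ck 0 V f -> Ck 0 V g -> (forall x, bdK x -> f x <= g x) -> IBd f <= IBd g.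
Proof. by move=> fC gC e; apply: (pf_le pf_IBd) => //; exact: Ck0_bdK. Qed.
Lemma IBge0 f : Ck 0 V f -> (forall x, bdK x -> 0 <= f x) -> 0 <= IBd f.
Proof. by move=> fC e; apply: (pf_ge0 pf_IBd) => //; exact: Ck0_bdK. Qed.

Lemma bounded_K0 f : Ck 0 V f -> exists2 C, 0 <= C & forall x, @K0 R k x -> `|f x| <= C.
Proof. by move=> fC; apply: cont_bounded; [exact: K0_compact|exact: Ck0_K0]. Qed.

Lemma bdK_compact : compact bdK.
Proof.
apply: continuous_compact; last exact: K1_compact.
by apply: continuous_in_subspaceT => x _; exact: bd_incl_cont.
Qed.

Lemma bounded_bdK f : Ck 0 V f -> exists2 C, 0 <= C & forall x, bdK x -> `|f x| <= C.
Proof. by move=> fC; apply: cont_bounded; [exact: bdK_compact|exact: Ck0_bdK]. Qed.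

Lemma big_ord_n (T : nmodType) (F : 'I_n -> T) :
  \sum_i F i = F ord0 + (F (lift ord0 ord0) + \sum_(j < k) F (lift ord0 (lift ord0 j))).
Proof. by rewrite 2!big_ord_recl. Qed.

Lemma div_Om (F : 'I_n -> 'rV[R]_n -> R) : (forall i, Ck 1 V (F i)) -> (forall i, per (F i)) ->
  IO (fun x => \sum_i pd i (F i) x) = IBd (fun x => x 0 ord0 * F ord0 x + x 0 (lift ord0 ord0) * F (lift ord0 ord0) x).
Proof.
move=> FC Fp; rewrite (div_thm oV VK0 FC); last first.
  by move=> j q bq _; apply: Fp => //; exact: solid_torus_polar.
by rewrite IBdE; congr IB; apply/funext => p; congr (_ * _ + _ * _); rewrite mxE.
Qed.

Lemma div_ip p q (psi : 'rV[R]_n -> 'M[R]_(p, q)) (W : 'I_n -> 'rV[R]_n -> 'M[R]_(p, q)) :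
  mCk V 1 psi -> per psi -> (forall i, mCk V 1 (W i)) -> (forall i, per (W i)) ->
  IO (fun x => \sum_i (ip (mpd i psi x) (W i x) + ip (psi x) (mpd i (W i) x))) =
  IBd (fun x => ip (psi x) (x 0 ord0 *: W ord0 x + x 0 (lift ord0 ord0) *: W (lift ord0 ord0) x)).
Proof.
move=> pC pp WC Wp.
have e : IO (fun x => \sum_i pd i (fun x => ip (psi x) (W i x)) x) =
   IBd (fun x => x 0 ord0 * ip (psi x) (W ord0 x) + x 0 (lift ord0 ord0) * ip (psi x) (W (lift ord0 ord0) x)).
  apply: (div_Om (F := fun i x => ip (psi x) (W i x))) => i; first exact: Ck_ip.
  by move=> x j Ox j1; rewrite pp // Wp.
transitivity (IO (fun x => \sum_i pd i (fun x => ip (psi x) (W i x)) x)).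
  apply: IOeq => [||x /OV Vx].
  - apply: Ck_sum => // i; apply: (CkD oV (k := 0)); apply: Ck_ip => //; try exact: mCk_mpd; exact: (mCk_le (k := 1)).
  - by apply: Ck_sum => // i; apply: Ck_partial; apply: Ck_ip.
  by apply: eq_bigr => i _; rewrite (pd_ip oV).
rewrite e; congr IBd; apply/funext => x.
by rewrite ipDr !ipZr.
Qed.

End OnV.
End Functionals.

(** * Dirac operators and their integral identities *)

Section Spinor.
Variables (R : realType) (k N : nat).
Local Notation n := k.+2.
Local Notation Om := (@solid_torus R k).
Variables (c : 'I_n -> 'M[R]_N) (J : 'M[R]_N) (H : clifford c J).
Variables (V : set 'rV[R]_n) (oV : open V) (OV : Om `<=` V).
Implicit Types (psi chi : 'rV[R]_n -> 'M[R]_N) (x : 'rV[R]_n).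

Section Frame.
Variable E : 'rV[R]_n -> 'M[R]_n.

(** Clifford multiplication by the coordinate differential dx^i: the entry [E x a i] is the value of
    dx^i on the frame vector e_a, and E^T E is the inverse metric when E is orthonormal. *)
Definition ce (i : 'I_n) x : 'M[R]_N := cl c (col i (E x))^T.
Definition Sc (i j : 'I_n) x : 'M[R]_N := 2^-1 *: (ce i x *m ce j x - ce j x *m ce i x).

Lemma ceE i x : ce i x = \sum_a E x a i *: c a.
Proof. by rewrite /ce /cl; apply: eq_bigr => a _; rewrite !mxE. Qed.

Lemma ceT i x : (ce i x)^T = - ce i x.
Proof. exact: (clT H). Qed.

Lemma ceJ i x : ce i x *m J = - (J *m ce i x).
Proof. exact: (clJ H). Qed.

Lemma ce_mul i j x : ce i x *m ce j x = - (ce j x *m ce i x) - (2 * \sum_a E x a i * E x a j)%:M.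
Proof.
rewrite /ce (cl_mul H); congr (_ - (2 * _)%:M); rewrite mxE; apply: eq_bigr => a _.
by rewrite !mxE.
Qed.

Lemma ScE i j x : Sc i j x = ce i x *m ce j x + (\sum_a E x a i * E x a j)%:M.
Proof.
rewrite /Sc (ce_mul j i x).
have -> : \sum_a E x a j * E x a i = \sum_a E x a i * E x a j by apply: eq_bigr => a _; rewrite mulrC.
rewrite -[(2 * _)%:M]scale_scalar_mx; move: (ce i x *m _) (_%:M) => P Q.
by apply/matrixP => a b; rewrite !mxE; field.
Qed.

Lemma Sc_skew i j x : Sc i j x = - Sc j i x.
Proof. by rewrite /Sc -scalerN opprB. Qed.

Lemma Sc_antisym (X : 'I_n -> 'I_n -> 'M[R]_N) x :
  \sum_i \sum_j Sc i j x *m X i j = 2^-1 *: \sum_i \sum_j Sc i j x *m (X i j - X j i).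
Proof.
have e : \sum_i \sum_j Sc i j x *m X i j = - \sum_i \sum_j Sc i j x *m X j i.
  rewrite exchange_big /= -sumrN; apply: eq_bigr => i _; rewrite -sumrN; apply: eq_bigr => j _.
  by rewrite Sc_skew mulNmx.
have -> : \sum_i \sum_j Sc i j x *m (X i j - X j i) =
   \sum_i \sum_j Sc i j x *m X i j - \sum_i \sum_j Sc i j x *m X j i.
  rewrite -sumrB; apply: eq_bigr => i _; rewrite -sumrB; apply: eq_bigr => j _; exact: mulmxBr.
by rewrite -e; move: (\sum_i _) => P; apply/matrixP => a b; rewrite !mxE; field.
Qed.

(** Because [Sc i j] is c^i c^j plus the scalar g^ij, the form splits into the gradient part and,
    the c^i being skew, minus the Dirac part. *)
Lemma Sc_quad (X Y : 'I_n -> 'M[R]_N) x :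
  \sum_i \sum_j ip (X i) (Sc i j x *m Y j) =
  \sum_a ip (\sum_i E x a i *: X i) (\sum_j E x a j *: Y j) -
  ip (\sum_i ce i x *m X i) (\sum_j ce j x *m Y j).
Proof.
have -> : \sum_a ip (\sum_i E x a i *: X i) (\sum_j E x a j *: Y j) =
   \sum_i \sum_j (\sum_a E x a i * E x a j) * ip (X i) (Y j).
  transitivity (\sum_a \sum_i \sum_j (E x a i * E x a j) * ip (X i) (Y j)).
    apply: eq_bigr => a _; rewrite ip_suml; apply: eq_bigr => i _; rewrite ip_sumr.
    by apply: eq_bigr => j _; rewrite ipZl ipZr mulrA.
  rewrite exchange_big; apply: eq_bigr => i _; rewrite exchange_big; apply: eq_bigr => j _.
  by rewrite mulr_suml.
rewrite ip_suml -sumrB; apply: eq_bigr => i _; rewrite ip_sumr -sumrB; apply: eq_bigr => j _.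
rewrite ScE mulmxDl ipDr mul_scalar_mx ipZr addrC; congr (_ + _).
by rewrite -mulmxA ip_adjr ceT mulNmx ipNl.
Qed.

End Frame.

Section Connection.
Variables (E : 'rV[R]_n -> 'M[R]_n) (rho : 'rV[R]_n -> R) (O : 'I_n -> 'rV[R]_n -> 'M[R]_N).
Hypotheses (EC : mCk V 1 E) (rC : Ck 1 V rho) (OC : forall i, mCk V 1 (O i)).
Hypotheses (Ep : per E) (rp : per rho) (Op : forall i, per (O i)).
Hypotheses (OT : forall i x, Om x -> (O i x)^T = - O i x).
Hypotheses (OJ : forall i x, Om x -> O i x *m J = J *m O i x).

(* [rho] is the volume density, so that [flux] is the normal component of
   [rho 1/2 [c^i, c^j] nab_j chi]; [ZS] and [Zc] vanish when [O] is the spin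
   connection and [rho] its density, and are error terms in general. *)
Definition nab i psi x := mpd i psi x + O i x *m psi x.
Definition dirac_op psi x := \sum_i ce E i x *m nab i psi x.
Definition framed a psi x := \sum_i E x a i *: nab i psi x.
Definition ZS j x := \sum_i (mpd i (fun y => rho y *: Sc E i j y) x +
   rho x *: (O i x *m Sc E i j x - Sc E i j x *m O i x)).
Definition Zc x := \sum_i (mpd i (fun y => rho y *: ce E i y) x +
   rho x *: (O i x *m ce E i x - ce E i x *m O i x)).
Definition curv i j x := mpd i (O j) x - mpd j (O i) x + (O i x *m O j x - O j x *m O i x).
Definition flux chi x := rho x *: \sum_j
   (x 0 ord0 *: Sc E ord0 j x + x 0 (lift ord0 ord0) *: Sc E (lift ord0 ord0) j x) *m nab j chi x.

Lemma mCk_ce q i : mCk V q E -> mCk V q (ce E i).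
Proof.
move=> EC'; apply: (mCk_congr (A := fun x => \sum_a E x a i *: c a) oV).
  by move=> x _; rewrite ceE.
by apply: mCk_sum => // a; apply: mCkZ => //; exact: mCk_cst.
Qed.

Lemma mCk_Sc q i j : mCk V q E -> mCk V q (Sc E i j).
Proof.
move=> EC'; apply: mCkZ => //; first exact: Ck_cst.
by apply: mCkB => //; apply: mCkM => //; exact: mCk_ce.
Qed.

Lemma per_ce i : per (ce E i).
Proof. by move=> x j Ox j1; rewrite /ce Ep. Qed.
Lemma per_Sc i j : per (Sc E i j).
Proof. by move=> x l Ox l1; rewrite /Sc !per_ce. Qed.

Lemma mCk_nab q i psi : mCk V q (O i) -> mCk V q.+1 psi -> mCk V q (nab i psi).
Proof.
move=> OC' pC; apply: mCkD => //; first exact: mCk_mpd.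
by apply: mCkM => //; apply: mCk_le pC.
Qed.

Lemma per_nab i psi : mCk V 1 psi -> per psi -> per (nab i psi).
Proof.
move=> pC pp x j Ox j1; rewrite /nab Op // pp //; congr (_ + _).
exact: (per_mpd i oV OV pC pp).
Qed.

(** The divergence theorem for the field with components rho <psi, 1/2 [c^i, c^j] nab_j chi>.
    Skewness of [O] allows differentiating the inner product covariantly; the skew coefficient lets
    second derivatives of chi survive only through the curvature. The connection is kept general
    because the identity is applied both to the zero connection and to the spin connection. *)
Lemma dirac_identity psi chi : mCk V 1 psi -> mCk V 2 chi -> per psi -> per chi ->
  IO (fun x => rho x * (\sum_a ip (framed a psi x) (framed a chi x) - ip (dirac_op psi x) (dirac_op chi x))
      + ip (psi x) (\sum_j ZS j x *m nab j chi x)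
      + rho x * ip (psi x) (2^-1 *: (\sum_i \sum_j Sc E i j x *m curv i j x) *m chi x)) =
  IBd (fun x => ip (psi x) (flux chi x)).
Proof.
move=> pC cC pp cp.
have cC1 : mCk V 1 chi by apply: mCk_le cC.
pose W i x := rho x *: \sum_j Sc E i j x *m nab j chi x.
have WC i : mCk V 1 (W i).
  apply: mCkZ => //; apply: mCk_sum => // j; apply: mCkM => //; [exact: mCk_Sc|exact: mCk_nab].
have Wp i : per (W i).
  move=> x j Ox j1; rewrite /W rp //; congr (_ *: _); apply: eq_bigr => l _.
  by rewrite per_Sc // per_nab.
have := div_ip oV OV pC pp WC Wp.
have -> : IBd (fun x => ip (psi x) (x 0 ord0 *: W ord0 x + x 0 (lift ord0 ord0) *: W (lift ord0 ord0) x)) =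
   IBd (fun x => ip (psi x) (flux chi x)).
  congr IBd; apply/funext => x; congr ip; rewrite /W /flux.
  rewrite !scalerA ![_ * rho x]mulrC -!scalerA -scalerDr; congr (_ *: _).
  rewrite !scaler_sumr -big_split; apply: eq_bigr => j _.
  by rewrite /= mulmxDl !scalemxAl.
move=> <-; apply: (IOeq OV).
- have C0 : forall p q (A : 'rV[R]_n -> 'M[R]_(p, q)), mCk V 1 A -> mCk V 0 A by move=> p q A; exact: mCk_le.
  have E0 := C0 _ _ _ EC; have O0 i := C0 _ _ _ (OC i); have r0 : Ck 0 V rho by apply: Ck_le rC.
  have n0 i psi' : mCk V 1 psi' -> mCk V 0 (nab i psi') by move=> ?; apply: mCk_nab.
  have f0 a psi' : mCk V 1 psi' -> mCk V 0 (framed a psi').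
    by move=> pC'; apply: mCk_sum => // i; apply: mCkZ => //; exact: n0.
  have d0 psi' : mCk V 1 psi' -> mCk V 0 (dirac_op psi').
    by move=> pC'; apply: mCk_sum => // i; apply: mCkM => //; [exact: mCk_ce|exact: n0].
  have S0 i j : mCk V 0 (Sc E i j) by apply: mCk_Sc.
  apply: (CkD oV (k := 0)); [apply: (CkD oV (k := 0))|].
  + apply: (CkM oV r0); apply: (CkB oV (k := 0)); last by apply: Ck_ip => //; exact: d0.
    by apply: Ck_sum => // a; apply: Ck_ip => //; exact: f0.
  + apply: Ck_ip => //; first exact: C0.
    apply: mCk_sum => // j; apply: mCkM => //; last exact: n0.
    apply: mCk_sum => // i; apply: mCkD => //.
      by apply: mCk_mpd => //; apply: mCkZ => //; exact: mCk_Sc.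
    by apply: mCkZ => //; apply: mCkB => //; apply: mCkM.
  + apply: (CkM oV r0); apply: Ck_ip => //; first exact: C0.
    apply: mCkM => //; last exact: C0.
    apply: mCkZ => //; first exact: Ck_cst.
    apply: mCk_sum => // i; apply: mCk_sum => // j; apply: mCkM => //.
    apply: mCkD => //; first by apply: mCkB => //; exact: mCk_mpd.
    by apply: mCkB => //; apply: mCkM.
- apply: Ck_sum => // i; apply: (CkD oV (k := 0)); apply: Ck_ip => //; try exact: mCk_mpd; exact: (mCk_le (k := 1)).
move=> x Ox; have Vx := OV Ox.
have WE i : mpd i (W i) x = \sum_j (mpd i (fun y => rho y *: Sc E i j y) x *m nab j chi x +
    rho x *: (Sc E i j x *m (mpd i (mpd j chi) x + (mpd i (O j) x *m chi x + O j x *m mpd i chi x)))).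
  have -> : W i = fun y => \sum_j (rho y *: Sc E i j y) *m nab j chi y.
    by apply/funext => y; rewrite /W scaler_sumr; apply: eq_bigr => j _; rewrite scalemxAl.
  have SC j : mCk V 1 (fun y => rho y *: Sc E i j y) by apply: mCkZ => //; exact: mCk_Sc.
  have nC j : mCk V 1 (nab j chi) by apply: mCk_nab.
  rewrite (mpd_sum oV Vx) => [|j]; last by apply: mCkM.
  apply: eq_bigr => j _; rewrite (mpdM oV Vx) // -scalemxAl; congr (_ + _ *: (_ *m _)).
  rewrite /nab (mpdD oV Vx) //; first by rewrite (mpdM oV Vx).
    exact: mCk_mpd.
  exact: mCkM.
have nabE i psi' : mpd i psi' x = nab i psi' x - O i x *m psi' x by rewrite /nab addrK.
transitivity (\sum_i (ip (nab i psi x) (W i x) + ip (psi x) (mpd i (W i) x + O i x *m W i x))); last first.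
  apply: eq_bigr => i _; rewrite [mpd i psi x]nabE ipBl ipDr ip_adjl OT // mulNmx ipNr.
  by rewrite opprK -addrA [ip _ (O i x *m _) + _]addrC.
rewrite big_split /= -ip_sumr.
have -> : \sum_i ip (nab i psi x) (W i x) = rho x * (\sum_a ip (framed a psi x) (framed a chi x) - ip (dirac_op psi x) (dirac_op chi x)).
  rewrite /framed /dirac_op -(Sc_quad E (fun i => nab i psi x) (fun i => nab i chi x)) mulr_sumr.
  apply: eq_bigr => i _; rewrite /W ipZr ip_sumr; congr (_ * _).
rewrite -addrA; congr (_ + _); rewrite -ipZr -ipDr; congr ip.
transitivity (\sum_j ZS j x *m nab j chi x + rho x *: (\sum_i \sum_j Sc E i j x *m
   (mpd i (mpd j chi) x + mpd i (O j) x *m chi x + O j x *m mpd i chi x + O i x *m nab j chi x))).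
  congr (_ + rho x *: _); rewrite Sc_antisym -scalemxAl; congr (_ *: _).
  rewrite mulmx_suml; apply: eq_bigr => i _; rewrite mulmx_suml; apply: eq_bigr => j _.
  rewrite -mulmxA; congr (_ *m _); rewrite /curv (mpd_sym oV Vx i j cC) // /nab.
  rewrite !mulmxDl !mulNmx !mulmxDr !mulmxA.
  move: (mpd j (mpd i chi) x) (mpd i (O j) x *m _) (mpd j (O i) x *m _) (O i x *m mpd j chi x)
    (O j x *m mpd i chi x) (O i x *m O j x *m _) (O j x *m O i x *m _) => a1 a2 a3 a4 a5 a6 a7.
  by apply/matrixP => u v; rewrite !mxE; ring.
rewrite /ZS; under eq_bigr do rewrite mulmx_suml.
rewrite exchange_big /= scaler_sumr -big_split; apply: eq_bigr => i _ /=.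
rewrite WE /W -scalemxAr mulmx_sumr !scaler_sumr -!big_split; apply: eq_bigr => j _ /=.
rewrite mulmxDl -[(rho x *: (_ - _)) *m _]scalemxAl [(O i x *m _ - _) *m _]mulmxBl [rho x *: (_ - _)]scalerBr
  !mulmxDr !scalerDr !mulmxA.
move: (mpd i (fun _ => _) x *m _) (rho x *: (O i x *m _ *m _)) (rho x *: (Sc E i j x *m O i x *m _))
  (rho x *: (Sc E i j x *m mpd i (mpd j chi) x)) (rho x *: (Sc E i j x *m mpd i (O j) x *m _))
  (rho x *: (Sc E i j x *m O j x *m _)) => a1 a2 a3 a4 a5 a6.
by apply/matrixP => u v; rewrite !mxE; ring.
Qed.

(** The divergence theorem for the field - rho <psi, c^i J psi>. As c^i and J anticommute, c^i J is
    symmetric, so the derivatives of the two factors contribute equally; hence the factor 2. *)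
Lemma diracJ_identity psi : mCk V 1 psi -> per psi ->
  IO (fun x => 2 * (rho x * ip (dirac_op psi x) (J *m psi x)) - ip (psi x) (Zc x *m (J *m psi x))) =
  IBd (fun x => - (rho x * ip (psi x) ((x 0 ord0 *: ce E ord0 x + x 0 (lift ord0 ord0) *: ce E (lift ord0 ord0) x)
       *m (J *m psi x)))).
Proof.
move=> pC pp.
pose W i x := - ((rho x *: ce E i x) *m (J *m psi x)).
have rcC i : mCk V 1 (fun x => rho x *: ce E i x) by apply: mCkZ => //; exact: mCk_ce.
have JpC : mCk V 1 (fun x => J *m psi x) by apply: mCkM => //; exact: mCk_cst.
have WC i : mCk V 1 (W i) by apply: mCkN => //; apply: mCkM.
have Wp i : per (W i) by move=> x j Ox j1; rewrite /W rp // per_ce // pp.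
have := div_ip oV OV pC pp WC Wp.
have -> : IBd (fun x => ip (psi x) (x 0 ord0 *: W ord0 x + x 0 (lift ord0 ord0) *: W (lift ord0 ord0) x)) =
   IBd (fun x => - (rho x * ip (psi x) ((x 0 ord0 *: ce E ord0 x + x 0 (lift ord0 ord0) *: ce E (lift ord0 ord0) x)
       *m (J *m psi x)))).
  congr IBd; apply/funext => x; rewrite -ipZr -ipNr; congr ip; rewrite /W.
  by rewrite !scalerN -opprD -!scalemxAl mulmxDl -!scalemxAl scalerDr !scalerA ![rho x * _]mulrC.
move=> <-; apply: (IOeq OV).
- have C0 : forall p q (A : 'rV[R]_n -> 'M[R]_(p, q)), mCk V 1 A -> mCk V 0 A by move=> p q A; exact: mCk_le.
  have E0 := C0 _ _ _ EC; have O0 i := C0 _ _ _ (OC i); have r0 : Ck 0 V rho by apply: Ck_le rC.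
  have d0 : mCk V 0 (dirac_op psi).
    by apply: mCk_sum => // i; apply: mCkM => //; [exact: mCk_ce|exact: mCk_nab].
  apply: (CkB oV (k := 0)).
    apply: (CkM oV (Ck_cst V 0 2)); apply: (CkM oV r0); apply: Ck_ip => //; exact: C0.
  apply: Ck_ip => //; first exact: C0.
  apply: mCkM => //; last exact: C0.
  apply: mCk_sum => // i; apply: mCkD => //; first exact: mCk_mpd.
  by apply: mCkZ => //; apply: mCkB => //; apply: mCkM => //; exact: mCk_ce.
- apply: Ck_sum => // i; apply: (CkD oV (k := 0)); apply: Ck_ip => //; try exact: mCk_mpd; exact: (mCk_le (k := 1)).
move=> x Ox; have Vx := OV Ox.
have nabE i psi' : mpd i psi' x = nab i psi' x - O i x *m psi' x by rewrite /nab addrK.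
rewrite /Zc /dirac_op mulmx_suml ip_sumr ip_suml mulrA mulr_sumr -sumrB; apply: eq_bigr => i _.
have -> : mpd i (W i) x = - (mpd i (fun y => rho y *: ce E i y) x *m (J *m psi x) +
    rho x *: (ce E i x *m (J *m mpd i psi x))).
  rewrite /W (mpdN oV Vx); last exact: mCkM.
  by rewrite (mpdM oV Vx) // (mpdM oV Vx i (mCk_cst V 1 J) pC) mpd_cst mul0mx add0r -scalemxAl.
rewrite !(nabE i psi) /W -scalemxAl mulmxDl -[(rho x *: _) *m _]scalemxAl mulmxBl !mulmxBr !ipNr !ipDr !ipZr !ipBr !ipBl.
have t1 : ip (nab i psi x) (ce E i x *m (J *m psi x)) = - ip (ce E i x *m nab i psi x) (J *m psi x).
  by rewrite ip_adjl ceT mulNmx ipNr opprK.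
have t2 : ip (psi x) (ce E i x *m (J *m nab i psi x)) = - ip (ce E i x *m nab i psi x) (J *m psi x).
  by rewrite mulmxA ceJ mulNmx ipNr -mulmxA ip_adjr (J_sym H) ipC.
have t3 : ip (O i x *m psi x) (ce E i x *m (J *m psi x)) = - ip (psi x) (O i x *m ce E i x *m (J *m psi x)).
  by rewrite ip_adjl OT // mulNmx ipNr !mulmxA.
have t4 : ip (psi x) (ce E i x *m (J *m (O i x *m psi x))) = ip (psi x) (ce E i x *m O i x *m (J *m psi x)).
  by rewrite !mulmxA -[_ *m J *m O i x]mulmxA -OJ // mulmxA.
rewrite t1 t2 t3 t4; ring.
Qed.

End Connection.
End Spinor.

Lemma nsq_sum_le (R : realType) p q n (Y : 'I_n -> 'M[R]_(p, q)) :
  nsq (\sum_a Y a) <= n%:R * \sum_a nsq (Y a).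
Proof.
have e : \sum_a \sum_b (nsq (Y a) + nsq (Y b)) / 2 = n%:R * \sum_a nsq (Y a).
  transitivity (\sum_a (n%:R * nsq (Y a) + \sum_b nsq (Y b)) / 2).
    apply: eq_bigr => a _; rewrite -mulr_suml big_split /= sumr_const card_ord.
    by rewrite mulr_natl.
  rewrite -mulr_suml big_split /= sumr_const card_ord -mulr_sumr -mulr_natl; by field.
rewrite -e ip_suml; apply: ler_sum => a _; rewrite ip_sumr; apply: ler_sum => b _.
have := @ip_agm R p q 1 (Y a) (Y b) ltr01; rewrite invr1 !mul1r; lra.
Qed.

(** * Derivatives of functions restricted to the boundary *)

Section BoundaryCalculus.
Variables (R : realType) (k : nat).
Local Notation n := k.+2.
Local Notation Om := (@solid_torus R k).
Variables (V : set 'rV[R]_n) (oV : open V) (OV : Om `<=` V).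

Lemma is_derive_bd (p : 'rV[R]_k.+1) (a : 'I_k.+1) (i : 'I_n) :
  is_derive p 'e_a (fun p => bd_incl p 0 i)
   (if i == ord0 then (a == ord0)%:R * - sin (p 0 0)
    else if i == lift ord0 ord0 then (a == ord0)%:R * cos (p 0 0) else (lift ord0 a == i)%:R).
Proof.
have ct := is_derive_coord p ('e_a : 'rV[R]_k.+1) 0.
have ea (j : 'I_k.+1) : ('e_a : 'rV[R]_k.+1) 0 j = (a == j)%:R by rewrite mxE eqxx eq_sym.
case: (lift2E i) => [->|->|[j ->]] /=.
- have -> : (fun z : 'rV[R]_k.+1 => bd_incl z 0 ord0) = (fun z => cos (z 0 0)).
    by apply/funext => z; rewrite mxE.
  have := is_derive_compR ct (is_derive_cos (p 0 0)); rewrite ea mulrC; exact.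
- have -> : (fun z : 'rV[R]_k.+1 => bd_incl z 0 (lift ord0 ord0)) = (fun z => sin (z 0 0)).
    by apply/funext => z; rewrite mxE.
  have := is_derive_compR ct (is_derive_sin (p 0 0)); rewrite ea mulrC; exact.
have -> : (fun z : 'rV[R]_k.+1 => bd_incl z 0 (lift ord0 (lift ord0 j))) = (fun z => z 0 (lift ord0 j)).
  by apply/funext => z; rewrite mxE /=; congr (z 0 _); apply: val_inj; rewrite /= inordK // ltnS ltn_ord.
by have := is_derive_coord p ('e_a : 'rV[R]_k.+1) (lift ord0 j); rewrite ea (inj_eq lift_inj).
Qed.

Lemma is_derive_on_bd (f : 'rV[R]_n -> R) p (a : 'I_k.+1) : Ck 1 V f ->
  is_derive p 'e_a (fun p => f (bd_incl p))
    (\sum_i (if i == ord0 then (a == ord0)%:R * - sin (p 0 0)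
    else if i == lift ord0 ord0 then (a == ord0)%:R * cos (p 0 0) else (lift ord0 a == i)%:R) * pd i f (bd_incl p)).
Proof.
move=> fC; apply: (is_derive_chainE oV fC) => [|i]; first by apply: OV; exact: bd_Om.
exact: is_derive_bd.
Qed.

Lemma pd_bd_th (f : 'rV[R]_n -> R) p : Ck 1 V f ->
  pd ord0 (fun p => f (bd_incl p)) p =
  - sin (p 0 0) * pd ord0 f (bd_incl p) + cos (p 0 0) * pd (lift ord0 ord0) f (bd_incl p).
Proof.
move=> fC; have := pd_val (is_derive_on_bd p ord0 fC); rewrite big_ord_n => ->.
rewrite !eqxx /= !mul1r addrA big1 ?addr0 // => j _.
by rewrite mul0r.
Qed.

Lemma pd_bd_t (f : 'rV[R]_n -> R) p (j : 'I_k) : Ck 1 V f ->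
  pd (lift ord0 j) (fun p => f (bd_incl p)) p = pd (lift ord0 (lift ord0 j)) f (bd_incl p).
Proof.
move=> fC; have := pd_val (is_derive_on_bd p (lift ord0 j) fC); rewrite big_ord_n => ->.
rewrite !eqxx /= !mul0r !add0r (bigD1 j) //= eqxx mul1r big1 ?addr0 // => l lj.
by rewrite !(inj_eq lift_inj) eq_sym (negPf lj) mul0r.
Qed.

Lemma mpd_bd_th p q (A : 'rV[R]_n -> 'M[R]_(p, q)) t : mCk V 1 A ->
  mpd ord0 (fun p => A (bd_incl p)) t =
  - sin (t 0 0) *: mpd ord0 A (bd_incl t) + cos (t 0 0) *: mpd (lift ord0 ord0) A (bd_incl t).
Proof. by move=> AC; apply/matrixP => a b; rewrite ?(mpdE, mxE) (pd_bd_th t (AC a b)). Qed.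

Lemma mpd_bd_t p q (A : 'rV[R]_n -> 'M[R]_(p, q)) t (j : 'I_k) : mCk V 1 A ->
  mpd (lift ord0 j) (fun p => A (bd_incl p)) t = mpd (lift ord0 (lift ord0 j)) A (bd_incl t).
Proof. by move=> AC; apply/matrixP => a b; rewrite ?(mpdE, mxE) (pd_bd_t t j (AC a b)). Qed.

End BoundaryCalculus.

(** * The boundary condition and the trace inequality *)

Section Spinor.
Variables (R : realType) (k N : nat).
Local Notation n := k.+2.
Local Notation Om := (@solid_torus R k).
Variables (c : 'I_n -> 'M[R]_N) (J : 'M[R]_N) (H : clifford c J).
Variables (V : set 'rV[R]_n) (oV : open V) (OV : Om `<=` V).
Implicit Types (psi chi f g : 'rV[R]_n -> 'M[R]_N) (x : 'rV[R]_n).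
Local Notation o1 := (lift ord0 ord0).

Definition nn x : 'rV[R]_n := x 0 ord0 *: 'e_ord0 + x 0 o1 *: 'e_o1.
Definition tau x : 'rV[R]_n := - x 0 o1 *: 'e_ord0 + x 0 ord0 *: 'e_o1.
Definition beta x : 'M[R]_N := cl c (nn x) *m J.
Definition bdc psi := forall p, beta (bd_incl p) *m psi (bd_incl p) = psi (bd_incl p).
Definition Sp psi := [/\ mCk V 2 psi, per psi & bdc psi].
(** The squared L^2 norm for the flat measure, which stays fixed while frames and operators vary;
    squares avoid roots in all estimates. *)
Definition nf f := IO (fun x => nsq (f x)).
Definition gradN psi := IO (fun x => \sum_i nsq (mpd i psi x)).
Definition cC f := mCk V 0 f /\ per f.

Lemma nnE x a : nn x 0 a = if a == ord0 then x 0 ord0 else if a == o1 then x 0 o1 else 0.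
Proof.
rewrite !mxE /=; have [->|a0] := eqVneq a ord0; first by rewrite mulr1 mulr0 addr0.
by case: eqP => _; rewrite ?mulr1 ?mulr0 ?addr0 ?add0r.
Qed.

Lemma nn_sq x : (nn x *m (nn x)^T) 0 0 = x 0 ord0 ^+ 2 + x 0 o1 ^+ 2.
Proof.
rewrite mxE (eq_bigr (fun i => nn x 0 i ^+ 2)) => [|i _]; last by rewrite [X in _ * X]mxE expr2.
rewrite big_ord_n !nnE /= big1 ?addr0 // => j _.
by rewrite nnE /= expr0n.
Qed.

Lemma mCk_cl q (v : 'rV[R]_n -> 'rV[R]_n) : mCk V q v -> mCk V q (fun x => cl c (v x)).
Proof. by move=> vC; apply: mCk_sum => // a; apply: mCkZ => //; exact: mCk_cst. Qed.

Lemma mCk_nn q : mCk V q nn.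
Proof. by apply: mCkD => //; apply: mCkZ => //; try exact: Ck_coord; exact: mCk_cst. Qed.
Lemma mCk_tau q : mCk V q tau.
Proof.
apply: mCkD => //; apply: mCkZ => //; try exact: mCk_cst; last exact: Ck_coord.
by apply: CkN => //; exact: Ck_coord.
Qed.
Lemma mCk_beta q : mCk V q beta.
Proof. by apply: mCkM => //; [apply: mCk_cl; exact: mCk_nn|exact: mCk_cst]. Qed.

Lemma cln_sq p : cl c (nn (bd_incl p)) *m cl c (nn (bd_incl p)) = (- 1)%:M.
Proof. by rewrite (cl_sq H) nn_sq bd_circle. Qed.

Lemma betaT x : (beta x)^T = beta x.
Proof. by rewrite /beta trmx_mul (J_sym H) (clT H) mulmxN -(clJ H). Qed.

Lemma beta_sq p : beta (bd_incl p) *m beta (bd_incl p) = 1%:M.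
Proof.
rewrite /beta {1}(clJ H) mulNmx -mulmxA [cl c _ *m (_ *m J)]mulmxA cln_sq mul_scalar_mx -scalemxAr (J_sq H).
by rewrite scaleN1r opprK.
Qed.

Lemma clclJ (u v : 'rV[R]_n) : cl c u *m cl c v *m J = J *m (cl c u *m cl c v).
Proof.
rewrite -[LHS]mulmxA.
rewrite (clJ H v) mulmxN.
by rewrite [in LHS]mulmxA (clJ H u) mulNmx opprK mulmxA.
Qed.

Lemma beta_anti p (v : 'rV[R]_n) :
  let X := cl c (nn (bd_incl p)) *m cl c v - cl c v *m cl c (nn (bd_incl p)) in
  X *m beta (bd_incl p) = - (beta (bd_incl p) *m X).
Proof.
move=> X; set g := cl c (nn _) in X *; set Y := cl c v in X *.
have XJ : J *m X = X *m J by rewrite /X mulmxBr mulmxBl /g /Y -!clclJ.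
have g2 : g *m g = (- 1)%:M by exact: cln_sq.
have e : X *m g = - (g *m X).
  rewrite /X mulmxBl mulmxBr opprB !mulmxA g2 -[Y *m g *m g]mulmxA g2 mul_scalar_mx mul_mx_scalar.
  by rewrite addrC.
by rewrite /beta -/g mulmxA e mulNmx -!mulmxA XJ.
Qed.

(** X exchanges the eigenspaces of b, so <p, X d> sees only the component of d in the eigenspace
    opposite to that of p. That component is not free: differentiating b p = s p gives b d + K p = s
    d, which expresses it by K p. *)
Lemma beta_flux (b X K p d : 'M[R]_N) s : b^T = b -> s * s = 1 -> b *m p = s *: p ->
  X *m b = - (b *m X) -> b *m d + K *m p = s *: d ->
  2 * ip p (X *m d) = s * ip p (X *m (K *m p)).
Proof.
move=> bT s2 bp Xb bd.
have e : s * ip p (X *m d) = ip p (X *m b *m d) + ip p (X *m (K *m p)).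
  by rewrite -mulmxA -ipDr -mulmxDr bd -scalemxAr ipZr.
have e1 : ip p (X *m b *m d) = - (s * ip p (X *m d)).
  by rewrite Xb mulNmx ipNr -mulmxA [ip p (b *m _)]ip_adjr bT bp ipZl.
by have -> : ip p (X *m (K *m p)) = 2 * (s * ip p (X *m d)); [lra|rewrite -[LHS]mul1r -s2; ring].
Qed.

Lemma betaE x : beta x = x 0 ord0 *: (c ord0 *m J) + x 0 o1 *: (c o1 *m J).
Proof. by rewrite /beta /nn clD !clZ !cl_e mulmxDl !scalemxAl. Qed.

Lemma mpd_beta i x : V x -> mpd i beta x = (i == ord0)%:R *: (c ord0 *m J) + (i == o1)%:R *: (c o1 *m J).
Proof.
move=> Vx; have cs (A : 'M[R]_N) : mCk V 1 (fun=> A) by exact: mCk_cst.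
rewrite (mpd_congr (B := fun x => x 0 ord0 *: (c ord0 *m J) + x 0 o1 *: (c o1 *m J)) oV) //; last first.
  by move=> y _; exact: betaE.
have xc j : Ck 1 V (fun x : 'rV[R]_n => x 0 j) by exact: Ck_coord.
rewrite (mpdD oV Vx); [|exact: mCkZ|exact: mCkZ].
rewrite !(mpdZ oV Vx) // !mpd_cst !scaler0 !addr0.
by rewrite !partial_coord.
Qed.

(** The boundary condition can be differentiated in tangential directions. The derivative of beta
    along the circle is c(tau) J, while beta does not depend on the torus coordinates. *)
Lemma bdc_tangent psi p : mCk V 1 psi -> bdc psi ->
  let x := bd_incl p in
  beta x *m (- x 0 o1 *: mpd ord0 psi x + x 0 ord0 *: mpd o1 psi x) + cl c (tau x) *m J *m psi x =
     - x 0 o1 *: mpd ord0 psi x + x 0 ord0 *: mpd o1 psi x /\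
  forall j, beta x *m mpd (lift ord0 (lift ord0 j)) psi x = mpd (lift ord0 (lift ord0 j)) psi x.
Proof.
move=> pC bp x; have Vx : V x by apply: OV; exact: bd_Om.
pose F y := beta y *m psi y - psi y.
have bpC : mCk V 1 (fun y => beta y *m psi y) by apply: mCkM => //; exact: mCk_beta.
have FC : mCk V 1 F by apply: mCkB.
have F0 a : mpd a (fun q => F (bd_incl q)) p = 0.
  have -> : (fun q => F (bd_incl q)) = fun=> 0 by apply/funext => q; rewrite /F bp subrr.
  by rewrite mpd_cst.
have FE i : mpd i F x = beta x *m mpd i psi x - mpd i psi x + ((i == ord0)%:R *: (c ord0 *m J) + (i == o1)%:R *: (c o1 *m J)) *m psi x.
  rewrite /F (mpdB oV Vx) // (mpdM oV Vx) //; last exact: mCk_beta.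
  by rewrite mpd_beta // -addrA addrC.
have sE : sin (p 0 0) = x 0 o1 by rewrite mxE.
have cE : cos (p 0 0) = x 0 ord0 by rewrite mxE.
split=> [|j].
  have := F0 ord0; rewrite (mpd_bd_th oV OV) // sE cE !FE /= !scale1r !scale0r !add0r !addr0 => e.
  apply/eqP; rewrite -subr_eq0; apply/eqP; rewrite -[RHS]e /tau clD !clZ !cl_e.
  rewrite !mulmxDl !mulmxDr -!scalemxAl -!scalemxAr !scalerDr !scalerN.
  move: (_ *: (beta x *m mpd ord0 psi x)) (_ *: (beta x *m mpd o1 psi x)) (_ *: mpd ord0 psi x)
   (_ *: mpd o1 psi x) (_ *: (c ord0 *m J *m psi x)) (_ *: (c o1 *m J *m psi x)) => a1 a2 a3 a4 a5 a6.
  by apply/matrixP => a b; rewrite !mxE; ring.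
have := F0 (lift ord0 j); rewrite (mpd_bd_t oV OV) // FE /= !scale0r addr0 mul0mx addr0.
by move/eqP; rewrite subr_eq0 => /eqP.
Qed.

Lemma IOleK (f g : 'rV[R]_n -> R) : Ck 0 V f -> Ck 0 V g -> (forall x, @K0 R k x -> f x <= g x) -> IO f <= IO g.
Proof. by move=> fC gC e; apply: (pf_le (@pf_IO R k)) => //; apply: (Ck0_K0 OV). Qed.

Lemma Ck_nsq f : mCk V 0 f -> Ck 0 V (fun x => nsq (f x)).
Proof. by move=> fC; exact: Ck_ip. Qed.

Lemma nf_ge0 f : mCk V 0 f -> 0 <= nf f.
Proof. by move=> fC; apply: (IOge0 OV) => [|x _]; [exact: Ck_nsq|exact: ip_ge0]. Qed.

Lemma nf_congr f g : mCk V 0 f -> mCk V 0 g -> (forall x, Om x -> f x = g x) -> nf f = nf g.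
Proof. by move=> fC gC e; apply: (IOeq OV) => [||x Ox]; [exact: Ck_nsq|exact: Ck_nsq|rewrite e]. Qed.

Lemma nfD f g : mCk V 0 f -> mCk V 0 g -> nf (fun x => f x + g x) <= 2 * nf f + 2 * nf g.
Proof.
move=> fC gC; have f2 := Ck_nsq fC; have g2 := Ck_nsq gC.
have c2 : Ck 0 V (fun=> 2) by exact: Ck_cst.
rewrite /nf.
rewrite -(IOZ OV 2 f2).
rewrite -(IOZ OV 2 g2).
have h1 := CkM oV c2 f2.
have h2 := CkM oV c2 g2.
have h3 := IOD OV h1 h2.
rewrite -h3.
apply: (IOle OV) => [||x _]; [by apply: Ck_nsq; apply: mCkD| |exact: ip_norm2D].
by apply: (CkD oV); [exact: (CkM oV c2 f2)|exact: (CkM oV c2 g2)].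
Qed.

Lemma nfZ a f : mCk V 0 f -> nf (fun x => a *: f x) = a ^+ 2 * nf f.
Proof.
move=> fC; rewrite -(IOZ OV); last exact: Ck_nsq.
by congr IO; apply/funext => x; rewrite ipZl ipZr mulrA.
Qed.

Lemma nfN f : mCk V 0 f -> nf (fun x => - f x) = nf f.
Proof. by move=> fC; congr IO; apply/funext => x; rewrite ipNl ipNr opprK. Qed.

Lemma nfB f g : mCk V 0 f -> mCk V 0 g -> nf (fun x => f x - g x) <= 2 * nf f + 2 * nf g.
Proof. by move=> fC gC; rewrite -(nfN gC); apply: nfD => //; exact: mCkN. Qed.

Lemma nf_mul (M : 'rV[R]_n -> 'M[R]_N) : mCk V 0 M ->
  exists2 C, 0 <= C & forall f, mCk V 0 f -> nf (fun x => M x *m f x) <= C * nf f.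
Proof.
move=> MC; have [C C0 HC] := bounded_K0 OV (Ck_nsq MC).
exists C => // f fC; rewrite -(IOZ OV); last exact: Ck_nsq.
apply: IOleK => [||x Kx]; first by apply: Ck_nsq; apply: mCkM.
  by apply: (CkM oV); [exact: Ck_cst|exact: Ck_nsq].
apply: (le_trans (ip_mul_le _ _)); apply: ler_wpM2r; first exact: ip_ge0.
exact: (le_trans (ler_norm _) (HC x Kx)).
Qed.

Definition pos2 (i : 'I_n) x : R := if i == ord0 then x 0 ord0 else if i == o1 then x 0 o1 else 0.

(** The divergence theorem for |psi|^2 times the radial field (x, y, 0), whose divergence is 2 and
    which is the unit normal on the boundary. *)
Lemma trace_identity psi : mCk V 1 psi -> per psi ->
  IBd (fun x => nsq (psi x)) =
  IO (fun x => 2 * nsq (psi x) + 2 * \sum_i pos2 i x * ip (psi x) (mpd i psi x)).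
Proof.
move=> pC pp.
have pos2C i q : Ck q V (pos2 i).
  rewrite /pos2; case: (i == ord0); first exact: Ck_coord.
  by case: (i == o1); [exact: Ck_coord|exact: Ck_cst].
have pos2p i : per (pos2 i).
  move=> x j Ox j1; rewrite /pos2 !mxE /=.
  have -> : (ord0 == j) = false by apply/eqP => e; rewrite -e in j1.
  have -> : (o1 == j) = false by apply/eqP => e; rewrite -e in j1.
  by rewrite !addr0.
have WC i : mCk V 1 (fun x => pos2 i x *: psi x) by apply: mCkZ.
have Wp i : per (fun x => pos2 i x *: psi x) by move=> x j Ox j1; rewrite pos2p // pp.
have e := div_ip oV OV pC pp WC Wp.
have p0 : mCk V 0 psi by apply: mCk_le pC.
 transitivity (IBd (fun x => ip (psi x) (x 0 ord0 *: (pos2 ord0 x *: psi x) + x 0 o1 *: (pos2 o1 x *: psi x)))).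
  apply: (IBeq OV); first exact: Ck_nsq.
    apply: Ck_ip => //; apply: mCkD => //; apply: mCkZ => //; try exact: Ck_coord; exact: (mCk_le _ (WC _)).
  by move=> x bx; rewrite /pos2 /= !scalerA -scalerDl ipZr -!expr2 bdK_circle // mul1r.
rewrite -e; apply: (IOeq OV).
- apply: Ck_sum => // i; apply: (CkD oV (k := 0)); apply: Ck_ip => //; try exact: mCk_mpd; exact: (mCk_le _ (WC _)).
- apply: (CkD oV (k := 0)); first by apply: (CkM oV (k := 0)); [exact: Ck_cst|exact: Ck_nsq].
  apply: (CkM oV (k := 0)); first exact: Ck_cst.
  apply: Ck_sum => //.
  move=> i.
  apply: (CkM oV (k := 0)).
    exact: pos2C.
  apply: Ck_ip.
  - exact: oV.
  - exact: p0.
  exact: mCk_mpd.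
move=> x Ox; have Vx := OV Ox.
rewrite (eq_bigr (fun i => pd i (pos2 i) x * nsq (psi x) + 2 * (pos2 i x * ip (psi x) (mpd i psi x)))); last first.
  move=> i _; rewrite (mpdZ oV Vx) // ipZr ipDr !ipZr (ipC (mpd i psi x)); ring.
rewrite big_split /= -mulr_suml -mulr_sumr; congr (_ * _ + _).
rewrite big_ord_n /pos2 /= !partial_coord !eqxx big1 ?addr0 => [|j _]; first by [].
exact: (pd_val (is_derive_cst 0 x _)).
Qed.

Lemma pos2_le x i : @K0 R k x -> pos2 i x ^+ 2 <= 1.
Proof.
move=> /K0_Om; rewrite /solid_torus /= one_lift => h.
have a0 := sqr_ge0 (x 0 ord0); have a1 := sqr_ge0 (x 0 o1).
by rewrite /pos2; case: ifP => _; [lra|case: ifP => _; [lra|rewrite expr0n]].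
Qed.

Lemma trace_le e : 0 < e -> exists2 C, 0 <= C & forall psi, mCk V 1 psi -> per psi ->
  IBd (fun x => nsq (psi x)) <= e * gradN psi + C * nf psi.
Proof.
(* 2 is the divergence of the radial field, and each of the n directions costs e^-1 in the weighted
   inequality between arithmetic and geometric mean. *)
move=> e0; exists (2 + n%:R * e^-1).
  by rewrite addr_ge0 // mulr_ge0 // ltW // invr_gt0.
move=> psi pC pp; have p0 : mCk V 0 psi by apply: mCk_le pC.
have gC : Ck 0 V (fun x => \sum_i nsq (mpd i psi x)).
  by apply: Ck_sum => // i; apply: Ck_nsq; exact: mCk_mpd.
have pos2C i q : Ck q V (pos2 i).
  rewrite /pos2; case: (i == ord0); first exact: Ck_coord.
  by case: (i == o1); [exact: Ck_coord|exact: Ck_cst].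
have ce : Ck 0 V (fun=> e) by exact: Ck_cst.
have cC' : Ck 0 V (fun=> 2 + n%:R / e) by exact: Ck_cst.
have p2 := Ck_nsq p0.
rewrite (trace_identity pC pp) /gradN /nf -(IOZ OV e gC) -(IOZ OV _ p2) -(IOD OV (CkM oV ce gC) (CkM oV cC' p2)).
apply: IOleK.
- apply: (CkD oV (k := 0)); first by apply: (CkM oV (k := 0)); [exact: Ck_cst|exact: Ck_nsq].
  apply: (CkM oV (k := 0)); first exact: Ck_cst.
  apply: Ck_sum => //.
  move=> i.
  apply: (CkM oV (k := 0)).
    exact: pos2C.
  apply: Ck_ip.
  - exact: oV.
  - exact: p0.
  exact: mCk_mpd.
- apply: (CkD oV (k := 0)); apply: (CkM oV (k := 0)) => //; try exact: Ck_cst; exact: Ck_nsq.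
move=> x Kx.
have : 2 * \sum_i pos2 i x * ip (psi x) (mpd i psi x) <= \sum_i (e^-1 * nsq (psi x) + e * nsq (mpd i psi x)).
  rewrite mulr_sumr; apply: ler_sum => i _.
  have ei0 : 0 < e^-1 by rewrite invr_gt0.
  have := ip_agm (pos2 i x *: psi x) (mpd i psi x) ei0; rewrite !ipZl ipZr invrK => h.
  apply: (le_trans h); rewrite lerD2r; apply: ler_wpM2l; first exact: ltW.
  by rewrite mulrA -expr2 ler_piMl // ?ip_ge0 // pos2_le.
rewrite big_split /= sumr_const card_ord -mulr_sumr -mulr_natl; lra.
Qed.

End Spinor.

(** * Coercivity of the boundary value problem for large L *)

Section Garding.
Variables (R : realType) (k N : nat).
Local Notation n := k.+2.
Local Notation Om := (@solid_torus R k).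
Local Notation o1 := (lift ord0 ord0).
Local Notation l2 j := (lift ord0 (lift ord0 j)).
Variables (c : 'I_n -> 'M[R]_N) (J : 'M[R]_N) (H : clifford c J).
Implicit Types (psi chi f g : 'rV[R]_n -> 'M[R]_N) (x : 'rV[R]_n).

Definition nce (E : 'rV[R]_n -> 'M[R]_n) x := x 0 ord0 *: ce c E ord0 x + x 0 o1 *: ce c E o1 x.
Definition nSc (E : 'rV[R]_n -> 'M[R]_n) j x := x 0 ord0 *: Sc c E ord0 j x + x 0 o1 *: Sc c E o1 j x.
Definition tSc (E : 'rV[R]_n -> 'M[R]_n) x := - x 0 o1 *: nSc E ord0 x + x 0 ord0 *: nSc E o1 x.
Definition tanv (d : 'I_n -> 'M[R]_N) x := - x 0 o1 *: d ord0 + x 0 ord0 *: d o1.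
(* The unit normal is [nn] in the frame [E]: the frame is chosen such that the
   boundary condition involves the flat normal only. *)
Definition adapted (E : 'rV[R]_n -> 'M[R]_n) := forall p, exists2 l : R, 0 < l &
  E (bd_incl p) *m (nn (bd_incl p))^T = l *: (nn (bd_incl p))^T.

Section BoundaryFlux.
Variables (E : 'rV[R]_n -> 'M[R]_n) (p : 'rV[R]_k.+1) (l : R).
Let x := bd_incl p.
Hypothesis El : E x *m (nn x)^T = l *: (nn x)^T.

Lemma nce_bd : nce E x = l *: cl c (nn x).
Proof.
rewrite /nce /ce -!clZ -clD; congr cl.
have <- : (E x *m (nn x)^T)^T = l *: nn x by rewrite El linearZ /= trmxK.
rewrite trmx_mul trmxK /nn mulmxDl -!scalemxAl -!rowE.
by congr (_ *: _ + _ *: _); apply/matrixP => i j; rewrite !mxE.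
Qed.

Lemma nSc_bd j : nSc E j x = (l / 2) *: (cl c (nn x) *m ce c E j x - ce c E j x *m cl c (nn x)).
Proof.
have -> : nSc E j x = 2^-1 *: (nce E x *m ce c E j x - ce c E j x *m nce E x).
  rewrite /nSc /Sc /nce mulmxDl mulmxDr -!scalemxAl -!scalemxAr !scalerA.
  move: (ce c E ord0 x *m ce c E j x) (ce c E j x *m ce c E ord0 x) (ce c E o1 x *m ce c E j x)
   (ce c E j x *m ce c E o1 x) => a1 a2 a3 a4.
  by apply/matrixP => i i'; rewrite !mxE; ring.
by rewrite nce_bd -scalemxAl -scalemxAr -scalerBr scalerA mulrC.
Qed.

Lemma nSc_anti j : nSc E j x *m beta c J x = - (beta c J x *m nSc E j x).
Proof. by rewrite nSc_bd -scalemxAl (beta_anti H) -scalemxAr scalerN. Qed.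

Lemma tSc_anti : tSc E x *m beta c J x = - (beta c J x *m tSc E x).
Proof.
have a0 := nSc_anti ord0; have a1 := nSc_anti o1; move: a0 a1; rewrite /tSc.
move: (nSc E ord0 x) (nSc E o1 x) (beta c J x) => A B b a0 a1.
by rewrite mulmxDl mulmxDr -!scalemxAl -!scalemxAr a0 a1 !scalerN opprD.
Qed.

Lemma nSc_n : x 0 ord0 *: nSc E ord0 x + x 0 o1 *: nSc E o1 x = 0.
Proof.
rewrite /nSc (Sc_skew c E o1 ord0).
have s0 a : Sc c E a a x = 0 by rewrite /Sc subrr scaler0.
by rewrite !s0; move: (Sc c E ord0 o1 x) => A; apply/matrixP => i j; rewrite !mxE; ring.
Qed.

(** Only tangential derivatives enter the flux: the coefficient of the normal derivative contracts
    the skew [Sc i j] twice with the same vector. *)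
Lemma flux_tan (d : 'I_n -> 'M[R]_N) :
  \sum_j nSc E j x *m d j = tSc E x *m tanv d x + \sum_(j < k) nSc E (l2 j) x *m d (l2 j).
Proof.
rewrite big_ord_n addrA; congr (_ + _).
have r1 := bd_circle p; rewrite -/x in r1.
have e0 : nSc E ord0 x = - x 0 o1 *: tSc E x.
  rewrite -[LHS]scale1r -r1 /tSc -[LHS]subr0 -(scaler0 _ (x 0 ord0)) -nSc_n.
  move: (nSc E ord0 x) (nSc E o1 x) => A B.
  by apply/matrixP => i j; rewrite !mxE; ring.
have e1 : nSc E o1 x = x 0 ord0 *: tSc E x.
  rewrite -[LHS]scale1r -r1 /tSc -[LHS]subr0 -(scaler0 _ (x 0 o1)) -nSc_n.
  move: (nSc E ord0 x) (nSc E o1 x) => A B.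
  by apply/matrixP => i j; rewrite !mxE; ring.
by rewrite e0 e1 /tanv mulmxDr -!scalemxAl -!scalemxAr.
Qed.

Lemma flux_bd (d : 'I_n -> 'M[R]_N) (psi0 Kt : 'M[R]_N) (K : 'I_k -> 'M[R]_N) s :
  s * s = 1 -> beta c J x *m psi0 = s *: psi0 ->
  beta c J x *m tanv d x + Kt *m psi0 = s *: tanv d x ->
  (forall j, beta c J x *m d (l2 j) + K j *m psi0 = s *: d (l2 j)) ->
  2 * ip psi0 (\sum_j nSc E j x *m d j) =
  s * (ip psi0 (tSc E x *m (Kt *m psi0)) + \sum_j ip psi0 (nSc E (l2 j) x *m (K j *m psi0))).
Proof.
move=> s2 bp bt bj; have bT := betaT H x.
rewrite flux_tan ipDr mulrDr (beta_flux bT s2 bp tSc_anti bt) ip_sumr mulrDr !mulr_sumr; congr (_ + _).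
by apply: eq_bigr => j _; rewrite (beta_flux bT s2 bp (nSc_anti _) (bj j)).
Qed.

End BoundaryFlux.

Variables (V : set 'rV[R]_n) (oV : open V) (OV : Om `<=` V).

Definition D0 (E : 'rV[R]_n -> 'M[R]_n) psi x := \sum_i ce c E i x *m mpd i psi x.
Definition opA (E : 'rV[R]_n -> 'M[R]_n) (B : 'rV[R]_n -> 'M[R]_N) (L : R) psi x :=
  D0 E psi x + B x *m psi x - L *: (J *m psi x).

Section FixedFrame.
Variables (E : 'rV[R]_n -> 'M[R]_n).
Hypotheses (EC : mCk V 1 E) (Ep : per E) (Ea : adapted E).

Let O0 : 'I_n -> 'rV[R]_n -> 'M[R]_N := fun _ _ => 0.
Let r1 : 'rV[R]_n -> R := fun=> 1.
Definition divS j x := \sum_i mpd i (Sc c E i j) x.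
Definition divc x := \sum_i mpd i (ce c E i) x.

Let nab0 i psi x : nab O0 i psi x = mpd i psi x. Proof. by rewrite /nab mul0mx addr0. Qed.
Let dirac0 psi x : dirac_op c E O0 psi x = D0 E psi x.
Proof. by apply: eq_bigr => i _; rewrite nab0. Qed.
Let ZS0 j x : ZS c E r1 O0 j x = divS j x.
Proof.
apply: eq_bigr => i _; rewrite mul0mx mulmx0 subrr scaler0 addr0; congr mpd.
by apply/funext => y; rewrite scale1r.
Qed.
Let Zc0 x : Zc c E r1 O0 x = divc x.
Proof.
apply: eq_bigr => i _; rewrite mul0mx mulmx0 subrr scaler0 addr0; congr mpd.
by apply/funext => y; rewrite scale1r.
Qed.
Let curv0 i j x : curv O0 i j x = 0.
Proof. by rewrite /curv !mpd_cst mul0mx !subrr addr0. Qed.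

(** The zero connection with density 1 is allowed for every frame. The price is the term with the
    divergence of [Sc], which is of first order and is absorbed later by a small part of the
    gradient. *)
Lemma flat_identity psi : mCk V 2 psi -> per psi ->
  IO (fun x => \sum_a nsq (\sum_i E x a i *: mpd i psi x) - nsq (D0 E psi x) +
     ip (psi x) (\sum_j divS j x *m mpd j psi x)) =
  IBd (fun x => ip (psi x) (\sum_j nSc E j x *m mpd j psi x)).
Proof.
move=> pC pp; have pC1 : mCk V 1 psi by apply: mCk_le pC.
have OC i : mCk V 1 (O0 i) by exact: mCk_cst.
have rC : Ck 1 V r1 by exact: Ck_cst.
have Op i : per (O0 i) by [].
have OT i x : Om x -> (O0 i x)^T = - O0 i x by move=> _; rewrite trmx0 oppr0.
have rp : per r1 by [].
have := dirac_identity H oV OV EC rC OC Ep rp Op OT pC1 pC pp pp.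
have -> : (fun x => ip (psi x) (flux c E r1 O0 psi x)) = fun x => ip (psi x) (\sum_j nSc E j x *m mpd j psi x).
  apply/funext => x; rewrite /flux scale1r; congr ip; apply: eq_bigr => j _; by rewrite nab0.
move=> <-; congr IO; apply/funext => x; rewrite /r1 mul1r dirac0.
have -> : \sum_i \sum_j Sc c E i j x *m curv O0 i j x = 0.
  by apply: big1 => i _; apply: big1 => j _; rewrite curv0 mulmx0.
rewrite scaler0 mul0mx ip0r mulr0 addr0; congr (_ + _); [congr (_ - _)|congr ip].
  by apply: eq_bigr => a _; congr (ip _ _); apply: eq_bigr => i _; rewrite nab0.
by apply: eq_bigr => j _; rewrite ZS0 nab0.
Qed.

Lemma flatJ_identity psi : mCk V 1 psi -> per psi ->
  IO (fun x => 2 * ip (D0 E psi x) (J *m psi x) - ip (psi x) (divc x *m (J *m psi x))) =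
  IBd (fun x => - ip (psi x) (nce E x *m (J *m psi x))).
Proof.
move=> pC1 pp.
have OC i : mCk V 1 (O0 i) by exact: mCk_cst.
have rC : Ck 1 V r1 by exact: Ck_cst.
have OT i x : Om x -> (O0 i x)^T = - O0 i x by move=> _; rewrite trmx0 oppr0.
have OJ i x : Om x -> O0 i x *m J = J *m O0 i x by move=> _; rewrite mul0mx mulmx0.
have rp : per r1 by [].
have := diracJ_identity H oV OV EC rC OC Ep rp OT OJ pC1 pp.
have -> : (fun x => - (r1 x * ip (psi x) ((x 0 ord0 *: ce c E ord0 x + x 0 o1 *: ce c E o1 x) *m (J *m psi x)))) =
   fun x => - ip (psi x) (nce E x *m (J *m psi x)) by apply/funext => x; rewrite mul1r.
by move=> <-; congr IO; apply/funext => x; rewrite mul1r dirac0 Zc0.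
Qed.

Lemma flatJ_flux psi p : bdc c J psi ->
  exists2 l, 0 < l & - ip (psi (bd_incl p)) (nce E (bd_incl p) *m (J *m psi (bd_incl p))) = - (l * nsq (psi (bd_incl p))).
Proof.
move=> bp; have [l l0 El] := Ea p; exists l => //.
by rewrite (nce_bd El) -scalemxAl ipZr mulmxA bp.
Qed.

Lemma flat_flux psi p : mCk V 1 psi -> bdc c J psi ->
  2 * ip (psi (bd_incl p)) (\sum_j nSc E j (bd_incl p) *m mpd j psi (bd_incl p)) =
  ip (psi (bd_incl p)) (tSc E (bd_incl p) *m (cl c (tau (bd_incl p)) *m J *m psi (bd_incl p))).
Proof.
move=> pC bp; have [l l0 El] := Ea p.
have [bt bj] := bdc_tangent oV OV p pC bp.
rewrite (flux_bd (Kt := cl c (tau (bd_incl p)) *m J) (K := fun=> 0) (s := 1) El).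
- by rewrite mul1r big1 ?addr0 // => j _; rewrite mul0mx mulmx0 ip0r.
- by rewrite mulr1.
- by rewrite scale1r bp.
- by rewrite scale1r; exact: bt.
- by move=> j; rewrite mul0mx addr0 scale1r bj.
Qed.

Hypothesis Ed : forall x, Om x -> 0 < \det (E x).

Lemma elliptic : exists2 K, 0 <= K & forall psi, mCk V 1 psi ->
  gradN psi <= K * IO (fun x => \sum_a nsq (\sum_i E x a i *: mpd i psi x)).
Proof.
pose V' := V `&` [set x | 0 < \det (E x)].
have dC : Ck 1 V (fun x => \det (E x)) by apply: Ck_det.
have oV' : open V' by apply: open_pos => //; apply: Ck_le dC.
have OV' : Om `<=` V' by move=> x Ox; split; [exact: OV|exact: Ed].
have V'V : V' `<=` V by move=> x [].
have iC : mCk V' 0 (fun x => invmx (E x)).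
  apply: mCk_invmx => // [x [_ h]|]; first by rewrite gt_eqF.
  by apply: (mCk_sub V'V); apply: mCk_le EC.
have [C C0 HC] := bounded_K0 OV' (Ck_nsq oV' iC).
exists (n%:R * n%:R * C); first by rewrite !mulr_ge0.
move=> psi pC; have m0 i : mCk V 0 (mpd i psi) by exact: mCk_mpd.
have eC : Ck 0 V (fun x => \sum_a nsq (\sum_i E x a i *: mpd i psi x)).
  apply: Ck_sum => // a; apply: (Ck_nsq oV); apply: mCk_sum => // i; apply: mCkZ => //.
  exact: (mCk_le _ EC).
rewrite -(IOZ OV _ eC); apply: (IOleK OV).
- by apply: Ck_sum => // i; apply: (Ck_nsq oV); exact: m0.
- by apply: (CkM oV (k := 0)) => //; exact: Ck_cst.
move=> x Kx; have Ox := K0_Om Kx.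
have EV : invmx (E x) *m E x = 1%:M by rewrite mulVmx // unitmxE unitfE gt_eqF // Ed.
set X := fun a => \sum_i E x a i *: mpd i psi x.
have mE i : mpd i psi x = \sum_a invmx (E x) i a *: X a.
  transitivity (\sum_j (invmx (E x) *m E x) i j *: mpd j psi x).
    rewrite EV (bigD1 i) //= mxE eqxx scale1r big1 ?addr0 // => j ji.
    by rewrite mxE eq_sym (negPf ji) scale0r.
  transitivity (\sum_j \sum_a (invmx (E x) i a * E x a j) *: mpd j psi x).
    by apply: eq_bigr => j _; rewrite mxE scaler_suml.
  rewrite exchange_big; apply: eq_bigr => a _; rewrite scaler_sumr; apply: eq_bigr => j _.
  by rewrite scalerA.
have iE i a : invmx (E x) i a ^+ 2 <= C.
  apply: (@le_trans _ _ (nsq (invmx (E x)))); last exact: (le_trans (ler_norm _) (HC x Kx)).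
  rewrite ipE (bigD1 a) //= (bigD1 i) //= -expr2 -addrA lerDl.
  by apply: addr_ge0; do ?[apply: sumr_ge0 => ? _]; rewrite -?expr2 ?sqr_ge0.
apply: (@le_trans _ _ (\sum_(i < n) n%:R * \sum_a C * nsq (X a))).
  apply: ler_sum => i _; rewrite [in X in X <= _]mE; apply: (le_trans (nsq_sum_le _)).
  apply: ler_wpM2l; first exact: ler0n.
  apply: ler_sum => a _; rewrite ipZl ipZr mulrA -expr2; apply: ler_wpM2r; first exact: ip_ge0.
  exact: iE.
by rewrite sumr_const card_ord -mulr_sumr -(mulr_natl (n%:R * (C * _)) n) !mulrA lexx.
Qed.

Lemma first_order_bound : exists2 C, 0 <= C & forall psi e, mCk V 1 psi -> 0 < e ->
  - IO (fun x => ip (psi x) (\sum_j divS j x *m mpd j psi x)) <= e * gradN psi + C * e^-1 * nf psi.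
Proof.
have dC j : mCk V 0 (fun x => (divS j x)^T).
  by apply: mCkT => //; apply: mCk_sum => // i; apply: mCk_mpd => //; apply: mCk_Sc.
have sC : Ck 0 V (fun x => \sum_j nsq (divS j x)^T) by apply: Ck_sum => // j; apply: (Ck_nsq oV).
have [C C0 HC] := bounded_K0 OV sC; exists C => // psi e pC e0.
have m0 i : mCk V 0 (mpd i psi) by exact: mCk_mpd.
have p0 : mCk V 0 psi by apply: mCk_le pC.
have gC : Ck 0 V (fun x => \sum_i nsq (mpd i psi x)) by apply: Ck_sum => // i; apply: (Ck_nsq oV).
have tC : Ck 0 V (fun x => ip (psi x) (\sum_j divS j x *m mpd j psi x)).
  apply: Ck_ip => //; apply: mCk_sum => // j; apply: mCkM => //.
  by move=> a b; apply: (Ck_congr oV _ (dC j b a)) => y _; rewrite mxE.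
have c1 a : Ck 0 V (fun=> a) by exact: Ck_cst.
have pn := Ck_nsq oV p0.
rewrite /gradN /nf -(IOZ OV e gC) -(IOZ OV _ pn) -(IOD OV (CkM oV (c1 _) gC) (CkM oV (c1 _) pn)).
rewrite -mulN1r -(IOZ OV (-1) tC); apply: (IOleK OV).
- exact: (CkM oV (c1 _) tC).
- exact: (CkD oV (CkM oV (c1 _) gC) (CkM oV (c1 _) pn)).
move=> x Kx; rewrite mulN1r ip_sumr -sumrN.
have ei : 0 < e^-1 by rewrite invr_gt0.
apply: (@le_trans _ _ (\sum_j (e^-1 * (nsq (divS j x)^T * nsq (psi x)) + e * nsq (mpd j psi x)))).
  apply: ler_sum => j _.
  have := ip_agm ((divS j x)^T *m psi x) (- mpd j psi x) ei.
  rewrite invrK ipNl !ipNr opprK -ip_adjr => h.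
  have h1 := ip_mul_le (divS j x)^T (psi x).
  have h2 : e^-1 * nsq ((divS j x)^T *m psi x) <= e^-1 * (nsq (divS j x)^T * nsq (psi x)).
    by apply: ler_wpM2l => //; exact: ltW.
  have h3 : 0 <= e^-1 * nsq ((divS j x)^T *m psi x) by rewrite mulr_ge0 ?ip_ge0 ?ltW.
  have h4 : 0 <= e * nsq (mpd j psi x) by rewrite mulr_ge0 ?ip_ge0 ?ltW.
  lra.
rewrite big_split /= -!mulr_sumr -mulr_suml addrC lerD2l [C * _]mulrC -mulrA.
apply: ler_wpM2l; first exact: ltW.
by apply: ler_wpM2r; [exact: ip_ge0|exact: (le_trans (ler_norm _) (HC x Kx))].
Qed.

Lemma J_bound : exists2 C, 0 <= C & forall psi, mCk V 1 psi -> per psi -> bdc c J psi ->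
  2 * IO (fun x => ip (D0 E psi x) (J *m psi x)) <= C * nf psi.
Proof.
have MC : mCk V 0 (fun x => divc x *m J).
  apply: mCkM => //; last exact: mCk_cst.
  by apply: mCk_sum => // i; apply: mCk_mpd => //; apply: mCk_ce.
have [C C0 HC] := nf_mul oV OV MC; exists (1 + C); first by rewrite addr_ge0.
move=> psi pC pp bp; have p0 : mCk V 0 psi by apply: mCk_le pC.
have c1 a : Ck 0 V (fun=> a) by exact: Ck_cst.
have Jp : mCk V 0 (fun x => J *m psi x) by apply: mCkM => //; exact: mCk_cst.
have MpC : mCk V 0 (fun x => divc x *m J *m psi x) by apply: mCkM.
have dC : mCk V 0 (D0 E psi).
  apply: mCk_sum => // i; apply: mCkM => //; last exact: mCk_mpd.
  by apply: mCk_ce => //; apply: mCk_le EC.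
have t1 : Ck 0 V (fun x => ip (D0 E psi x) (J *m psi x)) by exact: Ck_ip.
have t2 : Ck 0 V (fun x => ip (psi x) (divc x *m J *m psi x)) by exact: Ck_ip.
have := flatJ_identity pC pp.
have -> : (fun x => 2 * ip (D0 E psi x) (J *m psi x) - ip (psi x) (divc x *m (J *m psi x))) =
  (fun x => 2 * ip (D0 E psi x) (J *m psi x) - ip (psi x) (divc x *m J *m psi x)).
  by apply/funext => x; rewrite mulmxA.
rewrite (IOB OV (CkM oV (c1 2) t1) t2) (IOZ OV 2 t1).
have nC : mCk V 0 (nce E).
  have ceC i : mCk V 0 (ce c E i) by apply: mCk_ce => //; apply: mCk_le EC.
  exact: (mCkD oV (mCkZ oV (Ck_coord V 0 _) (ceC _)) (mCkZ oV (Ck_coord V 0 _) (ceC _))).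
have b1 : IBd (fun x => - ip (psi x) (nce E x *m (J *m psi x))) <= 0.
  rewrite -(pf0 (@pf_IBd R k)); apply: (IBle OV); [|exact: c1|].
    by apply: (CkN oV (k := 0)); apply: Ck_ip => //; apply: mCkM.
  move=> x [p _ <-]; have [l l0 ->] := flatJ_flux p bp.
  by rewrite oppr_le0 mulr_ge0 ?ip_ge0 // ltW.
have b2 : IO (fun x => ip (psi x) (divc x *m J *m psi x)) <= (1 + C) * nf psi.
  have h := HC psi p0.
  apply: (@le_trans _ _ (nf psi + nf (fun x => divc x *m J *m psi x))); last lra.
  rewrite /nf -(IOD OV (Ck_nsq oV p0) (Ck_nsq oV MpC)); apply: (IOle OV t2).
    by apply: (CkD oV (k := 0)); exact: Ck_nsq.
  move=> x _; have := @ip_agm _ _ _ 1 (psi x) (divc x *m J *m psi x) ltr01.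
  rewrite invr1 !mul1r => h1; have h2 := ip_ge0 (psi x); have h3 := ip_ge0 (divc x *m J *m psi x); lra.
by move=> e; move: e b1 b2; lra.
Qed.

Lemma flux_bound : exists2 C, 0 <= C & forall psi, mCk V 1 psi -> bdc c J psi ->
  IBd (fun x => ip (psi x) (\sum_j nSc E j x *m mpd j psi x)) <= C * IBd (fun x => nsq (psi x)).
Proof.
have E0 : mCk V 0 E by apply: mCk_le EC.
have nSC j : mCk V 0 (nSc E j).
  have ScC i : mCk V 0 (Sc c E i j) by apply: mCk_Sc.
  exact: (mCkD oV (mCkZ oV (Ck_coord V 0 _) (ScC _)) (mCkZ oV (Ck_coord V 0 _) (ScC _))).
have tSC : mCk V 0 (tSc E).
  have coordN : Ck 0 V (fun x => - x 0 o1) by apply: (CkN oV (k := 0)); exact: Ck_coord.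
  exact: (mCkD oV (mCkZ oV coordN (nSC _)) (mCkZ oV (Ck_coord V 0 _) (nSC _))).
have MC : mCk V 0 (fun x => tSc E x *m (cl c (tau x) *m J)).
  by apply: mCkM => //; apply: mCkM => //; [apply: mCk_cl => //; exact: mCk_tau|exact: mCk_cst].
have [C C0 HC] := bounded_bdK OV (Ck_nsq oV MC); exists (1 + C); first by rewrite addr_ge0.
move=> psi pC bp; have p0 : mCk V 0 psi by apply: mCk_le pC.
have c1 a : Ck 0 V (fun=> a) by exact: Ck_cst.
rewrite -(IBZ OV (1 + C) (Ck_nsq oV p0)); apply: (IBle OV).
- apply: Ck_ip => //; apply: mCk_sum => // j; apply: mCkM => //; exact: mCk_mpd.
- by apply: (CkM oV (c1 _)); exact: Ck_nsq.
move=> x bx; have [p _ px] := bx; have := flat_flux p pC bp; rewrite px => e.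
have := @ip_agm _ _ _ 1 (psi x) (tSc E x *m (cl c (tau x) *m J *m psi x)) ltr01.
rewrite invr1 !mul1r -e; have := ip_mul_le (tSc E x *m (cl c (tau x) *m J)) (psi x).
rewrite -!mulmxA => h1 h2.
have h3 : nsq (tSc E x *m (cl c (tau x) *m J)) * nsq (psi x) <= C * nsq (psi x).
  by apply: ler_wpM2r; [exact: ip_ge0|exact: (le_trans (ler_norm _) (HC x bx))].
have h4 := ip_ge0 (psi x).
have h5 : 0 <= C * nsq (psi x) by rewrite mulr_ge0.
lra.
Qed.

Let garding_arith (K M CB C2 L d p a i q G : R) : 1 <= K -> 0 <= M -> 0 <= CB -> 0 <= C2 ->
  C2 + M + 2 * CB + 2 <= L -> 0 <= d -> 0 <= p -> G <= 2 * K * d + 2 * K * M * p ->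
  q = d - L * (2 * i) + L ^+ 2 * p -> 2 * i <= C2 * p -> q <= 2 * a + 2 * (CB * p) ->
  p + G <= 4 * K * a.
Proof.
move=> K1 M0 CB0 C20 LL d0 p0 gG qE ip qa.
have L1 : 1 <= L by lra.
have g6 : L * (2 * i) <= L * (C2 * p) by apply: ler_wpM2l => //; lra.
have L2 : (M + 2 * CB + 1) * p <= L * (L - C2) * p.
  apply: ler_wpM2r => //; have : 1 * (M + 2 * CB + 2) <= L * (L - C2) by apply: ler_pM; lra.
  lra.
have g8 : d + (M + 1) * p <= 2 * a.
  have -> : d + (M + 1) * p = d + (M + 2 * CB + 1) * p - 2 * (CB * p) by ring.
  have : L * (L - C2) * p = L ^+ 2 * p - L * (C2 * p) by ring.
  lra.
have g9 : 2 * K * (d + (M + 1) * p) <= 2 * K * (2 * a) by apply: ler_wpM2l => //; lra.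
have g10 : p <= 2 * K * p by rewrite ler_peMl //; lra.
have -> : 4 * K * a = 2 * K * (2 * a) by ring.
have : 2 * K * (d + (M + 1) * p) = (2 * K * d + 2 * K * M * p) + 2 * K * p by ring.
lra.
Qed.

(** In |D0 psi - L J psi|^2 the square L^2 |psi|^2 dominates the cross term, which is at most of
    size L |psi|^2. For large L it also absorbs [B], the first order remainder and the boundary flux
    after the trace inequality. *)
Lemma garding (B : 'rV[R]_n -> 'M[R]_N) : mCk V 0 B ->
  exists L0 C, 0 <= C /\ forall L psi, L0 <= L -> Sp c J V psi ->
    nf psi + gradN psi <= C * nf (opA E B L psi).
Proof.
move=> BC.
have [K0 K00 HK0] := elliptic; have [C1 C10 HC1] := first_order_bound.
have [C2 C20 HC2] := J_bound; have [Cf Cf0 HCf] := flux_bound.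
have [CB CB0 HCB] := nf_mul oV OV BC.
pose K := K0 + 1; have K1 : 1 <= K by rewrite /K; lra.
have Kp : 0 < K by lra.
(* t and e below are chosen so that K (t + Cf e) <= 1/2: then the gradients produced by the
   remainder and by the trace inequality are absorbed on the left. *)
pose t := (4 * K)^-1; have tp : 0 < t by rewrite invr_gt0; lra.
have Cf1 : 0 < Cf + 1 by lra.
pose e := (4 * K * (Cf + 1))^-1; have ep : 0 < e by rewrite invr_gt0 mulr_gt0 //; lra.
have [Ct Ct0 HCt] := trace_le N oV OV ep.
pose M := C1 * t^-1 + Cf * Ct.
have M0 : 0 <= M by rewrite addr_ge0 ?mulr_ge0 // invr_ge0 ltW.
exists (C2 + M + 2 * CB + 2), (4 * K); split; first lra.
move=> L psi LL0 [pC2 pp bp].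
have pC : mCk V 1 psi by apply: mCk_le pC2.
have p0 : mCk V 0 psi by apply: mCk_le pC2.
have c1 a : Ck 0 V (fun=> a) by exact: Ck_cst.
have E0 : mCk V 0 E by apply: mCk_le EC.
have dC : mCk V 0 (D0 E psi).
  by apply: mCk_sum => // i; apply: mCkM => //; [exact: mCk_ce|exact: mCk_mpd].
have Jp : mCk V 0 (fun x => J *m psi x) by apply: mCkM => //; exact: mCk_cst.
have Bp : mCk V 0 (fun x => B x *m psi x) by apply: mCkM.
have frC : Ck 0 V (fun x => \sum_a nsq (\sum_i E x a i *: mpd i psi x)).
  apply: Ck_sum => // a; apply: (Ck_nsq oV); apply: mCk_sum => // i; apply: mCkZ => //.
  exact: mCk_mpd.
have fdC : Ck 0 V (fun x => ip (psi x) (\sum_j divS j x *m mpd j psi x)).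
  apply: Ck_ip => //; apply: mCk_sum => // j; apply: mCkM => //; last exact: mCk_mpd.
  by apply: mCk_sum => // i; apply: mCk_mpd => //; apply: mCk_Sc.
have dnC := Ck_nsq oV dC.
set F := IO (fun x => \sum_a nsq (\sum_i E x a i *: mpd i psi x)).
have id1 : F - nf (D0 E psi) + IO (fun x => ip (psi x) (\sum_j divS j x *m mpd j psi x)) =
    IBd (fun x => ip (psi x) (\sum_j nSc E j x *m mpd j psi x)).
  rewrite -(flat_identity pC2 pp) /F /nf -(IOB OV frC dnC) -(IOD OV (CkB oV frC dnC) fdC) //.
have g1 := HK0 psi pC; rewrite -/F in g1.
have g2 := HC1 psi t pC tp.
have g3 := HCf psi pC bp.
have g4 := HCt psi pC pp.
have N0 : 0 <= nf psi by exact: (nf_ge0 oV OV).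
have G0 : 0 <= gradN psi.
  apply: (IOge0 OV) => [|x _]; last by apply: sumr_ge0 => i _; exact: ip_ge0.
  by apply: Ck_sum => // i; apply: (Ck_nsq oV); exact: mCk_mpd.
have F0 : 0 <= F.
  by apply: (IOge0 OV) => // x _; apply: sumr_ge0 => i _; exact: ip_ge0.
have g5 : Cf * IBd (fun x => nsq (psi x)) <= Cf * (e * gradN psi + Ct * nf psi) by exact: ler_wpM2l.
have gF : F <= nf (D0 E psi) + (t + Cf * e) * gradN psi + M * nf psi.
  rewrite /M; lra.
have te : K * (t + Cf * e) <= 2^-1.
  have e1 : K * t = 4^-1 by rewrite /t; field; lra.
  have e2 : K * ((Cf + 1) * e) = 4^-1.
    by rewrite /e; field; rewrite !gt_eqF //; lra.
  have e3 : 0 <= K * e by rewrite mulr_ge0 ?ltW.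
  have -> : K * (t + Cf * e) = K * t + K * ((Cf + 1) * e) - K * e by ring.
  lra.
have gG : gradN psi <= 2 * K * nf (D0 E psi) + 2 * K * M * nf psi.
  have h1 : gradN psi <= K * F by apply: (le_trans g1); rewrite /K mulrDl mul1r lerDl.
  have h2 : K * F <= K * (nf (D0 E psi) + (t + Cf * e) * gradN psi + M * nf psi).
    by apply: ler_wpM2l => //; exact: ltW.
  have h3 : K * (t + Cf * e) * gradN psi <= 2^-1 * gradN psi by exact: ler_wpM2r.
  have -> : 2 * K * nf (D0 E psi) + 2 * K * M * nf psi =
     2 * (K * (nf (D0 E psi) + (t + Cf * e) * gradN psi + M * nf psi) - K * (t + Cf * e) * gradN psi) by ring.
  lra.
have JC : Ck 0 V (fun x => ip (D0 E psi x) (J *m psi x)) by exact: Ck_ip.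
have id2 : nf (fun x => D0 E psi x - L *: (J *m psi x)) =
   nf (D0 E psi) - L * (2 * IO (fun x => ip (D0 E psi x) (J *m psi x))) + L ^+ 2 * nf psi.
  rewrite -(IOZ OV 2 JC) -(IOZ OV L (CkM oV (c1 2) JC)) /nf -(IOZ OV (L ^+ 2) (Ck_nsq oV p0)).
  rewrite -(IOB OV dnC (CkM oV (c1 L) (CkM oV (c1 2) JC))).
  rewrite -(IOD OV (CkB oV dnC (CkM oV (c1 L) (CkM oV (c1 2) JC))) (CkM oV (c1 _) (Ck_nsq oV p0))).
  congr IO; apply/funext => x.
  have JJ : nsq (J *m psi x) = nsq (psi x) by rewrite ip_adjl (J_sym H) mulmxA (J_sq H) mul1mx.
  by rewrite ipBl !ipBr !ipZl !ipZr JJ (ipC (J *m psi x)); ring.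
have g7 : nf (fun x => D0 E psi x - L *: (J *m psi x)) <= 2 * nf (opA E B L psi) + 2 * (CB * nf psi).
  have LJ : mCk V 0 (fun x => L *: (J *m psi x)) by apply: mCkZ => //; exact: c1.
  have AC : mCk V 0 (opA E B L psi) by apply: mCkB => //; apply: mCkD.
  have -> : (fun x => D0 E psi x - L *: (J *m psi x)) = fun x => opA E B L psi x - B x *m psi x.
    apply/funext => x; rewrite /opA; move: (L *: _) (D0 E psi x) (B x *m psi x) => a1 a2 a3.
    by apply/matrixP => i j; rewrite !mxE; ring.
  apply: (le_trans (nfB oV OV AC Bp)); rewrite lerD2l; apply: ler_wpM2l => //; exact: HCB.
have D00 : 0 <= nf (D0 E psi) by exact: (nf_ge0 oV OV).
exact: (garding_arith K1 M0 CB0 C20 LL0 D00 N0 gG id2 (HC2 _ pC pp bp) g7).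
Qed.

End FixedFrame.
End Garding.

(** * Density of the range along a path of operators *)

Lemma clopen_path (R : realType) (P : R -> Prop) :
  (forall s, 0 <= s <= 1 -> exists2 d, 0 < d & forall s', 0 <= s' <= 1 -> `|s' - s| < d -> (P s <-> P s')) ->
  P 0 -> P 1.
Proof.
move=> loc P0.
pose A : set R := [set s | 0 <= s <= 1 /\ forall u, 0 <= u <= s -> P u].
have A0 : A 0 by split=> [|u]; [lra|move=> h; have -> : u = 0 by lra].
have hsA : has_sup A by split; [exists 0|exists 1 => s [/andP[_ ->]]].
pose m := sup A.
have m01 : 0 <= m <= 1.
  apply/andP; split; first exact: (ub_le_sup (proj2 hsA) A0).
  by apply: ge_sup; [exists 0|move=> s [/andP[]]].
have [d d0 Hd] := loc m m01.
have [s [s01 sP] sm] : exists2 s, A s & m - d < s.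
  by have := sup_adherent d0 hsA => -[s As sm]; exists s.
have sle : s <= m by apply: (ub_le_sup (proj2 hsA)).
have Pm : P m by apply/(Hd s) => //; [rewrite ler0_norm; lra|apply: sP; lra].
have Pall u : 0 <= u <= 1 -> u < m + d -> P u.
  move=> u01 um; have [us|us] := leP u s; first by apply: sP; lra.
  by apply/(Hd u) => //; rewrite ltr_norml; lra.
have [m1|m1] := ltP m 1; last by apply: Pall; lra.
have Am : A (Order.min 1 (m + d / 2)).
  have q0 : m + d / 2 < m + d by lra.
  split=> [|u /andP[u0]]; first by rewrite le_min ge_min lexx /= andbT; lra.
  by rewrite le_min => /andP[u1 u2]; apply: Pall; lra.
have := ub_le_sup (proj2 hsA) Am; rewrite -/m ge_min; lra.
Qed.

Section Continuity.
Variables (R : realType) (k N : nat).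
Local Notation n := k.+2.
Local Notation Om := (@solid_torus R k).
Variables (V : set 'rV[R]_n) (oV : open V) (OV : Om `<=` V).
Implicit Types (psi chi f g : 'rV[R]_n -> 'M[R]_N) (x : 'rV[R]_n).
Local Notation field := ('rV[R]_n -> 'M[R]_N).

Definition dense_range (S C : field -> Prop) (A : field -> field) : Prop :=
  forall f, C f -> forall e, 0 < e -> exists2 psi, S psi & nf (fun x => f x - A psi x) <= e.

Section Step.
Variables (S C : field -> Prop) (A A' : field -> field) (Q : field -> R) (K d : R).
Hypotheses (S0 : S (fun=> 0)) (SD : forall psi chi, S psi -> S chi -> S (fun x => psi x + chi x)).
Hypotheses (C0 : forall f, C f -> mCk V 0 f) (CB : forall f psi, C f -> S psi -> C (fun x => f x - A' psi x)).
Hypotheses (AC : forall psi, S psi -> mCk V 0 (A psi)) (AC' : forall psi, S psi -> mCk V 0 (A' psi)).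
Hypothesis AD : forall psi chi x, S psi -> S chi -> Om x ->
  A' (fun x => psi x + chi x) x = A' psi x + A' chi x.
Hypotheses (K0 : 0 <= K) (d0 : 0 <= d) (Kd : K * d <= 16^-1).
Hypotheses (HQ : forall psi, S psi -> Q psi <= K * nf (A psi)).
Hypotheses (Hd : forall psi, S psi -> nf (fun x => A' psi x - A psi x) <= d * Q psi).

(** An approximate solution for [A] is one for [A']: by the a priori estimate the error (A' - A) psi
    is small compared with A psi, which is close to f. All quantities are squared norms, so each
    splitting costs a factor 2, and 1/16 suffices for the residual 1/2. *)
Lemma dense_half : dense_range S C A ->
  forall f, C f -> exists2 psi, S psi & nf (fun x => f x - A' psi x) <= 2^-1 * nf f.
Proof.
move=> D f Cf; have fC := C0 Cf; have f0 := nf_ge0 oV OV fC.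
have [fz|fp] := eqVneq (nf f) 0.
  (* For nf f = 0 no positive tolerance proportional to nf f exists, and the zero spinor already
     works. *)
  exists (fun=> 0) => //; rewrite fz mulr0 -fz le_eqVlt; apply/orP; left; apply/eqP.
  apply: (nf_congr oV OV) => //; first by apply: mCkB => //; exact: AC'.
  move=> x Ox; have := AD S0 S0 Ox.
  have -> : (fun x : 'rV[R]_n => (0 : 'M[R]_N) + 0) = fun=> 0 by apply/funext => y; rewrite addr0.
  by move/eqP; rewrite -subr_eq subrr eq_sym => /eqP ->; rewrite subr0.
have fgt : 0 < nf f by rewrite lt_neqAle eq_sym fp.
have e0 : 0 < 16^-1 * nf f by rewrite mulr_gt0 // invr_gt0.
have [psi Sp He] := D f Cf _ e0; exists psi => //.
have aC := AC Sp; have aC' := AC' Sp.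
have b1 : nf (A psi) <= 2 * nf f + 2 * (16^-1 * nf f).
  have -> : A psi = fun x => f x - (f x - A psi x) by apply/funext => x; rewrite opprB addrC subrK.
  by apply: (le_trans (nfB oV OV fC (mCkB oV fC aC))); rewrite lerD2l; lra.
have b2 : nf (fun x => A' psi x - A psi x) <= 16^-1 * nf (A psi).
  apply: (le_trans (Hd Sp)); apply: (@le_trans _ _ (d * (K * nf (A psi)))).
    by apply: ler_wpM2l => //; exact: HQ.
  by rewrite mulrA [d * K]mulrC; apply: ler_wpM2r => //; exact: (nf_ge0 oV OV).
have -> : (fun x => f x - A' psi x) = fun x => (f x - A psi x) - (A' psi x - A psi x).
  by apply/funext => x; rewrite opprB addrA subrK.
apply: (le_trans (nfB oV OV (mCkB oV fC aC) (mCkB oV aC' aC))); lra.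
Qed.

(** The halving step is applied to the successive residuals, which stay admissible by [CB]. Finitely
    many rounds reach any tolerance, so no limit and no completeness is involved. *)
Lemma dense_step : dense_range S C A -> dense_range S C A'.
Proof.
move=> D f Cf e e0.
have iter m : exists2 psi, S psi & nf (fun x => f x - A' psi x) <= 2^-1 ^+ m * nf f.
  elim: m => [|m [psi Spsi IH]].
    have [psi Spsi h] := dense_half D Cf; exists psi => //.
    by have := nf_ge0 oV OV (C0 Cf); rewrite expr0 mul1r; lra.
  have [chi Schi h] := dense_half D (CB Cf Spsi).
  exists (fun x => psi x + chi x); first exact: SD.
  have fC := C0 Cf.
  rewrite (nf_congr oV OV (g := fun x => f x - A' psi x - A' chi x)).
  - by apply: (le_trans h); rewrite exprS -mulrA; apply: ler_wpM2l; rewrite ?invr_ge0.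
  - by apply: mCkB => //; apply: AC'; exact: SD.
  - by apply: mCkB => //; [apply: mCkB => //|]; exact: AC'.
  - by move=> x Ox; rewrite AD // opprD addrA.
have f0 := nf_ge0 oV OV (C0 Cf).
pose m := Num.bound (nf f / e).
have hm : nf f / e < m%:R by apply: archi_boundP; rewrite divr_ge0 // ltW.
have [psi Sp h] := iter m; exists psi => //; apply: (le_trans h).
have m2 : (m%:R : R) <= 2 ^+ m by rewrite -natrX ler_nat ltnW // ltn_expl.
have p0 : (0 : R) < 2 ^+ m by rewrite exprn_gt0.
rewrite exprVn mulrC ler_pdivrMr // -ler_pdivrMl // mulrC.
by apply: le_trans m2; exact: ltW.
Qed.

End Step.

(** For the converse the estimate has to hold for [A']; perturbation gives it with constant 4 K,
    whence 1/64 in place of 1/16. [Q] is the norm that the estimate controls: it includes the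
    gradient when the principal part varies, and is the L^2 norm when only zeroth order terms do. *)
Lemma dense_iff (S C : field -> Prop) (A A' : field -> field) (Q : field -> R) (K d : R) :
  S (fun=> 0) -> (forall psi chi, S psi -> S chi -> S (fun x => psi x + chi x)) ->
  (forall f, C f -> mCk V 0 f) ->
  (forall f psi, C f -> S psi -> C (fun x => f x - A psi x)) ->
  (forall f psi, C f -> S psi -> C (fun x => f x - A' psi x)) ->
  (forall psi, S psi -> mCk V 0 (A psi)) -> (forall psi, S psi -> mCk V 0 (A' psi)) ->
  (forall psi chi x, S psi -> S chi -> Om x -> A (fun x => psi x + chi x) x = A psi x + A chi x) ->
  (forall psi chi x, S psi -> S chi -> Om x -> A' (fun x => psi x + chi x) x = A' psi x + A' chi x) ->
  0 <= K -> 0 <= d -> K * d <= 64^-1 ->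
  (forall psi, S psi -> 0 <= Q psi) ->
  (forall psi, S psi -> Q psi <= K * nf (A psi)) ->
  (forall psi, S psi -> nf (fun x => A' psi x - A psi x) <= d * Q psi) ->
  dense_range S C A <-> dense_range S C A'.
Proof.
move=> S0 SD C0 CB CB' AC AC' AD AD' K0 d0 Kd Q0 HQ Hd; split.
  by apply: (dense_step (Q := Q) (K := K) (d := d)) => //; lra.
have k4 : 0 <= 4 * K by lra.
have kd4 : 4 * K * d <= 16^-1 by rewrite -mulrA; lra.
apply: (dense_step (Q := Q) (K := 4 * K) (d := d)) => //.
  move=> psi Sp; have h1 := HQ psi Sp; have h2 := Hd psi Sp.
  have b : nf (A psi) <= 2 * nf (A' psi) + 2 * nf (fun x => A' psi x - A psi x).
    have -> : A psi = fun x => A' psi x - (A' psi x - A psi x).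
      by apply/funext => x; rewrite opprB addrC subrK.
    have -> : (fun x => A' psi x - (A' psi x - (A' psi x - A psi x))) = fun x => A' psi x - A psi x.
      by apply/funext => x; rewrite opprB addrC subrK.
    by apply: (nfB oV OV); [exact: AC'|apply: mCkB => //; [exact: AC'|exact: AC]].
  have h3 : K * nf (A psi) <= K * (2 * nf (A' psi) + 2 * (d * Q psi)).
    by apply: ler_wpM2l => //; lra.
  have h4 : K * d * Q psi <= 64^-1 * Q psi by apply: ler_wpM2r => //; exact: Q0.
  have h5 := Q0 psi Sp; have h6 := nf_ge0 oV OV (AC' psi Sp).
  have h7 : K * (2 * nf (A' psi) + 2 * (d * Q psi)) = 2 * K * nf (A' psi) + 2 * (K * d * Q psi) by ring.
  lra.
move=> psi Sp; have -> : nf (fun x => A psi x - A' psi x) = nf (fun x => A' psi x - A psi x).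
  by rewrite /nf; congr IO; apply/funext => x; rewrite -[A psi x - _]opprB ipNl ipNr opprK.
exact: Hd.
Qed.

Lemma first_order_nf (M : 'I_n -> 'rV[R]_n -> 'M[R]_N) (B : 'rV[R]_n -> 'M[R]_N) :
  (forall i, mCk V 0 (M i)) -> mCk V 0 B -> exists2 K, 0 <= K & forall psi, mCk V 1 psi ->
  nf (fun x => \sum_i M i x *m mpd i psi x + B x *m psi x) <= K * (nf psi + gradN psi).
Proof.
move=> MC BC.
have sC : Ck 0 V (fun x => \sum_i nsq (M i x)) by apply: Ck_sum => // i; apply: (Ck_nsq oV).
have [C1 C10 H1] := bounded_K0 OV sC; have [C2 C20 H2] := nf_mul oV OV BC.
exists (2 * (n%:R * C1) + 2 * C2); first by rewrite addr_ge0 ?mulr_ge0.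
move=> psi pC; have p0 : mCk V 0 psi by apply: mCk_le pC.
have m0 i : mCk V 0 (mpd i psi) by exact: mCk_mpd.
have Mm : mCk V 0 (fun x => \sum_i M i x *m mpd i psi x).
  by apply: mCk_sum => // i; apply: mCkM.
have Bp : mCk V 0 (fun x => B x *m psi x) by apply: mCkM.
have gC : Ck 0 V (fun x => \sum_i nsq (mpd i psi x)) by apply: Ck_sum => // i; apply: (Ck_nsq oV).
have g0 : 0 <= gradN psi by apply: (IOge0 OV) => // x _; apply: sumr_ge0 => i _; exact: ip_ge0.
have n0 := nf_ge0 oV OV p0.
apply: (le_trans (nfD oV OV Mm Bp)).
have b1 : nf (fun x => \sum_i M i x *m mpd i psi x) <= n%:R * C1 * gradN psi.
  rewrite /gradN -(IOZ OV _ gC); apply: (IOleK OV).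
  - exact: (Ck_nsq oV).
  - by apply: (CkM oV (k := 0)) => //; exact: Ck_cst.
  move=> x Kx; apply: (le_trans (nsq_sum_le _)); rewrite -mulrA; apply: ler_wpM2l => //.
  rewrite mulr_sumr; apply: ler_sum => i _; apply: (le_trans (ip_mul_le _ _)).
  apply: ler_wpM2r; first exact: ip_ge0.
  apply: le_trans (le_trans (ler_norm _) (H1 x Kx)).
  by rewrite (bigD1 i) //= lerDl; apply: sumr_ge0 => j _; exact: ip_ge0.
have b2 := H2 psi p0.
have b3 : 0 <= n%:R * C1 * nf psi by rewrite !mulr_ge0.
have b4 : 0 <= C2 * gradN psi by rewrite !mulr_ge0.
have -> : (2 * (n%:R * C1) + 2 * C2) * (nf psi + gradN psi) =
  2 * (n%:R * C1 * nf psi) + 2 * (n%:R * C1 * gradN psi) + 2 * (C2 * nf psi) + 2 * (C2 * gradN psi) by ring.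
lra.
Qed.

Section Transport.
Variables (c : 'I_n -> 'M[R]_N) (J : 'M[R]_N) (H : clifford c J).
Local Notation S := (Sp c J V).
Local Notation C := (@cC R k N V).

Lemma Sp0 : S (fun=> 0).
Proof. by split; [exact: mCk_cst|by []|move=> p; rewrite mulmx0]. Qed.

Lemma SpD psi chi : S psi -> S chi -> S (fun x => psi x + chi x).
Proof.
move=> [p1 p2 p3] [q1 q2 q3]; split; first exact: mCkD.
  by move=> x j Ox j1; rewrite p2 // q2.
by move=> p; rewrite mulmxDr p3 q3.
Qed.

Lemma opA_cC E B L psi : mCk V 0 E -> per E -> mCk V 0 B -> per B -> mCk V 2 psi -> per psi -> C (opA c J E B L psi).
Proof.
move=> EC Ep BC Bp p2 pp.
have p1 : mCk V 1 psi by apply: mCk_le p2.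
have p0 : mCk V 0 psi by apply: mCk_le p2.
split.
  apply: mCkB => //; last by apply: mCkZ => //; [exact: Ck_cst|apply: mCkM => //; exact: mCk_cst].
  apply: mCkD => //; last exact: mCkM.
  by apply: mCk_sum => // i; apply: mCkM => //; [exact: mCk_ce|exact: mCk_mpd].
move=> x j Ox j1; rewrite /opA Bp // pp //; congr (_ + _ - _); apply: eq_bigr => i _.
by rewrite (per_ce c Ep) // (per_mpd i oV OV p1 pp).
Qed.

Lemma opAD E B L psi chi x : mCk V 1 psi -> mCk V 1 chi -> Om x ->
  opA c J E B L (fun x => psi x + chi x) x = opA c J E B L psi x + opA c J E B L chi x.
Proof.
move=> pC qC Ox; have Vx := OV Ox; rewrite /opA /D0 !mulmxDr scalerDr.
have -> : \sum_i ce c E i x *m mpd i (fun x => psi x + chi x) x =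
   \sum_i ce c E i x *m mpd i psi x + \sum_i ce c E i x *m mpd i chi x.
  by rewrite -big_split; apply: eq_bigr => i _; rewrite (mpdD oV Vx) // mulmxDr.
move: (\sum_i _) (\sum_i _) (B x *m psi x) (B x *m chi x) (L *: _) (L *: _) => a1 a2 a3 a4 a5 a6.
by apply/matrixP => i j; rewrite !mxE; ring.
Qed.

Variables (E : 'rV[R]_n -> 'M[R]_n) (B : 'rV[R]_n -> 'M[R]_N).
Hypotheses (EC : mCk V 1 E) (Ep : per E) (Ea : adapted E) (BC : mCk V 0 B) (Bp : per B).
Hypothesis Ed : forall s x, 0 <= s <= 1 -> Om x -> 0 < \det ((1 - s)%:M + s *: E x).

(** Along the segment of frames the boundary condition, hence the space of spinors, is fixed by
    adaptedness, and the coercivity estimate holds at each s. Its threshold for L depends on s, so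
    the transported property only claims density for all sufficiently large L. *)
Theorem dense_transport :
  (forall L, 0 <= L -> dense_range S C (opA c J (fun=> 1%:M) (fun=> 0) L)) ->
  exists L0, forall L, L0 <= L -> dense_range S C (opA c J E B L).
Proof.
move=> flat.
pose Es s x : 'M[R]_n := (1 - s)%:M + s *: E x.
pose Bs s x : 'M[R]_N := s *: B x.
pose P s := exists L0, forall L, L0 <= L -> dense_range S C (opA c J (Es s) (Bs s) L).
have E0C : mCk V 0 E by apply: mCk_le EC.
have EsC s : mCk V 1 (Es s).
  by apply: mCkD => //; [exact: mCk_cst|apply: mCkZ => //; exact: Ck_cst].
have EsC0 s : mCk V 0 (Es s) by apply: mCk_le (EsC s).
have BsC s : mCk V 0 (Bs s) by apply: mCkZ => //; exact: Ck_cst.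
have Esp s : per (Es s) by move=> x j Ox j1; rewrite /Es Ep.
have Bsp s : per (Bs s) by move=> x j Ox j1; rewrite /Bs Bp.
have Esa s : 0 <= s <= 1 -> adapted (Es s).
  move=> s01 p; have [l l0 El] := Ea p; exists ((1 - s) + s * l).
    have [->|sn] := eqVneq s 0; first by rewrite mul0r subr0 addr0.
    have sp : 0 < s by rewrite lt_neqAle eq_sym sn; lra.
    by have := mulr_gt0 sp l0; lra.
  by rewrite /Es mulmxDl mul_scalar_mx -scalemxAl El scalerA -scalerDl.
(* The operators are affine in s, and the L term cancels: the difference is s' - s times one fixed
   operator of first order, with a bound that does not depend on L. *)
have op_diff s s' L psi x : opA c J (Es s') (Bs s') L psi x - opA c J (Es s) (Bs s) L psi x =
    (s' - s) *: (\sum_i (ce c E i x - ce c (fun=> 1%:M) i x) *m mpd i psi x + B x *m psi x).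
  have ceL u i : ce c (Es u) i x = ce c (fun=> 1%:M) i x + u *: (ce c E i x - ce c (fun=> 1%:M) i x).
    rewrite /ce -clB -clZ -clD; congr cl; apply/matrixP => a b; rewrite !mxE.
    by case: (b == i) => /=; rewrite ?mulr1n ?mulr0n; ring.
  rewrite /opA /D0.
  have sE u : \sum_i ce c (Es u) i x *m mpd i psi x = \sum_i ce c (fun=> 1%:M) i x *m mpd i psi x +
      u *: \sum_i (ce c E i x - ce c (fun=> 1%:M) i x) *m mpd i psi x.
    rewrite scaler_sumr -big_split; apply: eq_bigr => i _; rewrite ceL mulmxDl -scalemxAl //.
  rewrite (sE s) (sE s') /Bs -[(s' *: B x) *m _]scalemxAl -[(s *: B x) *m _]scalemxAl.
  move: (\sum_i _) (\sum_i _) (B x *m psi x) (L *: _) => a1 a2 a3 a4.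
  by apply/matrixP => i j; rewrite !mxE; ring.
have [K1 K10 HK1] : exists2 K, 0 <= K & forall psi, mCk V 1 psi ->
  nf (fun x => \sum_i (ce c E i x - ce c (fun=> 1%:M) i x) *m mpd i psi x + B x *m psi x) <= K * (nf psi + gradN psi).
  apply: first_order_nf => // i; apply: mCkB => //; apply: mCk_ce => //; exact: mCk_cst.
have loc s : 0 <= s <= 1 -> exists2 d, 0 < d & forall s', 0 <= s' <= 1 -> `|s' - s| < d -> (P s <-> P s').
  move=> s01.
  have [L0 [K [K0 HK]]] := garding H oV OV (EsC s) (Esp s) (Esa s s01) (fun x Ox => Ed s01 Ox) (BsC s).
  (* Squared norms bring in (s' - s)^2, which is at most |s' - s| <= d because |s' - s| < 1; then K
     K1 d <= 1/64. *)
  pose d := (64 * (K * K1 + 1))^-1.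
  have KK : 0 <= K * K1 by rewrite mulr_ge0.
  have d0 : 0 < d by rewrite invr_gt0 mulr_gt0 //; lra.
  exists (Order.min 1 d); first by rewrite lt_min ltr01.
  move=> s' s'01; rewrite lt_min => /andP[s1 sd].
  have ss : (s' - s) ^+ 2 <= d.
    rewrite -(real_normK (num_real _)) expr2; apply: (@le_trans _ _ `|s' - s|); last exact: ltW.
    by rewrite ler_piMl // ltW.
  have key L : L0 <= L -> dense_range S C (opA c J (Es s) (Bs s) L) <-> dense_range S C (opA c J (Es s') (Bs s') L).
    move=> LL0; have SC u psi : S psi -> C (opA c J (Es u) (Bs u) L psi).
      by move=> [p2 pp _]; apply: opA_cC.
    apply: (dense_iff (Q := fun psi => nf psi + gradN psi) (K := K) (d := (s' - s) ^+ 2 * K1)).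
    - exact: Sp0.
    - exact: SpD.
    - by move=> f [].
    - by move=> f psi [fC fp] /(SC s)[aC ap]; split; [exact: mCkB|move=> x j Ox j1; rewrite fp // ap].
    - by move=> f psi [fC fp] /(SC s')[aC ap]; split; [exact: mCkB|move=> x j Ox j1; rewrite fp // ap].
    - by move=> psi /(SC s)[].
    - by move=> psi /(SC s')[].
    - by move=> psi chi x [p2 _ _] [q2 _ _]; apply: opAD; [apply: mCk_le p2|apply: mCk_le q2].
    - by move=> psi chi x [p2 _ _] [q2 _ _]; apply: opAD; [apply: mCk_le p2|apply: mCk_le q2].
    - exact: K0.
    - by rewrite mulr_ge0 // sqr_ge0.
    - apply: (@le_trans _ _ ((K * K1) * d)).
        by rewrite -[K * K1 * d]mulrA [K1 * d]mulrC; apply: ler_wpM2l => //; exact: ler_wpM2r.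
      have e1 : (K * K1 + 1) * d = 64^-1 by rewrite /d; field; rewrite gt_eqF //; lra.
      have e2 : (K * K1 + 1) * d = (K * K1) * d + d by ring.
      lra.
    - move=> psi [p2 _ _]; have p1 : mCk V 1 psi by apply: mCk_le p2.
      apply: addr_ge0; first by apply: (nf_ge0 oV OV); apply: mCk_le p2.
      apply: (IOge0 OV) => [|x _]; last by apply: sumr_ge0 => i _; exact: ip_ge0.
      by apply: Ck_sum => // i; apply: (Ck_nsq oV); exact: mCk_mpd.
    - by move=> psi Spsi; apply: HK.
    - move=> psi [p2 _ _]; have p1 : mCk V 1 psi by apply: mCk_le p2.
      have p0 : mCk V 0 psi by apply: mCk_le p2.
      have -> : (fun x => opA c J (Es s') (Bs s') L psi x - opA c J (Es s) (Bs s) L psi x) = fun x =>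
         (s' - s) *: (\sum_i (ce c E i x - ce c (fun=> 1%:M) i x) *m mpd i psi x + B x *m psi x).
        by apply/funext => x; exact: op_diff.
      rewrite (nfZ oV OV); first by rewrite -[X in _ <= X]mulrA; apply: ler_wpM2l; [exact: sqr_ge0|exact: HK1].
      apply: mCkD => //; last exact: mCkM.
      apply: mCk_sum => // i; apply: mCkM => //; last exact: mCk_mpd.
      by apply: mCkB => //; apply: mCk_ce => //; exact: mCk_cst.
  split=> -[L1 HL1]; exists (Order.max L0 L1) => L; rewrite ge_max => /andP[h0 h1].
    exact: (proj1 (key L h0) (HL1 L h1)).
  exact: (proj2 (key L h0) (HL1 L h1)).
have P1 : P 1.
  apply: (clopen_path loc); exists 0 => L L0.
  have -> : Es 0 = fun=> 1%:M by apply/funext => x; rewrite /Es subr0 scale0r addr0.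
  have -> : Bs 0 = fun=> 0 by apply/funext => x; rewrite /Bs scale0r.
  exact: flat.
have [L0 HL0] := P1; exists L0 => L /HL0.
have -> : Es 1 = E by apply/funext => x; rewrite /Es subrr scale1r raddf0 add0r.
by have -> : Bs 1 = B by apply/funext => x; rewrite /Bs scale1r.
Qed.

End Transport.
End Continuity.

(** * The flat model: a uniform estimate and explicit spinors *)

Section FlatModel.
Variables (R : realType) (k N : nat).
Local Notation n := k.+2.
Local Notation Om := (@solid_torus R k).
Local Notation o1 := (lift ord0 ord0).
Local Notation l2 j := (lift ord0 (lift ord0 j)).
Variables (c : 'I_n -> 'M[R]_N) (J : 'M[R]_N) (H : clifford c J).
Variables (V : set 'rV[R]_n) (oV : open V) (OV : Om `<=` V).
Implicit Types (psi chi f g : 'rV[R]_n -> 'M[R]_N) (x : 'rV[R]_n).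
Local Notation field := ('rV[R]_n -> 'M[R]_N).

(* The torus directions are scaled by [s]; at [s = 0] only the Dirac operator of the
   disk remains. *)
Definition wt (s : R) (i : 'I_n) : R := if (i == ord0) || (i == o1) then 1 else s.
Definition Esig (s : R) (x : 'rV[R]_n) : 'M[R]_n := \matrix_(i, j) ((i == j)%:R * wt s i).

Lemma ce_sig s i x : ce c (Esig s) i x = wt s i *: c i.
Proof.
rewrite /ce /cl (bigD1 i) //= !mxE eqxx mul1r big1 ?addr0 // => a ai.
by rewrite !mxE (negPf ai) mul0r scale0r.
Qed.

Lemma Esig1 : Esig 1 = fun=> 1%:M.
Proof.
apply/funext => x; apply/matrixP => i j; rewrite !mxE /wt.
by case: (_ || _); rewrite mulr1.
Qed.

Lemma sig_nn s x : Esig s x *m (nn x)^T = (nn x)^T.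
Proof.
apply/matrixP => i j; rewrite ord1 mxE (bigD1 i) //= [Esig s x i i]mxE eqxx mul1r big1 ?addr0 => [|a ai].
  rewrite [(nn x)^T i 0]mxE nnE /wt; case: eqP => [_|_]; first by rewrite mul1r.
  by case: eqP => [_|_]; rewrite ?mul1r // mulr0.
by rewrite mxE eq_sym (negPf ai) mul0r mul0r.
Qed.

Lemma adapted_sig s : adapted (Esig s).
Proof. by move=> p; exists 1 => //; rewrite scale1r sig_nn. Qed.

Lemma mCk_sig s q : mCk V q (Esig s). Proof. exact: mCk_cst. Qed.

Lemma divS_sig s j x : divS c (Esig s) j x = 0.
Proof.
apply: big1 => i _.
have -> : Sc c (Esig s) i j = fun=> Sc c (Esig s) i j 0.
  by apply/funext => y; rewrite /Sc !ce_sig.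
exact: mpd_cst.
Qed.

Lemma divc_sig s x : divc c (Esig s) x = 0.
Proof.
apply: big1 => i _.
have -> : ce c (Esig s) i = fun=> ce c (Esig s) i 0 by apply/funext => y; rewrite !ce_sig.
exact: mpd_cst.
Qed.

Lemma tau_sq (p : 'rV[R]_k.+1) : (tau (bd_incl p) *m (tau (bd_incl p))^T) 0 0 = 1.
Proof.
have tE x a : tau x 0 a = if a == ord0 then - x 0 o1 else if a == o1 then x 0 ord0 else 0.
  rewrite !mxE /=; have [->|a0] := eqVneq a ord0; first by rewrite mulr1 mulr0 addr0.
  by case: eqP => _; rewrite ?mulr1 ?mulr0 ?addr0 ?add0r.
rewrite mxE (eq_bigr (fun i => tau (bd_incl p) 0 i ^+ 2)) => [|i _]; last by rewrite [X in _ * X]mxE expr2.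
rewrite big_ord_n !tE /= big1 ?addr0 => [|j _]; last by rewrite tE /= expr0n.
by rewrite sqrrN addrC bd_circle.
Qed.

Lemma nn_tau x : (nn x *m (tau x)^T) 0 0 = 0.
Proof.
rewrite mxE big_ord_n big1 ?addr0 => [|j _]; last by rewrite nnE /= mul0r.
by rewrite !nnE !mxE /= !mulr1 !mulr0 !addr0 add0r; ring.
Qed.

Lemma tSc_sig s p : tSc c (Esig s) (bd_incl p) = cl c (nn (bd_incl p)) *m cl c (tau (bd_incl p)).
Proof.
set x := bd_incl p.
have El : Esig s x *m (nn x)^T = 1 *: (nn x)^T by rewrite scale1r sig_nn.
rewrite /tSc (nSc_bd c El ord0) (nSc_bd c El o1) !ce_sig /wt /= !scale1r.
have e : cl c (tau x) = - x 0 o1 *: c ord0 + x 0 ord0 *: c o1 by rewrite /tau clD !clZ !cl_e.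
have anti : cl c (tau x) *m cl c (nn x) = - (cl c (nn x) *m cl c (tau x)).
  by rewrite (cl_mul H (nn x)) nn_tau mulr0 raddf0 subr0 opprK.
transitivity (2^-1 *: (cl c (nn x) *m cl c (tau x) - cl c (tau x) *m cl c (nn x))).
  rewrite e mulmxDl mulmxDr -!scalemxAl -!scalemxAr.
  move: (cl c (nn x) *m c ord0) (cl c (nn x) *m c o1) (c ord0 *m cl c (nn x)) (c o1 *m cl c (nn x)) => a1 a2 a3 a4.
  by apply/matrixP => i j; rewrite !mxE; field.
rewrite anti opprK; move: (_ *m _) => a1.
by apply/matrixP => i j; rewrite !mxE; field.
Qed.

Lemma flux_sig s psi p : mCk V 1 psi -> bdc c J psi ->
  ip (psi (bd_incl p)) (\sum_j nSc c (Esig s) j (bd_incl p) *m mpd j psi (bd_incl p)) =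
  - 2^-1 * nsq (psi (bd_incl p)).
Proof.
move=> pC bp; have := flat_flux H oV OV (adapted_sig s) p pC bp.
rewrite tSc_sig; set x := bd_incl p.
have tt : cl c (tau x) *m cl c (tau x) = (- 1)%:M by rewrite (cl_sq H) tau_sq.
have -> : cl c (nn x) *m cl c (tau x) *m (cl c (tau x) *m J *m psi x) = - psi x.
  rewrite -!mulmxA [cl c (tau x) *m (cl c (tau x) *m _)]mulmxA tt mul_scalar_mx scaleN1r mulmxN.
  by rewrite mulmxA bp.
by rewrite ipNr => e; lra.
Qed.

(** The constant depends neither on s nor on L. The unit circle contributes the flux exactly -
    |psi|^2 / 2, so twice the frame gradient plus the boundary norm equals twice |D psi|^2; the
    terms with J have the good sign; and the radial trace identity bounds |psi|^2 by the boundary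
    norm plus twice the gradient in the disk. *)
Lemma sig_estimate s L psi : 0 <= s -> 0 <= L -> Sp c J V psi ->
  nf psi <= 2 * nf (opA c J (Esig s) (fun=> 0) (s * L) psi).
Proof.
move=> s0 L0 [p2 pp bp].
have p1 : mCk V 1 psi by apply: mCk_le p2.
have p0 : mCk V 0 psi by apply: mCk_le p2.
have c1 a : Ck 0 V (fun=> a) by exact: Ck_cst.
have m0 i : mCk V 0 (mpd i psi) by exact: mCk_mpd.
have EC : mCk V 1 (Esig s) by exact: mCk_sig.
have Ep : per (Esig s) by [].
have dC : mCk V 0 (D0 c (Esig s) psi).
  by apply: mCk_sum => // i; apply: mCkM => //; apply: mCk_ce => //; exact: mCk_sig.
have pn := Ck_nsq oV p0.
have frC : Ck 0 V (fun x => \sum_a nsq (\sum_i Esig s x a i *: mpd i psi x)).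
  apply: Ck_sum => // a; apply: (Ck_nsq oV); apply: mCk_sum => // i; apply: mCkZ => //.
  exact: (mCk_sig s 0 a i).
have i1 : IO (fun x => \sum_a nsq (\sum_i Esig s x a i *: mpd i psi x)) - nf (D0 c (Esig s) psi) =
    - 2^-1 * IBd (fun x => nsq (psi x)).
  have := flat_identity H oV OV EC Ep p2 pp.
  have -> : (fun x => \sum_a nsq (\sum_i Esig s x a i *: mpd i psi x) - nsq (D0 c (Esig s) psi x) +
       ip (psi x) (\sum_j divS c (Esig s) j x *m mpd j psi x)) =
     fun x => \sum_a nsq (\sum_i Esig s x a i *: mpd i psi x) - nsq (D0 c (Esig s) psi x).
    apply/funext => x; have -> : \sum_j divS c (Esig s) j x *m mpd j psi x = 0.
      by apply: big1 => j _; rewrite divS_sig mul0mx.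
    by rewrite ip0r addr0.
  rewrite (IOB OV frC (Ck_nsq oV dC)) => ->; rewrite -(IBZ OV _ pn); apply: (IBeq OV).
  - apply: Ck_ip => //; apply: mCk_sum => // j; apply: mCkM => //.
    apply: mCkD => //; apply: mCkZ => //; try exact: Ck_coord; apply: mCk_Sc => //; exact: mCk_sig.
  - exact: (CkM oV (c1 _) pn).
  - by move=> x [p _ <-]; exact: flux_sig.
have i2 : 2 * IO (fun x => ip (D0 c (Esig s) psi x) (J *m psi x)) <= 0.
  have Jp : mCk V 0 (fun x => J *m psi x) by apply: mCkM => //; exact: mCk_cst.
  have t1 : Ck 0 V (fun x => ip (D0 c (Esig s) psi x) (J *m psi x)) by exact: Ck_ip.
  have := flatJ_identity H oV OV EC Ep p1 pp.
  have -> : (fun x => 2 * ip (D0 c (Esig s) psi x) (J *m psi x) - ip (psi x) (divc c (Esig s) x *m (J *m psi x))) =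
     fun x => 2 * ip (D0 c (Esig s) psi x) (J *m psi x).
    by apply/funext => x; rewrite divc_sig mul0mx ip0r subr0.
  rewrite (IOZ OV 2 t1) => ->; rewrite -(pf0 (@pf_IBd R k)); apply: (IBle OV); [|exact: c1|].
    apply: (CkN oV (k := 0)); apply: Ck_ip => //; apply: mCkM => //.
    by apply: mCkD => //; apply: mCkZ => //; try exact: Ck_coord; apply: mCk_ce => //; exact: mCk_sig.
  move=> x [p _ <-]; have [l l0 ->] := flatJ_flux (adapted_sig s) p bp.
  by rewrite oppr_le0 mulr_ge0 ?ip_ge0 // ltW.
have i3 : nf (D0 c (Esig s) psi) <= nf (opA c J (Esig s) (fun=> 0) (s * L) psi).
  have Jp : mCk V 0 (fun x => J *m psi x) by apply: mCkM => //; exact: mCk_cst.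
  have t1 : Ck 0 V (fun x => ip (D0 c (Esig s) psi x) (J *m psi x)) by exact: Ck_ip.
  have e : nf (opA c J (Esig s) (fun=> 0) (s * L) psi) = nf (D0 c (Esig s) psi) -
      (s * L) * (2 * IO (fun x => ip (D0 c (Esig s) psi x) (J *m psi x))) + (s * L) ^+ 2 * nf psi.
    rewrite -(IOZ OV 2 t1) -(IOZ OV (s * L) (CkM oV (c1 2) t1)) /nf -(IOZ OV ((s * L) ^+ 2) pn).
    rewrite -(IOB OV (Ck_nsq oV dC) (CkM oV (c1 (s * L)) (CkM oV (c1 2) t1))).
    rewrite -(IOD OV (CkB oV (Ck_nsq oV dC) (CkM oV (c1 (s * L)) (CkM oV (c1 2) t1))) (CkM oV (c1 _) pn)).
    congr IO; apply/funext => x.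
    have JJ : nsq (J *m psi x) = nsq (psi x) by rewrite ip_adjl (J_sym H) mulmxA (J_sq H) mul1mx.
    by rewrite /opA mul0mx addr0 ipBl !ipBr !ipZl !ipZr JJ (ipC (J *m psi x)); ring.
  have sL : 0 <= s * L by rewrite mulr_ge0.
  have h1 : s * L * (2 * IO (fun x => ip (D0 c (Esig s) psi x) (J *m psi x))) <= 0 by rewrite mulr_ge0_le0.
  have h2 : 0 <= (s * L) ^+ 2 * nf psi by rewrite mulr_ge0 ?sqr_ge0 // (nf_ge0 oV OV).
  by rewrite e; lra.
have i4 : nf psi <= IBd (fun x => nsq (psi x)) + 2 * IO (fun x => \sum_a nsq (\sum_i Esig s x a i *: mpd i psi x)).
  have pos2C i : Ck 0 V (pos2 i).
    by rewrite /pos2; case: (i == ord0); [exact: Ck_coord|case: (i == o1); [exact: Ck_coord|exact: Ck_cst]].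
  have tC : Ck 0 V (fun x => 2 * nsq (psi x) + 2 * \sum_i pos2 i x * ip (psi x) (mpd i psi x)).
    apply: (CkD oV (CkM oV (c1 2) pn)); apply: (CkM oV (c1 2)).
    by apply: Ck_sum => // i; apply: (CkM oV (pos2C i)); exact: Ck_ip.
  have tr := trace_identity oV OV p1 pp.
  have e1 : 2 * nf psi = IBd (fun x => nsq (psi x)) - 2 * IO (fun x => \sum_i pos2 i x * ip (psi x) (mpd i psi x)).
    have sC : Ck 0 V (fun x => \sum_i pos2 i x * ip (psi x) (mpd i psi x)).
      by apply: Ck_sum => // i; apply: (CkM oV (pos2C i)); exact: Ck_ip.
    by rewrite tr (IOD OV (CkM oV (c1 2) pn) (CkM oV (c1 2) sC)) (IOZ OV 2 pn) (IOZ OV 2 sC) addrK.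
  suff h : - (2 * IO (fun x => \sum_i pos2 i x * ip (psi x) (mpd i psi x))) <=
      nf psi + 2 * IO (fun x => \sum_a nsq (\sum_i Esig s x a i *: mpd i psi x)).
    by move: e1 h; lra.
  have sC : Ck 0 V (fun x => \sum_i pos2 i x * ip (psi x) (mpd i psi x)).
    by apply: Ck_sum => // i; apply: (CkM oV (pos2C i)); exact: Ck_ip.
  rewrite -mulNr -(IOZ OV (- 2) sC) /nf -(IOZ OV 2 frC) -(IOD OV pn (CkM oV (c1 2) frC)).
  apply: (IOleK OV); [exact: (CkM oV (c1 _) sC)|exact: (CkD oV pn (CkM oV (c1 2) frC))|].
  move=> x Kx.
  have h0 (i : 'I_n) : - 2 * (pos2 i x * ip (psi x) (mpd i psi x)) <= 2^-1 * (pos2 i x ^+ 2 * nsq (psi x)) + 2 * (if (i == ord0) || (i == o1) then nsq (mpd i psi x) else 0).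
    have t2 : (0 : R) < 2^-1 by rewrite invr_gt0.
    have := ip_agm (- pos2 i x *: psi x) (mpd i psi x) t2; rewrite !ipZl ipZr invrK /pos2.
    case: eqP => [_|_] /=; first by rewrite expr2; lra.
    by case: eqP => [_|_] /=; [rewrite expr2; lra|rewrite expr0n /=; lra].
  have h1 : - 2 * (\sum_i pos2 i x * ip (psi x) (mpd i psi x)) <=
     2^-1 * (x 0 ord0 ^+ 2 + x 0 o1 ^+ 2) * nsq (psi x) + 2 * (nsq (mpd ord0 psi x) + nsq (mpd o1 psi x)).
    rewrite mulr_sumr; apply: le_trans (ler_sum _ (fun i _ => h0 i)) _.
    rewrite big_ord_n /pos2 /= [X in _ + (_ + X)]big1 => [|j _].
      rewrite addr0; lra.
    by rewrite /= expr0n /= mul0r !mulr0 addr0.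
  have h2 : nsq (mpd ord0 psi x) + nsq (mpd o1 psi x) <= \sum_a nsq (\sum_i Esig s x a i *: mpd i psi x).
    have e (a : 'I_n) : \sum_i Esig s x a i *: mpd i psi x = wt s a *: mpd a psi x.
      rewrite (bigD1 a) //= mxE eqxx mul1r big1 ?addr0 // => i ia.
      by rewrite mxE eq_sym (negPf ia) mul0r scale0r.
    rewrite big_ord_n !e /wt /= !scale1r addrA lerDl; apply: sumr_ge0 => j _; exact: ip_ge0.
  have := K0_Om Kx; rewrite /solid_torus /= one_lift => r1.
  have q0 := ip_ge0 (psi x).
  have h3 : 2^-1 * (x 0 ord0 ^+ 2 + x 0 o1 ^+ 2) * nsq (psi x) <= 2^-1 * 1 * nsq (psi x).
    by apply: ler_wpM2r => //; apply: ler_wpM2l => //; rewrite invr_ge0.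
  move: h1 h2 h3 q0; lra.
have h0 : 0 <= IBd (fun x => nsq (psi x)) by apply: (IBge0 OV pn) => x _; exact: ip_ge0.
move: i1 i3 i4 h0; lra.
Qed.

Local Notation e12 := (c ord0 *m c o1).
(** [e12] squares to -1 and serves as imaginary unit in the disk: [Zm] is multiplication by z = x +
    i y, [Zb] by its conjugate, and [mono a b] by z^a conj(z)^b. *)
Definition Zm x : 'M[R]_N := x 0 ord0 *: 1%:M + x 0 o1 *: e12.
Definition Zb x : 'M[R]_N := x 0 ord0 *: 1%:M - x 0 o1 *: e12.
Definition mono (a b : nat) (xi : 'M[R]_N) x : 'M[R]_N := iter a (mulmx (Zm x)) (iter b (mulmx (Zb x)) xi).
Definition phase (kap : 'I_k -> int) x : R := 2 * pi * \sum_j (kap j)%:~R * x 0 (l2 j).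
(* [c ord0] squares to -1 and replaces the imaginary unit. *)
Definition ek kap x : 'M[R]_N := cos (phase kap x) *: 1%:M + sin (phase kap x) *: c ord0.
Definition Psum (s : seq (nat * nat * 'M[R]_N)) x := \sum_(t <- s) mono t.1.1 t.1.2 t.2 x.
Definition Pk kap f := exists s, f = fun x => Psum s x *m ek kap x.

Lemma c0_sq : c ord0 *m c ord0 = (- 1)%:M.
Proof.
by rewrite -(cl_e c ord0) (cl_sq H); congr (- _)%:M; rewrite mxE (bigD1 ord0) //= !mxE !eqxx mulr1 big1 ?addr0
  // => a a0; rewrite !mxE (negPf a0) andbF mul0r.
Qed.

Lemma c_anti a b : a != b -> c a *m c b = - (c b *m c a).
Proof. by move=> ab; rewrite (cl_anti H a b) (negPf ab) mulr0 raddf0 subr0. Qed.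

Lemma c0e : c ord0 *m e12 = - c o1.
Proof. by rewrite mulmxA c0_sq mul_scalar_mx scaleN1r. Qed.
Lemma ec0 : e12 *m c ord0 = c o1.
Proof. by rewrite -mulmxA (@c_anti o1 ord0) // mulmxN c0e opprK. Qed.
Lemma ee : e12 *m e12 = (- 1)%:M.
Proof. by rewrite mulmxA ec0 -(cl_e c o1) (cl_sq H); congr (- _)%:M; rewrite mxE (bigD1 o1) //= !mxE !eqxx mulr1 big1 ?addr0
  // => a a0; rewrite !mxE (negPf a0) andbF mul0r. Qed.

Lemma c0Z x : c ord0 *m Zm x = Zb x *m c ord0.
Proof.
by rewrite /Zm /Zb mulmxDr mulmxBl -!scalemxAr -!scalemxAl mulmx1 mul1mx c0e ec0 scalerN.
Qed.
Lemma c0Zb x : c ord0 *m Zb x = Zm x *m c ord0.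
Proof.
by rewrite /Zm /Zb mulmxDl mulmxBr -!scalemxAr -!scalemxAl mulmx1 mul1mx c0e ec0 scalerN opprK.
Qed.
Lemma ZZb x : Zm x *m Zb x = (x 0 ord0 ^+ 2 + x 0 o1 ^+ 2)%:M.
Proof.
rewrite /Zm /Zb mulmxDl !mulmxBr -!scalemxAr -!scalemxAl !mulmx1 !mul1mx ee.
rewrite -[RHS]scalemx1 -[(- 1)%:M]scalemx1; move: (1%:M : 'M[R]_N) e12 => I1 X.
by apply/matrixP => i j; rewrite !mxE; ring.
Qed.
Lemma ZbZ x : Zb x *m Zm x = Zm x *m Zb x.
Proof.
rewrite /Zm /Zb !mulmxDl !mulmxDr !mulmxN !mulNmx -!scalemxAr -!scalemxAl !mulmx1 !mul1mx ee.
move: (1%:M : 'M[R]_N) e12 => I1 X.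
by apply/matrixP => i j; rewrite !mxE; ring.
Qed.

Lemma e12_comm a : a != ord0 -> a != o1 -> c a *m e12 = e12 *m c a.
Proof.
by move=> a0 a1; rewrite [LHS]mulmxA (c_anti a0) mulNmx -[in LHS]mulmxA (c_anti a1) mulmxN opprK mulmxA.
Qed.
Lemma e12_J : J *m e12 = e12 *m J.
Proof. by rewrite -[in RHS]mulmxA (cl_J H) mulmxN mulmxA -[X in X *m _]opprK -(cl_J H) mulNmx -mulmxA mulmxA. Qed.

Lemma iter_comm (M A B X : 'M[R]_N) a : M *m A = B *m M ->
  M *m iter a (mulmx A) X = iter a (mulmx B) (M *m X).
Proof. by move=> MA; elim: a => [//|a IH] /=; rewrite mulmxA MA -mulmxA IH. Qed.

Lemma mono_c0 a b xi x : c ord0 *m mono a b xi x = mono b a (c ord0 *m xi) x.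
Proof.
rewrite /mono (iter_comm _ _ (c0Z x)) (iter_comm _ _ (c0Zb x)).
by elim: b => [//|b IH] /=; rewrite -IH -(iter_comm _ _ (esym (ZbZ x))).
Qed.
Lemma mono_comm M a b xi x : M *m e12 = e12 *m M -> M *m mono a b xi x = mono a b (M *m xi) x.
Proof.
move=> Me; rewrite /mono (@iter_comm M (Zm x) (Zm x)) ?(@iter_comm M (Zb x) (Zb x)) //.
  by rewrite /Zb mulmxBl mulmxBr -!scalemxAr -!scalemxAl mulmx1 mul1mx Me.
by rewrite /Zm mulmxDl mulmxDr -!scalemxAr -!scalemxAl mulmx1 mul1mx Me.
Qed.
Lemma mono_mulr Y a b xi x : mono a b xi x *m Y = mono a b (xi *m Y) x.
Proof.
rewrite /mono; elim: a => [|a IH] /=; last by rewrite -mulmxA IH.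
by elim: b => [//|b IH] /=; rewrite -mulmxA IH.
Qed.
Lemma monoD a b xi eta x : mono a b (xi + eta) x = mono a b xi x + mono a b eta x.
Proof.
rewrite /mono; elim: a => [|a IH] /=; last by rewrite IH mulmxDr.
by elim: b => [//|b IH] /=; rewrite IH mulmxDr.
Qed.
Lemma monoZ r a b xi x : mono a b (r *: xi) x = r *: mono a b xi x.
Proof.
rewrite /mono; elim: a => [|a IH] /=; last by rewrite IH scalemxAr.
by elim: b => [//|b IH] /=; rewrite IH scalemxAr.
Qed.
Lemma monoN a b xi x : mono a b (- xi) x = - mono a b xi x.
Proof. by rewrite -scaleN1r monoZ scaleN1r. Qed.
Lemma mono0 a b x : mono a b 0 x = 0.
Proof. by have := monoZ 0 a b 0 x; rewrite !scale0r. Qed.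
Lemma mono_sum (I : Type) (r : seq I) (F : I -> 'M[R]_N) a b x :
  mono a b (\sum_(i <- r) F i) x = \sum_(i <- r) mono a b (F i) x.
Proof. by elim/big_rec2: _ => [|i y z _ <-]; [exact: mono0|exact: monoD]. Qed.
Lemma monoSb a b xi x : mono a b.+1 xi x = Zb x *m mono a b xi x.
Proof. by rewrite /mono /= (iter_comm _ _ (ZbZ x)). Qed.
Lemma mono_cancel a b d xi p : mono (a + d) (b + d) xi (bd_incl p) = mono a b xi (bd_incl p).
Proof.
elim: d => [|d IH]; first by rewrite !addn0.
rewrite !addnS monoSb -[mono _.+1 _ _ _]/(Zm _ *m mono _ _ _ _) mulmxA ZbZ ZZb bd_circle.
by rewrite mul_scalar_mx scale1r.
Qed.

Lemma mCk_Zm q : mCk setT q Zm.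
Proof.
by apply: mCkD; [exact: openT| |]; apply: mCkZ; try exact: openT; try exact: Ck_coord; exact: mCk_cst.
Qed.
Lemma mCk_Zb q : mCk setT q Zb.
Proof.
by apply: mCkB; [exact: openT| |]; apply: mCkZ; try exact: openT; try exact: Ck_coord; exact: mCk_cst.
Qed.
Lemma mCk_mono q a b xi : mCk setT q (mono a b xi).
Proof.
elim: a => [|a IH].
  elim: b => [|b IH]; first exact: mCk_cst.
  exact: (mCkM openT (mCk_Zb q) IH).
exact: (mCkM openT (mCk_Zm q) IH).
Qed.

Let TT (x : 'rV[R]_n) : setT x. Proof. by []. Qed.

Lemma mpd_Zm i x : mpd i Zm x = (i == ord0)%:R *: 1%:M + (i == o1)%:R *: e12.
Proof.
have xc j : Ck 1 setT (fun x : 'rV[R]_n => x 0 j) by exact: Ck_coord.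
have cs (A : 'M[R]_N) : mCk setT 1 (fun _ : 'rV[R]_n => A) by exact: mCk_cst.
rewrite /Zm (mpdD openT (TT x) i (mCkZ openT (xc _) (cs _)) (mCkZ openT (xc _) (cs _))).
by rewrite !(mpdZ openT (TT x) i (xc _) (cs _)) !mpd_cst !scaler0 !addr0 !partial_coord.
Qed.
Lemma mpd_Zb i x : mpd i Zb x = (i == ord0)%:R *: 1%:M - (i == o1)%:R *: e12.
Proof.
have xc j : Ck 1 setT (fun x : 'rV[R]_n => x 0 j) by exact: Ck_coord.
have cs (A : 'M[R]_N) : mCk setT 1 (fun _ : 'rV[R]_n => A) by exact: mCk_cst.
rewrite /Zb (mpdB openT (TT x) i (mCkZ openT (xc _) (cs _)) (mCkZ openT (xc _) (cs _))).
by rewrite !(mpdZ openT (TT x) i (xc _) (cs _)) !mpd_cst !scaler0 !addr0 !partial_coord.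
Qed.

Lemma mpd_mono_t a b xi j x : mpd (l2 j) (mono a b xi) x = 0.
Proof.
elim: a => [|a IH].
  elim: b => [|b IH]; first exact: mpd_cst.
  rewrite (mpdM openT (TT x) _ (mCk_Zb 1) (mCk_mono 1 0 b xi)) mpd_Zb IH mulmx0 addr0.
  by rewrite /= !scale0r subr0 mul0mx.
rewrite (mpdM openT (TT x) _ (mCk_Zm 1) (mCk_mono 1 a b xi)) mpd_Zm IH mulmx0 addr0.
by rewrite /= !scale0r addr0 mul0mx.
Qed.

Lemma dbar_mono a b xi x : mpd ord0 (mono a b xi) x - e12 *m mpd o1 (mono a b xi) x =
  (2 * a%:R) *: mono a.-1 b xi x.
Proof.
have eZ : e12 *m Zm x = Zm x *m e12.
  by rewrite /Zm mulmxDl mulmxDr -!scalemxAr -!scalemxAl mulmx1 mul1mx.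
have eZb : e12 *m Zb x = Zb x *m e12.
  by rewrite /Zb mulmxBl mulmxBr -!scalemxAr -!scalemxAl mulmx1 mul1mx.
have := mpd_Zm^~ x; have := mpd_Zb^~ x; move: eZ eZb ee; move: e12 => X eZ eZb eX dZb dZm.
elim: a => [|a IH].
  rewrite mulr0 scale0r; elim: b => [|b IH]; first by rewrite /mono /= !mpd_cst mulmx0 subr0.
  rewrite !(mpdM openT (TT x) _ (mCk_Zb 1) (mCk_mono 1 0 b xi)) !dZb /= !scale1r !scale0r subr0 sub0r.
  rewrite mul1mx mulmxDr mulNmx mulmxN !mulmxA eX mul_scalar_mx scaleN1r opprK eZb opprD addrACA subrr add0r.
  by rewrite -mulmxA -mulmxBr IH mulmx0.
rewrite !(mpdM openT (TT x) _ (mCk_Zm 1) (mCk_mono 1 a b xi)) !dZm /= !scale1r !scale0r addr0 add0r.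
rewrite mul1mx mulmxDr !mulmxA eX mul_scalar_mx scaleN1r eZ opprD opprK addrACA -(mulmxA (Zm x) X) -mulmxBr IH.
case: a {IH} => [|a]; first by rewrite mulr0 scale0r mulmx0 addr0 -mulr2n -scaler_nat mulr1.
rewrite -scalemxAr -[Zm x *m mono _ _ _ _]/(mono a.+1 b xi x) -mulr2n -scaler_nat -scalerDl.
by congr (_ *: _); rewrite -[in RHS]natr1; ring.
Qed.

(** Factoring c ord0 out of the Dirac operator of the disk leaves 2 d/dz, which ignores powers of
    conj(z); moving c ord0 past the monomial exchanges z and conj(z). *)
Lemma D2_mono a b xi x : c ord0 *m mpd ord0 (mono a b xi) x + c o1 *m mpd o1 (mono a b xi) x =
  mono b a.-1 ((2 * a%:R) *: (c ord0 *m xi)) x.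
Proof.
rewrite monoZ -mono_c0 scalemxAr -dbar_mono mulmxBr mulmxA c0e mulNmx opprK //.
Qed.

Lemma Ck_phase q kap : Ck q setT (phase kap).
Proof.
apply: (CkM openT); first exact: Ck_cst.
by apply: Ck_sum => [|j]; [exact: openT|apply: (CkM openT); [exact: Ck_cst|exact: Ck_coord]].
Qed.

Lemma mCk_ek q kap : mCk setT q (ek kap).
Proof.
have [cc cs] := Ck_cos_sin openT (Ck_phase q kap).
by apply: (mCkD openT); apply: (mCkZ openT) => //; exact: mCk_cst.
Qed.

Lemma pd_phase i kap x : pd i (phase kap) x = 2 * pi * \sum_j (kap j)%:~R * (i == l2 j)%:R.
Proof.
have dC j : Ck 1 setT (fun x : 'rV[R]_n => (kap j)%:~R * x 0 (l2 j)).
  by apply: (CkM openT); [exact: Ck_cst|exact: Ck_coord].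
have sC : Ck 1 setT (fun x : 'rV[R]_n => \sum_j (kap j)%:~R * x 0 (l2 j)) by apply: Ck_sum => //; exact: openT.
have cC (a : R) : Ck 1 setT (fun _ : 'rV[R]_n => a) by exact: Ck_cst.
have c0 (a : R) : pd i (fun _ : 'rV[R]_n => a) x = 0 by apply: pd_val; exact: is_derive_cst.
rewrite /phase (partialM (Ck_derivable (cC _) (TT x)) (Ck_derivable sC (TT x))) c0 mul0r add0r.
rewrite (proj2 (partial_sum _ (fun j => Ck_derivable (dC j) (TT x)))); congr (_ * _).
apply: eq_bigr => j _; rewrite (partialM (Ck_derivable (cC _) (TT x)) (Ck_derivable (Ck_coord setT 1 _) (TT x))).
by rewrite c0 mul0r add0r partial_coord.
Qed.

Lemma mpd_ek i kap x : mpd i (ek kap) x = pd i (phase kap) x *: (ek kap x *m c ord0).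
Proof.
have [cc cs] := Ck_cos_sin openT (Ck_phase 1 kap).
have dp := derivableP' (Ck_derivable (Ck_phase 1 kap) (TT x) : derivable _ _ 'e_i).
have pc : pd i (fun y => cos (phase kap y)) x = - sin (phase kap x) * pd i (phase kap) x.
  by apply: pd_val; apply: (is_derive_compR dp); exact: is_derive_cos.
have ps : pd i (fun y => sin (phase kap y)) x = cos (phase kap x) * pd i (phase kap) x.
  by apply: pd_val; apply: (is_derive_compR dp); exact: is_derive_sin.
have k1 (A : 'M[R]_N) : mCk setT 1 (fun _ : 'rV[R]_n => A) by exact: mCk_cst.
rewrite /ek (mpdD openT (TT x) i (mCkZ openT cc (k1 _)) (mCkZ openT cs (k1 _))).
rewrite (mpdZ openT (TT x) i cc (k1 _)) (mpdZ openT (TT x) i cs (k1 _)) !mpd_cst !scaler0 !addr0 pc ps.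
rewrite mulmxDl -!scalemxAl mul1mx c0_sq -[(- 1)%:M]scalemx1.
move: (1%:M : 'M[R]_N) (c ord0) => A B.
by apply/matrixP => a b; rewrite !mxE; ring.
Qed.

Lemma per_ek kap : per (ek kap).
Proof.
move=> x j Ox j1; have [j' ->] : exists j', j = l2 j'.
  by case: (lift2E j) j1 => [->|->|[j' ->]] // _; exists j'.
have -> : ek kap (x + 'e_(l2 j')) = cos (phase kap x + (kap j')%:~R * (2 * pi)) *: 1%:M +
   sin (phase kap x + (kap j')%:~R * (2 * pi)) *: c ord0.
  suff e : phase kap (x + 'e_(l2 j')) = phase kap x + (kap j')%:~R * (2 * pi) by rewrite /ek e.
  rewrite /phase [X in _ = _ + X]mulrC -mulrDr; congr (_ * _).
  rewrite (eq_bigr (fun j => (kap j)%:~R * x 0 (l2 j) + (kap j)%:~R * (j == j')%:R)) => [|l _]; last first.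
    by rewrite !mxE eqxx /= mulrDr !(inj_eq lift_inj).
  rewrite big_split /= [X in _ + X](bigD1 j') //= eqxx mulr1 [X in _ + (_ + X)]big1 ?addr0 // => l lj.
  by rewrite (negPf lj) mulr0.
by have [-> ->] := cos_sin_periodz (phase kap x) (kap j').
Qed.

Lemma Psum_cat s s' x : Psum (s ++ s') x = Psum s x + Psum s' x.
Proof. by rewrite /Psum big_cat. Qed.

Lemma mCk_Psum q s : mCk setT q (Psum s).
Proof. by apply: (mCk_sum openT) => t; exact: mCk_mono. Qed.

Lemma per_Psum s : per (Psum s).
Proof.
move=> x j Ox j1; apply: eq_bigr => t _.
have z : Zm (x + 'e_j) = Zm x /\ Zb (x + 'e_j) = Zb x.
  have e0 : (x + 'e_j) 0 ord0 = x 0 ord0.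
    rewrite !mxE; have -> : (ord0 == j) = false by apply/eqP => e; rewrite -e in j1.
    by rewrite andbF addr0.
  have e1 : (x + 'e_j) 0 o1 = x 0 o1.
    rewrite !mxE; have -> : (o1 == j) = false by apply/eqP => e; rewrite -e in j1.
    by rewrite andbF addr0.
  by rewrite /Zm /Zb e0 e1.
by rewrite /mono (proj1 z) (proj2 z).
Qed.

(** The action of the operator on coefficient lists of a fixed frequency: first the disk part, then
    the torus derivatives and J. For exponent 0 the truncated predecessor is harmless, as its
    coefficient vanishes. *)
Definition ops (sg L : R) (kap : 'I_k -> int) (s : seq (nat * nat * 'M[R]_N)) :=
  [seq (t.1.2, t.1.1.-1, (2 * t.1.1%:R) *: (c ord0 *m t.2)) | t <- s] ++
  [seq (t.1.1, t.1.2, \sum_j (sg * (2 * pi * (kap j)%:~R)) *: (c (l2 j) *m t.2 *m c ord0) - L *: (J *m t.2)) | t <- s].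

Lemma mpd_mode i kap s x : mpd i (fun x => Psum s x *m ek kap x) x =
  (\sum_(t <- s) mpd i (mono t.1.1 t.1.2 t.2) x) *m ek kap x + pd i (phase kap) x *: (Psum s x *m c ord0 *m ek kap x).
Proof.
have ec : ek kap x *m c ord0 = c ord0 *m ek kap x.
  by rewrite /ek mulmxDl mulmxDr -!scalemxAr -!scalemxAl mulmx1 mul1mx.
rewrite (mpdM openT (TT x) i (mCk_Psum 1 s) (mCk_ek 1 kap)); congr (_ *m _ + _).
  by rewrite /Psum (mpd_sum openT (TT x) i) // => t; exact: mCk_mono.
by rewrite mpd_ek ec -scalemxAr mulmxA.
Qed.

(** Phases multiply from the right and therefore commute with the Clifford action; a torus
    derivative only adds a right factor c ord0, which the phase also commutes with. So the frequency
    is preserved and the disk polynomial stays a polynomial. *)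
Lemma opA_mode sg L kap s : opA c J (Esig sg) (fun=> 0) L (fun x => Psum s x *m ek kap x) =
  fun x => Psum (ops sg L kap s) x *m ek kap x.
Proof.
apply/funext => x; rewrite /opA mul0mx addr0 /D0 big_ord_n !ce_sig /wt /= !scale1r !mpd_mode.
have p0 : pd ord0 (phase kap) x = 0 by rewrite pd_phase big1 ?mulr0 // => j _; rewrite mulr0.
have p1 : pd o1 (phase kap) x = 0 by rewrite pd_phase big1 ?mulr0 // => j _; rewrite mulr0.
have pj j : pd (l2 j) (phase kap) x = 2 * pi * (kap j)%:~R.
  rewrite pd_phase (bigD1 j) //= eqxx mulr1 big1 ?addr0 // => l lj.
  by rewrite !(inj_eq lift_inj) eq_sym (negPf lj) mulr0.
rewrite p0 p1 !scale0r !addr0 addrA !mulmxA -mulmxDl.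
rewrite (eq_bigr (fun j => (sg * (2 * pi * (kap j)%:~R)) *: (c (l2 j) *m Psum s x *m c ord0) *m ek kap x)); last first.
  move=> j _; rewrite ce_sig /wt /= mpd_mode pj big1 => [|t _]; last exact: mpd_mono_t.
  by rewrite mul0mx add0r -scalemxAl -scalemxAr scalerA -scalemxAl !mulmxA.
rewrite -mulmx_suml scalemxAl -mulmxDl -mulmxBl; congr (_ *m _).
rewrite /ops Psum_cat -addrA; congr (_ + _).
  rewrite !mulmx_sumr -big_split /Psum big_map; apply: eq_bigr => t _ /=; exact: D2_mono.
rewrite /Psum big_map /= mulmx_sumr scaler_sumr.
rewrite (eq_bigr (fun j => \sum_(t <- s) (sg * (2 * pi * (kap j)%:~R)) *: (c (l2 j) *m mono t.1.1 t.1.2 t.2 x *m c ord0))); last first.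
  by move=> j _; rewrite mulmx_sumr mulmx_suml scaler_sumr.
rewrite exchange_big /= -sumrB; apply: eq_bigr => t _.
rewrite monoD monoN monoZ mono_sum -(mono_comm _ _ _ _ e12_J); congr (_ - _).
apply: eq_bigr => j _; rewrite monoZ -mono_mulr; congr (_ *: (_ *m _)).
by rewrite -mono_comm //; apply: e12_comm.
Qed.

End FlatModel.

(** * Density of the range for the flat operators *)

Section FlatDensity.
Variables (R : realType) (k N : nat).
Local Notation n := k.+2.
Local Notation Om := (@solid_torus R k).
Local Notation o1 := (lift ord0 ord0).
Local Notation l2 j := (lift ord0 (lift ord0 j)).
Variables (c : 'I_n -> 'M[R]_N) (J : 'M[R]_N) (H : clifford c J).
Variables (V : set 'rV[R]_n) (oV : open V) (OV : Om `<=` V).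
Implicit Types (psi chi f g : 'rV[R]_n -> 'M[R]_N) (x : 'rV[R]_n) (s : seq (nat * nat * 'M[R]_N)).
Implicit Types (kap : 'I_k -> int).
Local Notation field := ('rV[R]_n -> 'M[R]_N).
Local Notation mode s kap := (fun x => Psum c s x *m ek c kap x).

Lemma mCk_T q p r (f : 'rV[R]_n -> 'M[R]_(p, r)) : mCk setT q f -> mCk V q f.
Proof. by move=> fC a b; apply: Ck_sub (fC a b). Qed.

Lemma mCk_mode q s kap : mCk V q (mode s kap).
Proof. by apply: mCk_T; apply: (mCkM openT); [exact: mCk_Psum|exact: mCk_ek]. Qed.

Lemma per_mode s kap : per (mode s kap).
Proof. by move=> x j Ox j1; rewrite per_Psum // per_ek. Qed.

Lemma Kc_sq : c ord0 *m J *m (c ord0 *m J) = 1%:M.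
Proof.
rewrite mulmxA -[_ *m J *m c ord0]mulmxA -[J *m c ord0]opprK -(cl_J H) mulmxN mulNmx mulmxA.
by rewrite (c0_sq H) mul_scalar_mx scaleN1r mulNmx opprK (J_sq H).
Qed.

Lemma beta_mono a b xi x : beta c J x *m mono c a b xi x = mono c b.+1 a (c ord0 *m J *m xi) x.
Proof.
have -> : beta c J x = Zm c x *m c ord0 *m J.
  by rewrite /beta /nn clD !clZ !cl_e /Zm !mulmxDl -!scalemxAl mul1mx (ec0 H).
rewrite -mulmxA (mono_comm _ _ _ _ (e12_J H)) -mulmxA (mono_c0 H) -[c ord0 *m J *m xi]mulmxA //.
Qed.

Lemma Psum_cons a b xi s x : Psum c ((a, b, xi) :: s) x = mono c a b xi x + Psum c s x.
Proof. by rewrite /Psum big_cons. Qed.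
Lemma Psum_nil x : Psum c [::] x = 0.
Proof. by rewrite /Psum big_nil. Qed.

Lemma D2_ops s kap : opA c J (Esig 0) (fun=> 0) 0 (mode s kap) =
  mode [seq (t.1.2, t.1.1.-1, (2 * t.1.1%:R) *: (c ord0 *m t.2)) | t <- s] kap.
Proof.
rewrite opA_mode //; apply/funext => x; congr (_ *m _); rewrite /ops Psum_cat /Psum [X in _ + X]big_map.
rewrite [X in _ + X]big1 ?addr0 // => t _ /=.
rewrite scale0r subr0 big1 ?mono0 // => j _.
by rewrite mul0r scale0r.
Qed.

(** z^(b+1) conj(z)^a with a suitable coefficient solves the equation, and pure powers of conj(z)
    are in the kernel. On the unit circle z conj(z) = 1, and beta sends z^p conj(z)^q to z^(q+1)
    conj(z)^p, so one pure power suffices to restore the boundary condition. *)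
Lemma flat_solve1 a b xi kap : exists s, bdc c J (mode s kap) /\
  opA c J (Esig 0) (fun=> 0) 0 (mode s kap) = mode [:: (a, b, xi)] kap.
Proof.
pose eta := - (2 * b.+1%:R)^-1 *: (c ord0 *m xi).
have b0 : (2 * b.+1%:R : R) != 0 by rewrite mulf_neq0 // pnatr_eq0.
have eE : (2 * b.+1%:R) *: (c ord0 *m eta) = xi.
  rewrite /eta -scalemxAr mulmxA (c0_sq H) mul_scalar_mx scaleN1r scalerA scalerN mulrN mulfV //.
  by rewrite scaleN1r opprK.
pose K := c ord0 *m J.
have KK : K *m (K *m eta) = eta by rewrite mulmxA Kc_sq mul1mx.
have D2p h : h.1.1 = 0%N -> opA c J (Esig 0) (fun=> 0) 0 (mode [:: (b.+1, a, eta); h] kap) = mode [:: (a, b, xi)] kap.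
  move=> h0; rewrite D2_ops; apply/funext => x; congr (_ *m _).
  by case: h h0 => [[h1 h2] h3] /= ->; rewrite !Psum_cons !Psum_nil mulr0 scale0r mono0 !addr0 eE.
case: (leqP a b) => ab.
  (* On the circle the image under beta of the particular solution is the pure power conj(z)^(b-a);
     adding it gives a sum whose two terms beta exchanges. *)
  exists [:: (b.+1, a, eta); (0%N, (b - a)%N, K *m eta)]; split; last exact: D2p.
  move=> p; rewrite mulmxA !Psum_cons Psum_nil !addr0. rewrite (mulmxDr (beta c J (bd_incl p))).
  idtac; rewrite  !beta_mono -/K KK addrC; congr ((_ + _) *m _).
    have e : b.+1 = ((b - a).+1 + a)%N by rewrite addSn subnK.
    by rewrite [in RHS]e -[in RHS](add0n a) (mono_cancel H).
  have e : b.+1 = ((b - a) + a.+1)%N by rewrite addnS subnK.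
  by rewrite e -[a.+1 in LHS](add0n a.+1) (mono_cancel H).
(* Here the particular solution itself restricts to the pure power conj(z)^(a-b-1) on the circle;
   subtracting that makes the boundary values vanish. *)
exists [:: (b.+1, a, eta); (0%N, (a - b.+1)%N, - eta)]; split; last exact: D2p.
move=> p; rewrite mulmxA !Psum_cons Psum_nil !addr0 (mulmxDr (beta c J (bd_incl p))) !beta_mono -/K mulmxN !monoN.
have e1 : a.+1 = ((a - b.+1).+1 + b.+1)%N by rewrite addSn subnK.
have e2 : a = ((a - b.+1) + b.+1)%N by rewrite subnK.
have h1 xi' : mono c a.+1 b.+1 xi' (bd_incl p) = mono c (a - b.+1).+1 0 xi' (bd_incl p).
  by rewrite -(mono_cancel H (a - b.+1).+1 0 b.+1) -e1.
have h2 xi' : mono c b.+1 a xi' (bd_incl p) = mono c 0 (a - b.+1) xi' (bd_incl p).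
  by rewrite -(mono_cancel H 0 (a - b.+1) b.+1) -e2.
by rewrite h1 h2 !subrr !mul0mx.
Qed.

Lemma bdcD psi chi : bdc c J psi -> bdc c J chi -> bdc c J (fun x => psi x + chi x).
Proof. by move=> h1 h2 p; rewrite mulmxDr h1 h2. Qed.

Lemma mode_cat s s' kap : mode (s ++ s') kap = fun x => Psum c s x *m ek c kap x + Psum c s' x *m ek c kap x.
Proof. by apply/funext => x; rewrite Psum_cat mulmxDl. Qed.

Lemma flat_solve s kap : exists s', bdc c J (mode s' kap) /\
  opA c J (Esig 0) (fun=> 0) 0 (mode s' kap) = mode s kap.
Proof.
elim: s => [|[[a b] xi] s [s' [bs' es']]].
  exists [::]; split=> [p|]; last by rewrite D2_ops.
  by rewrite /Psum big_nil mul0mx mulmx0.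
have [s1 [b1 e1]] := flat_solve1 a b xi kap; exists (s1 ++ s'); rewrite mode_cat; split; first exact: bdcD.
have hT : (fun x => Psum c s1 x *m ek c kap x + Psum c s' x *m ek c kap x) = mode (s1 ++ s') kap by rewrite mode_cat.
have l1 t : mCk setT 1 (mode t kap) by apply: (mCkM openT); [exact: mCk_Psum|exact: mCk_ek].
apply/funext => x.
have -> : opA c J (Esig 0) (fun=> 0) 0 (fun x => Psum c s1 x *m ek c kap x + Psum c s' x *m ek c kap x) x =
  opA c J (Esig 0) (fun=> 0) 0 (mode s1 kap) x + opA c J (Esig 0) (fun=> 0) 0 (mode s' kap) x.
  rewrite /opA /D0 !mul0mx !scale0r !addr0 !subr0 -big_split; apply: eq_bigr => i _ /=.
  by rewrite (mpdD openT _ i (l1 s1) (l1 s')) // mulmxDr.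
by rewrite e1 es' /= -mulmxDl -Psum_cat.
Qed.

Definition Sk kap psi := Pk c kap psi /\ bdc c J psi.

Lemma Sk_Sp kap psi : Sk kap psi -> Sp c J V psi.
Proof. by move=> [[s ->] b]; split; [exact: mCk_mode|exact: per_mode|]. Qed.

Lemma cTc a : (c a)^T *m c a = 1%:M /\ c a *m (c a)^T = 1%:M.
Proof.
have cs : c a *m c a = (- 1)%:M.
  by rewrite -(cl_e c a) (cl_sq H); congr (- _)%:M; rewrite mxE (bigD1 a) //= !mxE !eqxx mulr1 big1 ?addr0
    // => i ia; rewrite !mxE (negPf ia) andbF mul0r.
have cT : (c a)^T = - c a by rewrite -[in LHS](cl_e c a) (clT H) cl_e.
by rewrite cT mulNmx mulmxN cs raddfN opprK.
Qed.

Lemma nsq_c a (X : 'M[R]_N) : nsq (c a *m X) = nsq X.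
Proof. by rewrite ip_adjl mulmxA (proj1 (cTc a)) mul1mx. Qed.

Lemma nsq_mulc a (X : 'M[R]_N) : nsq (X *m c a) = nsq X.
Proof. exact: (ip_mulr _ (proj2 (cTc a))). Qed.

(** At a fixed frequency the torus derivatives are bounded operators of order zero, with norm
    depending on the frequency. Hence along the scaling s from 0 to 1 the operators differ by a
    bounded term, and the uniform L^2 estimate is all that the continuity method needs. *)
Lemma flat_mode kap L : 0 <= L -> dense_range (Sk kap) (Pk c kap) (opA c J (fun=> 1%:M) (fun=> 0) L).
Proof.
move=> L0.
pose A sg := opA c J (Esig sg) (fun=> 0) (sg * L).
pose P sg := dense_range (Sk kap) (Pk c kap) (A sg).
have P0 : P 0.
  move=> _ [s ->] e e0; have [s' [b E]] := flat_solve s kap; exists (mode s' kap); first by split=> //; exists s'.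
  rewrite /A mul0r E (_ : (fun x => _) = fun=> 0); last by apply/funext => x; rewrite subrr.
  by rewrite /nf (_ : (fun=> _) = fun=> 0) ?(pf0 (@pf_IO R k)) ?ltW //; apply/funext => x; rewrite ip0l.
pose G psi x : 'M[R]_N := \sum_j (2 * pi * (kap j)%:~R) *: (c (l2 j) *m psi x *m c ord0) - L *: (J *m psi x).
have diff (s s' : R) psi x : Sk kap psi -> A s' psi x - A s psi x = (s' - s) *: G psi x.
  move=> [[t ->] _]; rewrite /A !opA_mode // -mulmxBl /ops !Psum_cat.
  rewrite opprD addrACA subrr add0r /Psum !big_map -sumrB /= /G.
  have -> : \sum_(j < k) (2 * pi * (kap j)%:~R) *: (c (l2 j) *m (Psum c t x *m ek c kap x) *m c ord0) =
      (\sum_(j < k) (2 * pi * (kap j)%:~R) *: (c (l2 j) *m Psum c t x *m c ord0)) *m ek c kap x.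
    rewrite [RHS]mulmx_suml; apply: eq_bigr => j _; rewrite -scalemxAl; congr (_ *: _).
    rewrite -!mulmxA; congr (_ *m (_ *m _)).
    by rewrite /ek mulmxDl mulmxDr -!scalemxAr -!scalemxAl mulmx1 mul1mx.
  rewrite [J *m (_ *m _)]mulmxA [L *: (_ *m ek _ _ _)]scalemxAl -mulmxBl scalemxAl; congr (_ *m _).
  rewrite scalerBr /Psum mulmx_sumr !scaler_sumr.
  rewrite [X in _ = X - _](eq_bigr (fun j => \sum_(u <- t) (s' - s) *: ((2 * pi * (kap j)%:~R) *: (c (l2 j) *m mono c u.1.1 u.1.2 u.2 x *m c ord0)))); last first.
    by move=> j _; rewrite mulmx_sumr mulmx_suml !scaler_sumr.
  rewrite exchange_big /= -sumrB; apply: eq_bigr => u _.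
  rewrite (mono_comm _ _ _ _ (e12_J H)) !monoD !monoN !monoZ !mono_sum.
  have eS r : \sum_(i < k) mono c u.1.1 u.1.2 ((r * (2 * pi * (kap i)%:~R)) *: (c (l2 i) *m u.2 *m c ord0)) x =
      r *: \sum_(i < k) (2 * pi * (kap i)%:~R) *: (c (l2 i) *m mono c u.1.1 u.1.2 u.2 x *m c ord0).
    rewrite scaler_sumr; apply: eq_bigr => j _.
    by rewrite monoZ -mono_mulr -(mono_comm _ _ _ _ (e12_comm H _ _)) // scalerA.
  have gen (X Y : 'M[R]_N) : s' *: X - (s' * L) *: Y - (s *: X - (s * L) *: Y) = (s' - s) *: X - (s' - s) *: (L *: Y).
    by apply/matrixP => i j; rewrite !mxE; ring.
  by rewrite !eS -scaler_sumr; exact: gen.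
pose K1 := 2 * (k%:R * \sum_j (2 * pi * (kap j)%:~R) ^+ 2) + 2 * L ^+ 2.
have K10 : 0 <= K1.
  by rewrite addr_ge0 ?mulr_ge0 ?sqr_ge0 //; apply: sumr_ge0 => j _; exact: sqr_ge0.
have HG psi : Sk kap psi -> nf (G psi) <= K1 * nf psi.
  move=> Sps; have [p2 _ _] := Sk_Sp Sps; have p0 : mCk V 0 psi by apply: mCk_le p2.
  have GC : mCk V 0 (G psi).
    apply: (mCkB oV); last first.
      by apply: (mCkZ oV); [exact: Ck_cst|apply: (mCkM oV) => //; exact: mCk_cst].
    apply: (mCk_sum oV) => j; apply: (mCkZ oV); first exact: Ck_cst.
    by apply: (mCkM oV); [apply: (mCkM oV) => //; exact: mCk_cst|exact: mCk_cst].
  rewrite -(IOZ OV K1 (Ck_nsq oV p0)); apply: (IOleK OV).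
  - exact: (Ck_nsq oV).
  - by apply: (CkM oV (k := 0)); [exact: Ck_cst|exact: (Ck_nsq oV)].
  move=> x _; rewrite /G; apply: (le_trans (_ : _ <= 2 * nsq (\sum_j (2 * pi * (kap j)%:~R) *: (c (l2 j) *m psi x *m c ord0)) + 2 * nsq (- (L *: (J *m psi x))))).
    exact: ip_norm2D.
  rewrite ipNl ipNr opprK ipZl ipZr.
  have -> : nsq (J *m psi x) = nsq (psi x) by rewrite ip_adjl (J_sym H) mulmxA (J_sq H) mul1mx.
  have := nsq_sum_le (fun j : 'I_k => (2 * pi * (kap j)%:~R) *: (c (l2 j) *m psi x *m c ord0)).
  rewrite (eq_bigr (fun j => (2 * pi * (kap j)%:~R) ^+ 2 * nsq (psi x))) => [|j _]; last first.
    by rewrite ipZl ipZr nsq_mulc nsq_c mulrA -expr2.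
  rewrite -mulr_suml /K1; move: (\sum_j _ ^+ 2) (nsq (psi x)) (nsq _) => a b d hd.
  have -> : (2 * (k%:R * a) + 2 * L ^+ 2) * b = 2 * (k%:R * (a * b)) + 2 * (L * (L * b)) by ring.
  by lra.
have Slin psi : Sk kap psi -> Sp c J V psi := @Sk_Sp kap psi.
have SD psi chi : Sk kap psi -> Sk kap chi -> Sk kap (fun x => psi x + chi x).
  move=> [[t ->] b1] [[t' ->] b2]; split; last exact: bdcD.
  by exists (t ++ t'); rewrite mode_cat.
have AP sg psi : Sk kap psi -> Pk c kap (A sg psi).
  by move=> [[t ->] _]; rewrite /A opA_mode //; eexists.
have AC sg psi : Sk kap psi -> mCk V 0 (A sg psi).
  by move=> /(AP sg)[t ->]; exact: mCk_mode.
have PB f g : Pk c kap f -> Pk c kap g -> Pk c kap (fun x => f x - g x).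
  move=> [t ->] [t' ->]; exists (t ++ [seq (u.1, - u.2) | u <- t']); apply/funext => x.
  rewrite Psum_cat mulmxDl; congr (_ + _); rewrite -mulNmx; congr (_ *m _).
  by rewrite /Psum big_map -sumrN; apply: eq_bigr => u _; rewrite monoN.
have AD sg psi chi x : Sk kap psi -> Sk kap chi -> Om x -> A sg (fun x => psi x + chi x) x = A sg psi x + A sg chi x.
  move=> /Slin[p2 _ _] /Slin[q2 _ _]; rewrite /A; apply: (opAD oV OV); [apply: mCk_le p2|apply: mCk_le q2] => //.
have loc (s : R) : 0 <= s <= 1 -> exists2 d, 0 < d & forall s' : R, 0 <= s' <= 1 -> `|s' - s| < d -> (P s <-> P s').
  (* The a priori constant is 2, so 2 d K1 <= 1/64 is required. *)
  move=> /andP[s0 _]; pose d := (128 * (K1 + 1))^-1.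
  have d0 : 0 < d by rewrite invr_gt0 mulr_gt0 //; lra.
  exists (Order.min 1 d); first by rewrite lt_min ltr01.
  move=> s' s'01; rewrite lt_min => /andP[s1 sd].
  have ss : (s' - s) ^+ 2 <= d.
    rewrite -(real_normK (num_real _)) expr2; apply: (@le_trans _ _ `|s' - s|); last exact: ltW.
    by rewrite ler_piMl // ltW.
  apply: (@dense_iff R k N V oV OV (Sk kap) (Pk c kap) (A s) (A s') (@nf R k N) 2 ((s' - s) ^+ 2 * K1)).
  - by split; [exists [::]; apply/funext => x; rewrite /Psum big_nil mul0mx|move=> p; rewrite mulmx0].
  - exact: SD.
  - by move=> f [t ->]; exact: mCk_mode.
  - by move=> f psi Cf /(AP s); exact: PB.
  - by move=> f psi Cf /(AP s'); exact: PB.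
  - exact: AC.
  - exact: AC.
  - exact: AD.
  - exact: AD.
  - by [].
  - by rewrite mulr_ge0 // sqr_ge0.
  - have e1 : 128 * (K1 + 1) * d = 1 by rewrite /d mulfV // gt_eqF // mulr_gt0 //; lra.
    have e2 : (s' - s) ^+ 2 * K1 <= d * K1 by apply: ler_wpM2r.
    have e3 : 128 * (K1 + 1) * d = 128 * (d * K1) + 128 * d by ring.
    lra.
  - by move=> psi /Slin[p2 _ _]; apply: (nf_ge0 oV OV); apply: mCk_le p2.
  - by move=> psi /Slin Sps; exact: (sig_estimate H oV OV).
  - move=> psi Sps; have -> : (fun x => A s' psi x - A s psi x) = fun x => (s' - s) *: G psi x.
      by apply/funext => x; exact: diff.
    have [p2 _ _] := Slin _ Sps; have p0 : mCk V 0 psi by apply: mCk_le p2.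
    rewrite (nfZ oV OV); first by rewrite -mulrA; apply: ler_wpM2l; [exact: sqr_ge0|exact: HG].
    apply: (mCkB oV); last first.
      by apply: (mCkZ oV); [exact: Ck_cst|apply: (mCkM oV) => //; exact: mCk_cst].
    apply: (mCk_sum oV) => j; apply: (mCkZ oV); first exact: Ck_cst.
    by apply: (mCkM oV); [apply: (mCkM oV) => //; exact: mCk_cst|exact: mCk_cst].
have := clopen_path loc P0; rewrite /P /A Esig1 mul1r //.
Qed.

Definition Msum (f : field) := exists l : seq (('I_k -> int) * seq (nat * nat * 'M[R]_N)),
  f = fun x => \sum_(m <- l) Psum c m.2 x *m ek c m.1 x.

Lemma mCk_Msum q f : Msum f -> mCk V q f.
Proof. by move=> [l ->]; apply: (mCk_sum oV) => m; exact: mCk_mode. Qed.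

Lemma flat_Msum L : 0 <= L -> dense_range (Sp c J V) Msum (opA c J (fun=> 1%:M) (fun=> 0) L).
Proof.
move=> L0 _ [l ->]; elim: l => [|[kap s] l IH] e e0.
  exists (fun=> 0); first exact: Sp0.
  have -> : (fun x => \sum_(m <- [::]) Psum c m.2 x *m ek c m.1 x - opA c J (fun=> 1%:M) (fun=> 0) L (fun=> 0) x) = fun=> 0.
    apply/funext => x; rewrite big_nil /opA /D0 !mulmx0 scaler0 big1 ?addr0 ?subr0 // => i _.
    by rewrite mpd_cst mulmx0.
  by rewrite /nf (_ : (fun=> _) = fun=> 0) ?(pf0 (@pf_IO R k)) ?ltW //; apply/funext => x; rewrite ip0l.
have e4 : 0 < e / 4 by rewrite divr_gt0.
have [psi Sps hp] := IH _ e4.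
have [chi /Sk_Sp Schi hc] := @flat_mode kap L L0 (mode s kap) (ex_intro _ s erefl) _ e4.
exists (fun x => chi x + psi x); first exact: (SpD oV).
have [[p2 pp _] [q2 qp _]] := (Sps, Schi).
have p1 : mCk V 1 psi by apply: mCk_le p2.
have q1 : mCk V 1 chi by apply: mCk_le q2.
have AC f : mCk V 2 f -> per f -> mCk V 0 (opA c J (fun=> 1%:M) (fun=> 0) L f).
  by move=> f2 fp; have [] := @opA_cC R k N V oV OV c J (fun=> 1%:M) (fun=> 0) L f _ _ _ _ f2 fp => //; exact: mCk_cst.
have MC : mCk V 0 (fun x => \sum_(m <- l) Psum c m.2 x *m ek c m.1 x) by apply: mCk_Msum; exists l.
rewrite (nf_congr oV OV (g := fun x => (Psum c s x *m ek c kap x - opA c J (fun=> 1%:M) (fun=> 0) L chi x) +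
    (\sum_(m <- l) Psum c m.2 x *m ek c m.1 x - opA c J (fun=> 1%:M) (fun=> 0) L psi x))).
- apply: (le_trans (nfD oV OV (mCkB oV (mCk_mode 0 s kap) (AC _ q2 qp)) (mCkB oV MC (AC _ p2 pp)))).
  by move: hp hc; lra.
- apply: (mCkB oV); first by apply: mCk_Msum; exists ((kap, s) :: l).
  by apply: AC; [exact: mCkD|move=> x j Ox j1; rewrite pp // qp].
- by apply: (mCkD oV); apply: (mCkB oV) => //; [exact: mCk_mode|exact: AC|exact: AC].
- by move=> x Ox; rewrite big_cons /= (opAD oV OV) // opprD addrACA.
Qed.

Theorem flat_dense :
  (forall f, cC V f -> forall e, 0 < e -> exists2 m, Msum m & nf (fun x => f x - m x) <= e) ->
  forall L, 0 <= L -> dense_range (Sp c J V) (@cC R k N V) (opA c J (fun=> 1%:M) (fun=> 0) L).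
Proof.
move=> SW L L0 f Cf e e0.
have e4 : 0 < e / 4 by rewrite divr_gt0.
have [m Mm hm] := SW f Cf _ e4; have [psi Sps hp] := flat_Msum L0 Mm e4.
exists psi => //; have [p2 pp _] := Sps; have mC := mCk_Msum 0 Mm; have [fC _] := Cf.
have AC : mCk V 0 (opA c J (fun=> 1%:M) (fun=> 0) L psi).
  by have [] := @opA_cC R k N V oV OV c J (fun=> 1%:M) (fun=> 0) L psi _ _ _ _ p2 pp => //; exact: mCk_cst.
have -> : (fun x => f x - opA c J (fun=> 1%:M) (fun=> 0) L psi x) = fun x => (f x - m x) +
   (m x - opA c J (fun=> 1%:M) (fun=> 0) L psi x) by apply/funext => x; rewrite addrA subrK.
apply: (le_trans (nfD oV OV (mCkB oV fC mC) (mCkB oV mC AC))).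
by move: hm hp; lra.
Qed.

End FlatDensity.

(** * A Stone-Weierstrass theorem *)

Section StoneWeierstrass.
Variables (R : realType) (X : topologicalType) (K : set X).
Hypothesis cK : compact K.

(** Compactness for directed families: a condition that near each point holds for all late members
    holds everywhere for a single member. It replaces the choice of a finite subcover followed by a
    finite maximum or minimum. *)
Lemma compact_directed (T : Type) (D : set T) (le : T -> T -> Prop) (P : T -> X -> Prop) :
  D !=set0 -> (forall a, le a a) -> (forall a b d, le a b -> le b d -> le a d) ->
  (forall a b, D a -> D b -> exists d, [/\ D d, le a d & le b d]) ->
  (forall y, K y -> exists2 a, D a & \forall y' \near y, forall b, D b -> le a b -> P b y') ->
  exists2 a, D a & forall y, K y -> P a y.
Proof.
move=> D0 rf tr dir loc.
pose F : set_system T := filter_from D (fun a => [set b | D b /\ le a b]).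
have FF : Filter F.
  apply: filter_from_filter => // a b Da Db; have [d [Dd ad bd]] := dir a b Da Db.
  by exists d => // e [De de]; split; split=> //; exact: tr de.
have H y : K y -> \forall y' \near y & b \near F, P b y'.
  move=> Ky; have [a Da na] := loc y Ky.
  exists ([set y' | forall b, D b -> le a b -> P b y'], [set b | D b /\ le a b]) => /=.
    by split=> //; exists a.
  by move=> [y' b] /= [h [Db ab]]; exact: h.
have [a Da ha] := (compact_near_coveringP K).1 cK _ F (fun b y => P b y) FF H.
by exists a => //; apply: ha.
Qed.

(* Polynomials without constant term that converge uniformly to |u| on [-1, 1]. *)
Fixpoint absp (m : nat) (u : R) : R := if m is m'.+1 then absp m' u + (u ^+ 2 - absp m' u ^+ 2) / 2 else 0.

(** The third clause is the invariant that carries the rate of convergence: it yields an error of at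
    most 2/m, uniformly in u. *)
Lemma absp_bound m u : `|u| <= 1 -> [/\ 0 <= absp m u, absp m u <= `|u| &
  (`|u| - absp m u) * (2 + m%:R * `|u|) <= 2 * `|u|].
Proof.
move=> u1; have u0 := normr_ge0 u.
elim: m => [|m [p0 pu h]] /=; first by split=> //; rewrite mul0r subr0 addr0 mulrC.
rewrite -(real_normK (num_real u)); move: (`|u|) (absp m u) u0 u1 p0 pu h => v p v0 v1 p0 pv h.
have e : v - (p + (v ^+ 2 - p ^+ 2) / 2) = (v - p) * (1 - (v + p) / 2) by field.
have d0 : 0 <= v - p by lra.
have d1 : 0 <= 1 - (v + p) / 2 by lra.
split.
- have : 0 <= (v - p) * (v + p) by rewrite mulr_ge0 //; lra.
  have -> : (v - p) * (v + p) = v ^+ 2 - p ^+ 2 by ring.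
  lra.
- by have := mulr_ge0 d0 d1; rewrite -e; lra.
- rewrite e; apply: le_trans h; rewrite -mulrA; apply: ler_wpM2l => //.
  have m0 : 0 <= (m%:R : R) by [].
  have h1 : 0 <= v * p by rewrite mulr_ge0.
  have h2 : 0 <= v * (v * m%:R) by rewrite !mulr_ge0.
  have h3 : 0 <= m%:R * (v * p) by rewrite !mulr_ge0.
  have h4 : 0 <= v * v by rewrite mulr_ge0.
  have -> : (1 - (v + p) / 2) * (2 + m.+1%:R * v) = 2 + m%:R * v - p - (v * (v * m%:R) + v * v + m%:R * (v * p) + v * p) / 2.
    by rewrite -natr1; field.
  lra.
Qed.

Lemma absp_close m u : `|u| <= 1 -> `| `|u| - absp m u| * m%:R <= 2.
Proof.
move=> u1; have [p0 pu h] := absp_bound m u1; have u0 := normr_ge0 u.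
rewrite ger0_norm ?subr_ge0 //.
have [z|z] := eqVneq `|u| 0.
  have -> : `|u| - absp m u = 0 by lra.
  by rewrite mul0r.
have up : 0 < `|u| by rewrite lt_neqAle eq_sym z.
rewrite -(ler_pM2r up); apply: le_trans h; rewrite -mulrA; apply: ler_wpM2l; lra.
Qed.

Variable A : (X -> R) -> Prop.
Hypotheses (Ac : forall h, A h -> cont_on K h) (A1 : forall a, A (fun=> a)).
Hypotheses (AD : forall g h, A g -> A h -> A (fun x => g x + h x)).
Hypotheses (AM : forall g h, A g -> A h -> A (fun x => g x * h x)).

Definition uclos (h : X -> R) := forall e, 0 < e -> exists2 a, A a & forall x, K x -> `|h x - a x| <= e.

Lemma uclos_A h : A h -> uclos h.
Proof. by move=> Ah e e0; exists h => // x _; rewrite subrr normr0 ltW. Qed.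

Lemma uclosD g h : uclos g -> uclos h -> uclos (fun x => g x + h x).
Proof.
move=> Bg Bh e e0; have e2 : 0 < e / 2 by lra.
have [a Aa ha] := Bg _ e2; have [b Ab hb] := Bh _ e2.
exists (fun x => a x + b x); first exact: AD.
move=> x Kx; rewrite opprD addrACA; apply: (le_trans (ler_normD _ _)).
by have := ha x Kx; have := hb x Kx; lra.
Qed.

Lemma uclosZ r h : uclos h -> uclos (fun x => r * h x).
Proof.
move=> Bh e e0; have e2 : 0 < e / (`|r| + 1) by rewrite divr_gt0 // ltr_wpDl.
have [b Ab hb] := Bh _ e2; exists (fun x => r * b x); first exact: (AM (A1 r)).
move=> x Kx; rewrite -mulrBr normrM.
have r0 : 0 < `|r| + 1 by rewrite ltr_wpDl.
have := hb x Kx; rewrite ler_pdivlMr // mulrC => h1.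
by apply: le_trans h1; apply: ler_wpM2r => //; rewrite lerDl.
Qed.

Lemma uclos_abs h : uclos h -> uclos (fun x => `|h x|).
Proof.
move=> Bh e e0; have e2 : 0 < e / 2 by lra.
have [a Aa ha] := Bh _ e2; have [C C0 HC] := cont_bounded cK (Ac Aa).
pose M := C + 1; have M0 : 0 < M by rewrite /M; lra.
have Ap m : A (fun x => absp m (M^-1 * a x)).
  have Au : A (fun x => M^-1 * a x) by exact: (AM (A1 _)).
  elim: m => [|m IH] /=; first exact: A1.
  have As : A (fun x => - 1 * (absp m (M^-1 * a x) * absp m (M^-1 * a x))) by apply: (AM (A1 _)); exact: AM.
  have := AD IH (AM (AD (AM Au Au) As) (A1 2^-1)).
  rewrite (_ : (fun x => _) = fun x => absp m (M^-1 * a x) + ((M^-1 * a x) ^+ 2 - absp m (M^-1 * a x) ^+ 2) / 2) //.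
  by apply/funext => x; rewrite mulN1r !expr2.
pose m := (Num.bound (4 * M / e)).+1.
exists (fun x => M * absp m (M^-1 * a x)); first exact: (AM (A1 _)).
move=> x Kx.
have u1 : `|M^-1 * a x| <= 1.
  by rewrite normrM ger0_norm ?invr_ge0 ?(ltW M0) // mulrC ler_pdivrMr // mul1r; have := HC x Kx; rewrite /M; lra.
have hm : 4 * M / e < m%:R.
  apply: lt_trans (_ : (Num.bound (4 * M / e))%:R < _); last by rewrite ltr_nat.
  by apply: archi_boundP; rewrite divr_ge0 ?mulr_ge0 // ltW.
have m0 : (0 : R) < m%:R by rewrite ltr0n.
have h1 := absp_close m u1.
have h2 : `| `|a x| - M * absp m (M^-1 * a x)| <= e / 2.
  have -> : `|a x| = M * `|M^-1 * a x|.
    by rewrite normrM [`|M^-1|]ger0_norm ?invr_ge0 ?(ltW M0) // mulrA mulfV ?mul1r // gt_eqF.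
  rewrite -mulrBr normrM gtr0_norm // -(ler_pM2r m0) -mulrA.
  apply: (@le_trans _ _ (M * 2)); first by apply: ler_wpM2l => //; exact: ltW.
  by move: hm; rewrite ltr_pdivrMr // => hm; lra.
have h3 : `| `|h x| - `|a x| | <= e / 2 by apply: le_trans (ler_dist_dist _ _) (ha x Kx).
have := ler_normD (`|h x| - `|a x|) (`|a x| - M * absp m (M^-1 * a x)).
by rewrite addrA subrK; lra.
Qed.

Lemma uclos_max g h : uclos g -> uclos h -> uclos (fun x => Num.max (g x) (h x)).
Proof.
move=> Bg Bh; have := uclosZ 2^-1 (uclosD (uclosD Bg Bh) (uclos_abs (uclosD Bg (uclosZ (- 1) Bh)))).
rewrite (_ : (fun x => _) = fun x => Num.max (g x) (h x)) //.
by apply/funext => x; rewrite mulN1r maxr_absE mulrC.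
Qed.

Lemma uclos_min g h : uclos g -> uclos h -> uclos (fun x => Num.min (g x) (h x)).
Proof.
move=> Bg Bh; have := uclosZ (- 1) (uclos_max (uclosZ (- 1) Bg) (uclosZ (- 1) Bh)).
rewrite (_ : (fun x => _) = fun x => Num.min (g x) (h x)) //.
by apply/funext => x; rewrite !mulN1r -oppr_min opprK.
Qed.

(** Interpolation of f at any two points is assumed instead of separation of points, because
    periodic functions do not separate the points of [K] that represent the same point of the torus;
    a periodic f takes equal values there. *)
Theorem stone_weierstrass f : cont_on K f ->
  (forall x y, K x -> K y -> exists2 h, A h & h x = f x /\ h y = f y) -> uclos f.
Proof.
move=> fc sep.
have cl h : uclos h -> forall e x, 0 < e -> K x -> \forall y \near x, K y -> `|h y - h x| <= e.
  move=> Bh e x e0 Kx; have e3 : 0 < e / 3 by lra.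
  have [a Aa ha] := Bh _ e3; have := cont_near (Ac Aa Kx) e3; apply: filterS => y h1 Ky.
  have h2 := ha y Ky; have h3 := ha x Kx; move: h1 h2 h3; rewrite !ler_norml.
  by move=> /andP[? ?] /andP[? ?] /andP[? ?]; apply/andP; split; lra.
(* Maxima of interpolants that agree with f at x give a lower bound on all of [K]; minima over the
   points x will then give the upper bound. *)
have step e x : 0 < e -> K x -> exists2 h, uclos h & h x = f x /\ forall y, K y -> f y - e <= h y.
  move=> e0 Kx.
  have [] := @compact_directed (X -> R) [set h | uclos h /\ h x = f x] (fun g h => forall z, g z <= h z)
    (fun h y => K y -> f y - e <= h y).
  - by have [h Ah [hx _]] := sep x x Kx Kx; exists h; split=> //; exact: uclos_A.
  - by [].
  - by move=> a b d ab bd z; exact: le_trans (ab z) (bd z).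
  - move=> a b [Ba ax] [Bb bx]; exists (fun z => Num.max (a z) (b z)); split.
    + by split; [exact: uclos_max|rewrite ax bx maxxx].
    + by move=> z; rewrite le_max lexx.
    + by move=> z; rewrite le_max lexx orbT.
  - move=> y Ky; have [h Ah [hx hy]] := sep x y Kx Ky; exists h; first by split=> //; exact: uclos_A.
    have e2 : 0 < e / 2 by lra.
    near=> y' => b [Bb bx] hb Ky'.
    have h1 : `|h y' - h y| <= e / 2 by move: Ky'; near: y'; exact: (cl h (uclos_A Ah)).
    have h2 : `|f y' - f y| <= e / 2 by near: y'; exact: (cont_near (fc y Ky) e2).
    have := hb y'; move: h1 h2; rewrite hy !ler_norml => /andP[? ?] /andP[? ?]; lra.
  - by move=> h [Bh hx] hb; exists h => //; split=> // y Ky; exact: hb.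
move=> e e0; have e2 : 0 < e / 2 by lra.
have [K0|/set0P[x0 Kx0]] := eqVneq K set0.
  by exists (fun=> 0); [exact: A1|move=> x; rewrite K0].
have [] := @compact_directed (X -> R) [set h | uclos h /\ forall y, K y -> f y - e / 2 <= h y]
   (fun g h => forall z, h z <= g z) (fun h y => K y -> h y <= f y + e / 2).
- by have [h Bh [_ hb]] := step _ x0 e2 Kx0; exists h.
- by [].
- by move=> a b d ab bd z; exact: le_trans (bd z) (ab z).
- move=> a b [Ba ax] [Bb bx]; exists (fun z => Num.min (a z) (b z)); split.
  + by split; [exact: uclos_min|move=> y Ky; rewrite le_min ax // bx].
  + by move=> z; rewrite ge_min lexx.
  + by move=> z; rewrite ge_min lexx orbT.
- move=> y Ky; have [h Bh [hy hb]] := step _ y e2 Ky; exists h => //.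
  have e4 : 0 < e / 4 by lra.
  near=> y' => b [Bb bb] bh Ky'.
  have h1 : `|h y' - h y| <= e / 4 by move: Ky'; near: y'; exact: (cl h Bh).
  have h2 : `|f y' - f y| <= e / 4 by near: y'; exact: (cont_near (fc y Ky) e4).
  have := bh y'; move: h1 h2; rewrite hy !ler_norml => /andP[? ?] /andP[? ?]; lra.
move=> h [Bh hb] hu; have [a Aa ha] := Bh _ e2; exists a => // x Kx.
have := ha x Kx; have := hb x Kx; have := hu x Kx Kx; rewrite !ler_norml => ? ? /andP[? ?].
by apply/andP; split; lra.
Unshelve. all: by end_near.
Qed.

End StoneWeierstrass.

(** * Density of the Fourier-polynomial spinors *)

Section ModesDense.
Variables (R : realType) (k N : nat).
Local Notation n := k.+2.
Local Notation Om := (@solid_torus R k).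
Local Notation o1 := (lift ord0 ord0).
Local Notation l2 j := (lift ord0 (lift ord0 j)).
Variables (c : 'I_n -> 'M[R]_N) (J : 'M[R]_N) (H : clifford c J).
Variables (V : set 'rV[R]_n) (oV : open V) (OV : Om `<=` V).
Implicit Types (kap : 'I_k -> int) (x : 'rV[R]_n).
Local Notation field := ('rV[R]_n -> 'M[R]_N).

(** The parameters 0 and 1 give the same angle; subtracting the truth value of s = 1 picks the
    representative in [0, 1). *)
Lemma circle_inj (s t : R) : 0 <= s <= 1 -> 0 <= t <= 1 -> cos (2 * pi * s) = cos (2 * pi * t) ->
  sin (2 * pi * s) = sin (2 * pi * t) -> s - (s == 1)%:R = t - (t == 1)%:R.
Proof.
wlog st : s t / s <= t.
  move=> W s01 t01 cE sE; have [st|ts] := leP s t; first exact: W.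
  by apply: esym; apply: W => //; exact: ltW.
move=> s01 t01 cE sE.
have c1 : cos (2 * (pi * (t - s))) = 1.
  have -> : 2 * (pi * (t - s)) = 2 * pi * t - 2 * pi * s by ring.
  by rewrite cosB cE sE -!expr2 cos2Dsin2.
have s0 : sin (pi * (t - s)) = 0.
  have := cos2Dsin2 (pi * (t - s)); move: c1.
  rewrite mulr_natl mulr2n cosD -!expr2 => c1 c2; apply/eqP; rewrite -sqrf_eq0; apply/eqP; lra.
have [e|ne] := eqVneq t s; first by rewrite e.
have [e1|n1] := eqVneq (t - s) 1.
  have -> : t = 1 by lra.
  have -> : s = 0 by lra.
  by rewrite eqxx [(0 : R) == 1]eq_sym oner_eq0 subr0 subrr.
have d0 : 0 < t - s by rewrite subr_gt0 lt_neqAle eq_sym ne.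
have d1 : t - s < 1 by rewrite lt_neqAle n1 /=; lra.
have := @sin_gt0_pi R (pi * (t - s)); rewrite s0 ltxx => h.
suff : false by []; apply: h.
by rewrite mulr_gt0 ?pi_gt0 //= -[X in _ < X]mulr1 ltr_pM2l // pi_gt0.
Qed.

Lemma MsumD f g : Msum c f -> Msum c g -> Msum c (fun x => f x + g x).
Proof. by move=> [l ->] [l' ->]; exists (l ++ l'); apply/funext => x; rewrite big_cat. Qed.

Lemma Msum0 : Msum c (fun=> 0).
Proof. by exists [::]; apply/funext => x; rewrite big_nil. Qed.

Lemma Msum_mono a b xi kap : Msum c (fun x => mono c a b xi x *m ek c kap x).
Proof. by exists [:: (kap, [:: (a, b, xi)])]; apply/funext => x; rewrite big_seq1 Psum_cons Psum_nil addr0. Qed.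

(** Spinor modes are matrix-valued and form no commutative algebra. The scalar functions that
    preserve their span do, and this is the algebra to which Stone-Weierstrass applies. *)
Definition mult (h : 'rV[R]_n -> R) := Ck 0 setT h /\ forall m, Msum c m -> Msum c (fun x => h x *: m x).

Lemma multP h : Ck 0 setT h -> (forall a b xi kap, Msum c (fun x => h x *: (mono c a b xi x *m ek c kap x))) -> mult h.
Proof.
move=> hC hm; split=> // _ [l ->]; elim: l => [|[kap s] l IH].
  by rewrite (_ : (fun x => _) = fun=> 0); [exact: Msum0|apply/funext => x; rewrite big_nil scaler0].
rewrite (_ : (fun x => _) = fun x => h x *: (Psum c s x *m ek c kap x) + h x *: (\sum_(m <- l) Psum c m.2 x *m ek c m.1 x)).
  apply: MsumD IH; elim: s => [|[[a b] xi] s IHs].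
    by rewrite (_ : (fun x => _) = fun=> 0); [exact: Msum0|apply/funext => x; rewrite Psum_nil mul0mx scaler0].
  rewrite (_ : (fun x => _) = fun x => h x *: (mono c a b xi x *m ek c kap x) + h x *: (Psum c s x *m ek c kap x)).
    exact: MsumD.
  by apply/funext => x; rewrite Psum_cons mulmxDl scalerDr.
by apply/funext => x; rewrite big_cons scalerDr.
Qed.

Lemma mult_cst a : mult (fun=> a).
Proof.
apply: multP => [|a' b xi kap]; first exact: Ck_cst.
have := Msum_mono a' b (a *: xi) kap; rewrite (_ : (fun x => mono _ _ _ (_ *: _) _ *m _) = fun x => a *: (mono c a' b xi x *m ek c kap x)) //.
by apply/funext => x; rewrite monoZ scalemxAl.
Qed.

Lemma multD g h : mult g -> mult h -> mult (fun x => g x + h x).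
Proof.
move=> [gC gm] [hC hm]; split; first exact: (CkD openT (k := 0)).
move=> m Mm; rewrite (_ : (fun x => _) = fun x => g x *: m x + h x *: m x); first by apply: MsumD; [exact: gm|exact: hm].
by apply/funext => x; rewrite scalerDl.
Qed.

Lemma multM g h : mult g -> mult h -> mult (fun x => g x * h x).
Proof.
move=> [gC gm] [hC hm]; split; first exact: (CkM openT (k := 0)).
move=> m Mm; rewrite (_ : (fun x => _) = fun x => g x *: (h x *: m x)); first by apply: gm; exact: hm.
by apply/funext => x; rewrite scalerA.
Qed.

Lemma mult_x0 : mult (fun x => x 0 ord0).
Proof.
apply: multP => [|a b xi kap]; first exact: Ck_coord.
rewrite (_ : (fun x => _) = fun x => mono c a.+1 b (2^-1 *: xi) x *m ek c kap x + mono c a b.+1 (2^-1 *: xi) x *m ek c kap x).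
  by apply: MsumD; exact: Msum_mono.
apply/funext => x; rewrite -mulmxDl scalemxAl; congr (_ *m _).
rewrite (monoSb H) !monoZ -[mono c a.+1 _ _ _]/(Zm c x *m mono c a b xi x) -scalemxAr -scalerDr -mulmxDl.
have -> : Zm c x + Zb c x = (2 * x 0 ord0) *: 1%:M.
  by rewrite /Zm /Zb; move: (_ *m _) (1%:M) => X Y; apply/matrixP => i j; rewrite !mxE; ring.
by rewrite -scalemxAl mul1mx scalerA mulrA mulVf ?mul1r // pnatr_eq0.
Qed.

Lemma mult_x1 : mult (fun x => x 0 o1).
Proof.
apply: multP => [|a b xi kap]; first exact: Ck_coord.
pose eta := (- 2^-1) *: (c ord0 *m c o1 *m xi).
rewrite (_ : (fun x => _) = fun x => mono c a.+1 b eta x *m ek c kap x + mono c a b.+1 (- eta) x *m ek c kap x).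
  by apply: MsumD; exact: Msum_mono.
apply/funext => x; rewrite -mulmxDl scalemxAl; congr (_ *m _).
rewrite (monoSb H) !monoN -[mono c a.+1 _ _ _]/(Zm c x *m mono c a b eta x) mulmxN -mulmxBl.
have -> : Zm c x - Zb c x = (2 * x 0 o1) *: (c ord0 *m c o1).
  by rewrite /Zm /Zb; move: (_ *m _) (1%:M) => X Y; apply/matrixP => i j; rewrite !mxE; ring.
rewrite -scalemxAl (mono_comm _ _ _ _ (erefl _)) /eta -scalemxAr [_ *m (_ *m xi)]mulmxA (ee H).
rewrite mul_scalar_mx scaleN1r scalerN scaleNr opprK monoZ scalerA; congr (_ *: _).
by rewrite mulrAC mulfV ?mul1r // pnatr_eq0.
Qed.

Definition shiftk kap (j : 'I_k) (z : int) := fun i => kap i + (i == j)%:R * z.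

Lemma phase_shift kap j z x : phase (shiftk kap j z) x = phase kap x + z%:~R * (2 * pi * x 0 (l2 j)).
Proof.
rewrite /phase /shiftk (eq_bigr (fun i => (kap i)%:~R * x 0 (l2 i) + (i == j)%:R * z%:~R * x 0 (l2 i))) => [|i _].
  rewrite big_split /= mulrDr; congr (_ + _).
  rewrite (bigD1 j) //= eqxx mul1r big1 => [|i ij]; last by rewrite (negPf ij) !mul0r.
  by rewrite addr0; ring.
by rewrite intrD mulrDl intrM; case: (i == j).
Qed.

Lemma ek_shift kap j x : let th := 2 * pi * x 0 (l2 j) in
  ek c (shiftk kap j 1) x = cos th *: ek c kap x + sin th *: (c ord0 *m ek c kap x) /\
  ek c (shiftk kap j (- 1)) x = cos th *: ek c kap x - sin th *: (c ord0 *m ek c kap x).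
Proof.
move=> th; rewrite /ek !phase_shift -/th mul1r mulrNz mulN1r cosD sinD cosB sinB mulmxDr -!scalemxAr (c0_sq H) mulmx1.
rewrite -[(- 1)%:M]scalemx1; move: (1%:M : 'M[R]_N) (c ord0) => A B.
by split; apply/matrixP => a b; rewrite !mxE; ring.
Qed.

Lemma Ck_angle j q : Ck q setT (fun x : 'rV[R]_n => 2 * pi * x 0 (l2 j)).
Proof. by apply: (CkM openT); [exact: Ck_cst|exact: Ck_coord]. Qed.

Lemma mult_cos j : mult (fun x => cos (2 * pi * x 0 (l2 j))).
Proof.
apply: multP => [|a b xi kap]; first by have [] := Ck_cos_sin openT (Ck_angle j 0).
rewrite (_ : (fun x => _) = fun x => mono c a b (2^-1 *: xi) x *m ek c (shiftk kap j 1) x + mono c a b (2^-1 *: xi) x *m ek c (shiftk kap j (- 1)) x).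
  by apply: MsumD; exact: Msum_mono.
apply/funext => x; have [-> ->] := ek_shift kap j x; rewrite -mulmxDr monoZ addrACA subrr addr0.
have gen (A B : 'M[R]_N) r : r *: (A *m B) = (2^-1 *: A) *m (r *: B + r *: B).
  rewrite mulmxDr -!scalemxAl -!scalemxAr; move: (A *m B) => Y.
  by apply/matrixP => i' j'; rewrite !mxE; field.
exact: gen.
Qed.

Lemma mult_sin j : mult (fun x => sin (2 * pi * x 0 (l2 j))).
Proof.
apply: multP => [|a b xi kap]; first by have [] := Ck_cos_sin openT (Ck_angle j 0).
pose eta := (- 2^-1) *: (xi *m c ord0).
rewrite (_ : (fun x => _) = fun x => mono c a b eta x *m ek c (shiftk kap j 1) x + mono c a b (- eta) x *m ek c (shiftk kap j (- 1)) x).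
  by apply: MsumD; exact: Msum_mono.
apply/funext => x; have [-> ->] := ek_shift kap j x; rewrite monoN mulNmx -mulmxBr /eta monoZ -mono_mulr.
have gen (A B : 'M[R]_N) C r : r *: (A *m B) = (- 2^-1 *: (A *m c ord0)) *m
   (C *: B + r *: (c ord0 *m B) - (C *: B - r *: (c ord0 *m B))).
  have -> : C *: B + r *: (c ord0 *m B) - (C *: B - r *: (c ord0 *m B)) = (2 * r) *: (c ord0 *m B).
    by move: (c ord0 *m B) => Y; apply/matrixP => i j'; rewrite !mxE; ring.
  rewrite -scalemxAl -scalemxAr scalerA -mulmxA (mulmxA (c ord0)) (c0_sq H) mul_scalar_mx scaleN1r mulmxN.
  by rewrite scalerN -scaleNr; congr (_ *: _); field.
exact: gen.
Qed.

Lemma per_sub (T : Type) (F : 'rV[R]_n -> T) (r : seq 'I_k) x : per F -> Om x ->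
  F (x - \sum_(j <- r) 'e_(l2 j)) = F x.
Proof.
move=> Fp Ox; have OS s : Om (x - \sum_(j <- s) 'e_(l2 j)).
  have z (a : 'I_n) : (forall j, a != l2 j) -> (\sum_(j <- s) 'e_(l2 j) : 'rV[R]_n) 0 a = 0.
    by move=> aj; rewrite summxE big1 // => j _; rewrite mxE (negPf (aj j)) andbF.
  move: Ox; rewrite /solid_torus /= one_lift !mxE !z //= !subr0 //.
elim: r => [|j r IH]; first by rewrite big_nil subr0.
rewrite -[RHS]IH -(Fp _ (l2 j) (OS (j :: r)) isT) big_cons; congr F.
by rewrite opprD addrA addrAC subrK.
Qed.

(** The multipliers x, y, cos and sin determine a point up to the lattice. Within the unit cube the
    only ambiguity is 0 against 1, which is removed by subtracting the basis vectors of the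
    coordinates equal to 1. *)
Lemma mult_sep (T : Type) (F : 'rV[R]_n -> T) x y : per F -> @K0 R k x -> @K0 R k y ->
  (forall h, mult h -> h x = h y) -> F x = F y.
Proof.
move=> Fp Kx Ky hxy.
pose r (z : 'rV[R]_n) := [seq j <- index_enum 'I_k | z 0 (l2 j) == 1].
rewrite -(per_sub (r x) Fp (K0_Om Kx)) -(per_sub (r y) Fp (K0_Om Ky)); congr F.
have rE (z : 'rV[R]_n) (i : 'I_k) : (\sum_(j <- r z) 'e_(l2 j) : 'rV[R]_n) 0 (l2 i) = (z 0 (l2 i) == 1)%:R.
  rewrite big_filter summxE big_mkcond (bigD1 i) //= mxE !eqxx /= big1 ?addr0 => [|j ji].
    by case: (_ == 1).
  by case: ifP => // _; rewrite !mxE !(inj_eq lift_inj) eq_sym (negPf ji).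
have z (w : 'rV[R]_n) (a : 'I_n) : (forall j, a != l2 j) -> (\sum_(j <- r w) 'e_(l2 j) : 'rV[R]_n) 0 a = 0.
  by move=> aj; rewrite summxE big1 // => j _; rewrite mxE (negPf (aj j)) andbF.
have K01 w j : @K0 R k w -> 0 <= w 0 (l2 j) <= 1.
  by move=> [q [_ [_ +]] <-] => /(_ j); rewrite polarS in_itv.
apply/rowP => a; rewrite !mxE; case: (lift2E a) => [->|->|[j ->]].
- by rewrite !z // (hxy _ mult_x0).
- by rewrite !z // (hxy _ mult_x1).
- by rewrite !rE; apply: circle_inj; [exact: K01|exact: K01|exact: (hxy _ (mult_cos j))|exact: (hxy _ (mult_sin j))].
Qed.

Lemma Msum_cst xi : Msum c (fun=> xi).
Proof.
have := Msum_mono 0 0 xi (fun=> 0%R); rewrite (_ : (fun x => _) = fun=> xi) //.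
apply/funext => x; rewrite /ek /phase big1 => [|j _]; last by rewrite mul0r.
by rewrite mulr0 cos0 sin0 scale1r scale0r addr0 mulmx1.
Qed.

Theorem modes_dense f : cC V f -> forall e, 0 < e -> exists2 m, Msum c m & nf (fun x => f x - m x) <= e.
Proof.
move=> [fC fp] e e0.
have I0 : 0 <= IO (fun _ : 'rV[R]_n => 1) by apply: (IOge0 OV) => // ; exact: Ck_cst.
pose M := (N%:R * N%:R * IO (fun _ : 'rV[R]_n => 1) : R).
have M0 : 0 <= M by rewrite !mulr_ge0.
(* The bound by 1 makes d^2 <= d, so the squared norm of the error is at most M d <= e. *)
pose d := Num.min 1 (e / (M + 1)).
have M1 : 0 < M + 1 by lra.
have d0 : 0 < d by rewrite lt_min ltr01 divr_gt0.
have ap i j : exists h, mult h /\ forall x, @K0 R k x -> `|f x i j - h x| <= d.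
  have := @stone_weierstrass R _ (@K0 R k) (@K0_compact R k) mult _ mult_cst multD multM (fun x => f x i j) _ _ d d0.
  case=> //.
  - by move=> h [hC _] x _; exact: hC.
  - exact: (Ck0_K0 OV (fC i j)).
  - move=> x y Kx Ky; case: (pselect (forall h, mult h -> h x = h y)) => [same|].
      exists (fun=> f x i j); first exact: mult_cst.
      have pF : per (fun z => f z i j) by move=> z j' Oz j1; rewrite fp.
      by split=> //; exact: (mult_sep pF Kx Ky same).
    move=> /existsNP[g /not_implyP[mg gxy]].
    have ne : g y - g x != 0 by rewrite subr_eq0; apply/eqP => E; exact: gxy.
    exists (fun z => f x i j + (f y i j - f x i j) / (g y - g x) * (g z + - g x)).
      apply: (multD (mult_cst _)); apply: (multM (mult_cst _)).
      exact: (multD mg (mult_cst _)).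
    split; first by rewrite subrr mulr0 addr0.
    by rewrite divfK // addrC subrK.
  - by move=> a Aa h; exists a.
have [h hh] := boolp.choice (fun ij : 'I_N * 'I_N => ap ij.1 ij.2).
pose m x := \sum_(ij : 'I_N * 'I_N) h ij x *: (delta_mx ij.1 ij.2 : 'M[R]_N).
have mE x i j : m x i j = h (i, j) x.
  rewrite summxE (bigD1 (i, j)) //= !mxE !eqxx mulr1 big1 ?addr0 // => -[i' j'] ne.
  rewrite !mxE /=; case: (i =P i') ne => [->|_]; last by rewrite mulr0.
  by case: (j =P j') => [->|_]; rewrite ?eqxx // mulr0.
have Mm : Msum c m.
  rewrite /m; elim: (index_enum _) => [|ij r IH].
    by rewrite (_ : (fun x => _) = fun=> 0); [exact: Msum0|apply/funext => x; rewrite big_nil].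
  rewrite (_ : (fun x => _) = fun x => h ij x *: (delta_mx ij.1 ij.2 : 'M[R]_N) + \sum_(ij <- r) h ij x *: (delta_mx ij.1 ij.2 : 'M[R]_N)).
    by apply: MsumD IH; exact: ((hh ij).1.2 _ (Msum_cst _)).
  by apply/funext => x; rewrite big_cons.
exists m => //.
have c1 (a : R) : Ck 0 V (fun=> a) by exact: Ck_cst.
apply: (@le_trans _ _ (IO (fun _ : 'rV[R]_n => N%:R * N%:R * d * 1))).
  apply: (IOleK OV); [|exact: c1|].
    by apply: (Ck_nsq oV); apply: (mCkB oV) => //; exact: (mCk_Msum oV 0 Mm).
  move=> x Kx; rewrite ipE mulr1.
  apply: (@le_trans _ _ (\sum_(j < N) \sum_(i < N) d)).
    apply: ler_sum => j _; apply: ler_sum => i _; rewrite !mxE mE -expr2 -(real_normK (num_real _)).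
    have h1 := (hh (i, j)).2 x Kx; apply: (@le_trans _ _ (d * 1)); last by rewrite mulr1.
    rewrite expr2; apply: ler_pM => //; apply: (le_trans h1); rewrite /d ge_min lexx //.
  by rewrite !sumr_const !card_ord -mulrnA -[leLHS]mulr_natl natrM.
rewrite (IOZ OV _ (c1 1)).
have -> : N%:R * N%:R * d * IO (fun _ : 'rV[R]_n => 1) = M * d by rewrite /M; ring.
have h1 : d * (M + 1) <= e by rewrite -ler_pdivlMr // /d ge_min lexx orbT.
have E : M * d = d * (M + 1) - d by ring.
by rewrite E; lra.
Qed.

End ModesDense.

(** * Levi-Civita connection and scalar curvature in a frame *)

Section LeviCivita.
Variables (R : realType) (m : nat).
Implicit Types (x : 'rV[R]_m).

(* [KM] holds the Christoffel symbols of the first kind, [GM] the connection matrix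
   (using [E^T E = g^-1]) and [om] its expression in the frame [E]. *)
Definition KM (g : 'rV[R]_m -> 'M[R]_m) i x : 'M[R]_m := \matrix_(l, p)
  (2^-1 * (pd i (fun y => g y l p) x + pd l (fun y => g y i p) x - pd p (fun y => g y i l) x)).
Definition GM g (E : 'rV[R]_m -> 'M[R]_m) i x : 'M[R]_m := KM g i x *m ((E x)^T *m E x).
Definition om g E i x : 'M[R]_m := (mpd i E x + E x *m GM g E i x) *m g x *m (E x)^T.

Variables (g E : 'rV[R]_m -> 'M[R]_m) (W : set 'rV[R]_m) (oW : open W).

Lemma mCk_KM q i : mCk W q.+1 g -> mCk W q (KM g i).
Proof.
move=> gC l p; apply: (Ck_congr (f := fun x => 2^-1 * (pd i (fun y => g y l p) x + pd l (fun y => g y i p) x - pd p (fun y => g y i l) x)) oW).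
  by move=> y _; rewrite mxE.
apply: (CkM oW (k := q)); first exact: Ck_cst.
by apply: (CkB oW (k := q)); [apply: (CkD oW (k := q))|]; apply: Ck_partial; exact: gC.
Qed.

Lemma mCk_GM q i : mCk W q.+1 g -> mCk W q E -> mCk W q (GM g E i).
Proof. by move=> gC EC; apply: (mCkM oW); [exact: mCk_KM|apply: (mCkM oW) => //; apply: (mCkT oW)]. Qed.

Lemma mCk_om q i : mCk W q.+1 g -> mCk W q.+1 E -> mCk W q (om g E i).
Proof.
move=> gC EC; have g0 := mCk_le (leqnSn q) gC; have E0 := mCk_le (leqnSn q) EC.
apply: (mCkM oW); last exact: (mCkT oW).
apply: (mCkM oW) => //; apply: (mCkD oW); first exact: (mCk_mpd oW).
by apply: (mCkM oW) => //; exact: mCk_GM.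
Qed.

End LeviCivita.

(** * The spin connection and its curvature *)

Section SpinGeometry.
Variables (R : realType) (k N : nat).
Local Notation n := k.+2.
Variables (c : 'I_n -> 'M[R]_N) (J : 'M[R]_N) (H : clifford c J).
Implicit Types (x : 'rV[R]_n).

Lemma cl2_sum (I : Type) (r : seq I) (F : I -> 'M[R]_n) : cl2 c (\sum_(i <- r) F i) = \sum_(i <- r) cl2 c (F i).
Proof.
elim/big_rec2: _ => [|i y z _ <-]; last exact: cl2D.
by have := cl2Z c 0 0; rewrite !scale0r.
Qed.

Lemma cl2E (A : 'M[R]_n) : cl2 c A = \sum_a \sum_b A a b *: (4^-1 *: (c a *m c b)).
Proof.
rewrite /cl2 scaler_sumr; apply: eq_bigr => a _; rewrite scaler_sumr; apply: eq_bigr => b _.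
by rewrite !scalerA mulrC.
Qed.

Section Cl2Calculus.
Variables (m : nat) (W : set 'rV[R]_m) (oW : open W).

Lemma mCk_cl2 q (A : 'rV[R]_m -> 'M[R]_n) : mCk W q A -> mCk W q (fun y => cl2 c (A y)).
Proof.
move=> AC; apply: (mCk_congr oW (A := fun y => \sum_a \sum_b A y a b *: (4^-1 *: (c a *m c b)))).
  by move=> x _; rewrite cl2E.
by apply: (mCk_sum oW) => a; apply: (mCk_sum oW) => b; apply: (mCkZ oW); [exact: AC|exact: mCk_cst].
Qed.

Lemma mpd_cl2 i (A : 'rV[R]_m -> 'M[R]_n) (x : 'rV[R]_m) : W x -> mCk W 1 A -> mpd i (fun y => cl2 c (A y)) x = cl2 c (mpd i A x).
Proof.
move=> Wx AC.
have -> : (fun y => cl2 c (A y)) = fun y => \sum_a \sum_b A y a b *: (4^-1 *: (c a *m c b)).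
  by apply/funext => y; rewrite cl2E.
have tC a b : mCk W 1 (fun y => A y a b *: (4^-1 *: (c a *m c b))).
  by apply: (mCkZ oW); [exact: AC|exact: mCk_cst].
rewrite cl2E (mpd_sum oW Wx i); last by move=> a; apply: (mCk_sum oW) => b.
apply: eq_bigr => a _; rewrite (mpd_sum oW Wx i) //; apply: eq_bigr => b _.
by rewrite (mpdZ oW Wx i (AC a b) (mCk_cst W 1 _)) mpd_cst scaler0 addr0 mpdE.
Qed.

End Cl2Calculus.

Definition OM (g E : 'rV[R]_n -> 'M[R]_n) i x : 'M[R]_N := cl2 c (om g E i x).
(** The Riemannian volume density: E g E^T = 1 gives det(E)^2 det(g) = 1. *)
Definition rhoE (E : 'rV[R]_n -> 'M[R]_n) x : R := (\det (E x))^-1.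

Variables (g E : 'rV[R]_n -> 'M[R]_n).
Local Notation G := (GM g E).
Local Notation w := (om g E).
Local Notation O := (OM g E).

Section Smoothness.
Variables (W : set 'rV[R]_n) (oW : open W).

Lemma mCk_OM q i : mCk W q.+1 g -> mCk W q.+1 E -> mCk W q (O i).
Proof. by move=> gC EC; apply: (mCk_cl2 oW); exact: mCk_om. Qed.

End Smoothness.

Variables (W : set 'rV[R]_n) (oW : open W) (gC : mCk W 2 g) (EC : mCk W 2 E).
Hypotheses (gs : forall x, W x -> (g x)^T = g x).
Hypothesis Eo : forall x, W x -> E x *m g x *m (E x)^T = 1%:M.

Let g1 : mCk W 1 g. Proof. exact: mCk_le gC. Qed.
Let E1 : mCk W 1 E. Proof. exact: mCk_le EC. Qed.

Lemma gEE x : W x -> g x *m (E x)^T *m E x = 1%:M.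
Proof. by move=> Wx; apply: mulmx1C; rewrite mulmxA Eo. Qed.

Lemma EEg x : W x -> (E x)^T *m E x *m g x = 1%:M.
Proof. by move=> Wx; rewrite -mulmxA; apply: mulmx1C; rewrite Eo. Qed.

Lemma inv_gE x : W x -> invmx (g x) = (E x)^T *m E x.
Proof.
move=> Wx; have u : g x \in unitmx by case: (mulmx1_unit (EEg Wx)).
by rewrite -[LHS]mul1mx -(EEg Wx) -(mulmxA _ (g x)) mulmxV // mulmx1.
Qed.

Lemma pd_gs i a b x : W x -> pd i (fun y => g y a b) x = pd i (fun y => g y b a) x.
Proof. by move=> Wx; apply: (partial_congr oW) => // y Wy; rewrite -[in LHS](gs Wy) mxE. Qed.

Lemma GM_sym i l p x : W x -> G i x l p = G l x i p.
Proof.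
move=> Wx; rewrite !mxE; apply: eq_bigr => q _; rewrite ![KM _ _ _ _ _]mxE; congr (_ * _ * _).
by rewrite (pd_gs q i l Wx) [in LHS]addrAC [in RHS]addrAC; ring.
Qed.

Lemma KMD i x : W x -> KM g i x + (KM g i x)^T = mpd i g x.
Proof.
move=> Wx; apply/matrixP => l p; rewrite !mxE mpdE (pd_gs i p l Wx).
by field.
Qed.

(** Metric compatibility: this is the derivative of E g E^T = 1, in which the first-kind symbols
    symmetrise to the derivative of g. *)
Lemma om_skew i x : W x -> (w i x)^T = - w i x.
Proof.
move=> Wx; apply/eqP; rewrite -addr_eq0; apply/eqP.
have e0 : mpd i (fun y => E y *m g y *m (E y)^T) x = 0.
  by rewrite (mpd_congr oW (B := fun=> 1%:M) i Eo Wx) mpd_cst.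
have EgC : mCk W 1 (fun y => E y *m g y) by exact: (mCkM oW).
rewrite (mpdM oW Wx i EgC (mCkT oW E1)) (mpdM oW Wx i E1 g1) (mpdT oW Wx) -(KMD i Wx) in e0.
rewrite /om !trmx_mul linearD /= trmx_mul trmxK gs // /GM !trmx_mul trmxK.
rewrite -[RHS]e0 !mulmxDl !mulmxDr !mulmxDl.
have t1 : E x *m (KM g i x *m ((E x)^T *m E x)) *m g x *m (E x)^T = E x *m KM g i x *m (E x)^T.
  by rewrite -!mulmxA; congr (_ *m (_ *m _)); rewrite !mulmxA EEg // mul1mx.
have t2 : E x *m (g x *m ((E x)^T *m E x *m (KM g i x)^T *m (E x)^T)) = E x *m (KM g i x)^T *m (E x)^T.
  by rewrite -!mulmxA; congr (_ *m _); rewrite !mulmxA gEE // mul1mx.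
rewrite t1 t2 (mulmxA (E x) (g x) _).
move: (E x *m KM g i x *m (E x)^T) (E x *m (KM g i x)^T *m (E x)^T) (mpd i E x *m g x *m (E x)^T) (E x *m g x *m (mpd i E x)^T) => a1 a2 a3 a4.
by apply/matrixP => a b; rewrite !mxE; ring.
Qed.

Lemma mpd_frame i x : W x -> mpd i E x = w i x *m E x - E x *m G i x.
Proof.
move=> Wx; rewrite /om -!mulmxA [g x *m (_ *m _)]mulmxA gEE // mulmx1 addrK //.
Qed.

(** Clifford multiplication is parallel. The commutator with the spin connection undoes the rotation
    of the frame, and what is left is the Levi-Civita derivative of dx^j, with [G i x p j] the
    Christoffel symbol Gamma^j_(ip). *)
Lemma mpd_ce i j x : W x -> mpd i (ce c E j) x = - (O i x *m ce c E j x - ce c E j x *m O i x) -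
  \sum_p G i x p j *: ce c E p x.
Proof.
move=> Wx; rewrite /OM {1 2}/ce (cl2_comm H _ (om_skew i Wx)).
have -> : mpd i (ce c E j) x = cl c (col j (mpd i E x))^T.
  have -> : ce c E j = fun y => \sum_a E y a j *: c a by apply/funext => y; rewrite ceE.
  rewrite (mpd_sum oW Wx i) => [|a]; last by apply: (mCkZ oW); [exact: E1|exact: mCk_cst].
  rewrite /cl; apply: eq_bigr => a _.
  by rewrite (mpdZ oW Wx i (E1 a j) (mCk_cst W 1 _)) mpd_cst scaler0 addr0 !mxE mpdE.
rewrite -clN -[\sum_p _](_ : cl c (\sum_p G i x p j *: (col p (E x))^T) = _); last first.
  by rewrite cl_sum; apply: eq_bigr => p _; rewrite clZ.
rewrite -clB; congr cl; apply/rowP => a; rewrite mpd_frame // !mxE; congr (_ - _).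
  rewrite -sumrN; apply: eq_bigr => b _; rewrite !mxE; have /matrixP /(_ a b) := om_skew i Wx; rewrite !mxE => ->.
  by rewrite mulrC mulrN opprK.
by rewrite summxE; apply: eq_bigr => p _; rewrite !mxE mulrC.
Qed.

Lemma detE_neq0 x : W x -> \det (E x) != 0.
Proof.
move=> Wx; apply/eqP => d0; have := congr1 determinant (Eo Wx).
by rewrite !det_mulmx d0 !mul0r det1 => /eqP; rewrite eq_sym oner_eq0.
Qed.

Lemma Ck_rhoE q : mCk W q E -> Ck q W (rhoE E).
Proof. by move=> EqC; apply: (Ck_inv oW) => [y Wy|]; [exact: detE_neq0|exact: Ck_det]. Qed.

Lemma pd_rhoE i x : W x -> pd i (rhoE E) x = rhoE E x * \tr (G i x).
Proof.
move=> Wx; have dC : Ck 1 W (fun y => \det (E y)) by exact: (Ck_det oW).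
have rC := Ck_rhoE E1.
have e : pd i (fun y => \det (E y) * rhoE E y) x = 0.
  rewrite (partial_congr oW (g := fun=> 1) i) // => [|y Wy]; last by rewrite /rhoE mulfV ?detE_neq0.
  by apply: pd_val; exact: is_derive_cst.
rewrite (partialM (Ck_derivable dC Wx) (Ck_derivable rC Wx)) (partial_det oW i Wx E1) in e.
have d0 := detE_neq0 Wx; have u : E x \in unitmx by rewrite unitmxE unitfE.
have tE : \tr (\adj (E x) *m mpd i E x) = - (\det (E x) * \tr (G i x)).
  rewrite mpd_frame // mulmxBr raddfB /=.
  have -> : \tr (\adj (E x) *m (w i x *m E x)) = \det (E x) * \tr (w i x).
    by rewrite mxtrace_mulC -(mulmxA (w i x) (E x)) mul_mx_adj mul_mx_scalar linearZ.
  have -> : \tr (\adj (E x) *m (E x *m G i x)) = \det (E x) * \tr (G i x).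
    by rewrite (mulmxA _ (E x)) mul_adj_mx mul_scalar_mx linearZ.
  have -> : \tr (w i x) = 0.
    have := congr1 mxtrace (om_skew i Wx); rewrite mxtrace_tr raddfN /= => /eqP.
    by rewrite -subr_eq0 opprK -mulr2n mulrn_eq0 /= => /eqP.
  by rewrite mulr0 sub0r.
rewrite tE mulNr in e; apply: (mulfI d0); apply/eqP; rewrite -subr_eq0; apply/eqP.
by rewrite -[RHS]e; ring.
Qed.

(** The derivative of the density contributes the trace of the connection matrix, and absence of
    torsion makes it equal to the contraction coming from the derivative of c^i. *)
Lemma Zc_eq0 x : W x -> Zc c E (rhoE E) O x = 0.
Proof.
move=> Wx; have rC := Ck_rhoE E1.
rewrite /Zc (eq_bigr (fun i => rhoE E x *: (\tr (G i x) *: ce c E i x - \sum_p G i x p i *: ce c E p x))) => [|i _].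
  rewrite -scaler_sumr sumrB exchange_big /= -sumrB big1 ?scaler0 // => p _.
  rewrite -scaler_suml -scalerBl (eq_bigr (fun i => G p x i i)) => [|i _]; last exact: GM_sym.
  by rewrite subrr scale0r.
rewrite (mpdZ oW Wx i rC (mCk_ce c oW i E1)) pd_rhoE // mpd_ce //.
by rewrite -scalerA -!scalerDr -addrA [- _ - _]addrC subrK.
Qed.

Lemma mpd_Sc i j l x : W x -> mpd l (Sc c E i j) x + (O l x *m Sc c E i j x - Sc c E i j x *m O l x) =
  - \sum_p G l x p i *: Sc c E p j x - \sum_p G l x p j *: Sc c E i p x.
Proof.
move=> Wx; have cC q := mCk_ce c oW q E1.
have cM p q : mCk W 1 (fun y => ce c E p y *m ce c E q y) by exact: (mCkM oW).
rewrite {1}/Sc (mpdZ oW Wx l (Ck_cst W 1 2^-1) (mCkB oW (cM i j) (cM j i))).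
have -> : pd l (fun=> 2^-1) x = 0 by apply: pd_val; exact: is_derive_cst.
rewrite scale0r add0r (mpdB oW Wx l (cM i j) (cM j i)) !(mpdM oW Wx l (cC _) (cC _)) !mpd_ce //.
have gen (a : 'I_n -> R) (X : 'I_n -> 'M[R]_N) Y : \sum_p a p *: (2^-1 *: (X p *m Y - Y *m X p)) =
    2^-1 *: ((\sum_p a p *: X p) *m Y - Y *m \sum_p a p *: X p).
  rewrite mulmx_suml mulmx_sumr -sumrB scaler_sumr; apply: eq_bigr => p _.
  by rewrite -scalemxAl -scalemxAr -scalerBr !scalerA mulrC.
have e1 : \sum_p G l x p i *: Sc c E p j x = 2^-1 *: ((\sum_p G l x p i *: ce c E p x) *m ce c E j x -
    ce c E j x *m \sum_p G l x p i *: ce c E p x) by exact: gen.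
have e2 : \sum_p G l x p j *: Sc c E i p x = 2^-1 *: (ce c E i x *m (\sum_p G l x p j *: ce c E p x) -
    (\sum_p G l x p j *: ce c E p x) *m ce c E i x).
  rewrite -opprB scalerN -gen -sumrN; apply: eq_bigr => p _.
  by rewrite -!scalerN opprB.
rewrite e1 e2 /Sc; move: (\sum_p _) (\sum_p _) (ce c E i x) (ce c E j x) (O l x) => X Y A B Z.
rewrite -scalemxAl -scalemxAr !mulmxDl !mulmxDr !mulNmx !mulmxN !mulmxDl !mulmxDr !mulNmx !mulmxN !mulmxA.
move: (X *m B) (A *m Y) (B *m X) (Y *m A) (Z *m A *m B) (A *m Z *m B) (A *m B *m Z) (Z *m B *m A) (B *m Z *m A) (B *m A *m Z).
move=> a1 a2 a3 a4 a5 a6 a7 a8 a9 a10.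
by apply/matrixP => a b; rewrite !mxE; field.
Qed.

(** The first index is treated as for a vector field; the second contributes a symmetric Christoffel
    symbol contracted with the skew [Sc], hence nothing. *)
Lemma ZS_eq0 j x : W x -> ZS c E (rhoE E) O j x = 0.
Proof.
move=> Wx; have rC := Ck_rhoE E1.
rewrite /ZS (eq_bigr (fun i => rhoE E x *: (\tr (G i x) *: Sc c E i j x - \sum_p G i x p i *: Sc c E p j x
   - \sum_p G i x p j *: Sc c E i p x))) => [|i _]; last first.
  rewrite (mpdZ oW Wx i rC (mCk_Sc c oW i j E1)) pd_rhoE // -addrA -scalerDr mpd_Sc //.
  by rewrite -scalerA -scalerDr addrA.
rewrite -scaler_sumr !sumrB.
have -> : \sum_i \sum_p G i x p j *: Sc c E i p x = 0.
  have e : \sum_i \sum_p G i x p j *: Sc c E i p x = - \sum_i \sum_p G i x p j *: Sc c E i p x.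
    rewrite {1}exchange_big /= -sumrN; apply: eq_bigr => i _; rewrite -sumrN; apply: eq_bigr => p _.
    by rewrite (GM_sym p i j Wx) Sc_skew scalerN.
  apply/eqP; move/eqP: e; rewrite -subr_eq0 opprK -mulr2n -scaler_nat scaler_eq0 pnatr_eq0 //.
rewrite subr0 [X in _ - X]exchange_big /= -sumrB big1 ?scaler0 // => p _.
rewrite -scaler_suml -scalerBl (eq_bigr (fun i => G p x i i)) => [|i _]; last exact: GM_sym.
by rewrite subrr scale0r.
Qed.

(** [Om2] and [RM] are the curvature in the frame and in coordinates. Connection matrices act on
    rows from the right, so the quadratic terms appear in the order opposite to the usual one. *)
Definition Om2 i j x := mpd i (w j) x - mpd j (w i) x + (w j x *m w i x - w i x *m w j x).
Definition RM i j x := mpd i (G j) x - mpd j (G i) x - (G i x *m G j x - G j x *m G i x).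

Let wC i : mCk W 1 (w i). Proof. exact: mCk_om. Qed.
Let GC i : mCk W 1 (G i). Proof. exact: mCk_GM. Qed.

Lemma mpd_om_skew i j x : W x -> (mpd i (w j) x)^T = - mpd i (w j) x.
Proof.
move=> Wx; rewrite -(mpdT oW Wx) -(mpdN oW Wx i (wC j)).
by apply: (mpd_congr oW) => // y Wy; exact: om_skew.
Qed.

Lemma Om2_skew i j x : W x -> (Om2 i j x)^T = - Om2 i j x.
Proof.
move=> Wx; rewrite /Om2 linearD linearB /= linearB /= (trmx_mul (w j x)) (trmx_mul (w i x)) !mpd_om_skew // !om_skew //.
rewrite !mulNmx !mulmxN !opprK; move: (_ *m _) (w j x *m _) (mpd i _ _) (mpd j _ _) => a1 a2 a3 a4.
by apply/matrixP => a b; rewrite !mxE; ring.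
Qed.

Lemma curv_cl2 i j x : W x -> curv O i j x = cl2 c (Om2 i j x).
Proof.
move=> Wx; rewrite /curv /OM !(mpd_cl2 oW _ Wx) // (cl2_lie H (om_skew i Wx) (om_skew j Wx)).
by rewrite -!cl2B -cl2D.
Qed.

(** Mixed second derivatives of E commute. Computing them from the structure equation [mpd_frame]
    leaves exactly the equality of the two curvatures up to the change of frame. *)
Lemma Om2_RM i j x : W x -> Om2 i j x *m E x = E x *m RM i j x.
Proof.
move=> Wx; have dd a b : mpd a (mpd b E) x = mpd a (w b) x *m E x + w b x *m (w a x *m E x - E x *m G a x) -
    ((w a x *m E x - E x *m G a x) *m G b x + E x *m mpd a (G b) x).
  rewrite (mpd_congr oW (B := fun y => w b y *m E y - E y *m G b y) a) // => [|y Wy]; last exact: mpd_frame.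
  rewrite (mpdB oW Wx a (mCkM oW (wC b) E1) (mCkM oW E1 (GC b))) (mpdM oW Wx a (wC b) E1) (mpdM oW Wx a E1 (GC b)).
  by rewrite !mpd_frame.
have := mpd_sym oW Wx i j EC; rewrite !dd /Om2 /RM.
move: (w i x) (w j x) (E x) (G i x) (G j x) (mpd i (w j) x) (mpd j (w i) x) (mpd i (G j) x) (mpd j (G i) x).
move=> w1 w2 Ex G1 G2 dw1 dw2 dG1 dG2.
rewrite ?mulmxDl ?mulmxDr ?mulNmx ?mulmxN ?mulmxDl ?mulmxDr ?mulNmx ?mulmxN ?mulmxA.
move: (w1 *m w2 *m Ex) (w2 *m w1 *m Ex) (w1 *m Ex *m G2) (w2 *m Ex *m G1) (Ex *m G1 *m G2) (Ex *m G2 *m G1)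
  (dw1 *m Ex) (dw2 *m Ex) (Ex *m dG1) (Ex *m dG2) => a1 a2 a3 a4 a5 a6 a7 a8 a9 a10 /matrixP h.
apply/matrixP => a b; have := h a b; rewrite !mxE; lra.
Qed.

Lemma RM_entry i j l p x : RM i j x l p = mpd i (G j) x l p - mpd j (G i) x l p -
   (\sum_q G i x l q * G j x q p - \sum_q G j x l q * G i x q p).
Proof. by rewrite !mxE. Qed.

Lemma RM_bianchi i j l p x : W x -> RM i j x l p + RM j l x i p + RM l i x j p = 0.
Proof.
move=> Wx; have dG a b d : mpd a (G b) x d p = mpd a (G d) x b p.
  by rewrite !mpdE; apply: (partial_congr oW) => // y Wy; exact: GM_sym.
pose S a b d := \sum_q G a x d q * G b x q p.
have Ss a b d : S a b d = S d b a by apply: eq_bigr => q _; rewrite (GM_sym _ _ _ Wx).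
have e a b d : RM a b x d p = mpd a (G b) x d p - mpd b (G a) x d p - (S a b d - S b a d) by exact: RM_entry.
by rewrite !e (dG i l j) (dG j l i) (dG l j i) (Ss i j l) (Ss j i l) (Ss j l i); ring.
Qed.

Lemma riemann_RM a b i j x : W x -> riemann g b a i j x = RM i j x a b.
Proof.
have chE l p q y : W y -> christoffel g l p q y = G p y q l.
  move=> Wy; rewrite /christoffel mxE mulr_sumr; apply: eq_bigr => s _.
  rewrite inv_gE // !mxE -!pdE [RHS]mulrC mulrA [2^-1 * _]mulrC -mulrA; congr (_ * (_ * _)).
    by apply: eq_bigr => u _; rewrite !mxE mulrC.
move=> Wx; rewrite /riemann -!pdE RM_entry !mpdE.
rewrite (partial_congr oW (g := fun y => G j y a b) i) // => [|y Wy]; last exact: chE.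
rewrite (partial_congr oW (g := fun y => G i y a b) j) // => [|y Wy]; last exact: chE.
congr (_ - _ + _); rewrite -sumrB -sumrN; apply: eq_bigr => q _.
by rewrite !chE //; ring.
Qed.

Lemma Om2_entry i j a b x : W x -> Om2 i j x a b = \sum_l \sum_p E x a l * RM i j x l p * (g x *m (E x)^T) p b.
Proof.
move=> Wx; have -> : Om2 i j x = E x *m RM i j x *m (g x *m (E x)^T).
  by rewrite -Om2_RM // -mulmxA [E x *m _]mulmxA Eo // mulmx1.
rewrite mxE (eq_bigr (fun p => \sum_l E x a l * RM i j x l p * (g x *m (E x)^T) p b)) => [|p _].
  by rewrite exchange_big.
by rewrite [(E x *m _) a p]mxE mulr_suml.
Qed.

(** In frame components the curvature has both skew symmetries and satisfies the first Bianchi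
    identity, so its fourfold Clifford contraction collapses to the scalar curvature. The factor 4
    combines the 1/2 here, the 1/4 of the spin representation and the 2 of the contraction. *)
Lemma half_curv x : W x -> 2^-1 *: (\sum_i \sum_j Sc c E i j x *m curv O i j x) = (scalar_curvature g x / 4)%:M.
Proof.
move=> Wx.
pose Q a b l d := \sum_i \sum_j E x l i * E x d j * Om2 i j x a b.
have OA i j : Om2 j i x = - Om2 i j x by rewrite /Om2 opprD !opprB.
have Oanti i j a b : Om2 j i x a b = - Om2 i j x a b by rewrite OA [LHS]mxE.
have Q1 a b l d : Q b a l d = - Q a b l d.
  rewrite /Q -sumrN; apply: eq_bigr => i _; rewrite -sumrN; apply: eq_bigr => j _.
  by have /matrixP /(_ a b) := Om2_skew i j Wx; rewrite !mxE => ->; rewrite mulrN.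
have Q2 a b l d : Q a b d l = - Q a b l d.
  rewrite /Q exchange_big /= -sumrN; apply: eq_bigr => i _; rewrite -sumrN; apply: eq_bigr => j _.
  by rewrite (Oanti i j a b) (mulrC (E x d j) (E x l i)) mulrN.
pose F a b l d i j q p := E x l i * E x d j * (E x a q * RM i j x q p * (g x *m (E x)^T) p b).
have QE a b l d : Q a b l d = \sum_i \sum_j \sum_q \sum_p F a b l d i j q p.
  apply: eq_bigr => i _; apply: eq_bigr => j _; rewrite Om2_entry // mulr_sumr.
  by apply: eq_bigr => q _; rewrite mulr_sumr.
have Q3 a b l d : Q a b l d + Q l b d a + Q d b a l = 0.
  rewrite (QE l) (QE d) (QE a).
  have -> : \sum_i \sum_j \sum_q \sum_p F l b d a i j q p = \sum_i \sum_j \sum_q \sum_p F l b d a j q i p.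
    rewrite [RHS](eq_bigr (fun i => \sum_q \sum_j \sum_p F l b d a j q i p)) => [|i _]; last exact: exchange_big.
    rewrite [RHS]exchange_big /= [RHS](eq_bigr (fun q => \sum_j \sum_i \sum_p F l b d a j q i p)) => [|q _]; last exact: exchange_big.
    by rewrite [RHS]exchange_big.
  have -> : \sum_i \sum_j \sum_q \sum_p F d b a l i j q p = \sum_i \sum_j \sum_q \sum_p F d b a l q i j p.
    rewrite [RHS](eq_bigr (fun i => \sum_q \sum_j \sum_p F d b a l q i j p)) => [|i _]; last exact: exchange_big.
    by rewrite [RHS]exchange_big.
  rewrite -!big_split /= big1 // => i _; rewrite -!big_split /= big1 // => j _; rewrite -!big_split /= big1 // => q _.
  rewrite -!big_split /= big1 // => p _; rewrite /F.
  transitivity (E x l i * E x d j * E x a q * (g x *m (E x)^T) p b * (RM i j x q p + RM j q x i p + RM q i x j p)); first by ring.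
  by rewrite RM_bianchi // mulr0.
(* [Sc i j] differs from c^i c^j by the scalar g^ij, which is symmetric and disappears against the
   curvature, skew in i and j. *)
have S1 : \sum_i \sum_j Sc c E i j x *m curv O i j x = \sum_i \sum_j (ce c E i x *m ce c E j x) *m cl2 c (Om2 i j x).
  rewrite (eq_bigr (fun i => \sum_j (ce c E i x *m ce c E j x *m cl2 c (Om2 i j x) + (\sum_a E x a i * E x a j) *: cl2 c (Om2 i j x)))); last first.
    by move=> i _; apply: eq_bigr => j _; rewrite (ScE H) curv_cl2 // mulmxDl mul_scalar_mx.
  rewrite (eq_bigr (fun i => \sum_j (ce c E i x *m ce c E j x *m cl2 c (Om2 i j x)) + \sum_j ((\sum_a E x a i * E x a j) *: cl2 c (Om2 i j x)))); last first.
    by move=> i _; rewrite big_split.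
  rewrite big_split /= [X in _ + X](_ : _ = 0) ?addr0 //.
  set S := \sum_i \sum_j (_ *: _); have e : S = - S.
    rewrite {1}/S exchange_big /= /S -sumrN; apply: eq_bigr => i _; rewrite -sumrN; apply: eq_bigr => j _.
    rewrite (OA i j) cl2N scalerN; congr (- (_ *: _)); apply: eq_bigr => a _; exact: mulrC.
  by apply/eqP; move/eqP: e; rewrite -subr_eq0 opprK -mulr2n -scaler_nat scaler_eq0 pnatr_eq0.
have S2 : \sum_i \sum_j (ce c E i x *m ce c E j x) *m cl2 c (Om2 i j x) =
   4^-1 *: \sum_a \sum_b \sum_l \sum_d Q a b l d *: (c l *m c d *m (c a *m c b)).
  transitivity (\sum_i \sum_j \sum_a \sum_b \sum_l \sum_d (4^-1 * (E x l i * E x d j * Om2 i j x a b)) *: (c l *m c d *m (c a *m c b))).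
    apply: eq_bigr => i _; apply: eq_bigr => j _; rewrite /cl2 -scalemxAr mulmx_sumr scaler_sumr; apply: eq_bigr => a _.
    rewrite mulmx_sumr scaler_sumr; apply: eq_bigr => b _; rewrite !ceE mulmx_suml mulmx_suml scaler_sumr; apply: eq_bigr => l _.
    rewrite mulmx_sumr mulmx_suml scaler_sumr; apply: eq_bigr => d _.
    by rewrite -!scalemxAl -!scalemxAr -!scalemxAl !scalerA; congr (_ *: _); ring.
  rewrite scaler_sumr.
  rewrite (eq_bigr (fun i => \sum_a \sum_j \sum_b \sum_l \sum_d (4^-1 * (E x l i * E x d j * Om2 i j x a b)) *: (c l *m c d *m (c a *m c b)))); last by move=> i _; exact: exchange_big.
  rewrite exchange_big; apply: eq_bigr => a _ /=; rewrite scaler_sumr.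
  rewrite (eq_bigr (fun i => \sum_b \sum_j \sum_l \sum_d (4^-1 * (E x l i * E x d j * Om2 i j x a b)) *: (c l *m c d *m (c a *m c b)))); last by move=> i _; exact: exchange_big.
  rewrite exchange_big; apply: eq_bigr => b _ /=; rewrite scaler_sumr.
  rewrite (eq_bigr (fun i => \sum_l \sum_j \sum_d (4^-1 * (E x l i * E x d j * Om2 i j x a b)) *: (c l *m c d *m (c a *m c b)))); last by move=> i _; exact: exchange_big.
  rewrite exchange_big; apply: eq_bigr => l _ /=; rewrite scaler_sumr.
  rewrite (eq_bigr (fun i => \sum_d \sum_j (4^-1 * (E x l i * E x d j * Om2 i j x a b)) *: (c l *m c d *m (c a *m c b)))); last by move=> i _; exact: exchange_big.
  rewrite exchange_big; apply: eq_bigr => d _ /=; rewrite scalerA /Q mulr_sumr scaler_suml; apply: eq_bigr => i _.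
  by rewrite mulr_sumr scaler_suml.
rewrite S1 S2 (clifford_bianchi H Q1 Q2 Q3).
have -> : \sum_a \sum_b Q a b b a = scalar_curvature g x.
  transitivity (\sum_i \sum_j \sum_q \sum_p (\sum_a E x a j * E x a q) * (\sum_b (g x *m (E x)^T) p b * E x b i) * RM i j x q p).
    rewrite (eq_bigr (fun a => \sum_i \sum_b \sum_j E x b i * E x a j * Om2 i j x a b)); last by move=> a _; exact: exchange_big.
    rewrite exchange_big; apply: eq_bigr => i _ /=.
    rewrite (eq_bigr (fun a => \sum_j \sum_b E x b i * E x a j * Om2 i j x a b)); last by move=> a _; exact: exchange_big.
    rewrite exchange_big; apply: eq_bigr => j _ /=.
    rewrite (eq_bigr (fun a => \sum_q \sum_p \sum_b E x a j * E x a q * ((g x *m (E x)^T) p b * E x b i) * RM i j x q p)); last first.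
      move=> a _; rewrite (eq_bigr (fun b => \sum_q \sum_p E x b i * E x a j * (E x a q * RM i j x q p * (g x *m (E x)^T) p b))); last first.
        by move=> b _; rewrite Om2_entry // mulr_sumr; apply: eq_bigr => q _; rewrite mulr_sumr.
      rewrite exchange_big; apply: eq_bigr => q _ /=; rewrite exchange_big; apply: eq_bigr => p _ /=.
      by apply: eq_bigr => b _; ring.
    rewrite exchange_big; apply: eq_bigr => q _ /=; rewrite exchange_big; apply: eq_bigr => p _ /=.
    by rewrite mulr_suml mulr_suml; apply: eq_bigr => a _; rewrite mulr_sumr mulr_suml; apply: eq_bigr => b _.
  rewrite /scalar_curvature.
  have gd p i : \sum_b (g x *m (E x)^T) p b * E x b i = (p == i)%:R.
    by have /matrixP /(_ p i) := gEE Wx; rewrite mxE => ->; rewrite mxE.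
  have gi q j : \sum_a E x a j * E x a q = invmx (g x) q j.
    by rewrite inv_gE // mxE; apply: eq_bigr => a _; rewrite mxE mulrC.
  rewrite exchange_big /= [RHS]exchange_big /=; apply: eq_bigr => j _.
  rewrite exchange_big; apply: eq_bigr => q _ /=; rewrite /ricci mulr_sumr; apply: eq_bigr => i _.
  rewrite (bigD1 i) //= gd eqxx mulr1 gi riemann_RM // big1 ?addr0 // => p pi.
  by rewrite gd (negPf pi) mulr0 mul0r.
rewrite scale_scalar_mx scale_scalar_mx; congr (_%:M); by field.
Qed.

End SpinGeometry.

(** * The Lichnerowicz formula *)

Section Lichnerowicz.
Variables (R : realType) (k N : nat).
Local Notation n := k.+2.
Local Notation Om := (@solid_torus R k).
Local Notation o1 := (lift ord0 ord0).
Variables (c : 'I_n -> 'M[R]_N) (J : 'M[R]_N) (H : clifford c J).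
Variables (V : set 'rV[R]_n) (oV : open V) (OV : Om `<=` V).
Variables (g E : 'rV[R]_n -> 'M[R]_n).
Hypotheses (gC : mCk V 2 g) (EC : mCk V 2 E) (gp : per g) (Ep : per E).
Hypotheses (gs : forall x, Om x -> (g x)^T = g x).
Hypothesis Eo : forall x, Om x -> E x *m g x *m (E x)^T = 1%:M.
Hypothesis Ed : forall x, V x -> 0 < \det (E x).
Hypothesis sc : forall x, Om x -> - (n%:R * (n%:R - 1)) <= scalar_curvature g x.
Implicit Types (psi chi : 'rV[R]_n -> 'M[R]_N) (x : 'rV[R]_n).

Local Notation O := (OM c g E).
Local Notation rho := (rhoE E).
Local Notation U := (@inner_torus R k).

Let oU : open U. Proof. exact: inner_open. Qed.
Let UO : U `<=` Om. Proof. exact: inner_sub. Qed.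
Let UV : U `<=` V. Proof. by move=> x /UO /OV. Qed.
Let gU : mCk U 2 g. Proof. exact: mCk_sub gC. Qed.
Let EU : mCk U 2 E. Proof. exact: mCk_sub EC. Qed.
Let gsU x : U x -> (g x)^T = g x. Proof. by move=> /UO; exact: gs. Qed.
Let EoU x : U x -> E x *m g x *m (E x)^T = 1%:M. Proof. by move=> /UO; exact: Eo. Qed.
Let E1 : mCk V 1 E. Proof. exact: mCk_le EC. Qed.
Let E0 : mCk V 0 E. Proof. exact: mCk_le EC. Qed.
Let g1 : mCk V 1 g. Proof. exact: mCk_le gC. Qed.

Lemma OC i : mCk V 1 (O i). Proof. exact: (mCk_OM c oV i gC EC). Qed.
Let O0 i : mCk V 0 (O i). Proof. by apply: mCk_le (OC i). Qed.
Arguments O0 : clear implicits.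

Lemma rhoC : Ck 1 V rho.
Proof. by apply: (Ck_inv oV) => [y Vy|]; [rewrite gt_eqF // Ed|exact: Ck_det]. Qed.
Let rho0 : Ck 0 V rho. Proof. by apply: Ck_le rhoC. Qed.

Lemma rho_gt0 x : V x -> 0 < rho x. Proof. by move=> Vx; rewrite invr_gt0 Ed. Qed.

Lemma rho_per : per rho. Proof. by move=> x j Ox j1; rewrite /rhoE Ep. Qed.

Lemma O_per i : per (O i).
Proof.
move=> x j Ox j1; rewrite /OM /om /GM (Ep Ox j1) (gp Ox j1) (per_mpd i oV OV E1 Ep Ox j1).
suff -> : KM g i (x + 'e_j) = KM g i x by [].
apply/matrixP => l p; rewrite !mxE.
have pp a b q : pd q (fun y => g y a b) (x + 'e_j) = pd q (fun y => g y a b) x.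
  have gab : per (fun y => g y a b) by move=> y j' Oy j'1; rewrite gp.
  exact: (per_pd q oV OV (g1 a b) gab Ox j1).
by rewrite !pp.
Qed.

(** The orthonormality of the frame can be differentiated only on an open set; the result in the
    interior extends to the boundary by continuity. *)
Lemma O_skew i x : Om x -> (O i x)^T = - O i x.
Proof.
move=> Ox; apply: (Om_meq OV (A := fun x => (O i x)^T) (B := fun x => - O i x) (mCkT oV (O0 i)) (mCkN oV (O0 i)) _ Ox) => y Ux.
by rewrite /OM (cl2T H) // (om_skew oU gU EU gsU EoU).
Qed.

Lemma O_J i x : O i x *m J = J *m O i x. Proof. exact: (cl2J H). Qed.

Lemma om_skew_Om i x : Om x -> (om g E i x)^T = - om g E i x.
Proof.
have wC : mCk V 0 (om g E i) by apply: mCk_le (mCk_om oV i gC EC).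
move=> Ox; apply: (Om_meq OV (A := fun x => (om g E i x)^T) (B := fun x => - om g E i x) (mCkT oV wC) (mCkN oV wC) _ Ox) => y Ux.
exact: (om_skew oU gU EU gsU EoU).
Qed.

Let ceC i : mCk V 1 (ce c E i). Proof. exact: mCk_ce. Qed.
Let ceC0 i : mCk V 0 (ce c E i). Proof. exact: mCk_ce. Qed.
Let ScC i j : mCk V 1 (Sc c E i j). Proof. exact: mCk_Sc. Qed.
Let ScC0 i j : mCk V 0 (Sc c E i j). Proof. exact: mCk_Sc. Qed.
Arguments ceC0 : clear implicits.
Arguments ScC0 : clear implicits.

Let ZSC j : mCk V 0 (ZS c E rho O j).
Proof.
apply: (mCk_sum oV) => i; apply: (mCkD oV).
  by apply: (mCk_mpd oV); apply: (mCkZ oV); [exact: rhoC|exact: ScC].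
by apply: (mCkZ oV) => //; apply: (mCkB oV); apply: (mCkM oV).
Qed.

Arguments ZSC : clear implicits.

Let ZcC : mCk V 0 (Zc c E rho O).
Proof.
apply: (mCk_sum oV) => i; apply: (mCkD oV).
  by apply: (mCk_mpd oV); apply: (mCkZ oV); [exact: rhoC|exact: ceC].
by apply: (mCkZ oV) => //; apply: (mCkB oV); apply: (mCkM oV).
Qed.

Lemma ZS0_Om j x : Om x -> ZS c E rho O j x = 0.
Proof.
move=> Ox; apply: (Om_meq OV (A := ZS c E rho O j) (B := fun=> 0) (ZSC j) (mCk_cst V 0 0) _ Ox) => y Uy.
exact: (ZS_eq0 H oU gU EU gsU EoU).
Qed.

Lemma Zc0_Om x : Om x -> Zc c E rho O x = 0.
Proof.
move=> Ox; apply: (Om_meq OV (A := Zc c E rho O) (B := fun=> 0) ZcC (mCk_cst V 0 0) _ Ox) => y Uy.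
exact: (Zc_eq0 H oU gU EU gsU EoU).
Qed.

Definition Cx x : 'M[R]_N := 2^-1 *: (\sum_i \sum_j Sc c E i j x *m curv O i j x).

Lemma CxC : mCk V 0 Cx.
Proof.
apply: (mCkZ oV); first exact: Ck_cst.
apply: (mCk_sum oV) => i; apply: (mCk_sum oV) => j; apply: (mCkM oV) => //.
apply: (mCkD oV); first by apply: (mCkB oV); apply: (mCk_mpd oV); exact: OC.
by apply: (mCkB oV); apply: (mCkM oV).
Qed.

Lemma CxT x : Om x -> (Cx x)^T = Cx x.
Proof.
move=> Ox; apply: (Om_meq OV (A := fun x => (Cx x)^T) (mCkT oV CxC) CxC _ Ox) => y Ux.
by rewrite /Cx (half_curv H oU gU EU gsU EoU) // tr_scalar_mx.
Qed.

(** For a fixed matrix M the left side is continuous in x, so it suffices to treat the interior,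
    where [Cx] is the scalar curvature divided by 4. *)
Lemma Cx_bound x (M : 'M[R]_N) : Om x -> 0 <= ip M (Cx x *m M) + n%:R * (n%:R - 1) / 4 * nsq M.
Proof.
move: x; apply: Om_closure => x Ox.
  have fC : Ck 0 V (fun x => ip M (Cx x *m M) + n%:R * (n%:R - 1) / 4 * nsq M).
    apply: (CkD oV (k := 0)); last exact: Ck_cst.
    by apply: (Ck_ip oV); [exact: mCk_cst|apply: (mCkM oV); [exact: CxC|exact: mCk_cst]].
  exact: (fC x (OV Ox)).
rewrite /Cx (half_curv H oU gU EU gsU EoU) // mul_scalar_mx ipZr -mulrDl mulr_ge0 ?ip_ge0 //.
by have := sc (UO Ox); lra.
Qed.

Let dirC psi : mCk V 1 psi -> mCk V 0 (dirac_op c E O psi).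
Proof. by move=> pC; apply: (mCk_sum oV) => i; apply: (mCkM oV) => //; exact: (mCk_nab oV). Qed.

Let frC psi a : mCk V 1 psi -> mCk V 0 (framed E O a psi).
Proof. by move=> pC; apply: (mCk_sum oV) => i; apply: (mCkZ oV); [exact: E0|exact: (mCk_nab oV)]. Qed.

Arguments frC {psi} a _.

Lemma dirac_identity_spin psi chi : mCk V 1 psi -> mCk V 2 chi -> per psi -> per chi ->
  IO (fun x => rho x * (\sum_a ip (framed E O a psi x) (framed E O a chi x) -
      ip (dirac_op c E O psi x) (dirac_op c E O chi x) + ip (psi x) (Cx x *m chi x))) =
  IBd (fun x => ip (psi x) (flux c E rho O chi x)).
Proof.
move=> p1 c2 pp cp; have c1 : mCk V 1 chi by apply: mCk_le c2.
have p0 : mCk V 0 psi by apply: mCk_le p1.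
have c0 : mCk V 0 chi by apply: mCk_le c2.
rewrite -(dirac_identity H oV OV E1 rhoC OC Ep rho_per O_per O_skew p1 c2 pp cp).
have sC : Ck 0 V (fun x => \sum_a ip (framed E O a psi x) (framed E O a chi x) - ip (dirac_op c E O psi x) (dirac_op c E O chi x)).
  apply: (CkB oV (k := 0)); last exact: (Ck_ip oV (dirC p1) (dirC c1)).
  by apply: (Ck_sum oV) => a; exact: (Ck_ip oV (frC a p1) (frC a c1)).
have CC := Ck_ip oV p0 (mCkM oV CxC c0).
apply: (IOeq OV).
- exact: (CkM oV rho0 (CkD oV sC CC)).
- apply: (CkD oV (k := 0)); last exact: (CkM oV rho0 CC).
  apply: (CkD oV (k := 0)); first exact: (CkM oV rho0 sC).
  by apply: (Ck_ip oV p0); apply: (mCk_sum oV) => j; exact: (mCkM oV (ZSC j) (mCk_nab oV (O0 j) c1)).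
move=> x Ox; rewrite [\sum_j _ *m _]big1 => [|j _]; last by rewrite ZS0_Om // mul0mx.
by rewrite ip0r addr0 -mulrDr.
Qed.

(** Both sides equal the same symmetric volume integral. This moves the derivative in the cross
    terms from the unknown correction to the explicit boundary spinor. *)
Lemma flux_sym psi chi : mCk V 2 psi -> mCk V 2 chi -> per psi -> per chi ->
  IBd (fun x => ip (psi x) (flux c E rho O chi x)) = IBd (fun x => ip (chi x) (flux c E rho O psi x)).
Proof.
move=> p2 c2 pp cp; have c1 : mCk V 1 chi by apply: mCk_le c2.
have p1 : mCk V 1 psi by apply: mCk_le p2.
have p0 : mCk V 0 psi by apply: mCk_le p1.
have c0 : mCk V 0 chi by apply: mCk_le c2.
rewrite -!dirac_identity_spin //.
have gC' f h : mCk V 1 f -> mCk V 1 h -> Ck 0 V (fun x => rho x * (\sum_a ip (framed E O a f x) (framed E O a h x) -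
      ip (dirac_op c E O f x) (dirac_op c E O h x) + ip (f x) (Cx x *m h x))).
  move=> f1 h1; apply: (CkM oV rho0); apply: (CkD oV (k := 0)).
    apply: (CkB oV (k := 0)); last exact: (Ck_ip oV (dirC f1) (dirC h1)).
    by apply: (Ck_sum oV) => a; exact: (Ck_ip oV (frC a f1) (frC a h1)).
  by apply: (Ck_ip oV); [apply: mCk_le f1|apply: (mCkM oV CxC); apply: mCk_le h1].
apply: (IOeq OV); [exact: gC'|exact: gC'|].
move=> x Ox; congr (_ * (_ - _ + _)); [by apply: eq_bigr => a _; exact: ipC|exact: ipC|].
by rewrite ip_adjr CxT // ipC.
Qed.

Let nceC : mCk V 0 (nce c E).
Proof. exact: (mCkD oV (mCkZ oV (Ck_coord V 0 _) (ceC0 _)) (mCkZ oV (Ck_coord V 0 _) (ceC0 _))). Qed.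

Lemma diracJ_identity_spin psi : mCk V 1 psi -> per psi ->
  2 * IO (fun x => rho x * ip (dirac_op c E O psi x) (J *m psi x)) =
  - IBd (fun x => rho x * ip (psi x) (nce c E x *m (J *m psi x))).
Proof.
move=> p1 pp; have p0 : mCk V 0 psi by apply: mCk_le p1.
have JC := mCkM oV (mCk_cst V 0 J) p0.
have tC := CkM oV rho0 (Ck_ip oV (dirC p1) JC).
have bC := CkM oV rho0 (Ck_ip oV p0 (mCkM oV nceC JC)).
rewrite -mulN1r -(IBZ OV (- 1) bC) -(IOZ OV 2 tC).
have -> : (fun x => - 1 * (rho x * ip (psi x) (nce c E x *m (J *m psi x)))) =
    fun x => - (rho x * ip (psi x) ((x 0 ord0 *: ce c E ord0 x + x 0 o1 *: ce c E o1 x) *m (J *m psi x))).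
  by apply/funext => x; rewrite mulN1r.
rewrite -(diracJ_identity H oV OV E1 rhoC OC Ep rho_per O_skew (fun i x _ => O_J i x) p1 pp).
apply: (IOeq OV).
- exact: (CkM oV (Ck_cst V 0 2) tC).
- exact: (CkB oV (CkM oV (Ck_cst V 0 2) tC) (Ck_ip oV p0 (mCkM oV ZcC JC))).
by move=> x Ox; rewrite Zc0_Om // mul0mx ip0r subr0.
Qed.

(* The zeroth order part of the Dirac operator. *)
Definition Bop x : 'M[R]_N := \sum_i ce c E i x *m O i x.

Lemma BopC : mCk V 0 Bop.
Proof. by apply: (mCk_sum oV) => i; apply: (mCkM oV). Qed.

Lemma Bop_per : per Bop.
Proof. by move=> x j Ox j1; apply: eq_bigr => i _; rewrite O_per // (per_ce c Ep). Qed.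

Lemma opA_dirac L psi x : opA c J E Bop L psi x = dirac_op c E O psi x - L *: (J *m psi x).
Proof.
rewrite /opA /D0 /Bop mulmx_suml -big_split; congr (_ - _).
by apply: eq_bigr => i _; rewrite /nab mulmxDr mulmxA.
Qed.

(** Half the coefficient of <D psi, J psi> that remains after completing the square: 2 L from D - L
    J, reduced by 2 L / n from the modified connection. *)
Definition lam (L : R) := L * (1 - n%:R^-1).

(* Sum of squares of the modified connection nab_a + (L/n) c_a J. *)
Let completing_square L psi x :
  \sum_a nsq (framed E O a psi x + (L / n%:R) *: (c a *m (J *m psi x))) - nsq (opA c J E Bop L psi x) + L * lam L * nsq (psi x) =
  \sum_a nsq (framed E O a psi x) - nsq (dirac_op c E O psi x) + 2 * lam L * ip (dirac_op c E O psi x) (J *m psi x).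
Proof.
rewrite opA_dirac.
have n0 : (n%:R : R) != 0 by rewrite pnatr_eq0.
have JJ : nsq (J *m psi x) = nsq (psi x) by rewrite ip_adjl (J_sym H) mulmxA (J_sq H) mul1mx.
have sq a : nsq (framed E O a psi x + (L / n%:R) *: (c a *m (J *m psi x))) = nsq (framed E O a psi x) -
    2 * (L / n%:R) * ip (c a *m framed E O a psi x) (J *m psi x) + (L / n%:R) ^+ 2 * nsq (psi x).
  rewrite ipDl !ipDr !ipZl !ipZr (nsq_c H) JJ (ipC (c a *m _) (framed _ _ _ _ _)).
  have -> : ip (framed E O a psi x) (c a *m (J *m psi x)) = - ip (c a *m framed E O a psi x) (J *m psi x).
    by rewrite ip_adjr (cl_skew H) mulNmx ipNl.
  by ring.
rewrite (eq_bigr _ (fun a _ => sq a)) big_split sumrB /= sumr_const card_ord -mulr_sumr -ip_suml.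
have -> : \sum_a c a *m framed E O a psi x = dirac_op c E O psi x.
  rewrite /dirac_op /framed (eq_bigr (fun a => \sum_i E x a i *: c a *m nab O i psi x)) => [|a _].
    by rewrite exchange_big; apply: eq_bigr => i _; rewrite ceE mulmx_suml.
  by rewrite mulmx_sumr; apply: eq_bigr => i _; rewrite -scalemxAl -scalemxAr.
rewrite ipBl !ipBr !ipZl !ipZr JJ (ipC (J *m _) (dirac_op _ _ _ _ _)) -[_ *+ n]mulr_natl /lam.
move: (\sum_a _) => S.
by field.
Qed.

Lemma lichnerowicz L psi : mCk V 2 psi -> per psi ->
  IO (fun x => rho x * (\sum_a nsq (framed E O a psi x + (L / n%:R) *: (c a *m (J *m psi x))) +
     (L * lam L * nsq (psi x) + ip (psi x) (Cx x *m psi x)))) =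
  IO (fun x => rho x * nsq (opA c J E Bop L psi x)) + IBd (fun x => ip (psi x) (flux c E rho O psi x)) -
  lam L * IBd (fun x => rho x * ip (psi x) (nce c E x *m (J *m psi x))).
Proof.
move=> p2 pp; have p1 : mCk V 1 psi by apply: mCk_le p2.
have p0 : mCk V 0 psi by apply: mCk_le p1.
have JC := mCkM oV (mCk_cst V 0 J) p0.
have tC := CkM oV rho0 (Ck_ip oV (dirC p1) JC).
have [AC _] := @opA_cC R k N V oV OV c J E Bop L psi E0 Ep BopC Bop_per p2 pp.
have aC := CkM oV rho0 (Ck_nsq oV AC).
have sC : Ck 0 V (fun x => rho x * (\sum_a ip (framed E O a psi x) (framed E O a psi x) - ip (dirac_op c E O psi x) (dirac_op c E O psi x) + ip (psi x) (Cx x *m psi x))).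
  apply: (CkM oV rho0); apply: (CkD oV (k := 0)).
    apply: (CkB oV (k := 0)); last exact: (Ck_ip oV (dirC p1) (dirC p1)).
    by apply: (Ck_sum oV) => a; exact: (Ck_ip oV (frC a p1) (frC a p1)).
  exact: (Ck_ip oV p0 (mCkM oV CxC p0)).
have -> : - (lam L * IBd (fun x => rho x * ip (psi x) (nce c E x *m (J *m psi x)))) =
   IO (fun x => 2 * lam L * (rho x * ip (dirac_op c E O psi x) (J *m psi x))).
  by rewrite (IOZ OV _ tC) [2 * lam L]mulrC -[RHS]mulrA diracJ_identity_spin // mulrN.
rewrite -dirac_identity_spin // -(IOD OV aC sC).
have lC := CkM oV (Ck_cst V 0 (2 * lam L)) tC.
rewrite -(IOD OV (CkD oV aC sC) lC); congr IO; apply/funext => x.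
have gen (r X Y Z D I C q l : R) : X - Z + q = Y - D + l * I ->
    r * (X + (q + C)) = r * Z + r * (Y - D + C) + l * (r * I).
  move=> e; have -> : X = Y - D + l * I + Z - q by lra.
  by ring.
exact: (gen _ _ _ _ _ _ _ _ _ (completing_square L psi x)).
Qed.

(** L lam(L) = L^2 (1 - 1/n) equals n(n-1)/4 at L = n/2. At L = n it is four times as large, and the
    surplus is at least 1 since n >= 2. *)
Lemma lam_bound L : n%:R <= L -> n%:R * (n%:R - 1) / 4 + 1 <= L * lam L.
Proof.
move=> Ln; have n2 : 2 <= (n%:R : R) by rewrite ler_nat.
have n0 : (n%:R : R) != 0 by rewrite pnatr_eq0.
have i1 : 0 <= 1 - (n%:R : R)^-1 by rewrite subr_ge0 invf_le1; lra.
apply: (@le_trans _ _ (n%:R * (n%:R * (1 - n%:R^-1)))).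
  have -> : n%:R * (n%:R * (1 - n%:R^-1)) = n%:R * (n%:R - 1) :> R by rewrite mulrBr mulr1 mulfV.
  have : 2 * (2 - 1) <= n%:R * (n%:R - 1) :> R by apply: ler_pM => //; lra.
  lra.
have nn0 : 0 <= (n%:R : R) by lra.
rewrite /lam; apply: ler_pM; [exact: nn0|exact: mulr_ge0|exact: Ln|exact: ler_wpM2r].
Qed.

Lemma lichnerowicz_le L psi : n%:R <= L -> mCk V 2 psi -> per psi ->
  IO (fun x => rho x * nsq (psi x)) <=
  IO (fun x => rho x * nsq (opA c J E Bop L psi x)) + IBd (fun x => ip (psi x) (flux c E rho O psi x)) -
  lam L * IBd (fun x => rho x * ip (psi x) (nce c E x *m (J *m psi x))).
Proof.
move=> Ln p2 pp; rewrite -lichnerowicz //.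
have p1 : mCk V 1 psi by apply: mCk_le p2.
have p0 : mCk V 0 psi by apply: mCk_le p1.
have nC := Ck_nsq oV p0.
apply: (IOle OV).
- exact: (CkM oV rho0 nC).
- have JC := mCkM oV (mCk_cst V 0 J) p0.
  apply: (CkM oV rho0); apply: (CkD oV (k := 0)).
    apply: (Ck_sum oV) => a; apply: (Ck_nsq oV).
    exact: (mCkD oV (frC a p1) (mCkZ oV (Ck_cst V 0 (L / n%:R)) (mCkM oV (mCk_cst V 0 (c a)) JC))).
  exact: (CkD oV (CkM oV (Ck_cst V 0 (L * lam L)) nC) (Ck_ip oV p0 (mCkM oV CxC p0))).
move=> x Ox; apply: ler_wpM2l; first by apply: ltW; apply: rho_gt0; exact: OV.
have s0 : 0 <= \sum_a nsq (framed E O a psi x + (L / n%:R) *: (c a *m (J *m psi x))).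
  by apply: sumr_ge0 => a _; exact: ip_ge0.
have h1 := Cx_bound (psi x) Ox.
have h2 : (n%:R * (n%:R - 1) / 4 + 1) * nsq (psi x) <= L * lam L * nsq (psi x).
  by apply: ler_wpM2r; [exact: ip_ge0|exact: lam_bound].
by move: s0 h1 h2; move: (\sum_a _) => X; lra.
Qed.

Lemma fluxD psi chi x : V x -> mCk V 1 psi -> mCk V 1 chi ->
  flux c E rho O (fun x => psi x + chi x) x = flux c E rho O psi x + flux c E rho O chi x.
Proof.
move=> Vx p1 c1; rewrite /flux -scalerDr -big_split; congr (_ *: _); apply: eq_bigr => j _ /=.
by rewrite -mulmxDr; congr (_ *m _); rewrite /nab (mpdD oV Vx) // mulmxDr addrACA.
Qed.

Lemma mCk_flux psi : mCk V 1 psi -> mCk V 0 (flux c E rho O psi).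
Proof.
move=> p1; apply: (mCkZ oV rho0); apply: (mCk_sum oV) => j; apply: (mCkM oV); last exact: (mCk_nab oV (O0 j) p1).
exact: (mCkD oV (mCkZ oV (Ck_coord V 0 _) (ScC0 _ _)) (mCkZ oV (Ck_coord V 0 _) (ScC0 _ _))).
Qed.

Hypothesis Ea : adapted E.
Hypothesis flux_le0 : forall psi p, mCk V 1 psi -> bdc c J psi -> ip (psi (bd_incl p)) (flux c E rho O psi (bd_incl p)) <= 0.

(** Both boundary terms have the good sign on spinors obeying the boundary condition, so the surplus
    in the zeroth order term bounds |psi|^2. The constant compares rho with the flat density only
    and serves all L >= n simultaneously. *)
Lemma spin_estimate : exists2 K, 0 <= K & forall L psi, n%:R <= L -> Sp c J V psi -> nf psi <= K * nf (opA c J E Bop L psi).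
Proof.
have iC : Ck 0 V (fun x => (rho x)^-1) by apply: (Ck_inv oV) => // y Vy; rewrite gt_eqF // rho_gt0.
have [C1 C10 H1] := bounded_K0 OV rho0; have [C2 C20 H2] := bounded_K0 OV iC.
exists (C2 * C1); first by rewrite mulr_ge0.
move=> L psi Ln [p2 pp bp].
have p1 : mCk V 1 psi by apply: mCk_le p2.
have p0 : mCk V 0 psi by apply: mCk_le p1.
have nC := Ck_nsq oV p0.
have [AC _] := @opA_cC R k N V oV OV c J E Bop L psi E0 Ep BopC Bop_per p2 pp.
have aC := Ck_nsq oV AC.
have c1 (a : R) : Ck 0 V (fun=> a) by exact: Ck_cst.
have h1 : nf psi <= C2 * IO (fun x => rho x * nsq (psi x)).
  rewrite -(IOZ OV C2 (CkM oV rho0 nC)); apply: (IOleK OV nC (CkM oV (c1 _) (CkM oV rho0 nC))).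
  move=> x Kx; rewrite mulrA -[leLHS]mul1r; apply: ler_wpM2r; first exact: ip_ge0.
  have r0 := rho_gt0 (OV (K0_Om Kx)).
  rewrite -ler_pdivrMr // mul1r; apply: le_trans (H2 x Kx); exact: ler_norm.
have h2 : IO (fun x => rho x * nsq (opA c J E Bop L psi x)) <= C1 * nf (opA c J E Bop L psi).
  rewrite -(IOZ OV C1 aC); apply: (IOleK OV (CkM oV rho0 aC) (CkM oV (c1 _) aC)).
  move=> x Kx; apply: ler_wpM2r; first exact: ip_ge0.
  by apply: le_trans (H1 x Kx); exact: ler_norm.
have h3 := lichnerowicz_le Ln p2 pp.
have h4 : IBd (fun x => ip (psi x) (flux c E rho O psi x)) <= 0.
  rewrite -(pf0 (@pf_IBd R k)); apply: (IBle OV (Ck_ip oV p0 (mCk_flux p1)) (c1 0)).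
  by move=> x [p _ <-]; exact: (flux_le0 p p1 bp).
have h5 : 0 <= lam L * IBd (fun x => rho x * ip (psi x) (nce c E x *m (J *m psi x))).
  have n2 : 2 <= (n%:R : R) by rewrite ler_nat.
  apply: mulr_ge0.
    by apply: mulr_ge0; [lra|rewrite subr_ge0 invf_le1; lra].
  apply: (IBge0 OV (CkM oV rho0 (Ck_ip oV p0 (mCkM oV nceC (mCkM oV (mCk_cst V 0 J) p0))))).
  move=> x [p _ <-]; have [l l0 El] := Ea p.
  rewrite (nce_bd c El) -scalemxAl mulmxA -[cl c _ *m J]/(beta c J (bd_incl p)) bp ipZr.
  apply: mulr_ge0; last by apply: mulr_ge0; [exact: ltW|exact: ip_ge0].
  by apply: ltW; apply: rho_gt0; apply: OV; exact: bd_Om.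
apply: (le_trans h1); rewrite -mulrA; apply: ler_wpM2l => //; lra.
Qed.

(** The operators along the decrease of L differ by multiples of J, which is an isometry; the L^2
    estimate suffices and no gradient has to be controlled. *)
Lemma spin_dense L0 : (forall L, L0 <= L -> dense_range (Sp c J V) (@cC R k N V) (opA c J E Bop L)) ->
  dense_range (Sp c J V) (@cC R k N V) (opA c J E Bop n%:R).
Proof.
move=> D; have [K K0 HK] := spin_estimate.
pose M := Num.max L0 n%:R; pose l (s : R) : R := (1 - s) * M + s * n%:R.
have Mn : n%:R <= M by rewrite le_max lexx orbT.
have ln s : 0 <= s <= 1 -> n%:R <= l s.
  move=> /andP[s0 s1]; have -> : l s = n%:R + (1 - s) * (M - n%:R) by rewrite /l; ring.
  by rewrite lerDl mulr_ge0 //; lra.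
pose P s := dense_range (Sp c J V) (@cC R k N V) (opA c J E Bop (l s)).
suff : P 1 by rewrite /P /l subrr mul0r add0r mul1r.
apply: (clopen_path (P := P)); last first.
  by rewrite /P /l subr0 mul1r mul0r addr0; apply: D; rewrite le_max lexx.
move=> s s01; pose d := (64 * (K * (M - n%:R) ^+ 2 + 1))^-1.
have KK : 0 <= K * (M - n%:R) ^+ 2 by rewrite mulr_ge0 // sqr_ge0.
have d0 : 0 < d by rewrite invr_gt0 mulr_gt0 //; lra.
exists (Num.min 1 d); first by rewrite lt_min ltr01.
move=> s' s'01; rewrite lt_min => /andP[s1 sd].
have ss : (s' - s) ^+ 2 <= d.
  rewrite -(real_normK (num_real _)) expr2; apply: (@le_trans _ _ `|s' - s|); last exact: ltW.
  by rewrite ler_piMl // ltW.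
have SC u psi : Sp c J V psi -> cC V (opA c J E Bop (l u) psi).
  by move=> [p2 pp _]; apply: (opA_cC oV OV) => //; [exact: BopC|exact: Bop_per].
apply: (@dense_iff R k N V oV OV (Sp c J V) (@cC R k N V) _ _ (@nf R k N) K ((s' - s) ^+ 2 * (M - n%:R) ^+ 2)).
- exact: Sp0.
- exact: (SpD oV).
- by move=> f [].
- by move=> f psi [fC fp] /(SC s)[aC ap]; split; [exact: (mCkB oV)|move=> x j Ox j1; rewrite fp // ap].
- by move=> f psi [fC fp] /(SC s')[aC ap]; split; [exact: (mCkB oV)|move=> x j Ox j1; rewrite fp // ap].
- by move=> psi /(SC s)[].
- by move=> psi /(SC s')[].
- by move=> psi chi x [p2 _ _] [q2 _ _]; apply: (opAD oV OV); [apply: mCk_le p2|apply: mCk_le q2].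
- by move=> psi chi x [p2 _ _] [q2 _ _]; apply: (opAD oV OV); [apply: mCk_le p2|apply: mCk_le q2].
- exact: K0.
- by rewrite mulr_ge0 // sqr_ge0.
- have e1 : 64 * (K * (M - n%:R) ^+ 2 + 1) * d = 1 by rewrite /d mulfV // gt_eqF // mulr_gt0 //; lra.
  have e2 : (s' - s) ^+ 2 * (K * (M - n%:R) ^+ 2) <= d * (K * (M - n%:R) ^+ 2) by exact: ler_wpM2r.
  have e3 : K * ((s' - s) ^+ 2 * (M - n%:R) ^+ 2) = (s' - s) ^+ 2 * (K * (M - n%:R) ^+ 2) by ring.
  have e4 : 64 * (K * (M - n%:R) ^+ 2 + 1) * d = 64 * (d * (K * (M - n%:R) ^+ 2)) + 64 * d by ring.
  rewrite e3; lra.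
- by move=> psi [p2 _ _]; apply: (nf_ge0 oV OV); apply: mCk_le p2.
- by move=> psi Sps; apply: HK => //; exact: ln.
- move=> psi [p2 _ _]; have p0 : mCk V 0 psi by apply: mCk_le p2.
  have JC := mCkM oV (mCk_cst V 0 J) p0.
  have -> : (fun x => opA c J E Bop (l s') psi x - opA c J E Bop (l s) psi x) = fun x => ((s' - s) * (M - n%:R)) *: (J *m psi x).
    have gen (r r' : R) (X Y : 'M[R]_N) : X - r' *: Y - (X - r *: Y) = (r - r') *: Y.
      by apply/matrixP => a b; rewrite !mxE; ring.
    by apply/funext => x; rewrite /opA gen /l; congr (_ *: _); ring.
  rewrite (nfZ oV OV _ JC) exprMn le_eqVlt; apply/orP; left; apply/eqP; congr (_ * _).
  by rewrite /nf; congr IO; apply/funext => x; rewrite ip_adjl (J_sym H) mulmxA (J_sq H) mul1mx.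
Qed.

End Lichnerowicz.

(** The Jacobian has the expected entries only where f is differentiable, which is deduced here from
    C^1 components. *)
Lemma jac_entry (R : realType) m q (f : 'rV[R]_m -> 'rV[R]_q) p a i :
  (forall i, Ck 1 setT (fun y => f y 0 i)) -> 'J f p a i = pd a (fun y => f y 0 i) p.
Proof.
move=> fC; have df : differentiable f p.
  have -> : f = \sum_(i < q) (fun y => f y 0 i *: 'e_i).
    by apply/funext => y; rewrite fct_sumE; exact: row_sum_delta.
  apply: differentiable_sum => j; apply: differentiableZl.
  by have [] := C1_differentiable openT (fC j) (I : setT p).
have h : 'D_('e_a) f p = 'e_a *m 'J f p by exact: deriveEjacobian.
have e : 'J f p a i = (row a ('J f p)) 0 i by rewrite [RHS]mxE.
by rewrite e rowE -h derive_mx ?mxE ?pdE //; exact: diff_derivable.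
Qed.

(** * Geometry of the boundary *)

Section BoundaryTangent.
Variables (R : realType) (k : nat).
Local Notation n := k.+2.
Local Notation Om := (@solid_torus R k).
Local Notation o1 := (lift ord0 ord0).
Local Notation l2 j := (lift ord0 (lift ord0 j)).
Implicit Types (p : 'rV[R]_k.+1) (a b : 'I_k.+1).

(** The rows are the coordinate tangent vectors of the boundary. They are orthonormal for the
    Euclidean metric and together with the flat normal form an orthogonal matrix, which makes
    tangential projection a multiplication by P^T P. *)
Definition bdP p : 'M[R]_(k.+1, n) := \matrix_(a, i)
  (if i == ord0 then (a == ord0)%:R * - sin (p 0 0)
   else if i == o1 then (a == ord0)%:R * cos (p 0 0) else (lift ord0 a == i)%:R).

Lemma row_bdP0 p : row ord0 (bdP p) = tau (bd_incl p).
Proof.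
have tE (x : 'rV[R]_n) (a : 'I_n) : tau x 0 a = if a == ord0 then - x 0 o1 else if a == o1 then x 0 ord0 else 0.
  rewrite !mxE /=; have [->|a0] := eqVneq a ord0; first by rewrite mulr1 mulr0 addr0.
  by case: eqP => _; rewrite ?mulr1 ?mulr0 ?addr0 ?add0r.
apply/rowP => i; rewrite tE !mxE /= !mul1r; case: (lift2E i) => [->|->|[j ->]] //=.
Qed.

Lemma row_bdPS p j : row (lift ord0 j) (bdP p) = 'e_(l2 j).
Proof.
apply/rowP => i; rewrite !mxE /=; case: (lift2E i) => [->|->|[j' ->]] /=; rewrite ?mul0r //.
by rewrite eq_sym !(inj_eq lift_inj).
Qed.

Lemma bdP_n p : bdP p *m (nn (bd_incl p))^T = 0.
Proof.
apply/row_matrixP => a; rewrite row_mul row0; apply/matrixP => i j; rewrite !ord1 [RHS]mxE.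
have [b ->|->] := unliftP ord0 a; last first.
  set x := bd_incl p; have e : tau x *m (nn x)^T = (nn x *m (tau x)^T)^T by rewrite trmx_mul trmxK.
  by rewrite row_bdP0 -/x e mxE nn_tau.
by rewrite row_bdPS -rowE mxE mxE nnE.
Qed.

Lemma bdP_orth p : bdP p *m (bdP p)^T = 1%:M.
Proof.
apply/matrixP => a b.
have e : (bdP p *m (bdP p)^T) a b = (row a (bdP p) *m (row b (bdP p))^T) 0 0.
  by rewrite !mxE; apply: eq_bigr => i _; rewrite !mxE.
rewrite e [RHS]mxE; have [a' ->|->] := unliftP ord0 a; have [b' ->|->] := unliftP ord0 b.
- by rewrite !row_bdPS -rowE !mxE eqxx /= !(inj_eq lift_inj).
- by rewrite row_bdPS row_bdP0 -rowE !mxE /= !mulr0 addr0.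
- by rewrite row_bdPS row_bdP0 -[_ *m _]trmxK trmx_mul trmxK -rowE !mxE /= !mulr0 addr0.
- by rewrite row_bdP0 tau_sq eqxx.
Qed.

Lemma nn_unit p : nn (bd_incl p) *m (nn (bd_incl p))^T = 1%:M.
Proof. by apply/matrixP => i j; rewrite !ord1 nn_sq bd_circle mxE eqxx. Qed.

Lemma bdP_complete p : (bdP p)^T *m bdP p + (nn (bd_incl p))^T *m nn (bd_incl p) = 1%:M.
Proof.
pose Q : 'M[R]_(1 + k.+1, n) := col_mx (nn (bd_incl p)) (bdP p).
have QQ : Q *m Q^T = 1%:M.
  rewrite /Q tr_col_mx mul_col_row bdP_orth nn_unit bdP_n.
  have -> : nn (bd_incl p) *m (bdP p)^T = 0 by rewrite -[LHS]trmxK trmx_mul trmxK bdP_n trmx0.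
  by rewrite -scalar_mx_block.
have QT : Q^T *m Q = 1%:M by exact: (@mulmx1C _ n Q Q^T QQ).
by rewrite -QT /Q tr_col_mx mul_row_col addrC.
Qed.

Lemma mCk_bdP q : mCk setT q bdP.
Proof.
move=> b i; have [cc cs] := Ck_cos_sin openT (Ck_coord (setT : set 'rV[R]_k.+1) q 0).
rewrite (_ : (fun p => bdP p b i) = fun p => (if i == ord0 then (b == ord0)%:R * - sin (p 0 0)
   else if i == o1 then (b == ord0)%:R * cos (p 0 0) else (lift ord0 b == i)%:R)); last by apply/funext => z; rewrite mxE.
case: (i == ord0); first exact: (CkM openT (Ck_cst setT q _) (CkN openT cs)).
by case: (i == o1); [exact: (CkM openT (Ck_cst setT q _) cc)|exact: Ck_cst].
Qed.

Lemma bd_tangentE a p : bd_tangent a p = row a (bdP p).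
Proof.
have bC i : Ck 1 setT (fun q => @bd_incl R k q 0 i).
  split=> [q _|b].
    split.
      by apply: (continuous_comp (f := @bd_incl R k) (g := fun x : 'rV[R]_n => x 0 i)); [exact: bd_incl_cont|exact: coord_continuous].
    by move=> b; have [] := is_derive_bd q b i.
  rewrite (_ : pd b _ = fun q => bdP q b i); last first.
    by apply/funext => q; rewrite (pd_val (is_derive_bd q b i)) mxE.
  exact: (mCk_bdP 0 b i).
by apply/rowP => i; rewrite /bd_tangent [LHS]mxE (jac_entry p a i bC) (pd_val (is_derive_bd p a i)) !mxE.
Qed.

Section Restriction.
Variables (V : set 'rV[R]_n) (oV : open V) (OV : Om `<=` V).

Lemma pd_bd (f : 'rV[R]_n -> R) p a : Ck 1 V f ->
  pd a (fun p => f (bd_incl p)) p = \sum_i bdP p a i * pd i f (bd_incl p).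
Proof.
move=> fC; rewrite (pd_val (is_derive_on_bd oV OV p a fC)).
by apply: eq_bigr => i _; rewrite mxE.
Qed.

Lemma Ck_bd q (f : 'rV[R]_n -> R) : Ck q V f -> Ck q setT (fun p => f (bd_incl p)).
Proof.
elim: q f => [|q IH] f fC.
  move=> p _; apply: (continuous_comp (f := @bd_incl R k) (g := f)); first exact: bd_incl_cont.
  by apply: fC; apply: OV; exact: bd_Om.
have f1 : Ck 1 V f by apply: Ck_le fC.
split=> [p _|a].
  split.
    apply: (continuous_comp (f := @bd_incl R k) (g := f)); first exact: bd_incl_cont.
    by apply: (Ck_cont fC); apply: OV; exact: bd_Om.
  by move=> a; have [] := is_derive_on_bd oV OV p a f1.
rewrite (_ : pd a _ = fun p => \sum_i bdP p a i * pd i f (bd_incl p)); last by apply/funext => p; exact: pd_bd.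
apply: (Ck_sum openT) => i; apply: (CkM openT); first exact: mCk_bdP.
by apply: IH; exact: Ck_partial.
Qed.

Lemma mCk_bd q r s (A : 'rV[R]_n -> 'M[R]_(r, s)) : mCk V q A -> mCk setT q (fun p => A (bd_incl p)).
Proof. by move=> AC a b; exact: (Ck_bd (AC a b)). Qed.

Lemma mpd_bd r s (A : 'rV[R]_n -> 'M[R]_(r, s)) p a : mCk V 1 A ->
  mpd a (fun p => A (bd_incl p)) p = \sum_i bdP p a i *: mpd i A (bd_incl p).
Proof.
move=> AC; apply/matrixP => b d; rewrite mpdE (pd_bd p a (AC b d)) summxE.
by apply: eq_bigr => i _; rewrite [RHS]mxE mpdE.
Qed.

End Restriction.

Let TT (m : nat) (p : 'rV[R]_m) : setT p. Proof. by []. Qed.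

Lemma mpd_bdP_sym a b p i : mpd a bdP p b i = mpd b bdP p a i.
Proof.
have bC : Ck 2 setT (fun q => @bd_incl R k q 0 i).
  exact: (Ck_bd openT (fun x _ => I) (Ck_coord setT 2 i)).
have e b' : (fun q => bdP q b' i) = pd b' (fun q => bd_incl q 0 i).
  by apply/funext => q; rewrite (pd_val (is_derive_bd q b' i)) mxE.
rewrite !mpdE (e b) (e a); exact: (partial_sym a b openT bC (TT p)).
Qed.

(** These are the Christoffel symbols of the flat metric that the Euclidean one induces: symmetric
    in the first two indices, skew in the last two because P P^T = 1, hence zero. *)
Lemma mpd_bdP_tan a p : mpd a bdP p *m (bdP p)^T = 0.
Proof.
have bC := mCk_bdP 1.
pose X a b d := (mpd a bdP p *m (bdP p)^T) b d.
have s1 u v w : X u v w = X v u w.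
  by rewrite /X !mxE; apply: eq_bigr => i _; rewrite mpd_bdP_sym.
have s2 u v w : X u v w = - X u w v.
  have : mpd u (fun q => bdP q *m (bdP q)^T) p = 0.
    rewrite (_ : (fun q => _) = fun=> 1%:M) ?mpd_cst //; apply/funext => q; exact: bdP_orth.
  rewrite (mpdM openT (TT p) u bC (mCkT openT bC)) (mpdT openT (TT p)) => /matrixP /(_ v w).
  rewrite [LHS]mxE [X in _ = X]mxE -/(X u v w) => /eqP; rewrite addr_eq0 => /eqP ->; congr (- _).
  by rewrite /X !mxE; apply: eq_bigr => i _; rewrite !mxE mulrC.
apply/matrixP => v w; rewrite [RHS]mxE -/(X a v w).
have e : X a v w = - X a v w.
  by rewrite {1}s1 s2 s1 s2 opprK s1 s2.
lra.
Qed.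

End BoundaryTangent.

(** * Induced metric, boundary frame and mean curvature *)

Section BoundaryGeometry.
Variables (R : realType) (k : nat).
Local Notation n := k.+2.
Local Notation Om := (@solid_torus R k).
Local Notation o1 := (lift ord0 ord0).
Local Notation l2 j := (lift ord0 (lift ord0 j)).
Implicit Types (p : 'rV[R]_k.+1) (a b : 'I_k.+1).
Variables (V : set 'rV[R]_n) (oV : open V) (OV : Om `<=` V).
Variables (g E : 'rV[R]_n -> 'M[R]_n).
Hypotheses (gC : mCk V 2 g) (EC : mCk V 2 E).
Hypotheses (gpd : forall x, Om x -> posdefmx (g x)).
Hypothesis Eo : forall x, Om x -> E x *m g x *m (E x)^T = 1%:M.
Hypothesis Ed : forall x, Om x -> 0 < \det (E x).
Hypothesis Ea : adapted E.
Hypothesis Elow : forall p (j : 'I_k) (i : 'I_n), (i < l2 j)%N -> E (bd_incl p) (l2 j) i = 0.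
Hypothesis Edg : forall p (j : 'I_k), 0 < E (bd_incl p) (l2 j) (l2 j).

Let TT p : setT p. Proof. by []. Qed.
Let g1 : mCk V 1 g. Proof. exact: mCk_le gC. Qed.
Let E1 : mCk V 1 E. Proof. exact: mCk_le EC. Qed.

(* The frame of the boundary, which equals [Fr (gm p)], hence depends on the boundary
   metric only. *)
Definition Fb p := bdP p *m E (bd_incl p) *m (bdP p)^T.
Definition gm p := bdP p *m g (bd_incl p) *m (bdP p)^T.

Lemma PE_FP p : bdP p *m E (bd_incl p) = Fb p *m bdP p.
Proof.
have [l _ El] := Ea p.
rewrite -[LHS]mulmx1 -(bdP_complete p) mulmxDr !mulmxA -/(Fb p).
rewrite -[bdP p *m E _ *m (nn _)^T]mulmxA El -scalemxAr bdP_n scaler0 mul0mx addr0 //.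
Qed.

Lemma det_frame p l : E (bd_incl p) *m (nn (bd_incl p))^T = l *: (nn (bd_incl p))^T ->
  \det (E (bd_incl p)) = l * \det (Fb p).
Proof.
move=> El; pose Q : 'M[R]_(1 + k.+1, n) := col_mx (nn (bd_incl p)) (bdP p).
have QQ : Q *m Q^T = 1%:M.
  rewrite /Q tr_col_mx mul_col_row bdP_orth nn_unit bdP_n.
  have -> : nn (bd_incl p) *m (bdP p)^T = 0 by rewrite -[LHS]trmxK trmx_mul trmxK bdP_n trmx0.
  by rewrite -scalar_mx_block.
pose Q' : 'M[R]_n := Q.
have d1 : \det Q' * \det Q'^T = 1 by rewrite -det_mulmx [Q' *m _]QQ det1.
transitivity (\det (Q' *m E (bd_incl p) *m Q'^T)); first by rewrite !det_mulmx mulrAC d1 mul1r.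
have e : Q *m E (bd_incl p) *m Q^T = block_mx (l%:M) (nn (bd_incl p) *m E (bd_incl p) *m (bdP p)^T) 0 (Fb p).
  rewrite /Q tr_col_mx mul_col_mx mul_col_row; congr block_mx.
    by rewrite -mulmxA El -scalemxAr nn_unit scalemx1.
  by rewrite -mulmxA El -scalemxAr bdP_n scaler0.
have -> : Q' *m E (bd_incl p) *m Q'^T = block_mx (l%:M) (nn (bd_incl p) *m E (bd_incl p) *m (bdP p)^T) 0 (Fb p) :> 'M[R]_(1 + k.+1) by exact: e.
have d : \det (block_mx l%:M (nn (bd_incl p) *m E (bd_incl p) *m (bdP p)^T) 0 (Fb p)) = l * \det (Fb p).
  by rewrite det_ublock det_scalar1.
exact: d.
Qed.

(** The last rows are inherited from the triangular part of E. The sign of the first diagonal entry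
    is not visible in E; positivity of det E and of l forces it. *)
Lemma Fb_upper p : upper_tri (Fb p).
Proof.
have low (j : 'I_k) b : Fb p (lift ord0 j) b = (E (bd_incl p) *m (bdP p)^T) (l2 j) b.
  have -> : Fb p (lift ord0 j) b = row (lift ord0 j) (Fb p) 0 b by rewrite [RHS]mxE.
  by rewrite /Fb -mulmxA row_mul row_bdPS -rowE mxE.
have lowE (j : 'I_k) (b : 'I_k) : Fb p (lift ord0 j) (lift ord0 b) = E (bd_incl p) (l2 j) (l2 b).
  rewrite low mxE (eq_bigr (fun i => E (bd_incl p) (l2 j) i * (row (lift ord0 b) (bdP p)) 0 i)) => [|i _]; last by rewrite !mxE.
  rewrite row_bdPS (bigD1 (l2 b)) //= mxE !eqxx mulr1 big1 ?addr0 // => i ib.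
  by rewrite mxE (negPf ib) andbF mulr0.
have low0 (j : 'I_k) : Fb p (lift ord0 j) ord0 = 0.
  rewrite low mxE (eq_bigr (fun i => E (bd_incl p) (l2 j) i * (row ord0 (bdP p)) 0 i)) => [|i _]; last by rewrite !mxE.
  rewrite row_bdP0 big_ord_n !Elow // !mul0r !add0r big1 // => b _.
  by rewrite !mxE /= !mulr0 addr0 mulr0.
have tri (i j : 'I_k.+1) : (j < i)%N -> Fb p i j = 0.
  have [i' ->|->] := unliftP ord0 i => //; have [j' ->|->] := unliftP ord0 j => // ij.
  by rewrite lowE Elow.
split=> // i; have [i' ->|->] := unliftP ord0 i; first by rewrite lowE.
have [l l0 El] := Ea p.
have dF : 0 < \det (Fb p).
  by have := Ed (bd_Om p); rewrite (det_frame El) pmulr_rgt0.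
move: dF; rewrite -det_tr det_trig; last by apply/is_trig_mxP => i' j ij; rewrite mxE tri.
rewrite big_ord_recl mxE pmulr_lgt0 //; apply: prodr_gt0 => j _; by rewrite mxE lowE.
Qed.

Lemma gm_posdef p : posdefmx (gm p).
Proof.
have [sg pg] := gpd (bd_Om p); split; first by rewrite /gm !trmx_mul trmxK sg mulmxA.
move=> v v0; have vP : v *m bdP p != 0.
  apply/eqP => vP; move/eqP: v0; apply; by rewrite -[v]mulmx1 -(bdP_orth p) mulmxA vP mul0mx.
by have := pg _ vP; rewrite trmx_mul /gm !mulmxA.
Qed.

Lemma Fb_orth p : Fb p *m gm p *m (Fb p)^T = 1%:M.
Proof.
have -> : Fb p *m gm p *m (Fb p)^T = (Fb p *m bdP p) *m g (bd_incl p) *m (Fb p *m bdP p)^T.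
  by rewrite /gm (trmx_mul (Fb p)) !mulmxA.
rewrite -PE_FP trmx_mul -!mulmxA [E _ *m (_ *m _)]mulmxA [_ *m g _ *m (_ *m _)]mulmxA Eo; last exact: bd_Om.
by rewrite mul1mx bdP_orth.
Qed.

Lemma Fb_Fr p : Fb p = Fr (gm p).
Proof. by apply: Fr_uniq; [exact: gm_posdef|exact: Fb_upper|exact: Fb_orth]. Qed.

(** l is the length of the flat conormal in the inverse metric; volume density times this length is
    the area density of the boundary. *)
Lemma rho_sqrt p l : 0 < l -> E (bd_incl p) *m (nn (bd_incl p))^T = l *: (nn (bd_incl p))^T ->
  rhoE E (bd_incl p) * l = Num.sqrt (\det (gm p)).
Proof.
move=> l0 El; have dF : 0 < \det (Fb p).
  by have := Ed (bd_Om p); rewrite (det_frame El) pmulr_rgt0.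
have dd := congr1 determinant (Fb_orth p); rewrite !det_mulmx det_tr det1 in dd.
have -> : \det (gm p) = (\det (Fb p))^-1 ^+ 2.
  have dn : \det (Fb p) != 0 by rewrite gt_eqF.
  apply: (mulfI dn); apply: (mulIf dn); rewrite dd expr2 mulrA mulfV // mul1r mulVf //.
rewrite sqrtr_sqr gtr0_norm ?invr_gt0 // /rhoE (det_frame El) invfM mulrC mulrA mulfV ?mul1r //.
by rewrite gt_eqF.
Qed.

Definition oma a p := \sum_i bdP p a i *: om g E i (bd_incl p).

Lemma mpd_gm a p : mpd a gm p = mpd a (@bdP R k) p *m g (bd_incl p) *m (bdP p)^T +
  bdP p *m (\sum_i bdP p a i *: mpd i g (bd_incl p)) *m (bdP p)^T +
  bdP p *m g (bd_incl p) *m (mpd a (@bdP R k) p)^T.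
Proof.
have bC := @mCk_bdP R k 1; have gb := mCk_bd oV OV g1.
rewrite /gm (mpdM openT (TT p) a (mCkM openT bC gb) (mCkT openT bC)) (mpdT openT (TT p)).
by rewrite (mpdM openT (TT p) a bC gb) (mpd_bd oV OV p a g1) mulmxDl.
Qed.

(** The Koszul formula expresses both connections by first derivatives of the metrics. Of the
    derivatives of P only one survives in the combination, by their symmetry, and the rest is the
    tangential restriction of the ambient symbols. *)
Lemma koszul a p : KM gm a p = mpd a (@bdP R k) p *m g (bd_incl p) *m (bdP p)^T +
  bdP p *m (\sum_i bdP p a i *: KM g i (bd_incl p)) *m (bdP p)^T.
Proof.
set x := bd_incl p; set P := bdP p.
pose T3 (f : 'I_n -> 'I_n -> 'I_n -> R) a b d := \sum_i \sum_l \sum_q P a i * P b l * P d q * f i l q.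
have T3E (M : 'I_n -> 'M[R]_n) a' b d : (P *m (\sum_i P a' i *: M i) *m P^T) b d = T3 (fun i l q => M i l q) a' b d.
  rewrite mulmx_sumr mulmx_suml summxE; apply: eq_bigr => i _.
  rewrite -scalemxAr -scalemxAl [LHS]mxE.
  have -> : (P *m M i *m P^T) b d = \sum_q \sum_l P b l * M i l q * P d q.
    rewrite [LHS]mxE; apply: eq_bigr => q _.
    by rewrite [P^T _ _]mxE [(P *m _) _ _]mxE mulr_suml.
  rewrite exchange_big mulr_sumr; apply: eq_bigr => l _ /=; rewrite mulr_sumr; apply: eq_bigr => q _; ring.
pose X a b d := (mpd a (@bdP R k) p *m g x *m P^T) b d.
have Xs u v w : X u v w = X v u w.
  by rewrite /X -!mulmxA !mxE; apply: eq_bigr => i _; rewrite mpd_bdP_sym.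
have gs : (g x)^T = g x by have [] := gpd (bd_Om p).
have X' u v w : (P *m g x *m (mpd u (@bdP R k) p)^T) v w = X u w v.
  have -> : P *m g x *m (mpd u (@bdP R k) p)^T = (mpd u (@bdP R k) p *m g x *m P^T)^T.
    by rewrite !trmx_mul trmxK gs mulmxA.
  by rewrite mxE.
have mE u v w : mpd u gm p v w = X u v w + T3 (fun i l q => mpd i g x l q) u v w + X u w v.
  by rewrite mpd_gm -/x -/P [LHS]mxE [X in X + _ = _]mxE X' T3E.
apply/matrixP => b d; rewrite [LHS]mxE -!mpdE !mE [RHS]mxE -/(X a b d) T3E.
have -> : T3 (fun i l q => KM g i x l q) a b d = 2^-1 * (T3 (fun i l q => mpd i g x l q) a b d +
    T3 (fun i l q => mpd i g x l q) b a d - T3 (fun i l q => mpd i g x l q) d a b).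
  have -> : T3 (fun i l q => mpd i g x l q) b a d = T3 (fun i l q => mpd l g x i q) a b d.
    rewrite /T3 exchange_big; apply: eq_bigr => i _; apply: eq_bigr => l _; apply: eq_bigr => q _; ring.
  have -> : T3 (fun i l q => mpd i g x l q) d a b = T3 (fun i l q => mpd q g x i l) a b d.
    rewrite /T3 exchange_big; apply: eq_bigr => i _ /=; rewrite exchange_big.
    by apply: eq_bigr => l _; apply: eq_bigr => q _; ring.
  rewrite /T3 -big_split -sumrB mulr_sumr; apply: eq_bigr => i _ /=.
  rewrite -big_split -sumrB mulr_sumr; apply: eq_bigr => l _ /=.
  rewrite -big_split -sumrB mulr_sumr; apply: eq_bigr => q _ /=.
  by rewrite !mxE !mpdE; ring.
by rewrite (Xs b a d) (Xs d a b) (Xs d b a); field.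
Qed.

Lemma FbC q : mCk V q E -> mCk setT q Fb.
Proof.
move=> EqC; have bC := @mCk_bdP R k q.
exact: (mCkM openT (mCkM openT bC (mCk_bd oV OV EqC)) (mCkT openT bC)).
Qed.

(** The Gauss formula: the tangential part of the ambient connection form is the Levi-Civita form of
    the boundary in the frame [Fb]. This is the reason why the off-diagonal boundary operator is
    intrinsic. *)
Lemma om_tangential a p : bdP p *m oma a p *m (bdP p)^T = om gm Fb a p.
Proof.
set x := bd_incl p; set P := bdP p; set F := Fb p; set dP := mpd a (@bdP R k) p.
pose dE := \sum_i P a i *: mpd i E x; pose Ka := \sum_i P a i *: KM g i x.
pose EE := (E x)^T *m E x.
have EEg : EE *m g x = 1%:M by rewrite /EE -mulmxA; apply: mulmx1C; rewrite Eo //; exact: bd_Om.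
have omE : oma a p = (dE + E x *m (Ka *m EE)) *m g x *m (E x)^T.
  rewrite /dE /Ka /oma mulmx_suml mulmx_sumr -big_split /= !mulmx_suml; apply: eq_bigr => i _.
  by rewrite /om /GM -scalemxAl -scalemxAr -scalerDr -!scalemxAl.
have bC := @mCk_bdP R k 1; have Eb := mCk_bd oV OV E1.
have dPE : dP *m E x + P *m dE = mpd a Fb p *m P + F *m dP.
  have e := mpd_bd oV OV p a E1; rewrite -/x -/P -/dE in e.
  rewrite -(mpdM openT (TT p) a (FbC E1) bC) -e.
  rewrite -[LHS](mpdM openT (TT p) a bC Eb); congr (mpd _ _ p).
  by apply/funext => q; exact: PE_FP.
have PdE : P *m dE = mpd a Fb p *m P + F *m dP - dP *m E x by rewrite -dPE addrC addKr.
have PE : P *m E x = F *m P by exact: PE_FP.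
have FT : (E x)^T *m P^T = P^T *m F^T by rewrite -!trmx_mul PE.
have FFg : F^T *m F *m gm p = 1%:M by rewrite -mulmxA; apply: mulmx1C; exact: Fb_orth.
(* After the orthonormality of E this term contains only the tangential part of the derivative of P,
   which vanishes. *)
have z : dP *m E x *m g x *m (P^T *m F^T) = 0.
  rewrite -FT -!mulmxA [g x *m (_ *m _)]mulmxA [E x *m (_ *m _)]mulmxA [E x *m (g x *m _)]mulmxA.
  by rewrite Eo ?mul1mx; [exact: mpd_bdP_tan|exact: bd_Om].
transitivity ((P *m dE + F *m P *m (Ka *m EE)) *m g x *m (P^T *m F^T)).
  by rewrite omE -FT -PE !mulmxA mulmxDr !mulmxA.
rewrite PdE.
have -> : (mpd a Fb p *m P + F *m dP - dP *m E x + F *m P *m (Ka *m EE)) *m g x *m (P^T *m F^T) =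
   mpd a Fb p *m gm p *m F^T + F *m (dP *m g x *m P^T + P *m Ka *m P^T) *m F^T - dP *m E x *m g x *m (P^T *m F^T).
  have -> : F *m P *m (Ka *m EE) = F *m P *m Ka *m EE by rewrite mulmxA.
  rewrite !mulmxDl !mulNmx -[_ *m EE *m g x]mulmxA EEg mulmx1 /gm -/P -/x.
  rewrite mulmxDr mulmxDl !mulmxA.
  rewrite -!addrA; congr (_ + (_ + _)); exact: addrC.
rewrite z subr0 -koszul /om /GM -/F.
by rewrite mulmxDl mulmxDl -[F *m (_ *m _) *m gm p]mulmxA -[KM gm a p *m _ *m gm p]mulmxA FFg mulmx1.
Qed.

Definition nb p := nn (@bd_incl R k p).
(* [nab_a beta = cl (vb a p) J], so [Bm] is the shape operator in the frame. *)
Definition vb a p := mpd a nb p + nb p *m oma a p.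
Definition Bm p : 'M[R]_k.+1 := \matrix_(a, b) (vb a p *m (bdP p)^T) 0 b.

Lemma nbC q : mCk setT q nb.
Proof. by apply: (mCk_bd openT (fun x _ => I)); exact: (mCk_nn openT). Qed.

(** Orthogonality to the tangent vectors and adaptedness of the frame leave a multiple of (cos, sin,
    0) as frame components; unit length gives a sign, and pointing outwards fixes it. *)
Lemma unit_normalE nu p : outward_unit_normal g nu -> nu p = nb p *m E (bd_incl p).
Proof.
move=> /(_ p) [n1 n2 n3]; set x := bd_incl p in n1 n2 *; have [l l0 El] := Ea p.
pose v := nu p *m g x *m (E x)^T.
have EgE : g x *m (E x)^T *m E x = 1%:M.
  by apply: mulmx1C; rewrite mulmxA Eo //; exact: bd_Om.
have nuE : nu p = v *m E x by rewrite /v -!mulmxA [g x *m _]mulmxA EgE mulmx1.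
have vP : v *m (bdP p)^T = 0.
  have h : nu p *m g x *m (bdP p)^T = 0.
    apply/rowP => a; rewrite [RHS]mxE; have := n1 a; rewrite /inner bd_tangentE => <-.
    by rewrite !mxE; apply: eq_bigr => i _; rewrite !mxE.
  have FT : (E x)^T *m (bdP p)^T = (bdP p)^T *m (Fb p)^T by rewrite -!trmx_mul PE_FP.
  by rewrite /v -mulmxA FT mulmxA h mul0mx.
clearbody v.
have vn : v = (v *m (nb p)^T) *m nb p.
  by rewrite -[LHS]mulmx1 -(bdP_complete p) mulmxDr mulmxA vP mul0mx add0r mulmxA.
have [t vt] : exists t, v = t *: nb p.
  exists ((v *m (nb p)^T) 0 0); rewrite {1}vn {1}[v *m (nb p)^T]mx11_scalar mul_scalar_mx //.
have t2 : t ^+ 2 = 1.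
  have gE : nu p *m g x *m (nu p)^T = v *m v^T.
    rewrite nuE trmx_mul -!mulmxA; congr (_ *m _); rewrite !mulmxA Eo ?mul1mx //; exact: bd_Om.
  move: n2; rewrite /inner gE vt linearZ /= -scalemxAl -scalemxAr nn_unit !mxE eqxx mulr1 expr2 //.
(* The outward condition is the Euclidean product of nu with the flat normal, which equals t l;
   since l > 0 it determines the sign of t. *)
have tl : 0 < t * l.
  have e : (nu p *m (nb p)^T) 0 0 = t * l.
    by rewrite nuE -mulmxA El -scalemxAr vt -scalemxAl nn_unit !mxE eqxx mulr1 mulrC.
  have nbE i : (nb p)^T i 0 = nn x 0 i by rewrite mxE.
  have x0 : x 0 ord0 = cos (p 0 0) by rewrite mxE.
  have x1 : x 0 o1 = sin (p 0 0) by rewrite mxE.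
  move: n3; rewrite -e [X in _ -> 0 < X]mxE big_ord_n !nbE !nnE /= x0 x1 one_lift big1 ?addr0 // => j _.
  by rewrite nbE nnE mulr0.
have t1 : t = 1.
  have t0 : 0 < t by move: tl; rewrite pmulr_lgt0.
  by apply/eqP; rewrite -(@eqrXn2 _ 2) ?ltW // t2 expr1n.
by rewrite nuE vt t1 scale1r.
Qed.

(** With nu = [nb] E, the covariant derivative acts on frame components as derivative plus
    connection form, so nab_a nu = [vb] E. Writing the inverse induced metric as F^T F turns the
    trace of the shape operator into the stated one. *)
Lemma mean_curvatureE nu p : outward_unit_normal g nu -> (forall p, induced_metric g p = gm p) ->
  mean_curvature g nu p = \tr (Fb p *m Bm p).
Proof.
move=> on ind; set x := bd_incl p; set P := bdP p.
have nuE : nu = fun q => nb q *m E (bd_incl q) by apply/funext => q; exact: unit_normalE.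
have Eb := mCk_bd oV OV E1; have nC := nbC 1.
have nuC : mCk setT 1 nu by rewrite nuE; exact: (mCkM openT nC Eb).
have EgE : g x *m (E x)^T *m E x = 1%:M.
  by apply: mulmx1C; rewrite mulmxA Eo //; exact: bd_Om.
have ginv : invmx (g x) = (E x)^T *m E x.
  have EEg : (E x)^T *m E x *m g x = 1%:M by rewrite -mulmxA; apply: mulmx1C; rewrite Eo //; exact: bd_Om.
  have u : g x \in unitmx by case: (mulmx1_unit EEg).
  by rewrite -[LHS]mul1mx -EEg -(mulmxA _ (g x)) mulmxV // mulmx1.
have chE l i j : christoffel g l i j x = GM g E i x j l.
  rewrite /christoffel mxE mulr_sumr; apply: eq_bigr => q _.
  rewrite ginv !mxE -!pdE [RHS]mulrC mulrA [2^-1 * _]mulrC -mulrA; congr (_ * (_ * _)).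
  by apply: eq_bigr => u _; rewrite !mxE mulrC.
have cov a : covariant_derivative g nu a p = vb a p *m E x.
  have e1 : vb a p *m E x = mpd a nu p + nu p *m \sum_i P a i *: GM g E i x.
    rewrite nuE (mpdM openT (TT p) a nC Eb) (mpd_bd oV OV p a E1) /vb mulmxDl -addrA; congr (_ + _).
    have eO : oma a p *m E x = \sum_i P a i *: (mpd i E x + E x *m GM g E i x).
      rewrite [LHS]mulmx_suml; apply: eq_bigr => i _; rewrite -scalemxAl; congr (_ *: _).
      by rewrite /om -!mulmxA [g x *m (_ *m _)]mulmxA EgE mulmx1.
    have eG : E x *m (\sum_i P a i *: GM g E i x) = \sum_i P a i *: (E x *m GM g E i x).
      by rewrite mulmx_sumr; apply: eq_bigr => i _; rewrite -scalemxAr.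
    rewrite -[nb p *m oma a p *m E x]mulmxA eO -[nb p *m E _ *m _]mulmxA eG -mulmxDr; congr (_ *m _).
    by rewrite -big_split; apply: eq_bigr => i _; rewrite scalerDr.
  rewrite e1; apply/rowP => l; rewrite [LHS]mxE [RHS]mxE (jac_entry p a l) => [|i]; last exact: (nuC 0 i).
  rewrite mpdE; congr (_ + _); rewrite mxE exchange_big; apply: eq_bigr => j _ /=.
  rewrite summxE mulr_sumr; apply: eq_bigr => i _; rewrite chE bd_tangentE !mxE; ring.
have sff : second_fundamental_form g nu p *m (Fb p)^T = Bm p.
  pose Vm : 'M[R]_(k.+1, n) := \matrix_(a, i) vb a p 0 i.
  have rV a : row a Vm = vb a p by apply/rowP => i; rewrite !mxE.
  have -> : second_fundamental_form g nu p = Vm *m E x *m g x *m P^T.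
    apply/matrixP => a b; rewrite [LHS]mxE /inner cov bd_tangentE -/x -rV -!row_mul !mxE.
    by apply: eq_bigr => i _; rewrite !mxE.
  have FT : (E x)^T *m P^T = P^T *m (Fb p)^T by rewrite -!trmx_mul PE_FP.
  rewrite -!mulmxA -FT [g x *m (_ *m _)]mulmxA [E x *m (_ *m _)]mulmxA [E x *m (g x *m _)]mulmxA Eo ?mul1mx; last exact: bd_Om.
  by apply/matrixP => a b; rewrite [RHS]mxE -rV -row_mul !mxE.
have gi : invmx (gm p) = (Fb p)^T *m Fb p.
  have FFg : (Fb p)^T *m Fb p *m gm p = 1%:M by rewrite -mulmxA; apply: mulmx1C; exact: Fb_orth.
  have u : gm p \in unitmx by case: (mulmx1_unit FFg).
  by rewrite -[LHS]mul1mx -FFg -(mulmxA _ (gm p)) mulmxV // mulmx1.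
by rewrite /mean_curvature ind gi -mulmxA mxtrace_mulC -mulmxA sff.
Qed.

End BoundaryGeometry.

(** * Clifford products of two vectors *)

Section CliffordOuter.
Variables (R : realType) (N n : nat) (c : 'I_n -> 'M[R]_N) (J : 'M[R]_N) (H : clifford c J).

Lemma cl2_outer (u v : 'rV[R]_n) : cl2 c (u^T *m v) = 4^-1 *: (cl c u *m cl c v).
Proof.
rewrite /cl2 /cl mulmx_suml; congr (_ *: _); apply: eq_bigr => a _; rewrite mulmx_sumr; apply: eq_bigr => b _.
by rewrite -scalemxAl -scalemxAr scalerA mxE big_ord1 !mxE.
Qed.

Lemma cl_perp (u v : 'rV[R]_n) : u *m v^T = 0 -> cl c u *m cl c v = - (cl c v *m cl c u).
Proof. by move=> uv; rewrite (cl_mul H u v) uv mxE mulr0 raddf0 subr0. Qed.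

Lemma ip_clcl (u v : 'rV[R]_n) q (X : 'M[R]_(N, q)) : ip X (cl c u *m (cl c v *m X)) = - (u *m v^T) 0 0 * nsq X.
Proof.
have e : ip X (cl c u *m (cl c v *m X)) = ip X (cl c v *m (cl c u *m X)).
  by rewrite ip_adjr (clT H) mulNmx ipNl ip_adjr (clT H) mulNmx ipNl opprK ipC.
have s : cl c u *m (cl c v *m X) = - (cl c v *m (cl c u *m X)) - (2 * (u *m v^T) 0 0) *: X.
  by rewrite mulmxA (cl_mul H) mulmxBl mulNmx mul_scalar_mx mulmxA.
by have := congr1 (ip X) s; rewrite ipBr ipNr ipZr -e; lra.
Qed.

Lemma mCk_clv m (V : set 'rV[R]_m) q (v : 'rV[R]_m -> 'rV[R]_n) : open V -> mCk V q v -> mCk V q (fun x => cl c (v x)).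
Proof. by move=> oV vC; apply: (mCk_sum oV) => a; apply: (mCkZ oV); [exact: vC|exact: mCk_cst]. Qed.

Lemma mpd_clv m (V : set 'rV[R]_m) (v : 'rV[R]_m -> 'rV[R]_n) i x : open V -> V x -> mCk V 1 v ->
  mpd i (fun x => cl c (v x)) x = cl c (mpd i v x).
Proof.
move=> oV Vx vC; rewrite /cl (mpd_sum oV Vx i) => [|a]; last by apply: (mCkZ oV); [exact: vC|exact: mCk_cst].
apply: eq_bigr => a _.
by rewrite (mpdZ oV Vx i (vC 0 a) (mCk_cst V 1 _)) mpd_cst scaler0 addr0 mpdE.
Qed.

End CliffordOuter.

(** * The boundary flux on the eigenspaces of beta *)

Section BoundarySpinor.
Variables (R : realType) (k N : nat).
Local Notation n := k.+2.
Local Notation Om := (@solid_torus R k).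
Local Notation o1 := (lift ord0 ord0).
Local Notation l2 j := (lift ord0 (lift ord0 j)).
Implicit Types (p : 'rV[R]_k.+1) (a b : 'I_k.+1) (x : 'rV[R]_n) (psi chi : 'rV[R]_n -> 'M[R]_N).
Variables (c : 'I_n -> 'M[R]_N) (J : 'M[R]_N) (H : clifford c J).

(** On the boundary this is the projector onto the -1 eigenspace, taken as N column spinors at once:
    no section of the eigenbundle has to be chosen, and the norm is constant there since beta has
    trace 0. *)
Definition psi0 x : 'M[R]_N := 2^-1 *: (1%:M - beta c J x).
(* The part of the flux of psi0 that only depends on the boundary metric ga. *)
Definition Yf (ga : 'rV[R]_k.+1 -> 'M[R]_k.+1) p : 'M[R]_N := \sum_a
  (cl c (nb p) *m cl c (row a ((Fr (ga p))^T *m bdP p))) *m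
  (cl2 c ((bdP p)^T *m om ga (fun q => Fr (ga q)) a p *m bdP p) *m psi0 (bd_incl p) -
   2^-1 *: (cl c (mpd a (@nb R k) p) *m J)).

Variables (V : set 'rV[R]_n) (oV : open V) (OV : Om `<=` V).
Variables (g E : 'rV[R]_n -> 'M[R]_n).
Hypotheses (gC : mCk V 2 g) (EC : mCk V 2 E).
Hypotheses (gpd : forall x, Om x -> posdefmx (g x)).
Hypothesis Eo : forall x, Om x -> E x *m g x *m (E x)^T = 1%:M.
Hypothesis Ed : forall x, Om x -> 0 < \det (E x).
Hypothesis Ea : adapted E.
Hypothesis Elow : forall p (j : 'I_k) (i : 'I_n), (i < l2 j)%N -> E (bd_incl p) (l2 j) i = 0.
Hypothesis Edg : forall p (j : 'I_k), 0 < E (bd_incl p) (l2 j) (l2 j).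

Local Notation O := (OM c g E).
Local Notation FbE := (Fb E).
Local Notation omE := (oma g E).
Local Notation vbE := (vb g E).
Let TT p : setT p. Proof. by []. Qed.
Let gs x : Om x -> (g x)^T = g x. Proof. by move=> /gpd[]. Qed.

Lemma oma_skew a p : (omE a p)^T = - omE a p.
Proof.
rewrite /oma raddf_sum /= -sumrN; apply: eq_bigr => i _.
by rewrite linearZ /= (om_skew_Om oV OV gC EC gs Eo i (bd_Om p)) scalerN.
Qed.

Let n_oma_n a p : nb p *m omE a p *m (nb p)^T = 0.
Proof.
have e : (nb p *m omE a p *m (nb p)^T)^T = - (nb p *m omE a p *m (nb p)^T).
  by rewrite !trmx_mul trmxK oma_skew mulNmx mulmxN mulmxA.
apply/matrixP => i j; rewrite !ord1 [RHS]mxE; have /matrixP /(_ 0 0) := e.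
by rewrite [LHS]mxE [RHS]mxE; lra.
Qed.

Lemma vb_n a p : vbE a p *m (nb p)^T = 0.
Proof.
have nC := @nbC R k 1.
rewrite /vb mulmxDl n_oma_n addr0.
have : mpd a (fun q => @nb R k q *m (nb q)^T) p = 0.
  by rewrite (_ : (fun q => _) = fun=> 1%:M) ?mpd_cst //; apply/funext => q; exact: nn_unit.
rewrite (mpdM openT (TT p) a nC (mCkT openT nC)) (mpdT openT (TT p)) => /matrixP /(_ 0 0).
have -> : nb p *m (mpd a (@nb R k) p)^T = (mpd a (@nb R k) p *m (nb p)^T)^T by rewrite trmx_mul trmxK.
rewrite [LHS]mxE [X in _ + X]mxE [RHS]mxE => e.
by apply/matrixP => i j; rewrite !ord1 [RHS]mxE; lra.
Qed.

Lemma tan_n (w : 'rV[R]_k.+1) p : w *m bdP p *m (nb p)^T = 0.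
Proof. by rewrite -mulmxA bdP_n mulmx0. Qed.

Let Fa a p := row a ((FbE p)^T *m bdP p).

Let Fa_n a p : Fa a p *m (nb p)^T = 0.
Proof. by rewrite /Fa row_mul tan_n. Qed.

Let cn_anti (w : 'rV[R]_n) p : w *m (nb p)^T = 0 -> cl c w *m cl c (nb p) = - (cl c (nb p) *m cl c w).
Proof. exact: (cl_perp H). Qed.

Let beta_comm (w : 'rV[R]_n) p : w *m (nb p)^T = 0 -> beta c J (bd_incl p) *m cl c w = cl c w *m beta c J (bd_incl p).
Proof.
move=> wn; rewrite /beta -[nn (bd_incl p)]/(nb p) mulmxA (cn_anti wn) mulNmx -!mulmxA -mulmxN; congr (_ *m _).
by rewrite (clJ H) opprK.
Qed.

Let cn_beta p : cl c (nb p) *m beta c J (bd_incl p) = - J.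
Proof. by rewrite /beta mulmxA (cln_sq H) mul_scalar_mx scaleN1r. Qed.

Let beta_cn p : beta c J (bd_incl p) *m cl c (nb p) = J.
Proof.
rewrite /beta -[nn (bd_incl p)]/(nb p) -mulmxA -[J *m _]opprK -(clJ H) mulmxN mulmxA (cln_sq H).
by rewrite mul_scalar_mx scaleN1r opprK.
Qed.

Let X_anti a p : cl c (nb p) *m cl c (Fa a p) *m beta c J (bd_incl p) = - (beta c J (bd_incl p) *m (cl c (nb p) *m cl c (Fa a p))).
Proof.
rewrite -mulmxA -(beta_comm (Fa_n a p)) (mulmxA (cl c (nb p)) (beta c J (bd_incl p)) (cl c (Fa a p))) cn_beta mulNmx.
by rewrite (mulmxA (beta c J (bd_incl p)) (cl c (nb p)) (cl c (Fa a p))) beta_cn.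
Qed.

(** The derivatives are decomposed by completeness of tangent vectors and normal. The normal
    derivative drops out by skewness, and the normal component of each tangential coefficient drops
    out of its commutator with c(n). *)
Lemma flux_sum p l (d : 'I_n -> 'M[R]_N) : E (bd_incl p) *m (nn (bd_incl p))^T = l *: (nn (bd_incl p))^T ->
  \sum_j nSc c E j (bd_incl p) *m d j =
  l *: \sum_a (cl c (nb p) *m cl c (Fa a p)) *m (\sum_i bdP p a i *: d i).
Proof.
move=> El; set x := bd_incl p; set P := bdP p.
have dE j : d j = \sum_i (\sum_a P a j * P a i + nb p 0 j * nb p 0 i) *: d i.
  have cE i : \sum_a P a j * P a i + nb p 0 j * nb p 0 i = (j == i)%:R.
    have /matrixP /(_ j i) := bdP_complete p; rewrite [LHS]mxE [RHS]mxE => <-; congr (_ + _).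
      by rewrite [RHS]mxE; apply: eq_bigr => a _; rewrite [P^T _ _]mxE.
    by rewrite [RHS]mxE big_ord1 [_^T _ _]mxE.
  rewrite (bigD1 j) //= cE eqxx scale1r big1 ?addr0 // => i ij.
  by rewrite cE eq_sym (negPf ij) scale0r.
have PS a : \sum_j P a j *: nSc c E j x = l *: (cl c (nb p) *m cl c (Fa a p)).
  have ceE' : \sum_j P a j *: ce c E j x = cl c (row a (P *m (E x)^T)).
    rewrite /ce (eq_bigr (fun j => cl c (P a j *: (col j (E x))^T))) => [|j _]; last by rewrite clZ.
    rewrite -cl_sum; congr cl; apply/rowP => b; rewrite summxE !mxE; apply: eq_bigr => j _.
    by rewrite !mxE.
  have PET : P *m (E x)^T = (FbE p)^T *m P + (P *m (E x)^T *m (nb p)^T) *m nb p.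
    rewrite -[LHS]mulmx1 -(bdP_complete p) mulmxDr !mulmxA; congr (_ *m _ + _).
    by rewrite /Fb !trmx_mul trmxK mulmxA.
  have rE : row a (P *m (E x)^T) = Fa a p + ((P *m (E x)^T *m (nb p)^T) a 0) *: nb p.
    rewrite {1}PET; apply/rowP => b; rewrite mxE [LHS]mxE [RHS]mxE [Fa a p 0 b]mxE; congr (_ + _).
    by rewrite [LHS]mxE big_ord1 [RHS]mxE.
  rewrite (eq_bigr (fun j => (l / 2) *: (cl c (nb p) *m (P a j *: ce c E j x) - (P a j *: ce c E j x) *m cl c (nb p)))) => [|j _]; last first.
    by rewrite (nSc_bd c El) -scalemxAl -scalemxAr -scalerBr !scalerA mulrC.
  rewrite -scaler_sumr sumrB -mulmx_sumr -mulmx_suml ceE' rE (clD c (Fa a p)) (clZ c _ (nb p)).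
  have an := cn_anti (Fa_n a p); move: (cl c (Fa a p)) (cl c (nb p)) an => A B an.
  rewrite mulmxDr mulmxDl -scalemxAr -scalemxAl an; move: (B *m A) (B *m B) => X Y.
  by apply/matrixP => i j; rewrite !mxE; field.
have Pn : \sum_j nb p 0 j *: nSc c E j x = 0.
  rewrite big_ord_n big1 ?addr0 => [|j _]; last by rewrite nnE scale0r.
  by rewrite !nnE /=; exact: (nSc_n c E p).
transitivity (\sum_j \sum_i ((\sum_a (P a j *: nSc c E j x) *m (P a i *: d i)) + (nb p 0 j *: nSc c E j x) *m (nb p 0 i *: d i))).
  apply: eq_bigr => j _; rewrite {1}dE mulmx_sumr; apply: eq_bigr => i _.
  rewrite -scalemxAr scalerDl scaler_suml; congr (_ + _).
    by apply: eq_bigr => a _; rewrite -scalemxAl -scalemxAr scalerA.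
  by rewrite -scalemxAl -scalemxAr scalerA.
rewrite (eq_bigr (fun j => (\sum_a (P a j *: nSc c E j x) *m (\sum_i P a i *: d i)) + (nb p 0 j *: nSc c E j x) *m \sum_i (nb p 0 i *: d i))) => [|j _]; last first.
  rewrite big_split exchange_big /= mulmx_sumr; congr (_ + _).
  by apply: eq_bigr => a _; rewrite mulmx_sumr.
rewrite big_split exchange_big /= -[X in _ + X]mulmx_suml Pn mul0mx addr0 scaler_sumr; apply: eq_bigr => a _.
by rewrite -mulmx_suml PS -scalemxAl.
Qed.

Lemma O_a a p psi : mCk V 1 psi -> \sum_i bdP p a i *: nab O i psi (bd_incl p) =
  mpd a (fun q => psi (bd_incl q)) p + cl2 c (omE a p) *m psi (bd_incl p).
Proof.
move=> pC; rewrite (mpd_bd oV OV p a pC) /oma cl2_sum mulmx_suml -big_split; apply: eq_bigr => i _ /=.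
by rewrite cl2Z -scalemxAl -scalerDr.
Qed.

Let mpd_betab a p : mpd a (fun q => beta c J (bd_incl q)) p = cl c (mpd a (@nb R k) p) *m J.
Proof.
have nC := @nbC R k 1.
rewrite (mpdM openT (TT p) a (mCk_clv c openT nC) (mCk_cst setT 1 J)) mpd_cst mulmx0 addr0.
by rewrite (mpd_clv c a openT (TT p) nC).
Qed.

(** The derivative of the eigenvalue equation introduces c(vb) J by [beta_flux], with a factor s;
    replacing psi by s beta psi and moving c(n) J through gives a second s. So the result is - H/2
    on both eigenspaces. *)
Lemma flux_diag psi s p l : E (bd_incl p) *m (nn (bd_incl p))^T = l *: (nn (bd_incl p))^T ->
  s * s = 1 -> mCk V 1 psi ->
  (forall q, beta c J (bd_incl q) *m psi (bd_incl q) = s *: psi (bd_incl q)) ->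
  ip (psi (bd_incl p)) (\sum_j nSc c E j (bd_incl p) *m nab O j psi (bd_incl p)) =
  - 2^-1 * l * \tr (FbE p *m Bm g E p) * nsq (psi (bd_incl p)).
Proof.
move=> El s2 pC bp; set x := bd_incl p.
have pb := mCk_bd oV OV pC; have nC := @nbC R k 1.
have bC : mCk setT 1 (fun q => beta c J (bd_incl q)).
  exact: (mCkM openT (mCk_clv c openT nC) (mCk_cst setT 1 J)).
pose Da a := \sum_i bdP p a i *: nab O i psi x.
have tang a : beta c J x *m Da a + (cl c (vbE a p) *m J) *m psi x = s *: Da a.
  have e : mpd a (fun q => beta c J (bd_incl q) *m psi (bd_incl q)) p = mpd a (fun q => s *: psi (bd_incl q)) p.
    by congr (mpd _ _ p); apply/funext => q; exact: bp.
  rewrite (mpdM openT (TT p) a bC pb) mpd_betab (mpdZ openT (TT p) a (Ck_cst setT 1 s) pb) in e.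
  have z : pd a (fun=> s) p = 0 by apply: pd_val; exact: is_derive_cst.
  rewrite z scale0r add0r -/x in e.
  have comm : cl2 c (omE a p) *m beta c J x - beta c J x *m cl2 c (omE a p) = cl c (nb p *m omE a p) *m J.
    rewrite -(cl2_comm H (nb p) (oma_skew a p)) mulmxBl /beta -[nn x]/(nb p); congr (_ - _); first by rewrite mulmxA.
    by rewrite -!mulmxA (cl2J H).
  have gen (b C D K dp ps : 'M[R]_N) : D *m ps + b *m dp = s *: dp -> C *m b - b *m C = K -> b *m ps = s *: ps ->
      b *m (dp + C *m ps) + (D + K) *m ps = s *: (dp + C *m ps).
    move=> h1 <- h3; rewrite mulmxDr scalerDr -h1 mulmxDl mulmxBl -!mulmxA h3 -scalemxAr.
    by move: (D *m ps) (b *m dp) (b *m _) (s *: _) => X Y Z W; apply/matrixP => i j; rewrite !mxE; ring.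
  rewrite /Da (O_a a p pC) -/x /vb (clD c (mpd a (@nb R k) p)) (mulmxDl (cl c (mpd a (@nb R k) p)) _ J).
  exact: (gen _ _ _ _ _ _ e comm (bp p)).
rewrite (flux_sum _ El) ipZr ip_sumr.
have term a : 2 * ip (psi x) (cl c (nb p) *m cl c (Fa a p) *m Da a) = - (Fa a p *m (vbE a p)^T) 0 0 * nsq (psi x).
  rewrite (beta_flux (betaT H x) s2 (bp p) (X_anti a p) (tang a)).
  (* c(n) commutes with a product of two tangential Clifford vectors; brought next to J it forms
     beta, which acts on psi as s. *)
  have -> : cl c (nb p) *m cl c (Fa a p) *m (cl c (vbE a p) *m J *m psi x) = s *: (cl c (Fa a p) *m (cl c (vbE a p) *m psi x)).
    rewrite scalemxAr scalemxAr -(bp p) -/x !mulmxA; congr (_ *m _).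
    congr (_ *m _); rewrite -[nn x]/(nb p).
    have aF := cn_anti (Fa_n a p); have aV := cn_anti (vb_n a p).
    move: (cl c (nb p)) (cl c (Fa a p)) (cl c (vbE a p)) aF aV => A B D aF aV.
    by rewrite -[RHS]mulmxA aV mulmxN mulmxA aF mulNmx opprK.
  by rewrite ipZr mulrA s2 mul1r (ip_clcl H).
have tE : \tr (FbE p *m Bm g E p) = \sum_a (Fa a p *m (vbE a p)^T) 0 0.
  rewrite /mxtrace (eq_bigr (fun b => \sum_a FbE p b a * (vbE a p *m (bdP p)^T) 0 b)) => [|b _]; last first.
    by rewrite mxE; apply: eq_bigr => a _; rewrite [Bm _ _ _ _ _]mxE.
  rewrite exchange_big; apply: eq_bigr => a _ /=.
  rewrite /Fa row_mul -mulmxA -[bdP p *m (vbE a p)^T]trmxK [(bdP p *m (vbE a p)^T)^T]trmx_mul trmxK [RHS]mxE; apply: eq_bigr => b _.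
  by rewrite [row _ _ _ _]mxE [(FbE p)^T _ _]mxE [(_ *m _)^T _ _]mxE.
rewrite tE; move: (nsq _) term => B term.
rewrite [RHS](_ : _ = l * \sum_a (- 2^-1 * (Fa a p *m (vbE a p)^T) 0 0 * B)); last by rewrite -mulr_suml -mulr_sumr; ring.
by congr (_ * _); apply: eq_bigr => a _; have := term a; move: (ip _ _) ((_ *m _) 0 0) => A C; lra.
Qed.

Lemma mCk_beta_ q (W : set 'rV[R]_n) : open W -> mCk W q (beta c J).
Proof. by move=> oW; exact: (mCk_beta c J oW). Qed.

Lemma psi0C q : mCk V q psi0.
Proof. by apply: (mCkZ oV); [exact: Ck_cst|apply: (mCkB oV); [exact: mCk_cst|exact: mCk_beta_]]. Qed.

Lemma psi0_per : per psi0.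
Proof.
move=> x j Ox j1; rewrite /psi0 !betaE.
have e0 : (x + 'e_j) 0 ord0 = x 0 ord0.
  rewrite !mxE; have -> : (ord0 == j) = false by apply/eqP => e; rewrite -e in j1.
  by rewrite andbF addr0.
have e1 : (x + 'e_j) 0 o1 = x 0 o1.
  rewrite !mxE; have -> : (o1 == j) = false by apply/eqP => e; rewrite -e in j1.
  by rewrite andbF addr0.
by rewrite e0 e1.
Qed.

Lemma psi0_bd p : beta c J (bd_incl p) *m psi0 (bd_incl p) = - 1 *: psi0 (bd_incl p).
Proof.
rewrite /psi0 -scalemxAr mulmxBr mulmx1 (beta_sq H).
by rewrite scaleN1r -scalerN opprB.
Qed.

Lemma psi0_nsq p : nsq (psi0 (bd_incl p)) = N%:R / 2.
Proof.
have tb : \tr (beta c J (bd_incl p)) = 0.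
  have : \tr (J *m (beta c J (bd_incl p)) *m J) = \tr (beta c J (bd_incl p)).
    by rewrite mxtrace_mulC mulmxA (J_sq H) mul1mx.
  rewrite {1}/beta !mulmxA -[_ *m J *m J]mulmxA (J_sq H) mulmx1 -[J *m _]opprK -(clJ H) raddfN /= -/(beta c J (bd_incl p)).
  by lra.
rewrite /psi0 ipZl ipZr ipBl !ipBr /ip !trmx1 !mul1mx !mulmx1 (betaT H) (beta_sq H) tb mxtrace1.
by field.
Qed.

(** chi and psi0 lie in opposite eigenspaces. The mixed normal-tangential part of the connection
    yields an operator commuting with beta, which contributes nothing between them; what remains is
    the tangential part, determined by the boundary metric. *)
Lemma flux_cross (chi : 'M[R]_N) p l : E (bd_incl p) *m (nn (bd_incl p))^T = l *: (nn (bd_incl p))^T ->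
  beta c J (bd_incl p) *m chi = chi ->
  ip chi (\sum_j nSc c E j (bd_incl p) *m nab O j psi0 (bd_incl p)) = l * ip chi (Yf (gm g) p).
Proof.
move=> El bchi; set x := bd_incl p; set P := bdP p.
rewrite (flux_sum _ El) ipZr; congr (_ * _); rewrite /Yf !ip_sumr; apply: eq_bigr => a _.
have FF : Fr (gm g p) = FbE p by rewrite -(Fb_Fr gpd Eo Ed Ea Elow Edg).
have Fun : (fun q => Fr (gm g q)) = FbE by apply/funext => q; rewrite -(Fb_Fr gpd Eo Ed Ea Elow Edg).
rewrite FF Fun -/(Fa a p) (O_a a p (psi0C 1)) -/x.
rewrite -(om_tangential oV OV gC EC gpd Eo Ea a p) -/P.
have nC := @nbC R k 1.
have bC : mCk setT 1 (fun q => beta c J (bd_incl q)).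
  exact: (mCkM openT (mCk_clv c openT nC) (mCk_cst setT 1 J)).
have -> : mpd a (fun q => psi0 (bd_incl q)) p = - (2^-1 *: (cl c (mpd a (@nb R k) p) *m J)).
  rewrite (mpdZ openT (TT p) a (Ck_cst setT 1 2^-1) (mCkB openT (mCk_cst setT 1 1%:M) bC)).
  have z : pd a (fun=> (2^-1 : R)) p = 0 by apply: pd_val; exact: is_derive_cst.
  by rewrite z scale0r add0r (mpdB openT (TT p) a (mCk_cst setT 1 1%:M) bC) mpd_cst sub0r mpd_betab scalerN.
pose u := nb p *m omE a p *m P^T.
have PoN : P *m omE a p *m (nb p)^T = - u^T.
  by rewrite /u !trmx_mul trmxK oma_skew mulNmx mulmxN opprK mulmxA.
(* A skew matrix splits into its tangential block and a mixed block given by the row u; the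
   normal-normal entry is zero by skewness. *)
have dec : omE a p = P^T *m (P *m omE a p *m P^T) *m P + ((nb p)^T *m (u *m P) - (u *m P)^T *m nb p).
  have gen (Q : 'M[R]_(k.+1, n)) (o : 'M[R]_n) (w : 'rV[R]_n) : Q^T *m Q + w^T *m w = 1%:M ->
      Q *m o *m w^T = - (w *m o *m Q^T)^T -> w *m o *m w^T = 0 ->
      o = Q^T *m (Q *m o *m Q^T) *m Q + (w^T *m (w *m o *m Q^T *m Q) - (w *m o *m Q^T *m Q)^T *m w).
    move=> h1 h2 h3; have hN : Q^T *m (Q *m o *m w^T) *m w = - ((w *m o *m Q^T *m Q)^T *m w).
      by rewrite h2 mulmxN mulNmx -trmx_mul.
    have hZ : w^T *m (w *m o *m w^T) *m w = 0 by rewrite h3 mulmx0 mul0mx.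
    rewrite -hN -[LHS]mul1mx -[LHS]mulmx1 -h1 !mulmxDl !mulmxDr -[RHS]addr0 -hZ !mulmxA.
    move: (_ *m Q) (_ *m w) => A B.
    by rewrite -!addrA; congr (_ + _); rewrite addrCA.
  exact: (gen _ _ _ (bdP_complete p) PoN (n_oma_n a p)).
have clu : cl c (u *m P) *m cl c (nb p) = - (cl c (nb p) *m cl c (u *m P)) by apply: cn_anti; exact: tan_n.
have cO : cl2 c (omE a p) = cl2 c (P^T *m (P *m omE a p *m P^T) *m P) + 2^-1 *: (cl c (nb p) *m cl c (u *m P)).
  rewrite {1}dec cl2D cl2B !cl2_outer clu; congr (_ + _); move: (_ *m _) => A.
  by apply/matrixP => i j; rewrite !mxE; field.
have ga (X D A B : 'M[R]_N) : ip chi (X *m (- D + (A + B))) = ip chi (X *m (A - D)) + ip chi (X *m B).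
  by rewrite addrA [- _ + _]addrC mulmxDr ipDr.
rewrite cO (mulmxDl (cl2 c (P^T *m _ *m P)) _ (psi0 x)) ga -[RHS]addr0; congr (_ + _).
have g3 (A F U ps : 'M[R]_N) : F *m A = - (A *m F) -> A *m A = (-1)%:M -> A *m F *m (A *m U *m ps) = F *m (U *m ps).
  by move=> h1 h2; rewrite -!mulmxA (mulmxA F A) h1 mulNmx mulmxN -mulmxA (mulmxA A A) h2 mul_scalar_mx scaleN1r opprK.
rewrite -scalemxAl -scalemxAr ipZr (g3 _ _ _ _ (cn_anti (Fa_n a p)) (cln_sq H _)).
(* Inserting beta on the left and moving it to psi0 changes the sign, so the mixed contribution
   equals its own negative. *)
set T := ip chi _; have e : T = - T.
  have gen (b X Y ps : 'M[R]_N) : b^T = b -> b *m X = X *m b -> b *m Y = Y *m b -> b *m ps = - 1 *: ps -> b *m chi = chi ->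
      ip chi (X *m (Y *m ps)) = - ip chi (X *m (Y *m ps)).
    by move=> b1 b2 b3 b4 b5; rewrite -{1}b5 ip_adjl b1 mulmxA b2 -mulmxA (mulmxA b) b3 -mulmxA b4 scaleN1r !mulmxN ipNr.
  exact: (gen _ _ _ _ (betaT H x) (beta_comm (Fa_n a p)) (beta_comm (tan_n u p)) (psi0_bd p) bchi).
have -> : T = 0 by lra.
by rewrite mulr0.
Qed.

Lemma Yf_cont ga : (forall p, posdefmx (ga p)) -> mCk setT 2 ga -> mCk setT 0 (Yf ga).
Proof.
move=> gap gaC.
have [V' [oV' KV' _ FC]] : exists V', [/\ open V', (setT : set 'rV[R]_k.+1) `<=` V', V' `<=` setT & mCk V' 2 (fun p => Fr (ga p))].
  exact: (Fr_smooth openT (fun p _ => I) gaC (fun p _ => gap p)).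
have F2 : mCk setT 2 (fun p => Fr (ga p)) by exact: (mCk_sub KV' FC).
have F0 : mCk setT 0 (fun p => Fr (ga p)) by apply: mCk_le F2.
have P0 := @mCk_bdP R k 0; have n0 := @nbC R k 0; have n1 := @nbC R k 1.
have w0 a : mCk setT 0 (om ga (fun q => Fr (ga q)) a).
  by apply: (mCk_le (k := 1)) => //; exact: (mCk_om openT a gaC F2).
have rC a : mCk setT 0 (fun p => row a ((Fr (ga p))^T *m bdP p)).
  move=> i j; apply: (Ck_congr (f := fun p => ((Fr (ga p))^T *m bdP p) a j) openT); first by move=> q _; rewrite [RHS]mxE.
  exact: (mCkM openT (mCkT openT F0) P0).
apply: (mCk_sum openT) => a; apply: (mCkM openT).
  exact: (mCkM openT (mCk_clv c openT n0) (mCk_clv c openT (rC a))).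
apply: (mCkB openT).
  apply: (mCkM openT).
    by apply: (mCk_cl2 c openT); exact: (mCkM openT (mCkM openT (mCkT openT P0) (w0 a)) P0).
  by apply: (mCk_bd oV OV); exact: psi0C.
apply: (mCkZ openT); first exact: Ck_cst.
apply: (mCkM openT); last exact: mCk_cst.
by apply: (mCk_clv c openT); exact: (mCk_mpd openT).
Qed.

End BoundarySpinor.

Lemma metric_Ck (R : realType) m (K : set 'rV[R]_m) (g : 'rV[R]_m -> 'M[R]_m) q : metric_near K g ->
  exists V, [/\ open V, K `<=` V & mCk V q g].
Proof.
move=> [gs _]; have [W WP] := choice (fun ij : 'I_m * 'I_m => gs ij.1 ij.2).
exists [set x | forall ij, W ij x]; split.
- rewrite openE => x Wx; suff : \forall y \near x, forall ij, W ij y by [].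
  by apply: (filter_forall (F := nbhs x)) => ij; have [oW _ _] := WP ij; exact: (open_nbhs_nbhs (conj oW (Wx ij))).
- by move=> x Kx ij; have [_ KW _] := WP ij; exact: KW.
move=> i j; have [_ _ Ws] := WP (i, j); apply: (@Ck_sub R m q (W (i, j))); first by move=> x Wx; exact: (Wx (i, j)).
exact: (smooth_on_Ck _ Ws).
Qed.

(** * The adapted frame of the given metric *)

Section SolidFrame.
Variables (R : realType) (k : nat).
Local Notation n := k.+2.
Local Notation Om := (@solid_torus R k).
Local Notation o1 := (lift ord0 ord0).
Local Notation l2 j := (lift ord0 (lift ord0 j)).
Variable g : 'rV[R]_n -> 'M[R]_n.

Definition frameE (x : 'rV[R]_n) : 'M[R]_n := frame_of (g x : 'M[R]_(2 + k)) (x 0 ord0) (x 0 o1).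

Lemma frame_low (M : 'M[R]_(2 + k)) x y j i : frame_of M x y (rshift 2 j) i = Fr M (rshift 2 j) i.
Proof.
have e : dsubmx (frame_of M x y) = dsubmx (Fr M).
  rewrite /frame_of -mul_dsub_mx block_mxEv col_mxKd -[X in row_mx _ _ *m X]vsubmxK.
  by rewrite mul_row_col mul0mx add0r mul1mx.
by have /matrixP /(_ j i) := e; rewrite !mxE.
Qed.

Lemma l2_rshift j : (l2 j : 'I_n) = rshift 2 j.
Proof. exact: val_inj. Qed.

Lemma nnv_nn (x : 'rV[R]_n) : nnv k (x 0 ord0) (x 0 o1) = nn x.
Proof.
apply/rowP => i; rewrite nnE /nnv; case: (lift2E i) => [->|->|[j ->]] /=.
- by rewrite mxE; case: splitP => // j /= e; rewrite mxE (_ : j = 0) //; apply: val_inj.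
- by rewrite mxE; case: splitP => // j /= e; rewrite mxE (_ : j = 1) //; apply: val_inj.
by rewrite l2_rshift row_mxEr mxE.
Qed.

Hypothesis gm_ : metric_on_solid_torus g.

Let pos x : Om x -> posdefmx (g x). Proof. by case: gm_ => [[_ h] _]; exact: h. Qed.
Let circ x : Om x -> x 0 ord0 ^+ 2 + x 0 o1 ^+ 2 <= 1.
Proof. by rewrite /solid_torus /= one_lift. Qed.

Lemma metric_per : per g. Proof. by case: gm_ => _ h x j Ox; exact: h. Qed.

Lemma frameE_smooth : exists V, [/\ open V, Om `<=` V, mCk V 2 g, mCk V 2 frameE & forall x, V x -> 0 < \det (frameE x)].
Proof.
have [V [oV OV gC]] := metric_Ck 2 (proj1 gm_).
have [V' [oV' OV' VV' EC]] := frame_smooth oV OV gC (Ck_coord V 2 ord0) (Ck_coord V 2 o1) pos circ.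
have E0 : Ck 0 V' (fun x => \det (frameE x)) by apply: Ck_det => //; exact: (mCk_le _ EC).
exists (V' `&` [set x | 0 < \det (frameE x)]); split.
- exact: open_pos.
- move=> x Ox; split; first exact: OV'.
  have /= := frame_det (pos Ox) (circ Ox) (s := 1); rewrite subrr scale1r raddf0 add0r; apply.
  by rewrite ler01 lexx.
- by apply: (mCk_sub _ gC) => x [/VV'].
- by apply: (mCk_sub _ EC) => x [].
by move=> x [].
Qed.

Lemma frameE_orth x : Om x -> frameE x *m g x *m (frameE x)^T = 1%:M.
Proof. by move=> Ox; exact: (frame_orth (pos Ox) (circ Ox)). Qed.

Lemma frameE_det s x : 0 <= s <= 1 -> Om x -> 0 < \det ((1 - s)%:M + s *: frameE x).
Proof. by move=> s01 Ox; exact: (frame_det (pos Ox) (circ Ox) s01). Qed.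

Lemma frameE_per : per frameE.
Proof.
move=> x j Ox j1; rewrite /frameE (metric_per Ox j1).
have e (i : 'I_n) : (i <= 1)%N -> (x + 'e_j) 0 i = x 0 i.
  move=> i1; rewrite !mxE; have -> : (i == j) = false by apply/eqP => e; rewrite e in i1; lia.
  by rewrite andbF addr0.
by rewrite !e.
Qed.

Lemma frameE_adapted : adapted frameE.
Proof.
move=> p; have [l l0 e] := frame_normal (pos (bd_Om p)) (bd_circle p).
by exists l => //; rewrite -nnv_nn; exact: e.
Qed.

Lemma frameE_low p (j : 'I_k) (i : 'I_n) : (i < l2 j)%N -> frameE (bd_incl p) (l2 j) i = 0.
Proof.
move=> ij; rewrite /frameE l2_rshift frame_low; have [_ [u _]] := Fr_spec (pos (bd_Om p)).
by apply: u; rewrite -l2_rshift.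
Qed.

Lemma frameE_diag p (j : 'I_k) : 0 < frameE (bd_incl p) (l2 j) (l2 j).
Proof.
rewrite /frameE l2_rshift frame_low; have [_ [_ u]] := Fr_spec (pos (bd_Om p)).
exact: u.
Qed.

Lemma gm_induced p : induced_metric g p = gm g p.
Proof.
apply/matrixP => a b; rewrite mxE /inner !bd_tangentE.
rewrite -row_mul /gm [LHS]mxE [RHS]mxE; apply: eq_bigr => i _.
by rewrite [row _ _ _ _]mxE [(row _ _)^T _ _]mxE [row _ _ _ _]mxE [(bdP p)^T _ _]mxE.
Qed.

End SolidFrame.

(** * The estimate *)

Section MainEstimate.
Variables (R : realType) (k N : nat).
Local Notation n := k.+2.
Local Notation Om := (@solid_torus R k).
Local Notation l2 j := (lift ord0 (lift ord0 j)).
Variables (c : 'I_n -> 'M[R]_N) (J : 'M[R]_N) (H : clifford c J) (N0 : (0 < N)%N).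
Implicit Types (p : 'rV[R]_k.+1) (psi chi : 'rV[R]_n -> 'M[R]_N) (x : 'rV[R]_n).

Definition area (gam : 'rV[R]_k.+1 -> 'M[R]_k.+1) p : R := Num.sqrt (\det (gam p)).

(** The flux of psi0 is - H/2 times its squared norm N/2, which 4/N inverts. The 1 bounds the Dirac
    term; in the integral, the first summand is the J boundary term of psi0, the second what Young's
    inequality leaves of the cross term. *)
Definition mass_bound (gam : 'rV[R]_k.+1 -> 'M[R]_k.+1) : R :=
  4 / N%:R * (1 + IB (fun p => area gam p * (lam k n%:R * (N%:R / 2) + nsq (Yf c J gam p) / lam k n%:R))).

Variables (V : set 'rV[R]_n) (oV : open V) (OV : Om `<=` V).
Variables (g E : 'rV[R]_n -> 'M[R]_n).
Hypotheses (gC : mCk V 2 g) (EC : mCk V 2 E) (gp : per g) (Ep : per E).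
Hypotheses (gpd : forall x, Om x -> posdefmx (g x)).
Hypothesis Eo : forall x, Om x -> E x *m g x *m (E x)^T = 1%:M.
Hypothesis Ed : forall x, V x -> 0 < \det (E x).
Hypothesis Ei : forall s x, 0 <= s <= 1 -> Om x -> 0 < \det ((1 - s)%:M + s *: E x).
Hypothesis Ea : adapted E.
Hypothesis Elow : forall p (j : 'I_k) (i : 'I_n), (i < l2 j)%N -> E (bd_incl p) (l2 j) i = 0.
Hypothesis Edg : forall p (j : 'I_k), 0 < E (bd_incl p) (l2 j) (l2 j).
Hypothesis sc : forall x, Om x -> - (n%:R * (n%:R - 1)) <= scalar_curvature g x.

Local Notation O := (OM c g E).
Local Notation rho := (rhoE E).
Local Notation A := (opA c J E (Bop c g E) n%:R).
Local Notation phi := (psi0 c J).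
Local Notation S := (area (gm g)).
Local Notation fl psi := (flux c E rho O psi).
Local Notation lm := (lam k (n%:R : R)).
Local Notation Y := (Yf c J (gm g)).
Local Notation Hm p := (\tr (Fb E p *m Bm g E p)).

Let gs x : Om x -> (g x)^T = g x. Proof. by move=> /gpd[]. Qed.
Let EdO x : Om x -> 0 < \det (E x). Proof. by move=> /OV /Ed. Qed.
Let rho0 : Ck 0 V rho. Proof. by apply: Ck_le (rhoC oV EC Ed). Qed.
Let E0 : mCk V 0 E. Proof. exact: mCk_le EC. Qed.
Let E1 : mCk V 1 E. Proof. exact: mCk_le EC. Qed.

Lemma flux_bdE psi s p : s * s = 1 -> mCk V 1 psi ->
  (forall q, beta c J (bd_incl q) *m psi (bd_incl q) = s *: psi (bd_incl q)) ->
  ip (psi (bd_incl p)) (fl psi (bd_incl p)) = - 2^-1 * S p * Hm p * nsq (psi (bd_incl p)).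
Proof.
move=> s2 pC bp; have [l l0 El] := Ea p.
rewrite ipZr (flux_diag H oV OV gC EC gpd Eo El s2 pC bp) /area -(rho_sqrt Eo EdO Ea l0 El).
by ring.
Qed.

Hypothesis H0 : forall p, 0 <= Hm p.

Let S0 p : 0 <= S p. Proof. exact: sqrtr_ge0. Qed.

Lemma dense_n : dense_range (Sp c J V) (@cC R k N V) A.
Proof.
have fl0 psi p : mCk V 1 psi -> bdc c J psi -> ip (psi (bd_incl p)) (fl psi (bd_incl p)) <= 0.
  move=> pC bp; rewrite (flux_bdE p (s := 1)) ?mulr1 //; last by move=> q; rewrite bp scale1r.
  by have := mulr_ge0 (mulr_ge0 (S0 p) (H0 p)) (ip_ge0 (psi (bd_incl p))); lra.
have BC := @BopC R k N c V oV g E gC EC; have Bp := @Bop_per R k N c V oV OV g E gC EC gp Ep.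
have [L0 D] := dense_transport oV OV H E1 Ep Ea BC Bp Ei (flat_dense H oV OV (modes_dense H oV OV)).
exact: (spin_dense H oV OV gC EC gp Ep gs Eo Ed sc Ea fl0 D).
Qed.

Let pC q : mCk V q phi. Proof. exact: psi0C. Qed.

(** Density is applied to the right side - A psi0, so the correction chi is regular and satisfies
    the boundary condition exactly, while the equation holds only approximately. *)
Lemma small_dirac : exists2 chi, Sp c J V chi & IO (fun x => rho x * nsq (A (fun y => phi y + chi y) x)) <= 1.
Proof.
have [C C0 HC] := bounded_K0 OV rho0.
have BC := @BopC R k N c V oV g E gC EC; have Bp := @Bop_per R k N c V oV OV g E gC EC gp Ep.
have [AC Ap] := opA_cC oV OV c J n%:R E0 Ep BC Bp (pC 2) (@psi0_per R k N c J).
pose f x := - A phi x.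
have fC : cC V f by split; [exact: (mCkN oV AC)|move=> x j Ox j1; rewrite /f Ap].
(* C bounds the volume density, so the tolerance 1 / (C + 1) for the flat norm gives at most 1 for
   the Riemannian one. *)
have e0 : 0 < (C + 1)^-1 by rewrite invr_gt0; lra.
have [chi Sc' small] := dense_n fC e0; exists chi => //.
have [c2 cp bc] := Sc'; have [AcC _] := opA_cC oV OV c J n%:R E0 Ep BC Bp c2 cp.
have pcC : mCk V 2 (fun y => phi y + chi y) by exact: (mCkD oV (pC 2) c2).
have pcp : per (fun y => phi y + chi y).
  by move=> x j Ox j1; rewrite (@psi0_per R k N c J _ _ Ox j1) cp.
have [AsC _] := opA_cC oV OV c J n%:R E0 Ep BC Bp pcC pcp.
have dC : mCk V 0 (fun x => f x - A chi x) by exact: (mCkB oV (proj1 fC) AcC).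
have dn := Ck_nsq oV dC; have sn := Ck_nsq oV AsC.
apply: (@le_trans _ _ (C * nf (fun x => f x - A chi x))); last first.
  apply: (@le_trans _ _ (C * (C + 1)^-1)); first exact: ler_wpM2l.
  by rewrite ler_pdivrMr; lra.
rewrite /nf -(IOZ OV C dn); apply: (pf_le (@pf_IO R k)).
- exact: (Ck0_K0 OV (CkM oV rho0 sn)).
- exact: (Ck0_K0 OV (CkM oV (Ck_cst V 0 C) dn)).
move=> x Kx; have Ox := K0_Om Kx.
have -> : nsq (A (fun y => phi y + chi y) x) = nsq (f x - A chi x).
  have c1 : mCk V 1 chi by apply: mCk_le c2.
  rewrite (opAD oV OV c J E (Bop c g E) n%:R (pC 1) c1 Ox) /f.
  by rewrite -opprD ipNl ipNr opprK.
apply: ler_wpM2r; first exact: ip_ge0.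
by apply: le_trans (HC x Kx); exact: ler_norm.
Qed.

Let lm0 : 0 < lm.
Proof. by rewrite /lam mulr_gt0 // subr_gt0 invf_lt1 ?ltr1n // ltr0n. Qed.

Lemma young (X Z : 'M[R]_N) : 2 * ip X Z <= lm * nsq X + nsq Z / lm.
Proof.
have := ip_ge0 (lm *: X - Z); rewrite ipBl !ipBr !ipZl !ipZr (ipC Z X) => e.
have l1 : lm * lm^-1 = 1 by rewrite mulfV // gt_eqF.
have : 0 <= lm^-1 * (lm * (lm * nsq X) - lm * ip X Z - (lm * ip X Z - nsq Z)) by rewrite mulr_ge0 // invr_ge0 ltW.
have -> : lm^-1 * (lm * (lm * nsq X) - lm * ip X Z - (lm * ip X Z - nsq Z)) =
    (lm * lm^-1) * (lm * nsq X - 2 * ip X Z) + nsq Z / lm by ring.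
by rewrite l1; lra.
Qed.

(** As beta is 1 on chi and -1 on psi0, the J term is lam times area times |psi0|^2 - |chi|^2. Its
    negative part absorbs the chi side of Young's inequality for the cross term, and the flux of chi
    is nonpositive since H >= 0. *)
Lemma boundary_bound chi p : Sp c J V chi ->
  2 * ip (chi (bd_incl p)) (fl phi (bd_incl p)) + ip (chi (bd_incl p)) (fl chi (bd_incl p)) -
  lm * (rho (bd_incl p) * ip (phi (bd_incl p) + chi (bd_incl p)) (nce c E (bd_incl p) *m (J *m (phi (bd_incl p) + chi (bd_incl p))))) <=
  S p * (lm * (N%:R / 2) + nsq (Y p) / lm).
Proof.
move=> [c2 cp bc]; have c1 : mCk V 1 chi by apply: mCk_le c2.
have [l l0 El] := Ea p; set x := bd_incl p.
rewrite (flux_bdE p (s := 1)) ?mulr1 //; last by move=> q; rewrite bc scale1r.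
rewrite (nce_bd c El) -scalemxAl ipZr mulmxA -/(beta c J x) mulmxDr (psi0_bd H p) (bc p) ipZr.
rewrite (flux_cross H oV OV gC EC gpd Eo EdO Ea Elow Edg El (bc p)).
rewrite scaleN1r ipDl !ipDr !ipNr (psi0_nsq H p) -/x (ipC (phi x)).
have SE := rho_sqrt Eo EdO Ea l0 El; rewrite -/x -/(S p) in SE.
have := ler_wpM2l (S0 p) (young (chi x) (Y p)).
have := mulr_ge0 (mulr_ge0 (S0 p) (H0 p)) (ip_ge0 (chi x)).
rewrite -SE.
move: (ip _ _) (ip _ _) (nsq (chi x)) => a b d; lra.
Qed.

Let gmC : mCk setT 2 (gm g).
Proof. exact: (mCkM openT (mCkM openT (@mCk_bdP R k 2) (mCk_bd oV OV gC)) (mCkT openT (@mCk_bdP R k 2))). Qed.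

Let YC : mCk setT 0 Y.
Proof. exact: (@Yf_cont R k N c J V oV OV _ (gm_posdef gpd) gmC). Qed.

Let areaC : Ck 0 setT S.
Proof.
move=> p _; apply: (continuous_comp (f := fun p => \det (gm g p))); last exact: sqrt_continuous.
by have d := Ck_det openT (mCk_le (leq0n 2) gmC); exact: (d p I).
Qed.

(** In the integrated formula for psi0 + chi the volume term is nonnegative and the Dirac term at
    most 1. Isolating the flux of psi0, a negative multiple of H, leaves boundary terms that do not
    depend on the interior. *)
Theorem area_mean_curvature_le : IB (fun p => Hm p * S p) <= mass_bound (gm g).
Proof.
have [chi Sc' small] := small_dirac; have [c2 cp bc] := Sc'.
have c1 : mCk V 1 chi by apply: mCk_le c2.
have c0 : mCk V 0 chi by apply: mCk_le c2.
have pp := @psi0_per R k N c J.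
have pcC : mCk V 2 (fun y => phi y + chi y) by exact: (mCkD oV (pC 2) c2).
have pcp : per (fun y => phi y + chi y).
  by move=> x j Ox j1; rewrite (pp _ _ Ox j1) cp.
have LW := lichnerowicz_le H oV OV gC EC gp Ep gs Eo Ed sc (lexx n%:R) pcC pcp.
have fC psi : mCk V 1 psi -> mCk V 0 (fl psi) by move=> p1; exact: (@mCk_flux R k N c V oV g E gC EC Ed psi p1).
pose a x := ip (phi x) (fl phi x); pose b x := ip (chi x) (fl phi x).
pose b' x := ip (phi x) (fl chi x); pose d x := ip (chi x) (fl chi x).
pose e x := rho x * ip (phi x + chi x) (nce c E x *m (J *m (phi x + chi x))).
have aC : Ck 0 V a by exact: (Ck_ip oV (pC 0) (fC _ (pC 1))).
have bC : Ck 0 V b by exact: (Ck_ip oV c0 (fC _ (pC 1))).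
have b'C : Ck 0 V b' by exact: (Ck_ip oV (pC 0) (fC _ c1)).
have dC : Ck 0 V d by exact: (Ck_ip oV c0 (fC _ c1)).
have eC : Ck 0 V e.
  have pc0 := mCkD oV (pC 0) c0.
  apply: (CkM oV rho0); apply: (Ck_ip oV pc0); apply: (mCkM oV).
    exact: (mCkD oV (mCkZ oV (Ck_coord V 0 _) (mCk_ce c oV _ E0)) (mCkZ oV (Ck_coord V 0 _) (mCk_ce c oV _ E0))).
  exact: (mCkM oV (mCk_cst V 0 J) pc0).
have sumE : IBd (fun x => ip (phi x + chi x) (fl (fun y => phi y + chi y) x)) = IBd a + IBd (fun x => 2 * b x + d x).
  rewrite (IBD OV (CkM oV (Ck_cst V 0 2) bC) dC) (IBZ OV 2 bC).
  (* The flux pairing with the derivative on chi is replaced by the one with the derivative on psi0,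
     the only one that [flux_cross] can express by boundary data. *)
  have bb : IBd b' = IBd b by exact: (flux_sym H oV OV gC EC gp Ep gs Eo Ed (pC 2) c2 pp cp).
  have -> : IBd a + (2 * IBd b + IBd d) = IBd (fun x => (a x + b x) + (b' x + d x)).
    rewrite (IBD OV (CkD oV (k := 0) aC bC) (CkD oV (k := 0) b'C dC)) (IBD OV aC bC) (IBD OV b'C dC) bb; ring.
  apply: (IBeq OV).
  - exact: (Ck_ip oV (mCkD oV (pC 0) c0) (fC _ (mCkD oV (pC 1) c1))).
  - exact: (CkD oV (k := 0) (CkD oV (k := 0) aC bC) (CkD oV (k := 0) b'C dC)).
  move=> x /bdK_Om Ox; rewrite (@fluxD R k N c V oV g E _ _ _ (OV Ox) (pC 1) c1) ipDl !ipDr /a /b /b' /d; ring.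
have lhs0 : 0 <= IO (fun x => rho x * nsq (phi x + chi x)).
  apply: (IOge0 OV); first exact: (CkM oV rho0 (Ck_nsq oV (mCkD oV (pC 0) c0))).
  by move=> x Ox; rewrite mulr_ge0 ?ip_ge0 // ltW // (rho_gt0 Ed (OV Ox)).
pose W p := S p * (lm * (N%:R / 2) + nsq (Y p) / lm).
have WC : cont_on (@K1 R k) W.
  have w : Ck 0 setT W.
    apply: (CkM openT (k := 0)); first exact: areaC.
    apply: (CkD openT (k := 0)); first exact: Ck_cst.
    by apply: (CkM openT (k := 0)); [exact: (Ck_ip openT YC YC)|exact: Ck_cst].
  by move=> p _; exact: w.
have bd f : Ck 0 V f -> cont_on (@K1 R k) (fun p => f (bd_incl p)).
  by move=> f0 p _; exact: (Ck_bd oV OV f0).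
have up : IBd (fun x => 2 * b x + d x) - lm * IBd e <= IB W.
  have bdC := CkD oV (k := 0) (CkM oV (Ck_cst V 0 2) bC) dC.
  have leC := CkM oV (Ck_cst V 0 lm) eC.
  rewrite -(IBZ OV lm eC) !IBdE -(pfB (@pf_IB R k) (bd _ bdC) (bd _ leC)).
  apply: (pf_le (@pf_IB R k)); [exact: (contB (bd _ bdC) (bd _ leC))|exact: WC|].
  by move=> p _; exact: (boundary_bound p Sc').
have ae : (fun p => Hm p * S p) = fun p => - (4 / N%:R) * a (bd_incl p).
  apply/funext => p; rewrite /a (flux_bdE p (s := -1)) ?mulrNN ?mulr1 //; last exact: (psi0_bd H).
  have N1 : (N%:R : R) != 0 by rewrite pnatr_eq0 -lt0n.
  by rewrite (psi0_nsq H); field.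
rewrite ae (pfZ (@pf_IB R k) _ (bd _ aC)) /mass_bound -/W mulNr -mulrN.
apply: ler_wpM2l; first by rewrite divr_ge0.
rewrite sumE in LW; rewrite -IBdE.
move: LW small up; rewrite -/e; lra.
Qed.

End MainEstimate.

Theorem theorem1p8 (R : realType) (n : nat) (hn : (3 <= n <= 7)%N)
    (gam : 'rV[R]_((n - 2).+1) -> 'M[R]_((n - 2).+1))
    (hgam : metric_on_boundary gam) :
  exists C : R,
    forall (g : 'rV[R]_((n - 2).+2) -> 'M[R]_((n - 2).+2))
      (nu : 'rV[R]_((n - 2).+1) -> 'rV[R]_((n - 2).+2)),
      metric_on_solid_torus g ->
      (forall p, induced_metric g p = gam p) ->
      (forall x, solid_torus x ->
         - (n%:R * (n%:R - 1)) <= scalar_curvature g x) ->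
      outward_unit_normal g nu ->
      (forall p, 0 < mean_curvature g nu p) ->
      boundary_integral gam (mean_curvature g nu) <= C.
Proof.
have nE : (n - 2).+2 = n by lia.
(* With k = n - 2 the dimension is k.+2 by definition; the equation with n is kept for the constant
   in the curvature bound. *)
have {hn hgam} := nE; move: (n - 2)%N gam => k gam {}nE.
have [N [c [J [N0 H]]]] := clifford_exists R k.+2.
exists (mass_bound c J gam) => g nu mg gi sc nun Hp.
have [V [oV OV gC EC Ed]] := frameE_smooth mg.
have gE : gm g = gam by apply/funext => p; rewrite -gm_induced gi.
have hE p : mean_curvature g nu p = \tr (Fb (frameE g) p *m Bm g (frameE g) p).
  exact: (mean_curvatureE oV OV EC (frameE_orth mg) (frameE_adapted mg) p nun (gm_induced g)).
have sc' x : solid_torus x -> - (k.+2%:R * (k.+2%:R - 1)) <= scalar_curvature g x by move: sc; rewrite -nE => sc; exact: sc.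
have H0 p : 0 <= \tr (Fb (frameE g) p *m Bm g (frameE g) p) by rewrite -hE ltW.
have gpd : forall x, solid_torus x -> posdefmx (g x) by case: mg => [[]].
have := area_mean_curvature_le H N0 oV OV gC EC (metric_per mg) (frameE_per mg) gpd (frameE_orth mg) Ed
  (fun s x => @frameE_det R k g mg s x) (frameE_adapted mg) (frameE_low mg) (frameE_diag mg) sc' H0.
rewrite gE; apply: le_trans; rewrite /boundary_integral IBE.
rewrite le_eqVlt; apply/orP; left; apply/eqP.
congr Rintegral; apply/funext => th; congr torus_integral; apply/funext => t /=.
by rewrite -rcons_mxE hE /area.
Qed.
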